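(* The generating function $B=\sum_{k\ge0}B^{(k)}(t)$ of NES-pseudo-bridges (horizontal model) converges around $0$ and has a meromorphic continuation in $\mathbb{C}\setminus\mathcal E$, where $\mathcal E$ consists of the two real intervals $[-\sqrt2-1,-1]$ and $[\sqrt2-1,1]$, and of the curve $$\mathcal E_0=\left\{x+iy:\ x\ge0,\ y^2=\frac{1-x^2-2x^3}{1+2x}\right\}.$$ This curve is a natural boundary of $B$; that is, every point of $\mathcal E_0$ is a singularity of $B$. Likewise, the generating function $W$ of weakly directed bridges converges around $0$ and has a meromorphic continuation in $\mathbb{C}\setminus\mathcal E$, and the curve $\mathcal E_0$ is a natural boundary of $W$; that is, every point of $\mathcal E_0$ is a singularity of $W$. In particular, neither $B$ nor $W$ is D-finite.
   Context: The square lattice steps are N$=(0,1)$, E$=(1,0)$, S$=(0,-1)$, W$=(-1,0)$. All walks $v_0,\dots,v_n$ on $\mathbb{Z}^2$ are self-avoiding and counted up to translation by their length. A NES-walk has all its steps in $\{$N, E, S$\}$. The height $h(v)$ of a vertex is its ordinate. A walk is a bridge if all vertices $v\neq v_n$ satisfy $h(v_0)\le h(v)<h(v_n)$, a pseudo-bridge if all vertices satisfy $h(v_0)\le h(v)\le h(v_n)$ (its height is $h(v_n)-h(v_0)$). A walk is weakly directed if whenever $i<j$ and $h(v_i)=h(v_j)$, the portion $v_i,\dots,v_j$ avoids at least one of the steps N, E, S, W. $B^{(k)}(t)$ is the length generating function of NES-pseudo-bridges of height $k$: $B^{(k)}(t)=t^k/G_k(t)$ where $G_{-1}=1$, $G_0=1-t$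 and $G_{k+1}=(1-t+t^2+t^3)G_k-t^2G_{k-1}$ for $k\ge0$. The generating function of weakly directed bridges is $W=\dfrac1{1+t-\frac{2tB}{1+tB}}$. A power series in $t$ is D-finite if it satisfies a non-trivial linear differential equation with polynomial coefficients in $t$. *)

(* Defs.v *)
From HB Require Import structures.
From mathcomp Require Import all_boot all_order all_algebra.
From mathcomp Require Import all_classical all_reals all_analysis.
From mathcomp Require Import complex.

Set Implicit Arguments.
Unset Strict Implicit.
Unset Printing Implicit Defensive.

Import Order.TTheory GRing.Theory Num.Theory.
Import numFieldNormedType.Exports.

Local Open Scope classical_set_scope.
Local Open Scope ring_scope.
Local Open Scope complex_scope.

Inductive step : Type := North | East | South | West.

Definition step_code (s : step) : 'I_4 :=
  match s with
  | North => inord 0 | East => inord 1 | South => inord 2 | West => inord 3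
  end.

Definition step_decode (i : 'I_4) : step :=
  match val i with 0%N => North | 1%N => East | 2%N => South | _ => West end.

Lemma step_codeK : cancel step_code step_decode.
Proof. by case; rewrite /step_decode /= inordK. Qed.

HB.instance Definition _ := Finite.copy step (can_type step_codeK).

Definition step_vec (s : step) : int * int :=
  match s with
  | North => (0, 1) | East => (1, 0) | South => (0, -1) | West => (-1, 0)
  end.

(* A walk v_0, ..., v_n counted up to translation is encoded by its word of n
   steps, with v_0 placed at the origin. *)
Definition vertex (w : seq step) (i : nat) : int * int :=
  \sum_(s <- take i w) step_vec s.

Definition height (w : seq step) (i : nat) : int := (vertex w i).2.

Definition self_avoiding (w : seq step) : bool :=
  uniq [seq vertex w i | i <- iota 0 (size w).+1].

Definition nes_walk (w : seq step) : bool :=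
  self_avoiding w && all (mem [:: North; East; South]) w.

Definition pseudo_bridge (w : seq step) : bool :=
  self_avoiding w &&
  [forall i : 'I_(size w).+1,
     height w 0 <= height w i <= height w (size w)].

(* As the walk is self-avoiding, the vertices other than v_n are exactly the
   v_i with i < n. *)
Definition bridge (w : seq step) : bool :=
  self_avoiding w &&
  [forall i : 'I_(size w),
     height w 0 <= height w i < height w (size w)].

(* The steps of the portion v_i, ..., v_j are those of drop i (take j w). *)
Definition weakly_directed (w : seq step) : bool :=
  self_avoiding w &&
  [forall i : 'I_(size w).+1, forall j : 'I_(size w).+1,
     ((i < j)%N && (height w i == height w j)) ==>
     [exists s : step, s \notin drop i (take j w)]].

(* Coefficient of t^n in B^(k). *)
Definition nes_pseudo_bridges_of_height (k n : nat) : nat :=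
  #|[pred w : n.-tuple step | [&& nes_walk w, pseudo_bridge w
       & height w (size w) - height w 0 == k%:Z]]|.

(* Coefficient of t^n in B; a walk of length n has height at most n, so the sum
   over all k >= 0 stops at k = n. *)
Definition nes_pseudo_bridges (n : nat) : nat :=
  (\sum_(k < n.+1) nes_pseudo_bridges_of_height k n)%N.

(* Coefficient of t^n in W. *)
Definition weakly_directed_bridges (n : nat) : nat :=
  #|[pred w : n.-tuple step | weakly_directed w && bridge w]|.

(* The complex plane: the topology, norm and derivatives of MathComp-Analysis
   are attached to the regular algebra R[i]^o of R[i]. *)
Notation Cplx R := (R[i]^o)%type.

(* Formal power series with complex coefficients are sequences
   a : nat -> Cplx R, the coefficient of t^n being a n. *)
Definition gf (R : realType) (c : nat -> nat) : nat -> Cplx R :=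
  fun n => (c n)%:R.

Definition ps_deriv (R : realType) (a : nat -> Cplx R) : nat -> Cplx R :=
  fun n => n.+1%:R * a n.+1.

Definition ps_polymul (R : realType) (p : {poly (Cplx R)}) (a : nat -> Cplx R) :
    nat -> Cplx R :=
  fun n => \sum_(j < n.+1) p`_j * a (n - j)%N.

(* p`_0 a + p`_1 a' + ... + p`_d a^(d) = 0, where not all p`_i are 0. *)
Definition D_finite (R : realType) (a : nat -> Cplx R) : Prop :=
  exists p : seq {poly (Cplx R)},
    has (fun q => q != 0) p /\
    forall n, \sum_(i < size p) ps_polymul p`_i (iter i (@ps_deriv R) a) n = 0.

Definition ps_partial_sums (R : realType) (a : nat -> Cplx R) (z : Cplx R) :
    nat -> Cplx R :=
  series (fun n => a n * z ^+ n).

Definition converges_around_0 (R : realType) (a : nat -> Cplx R) : Prop :=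
  \forall z \near (0 : Cplx R), cvgn (ps_partial_sums a z).

Definition sums_around_0_to (R : realType) (a : nat -> Cplx R)
    (F : Cplx R -> Cplx R) : Prop :=
  \forall z \near (0 : Cplx R), ps_partial_sums a z @ \oo --> F z.

(* derivable f z 1 is complex differentiability: the base field of Cplx R as a
   normed module is Cplx R itself. *)
Definition holomorphic_at (R : realType) (f : Cplx R -> Cplx R) (z0 : Cplx R) :
    Prop :=
  \forall z \near z0, derivable f z 1.

(* A meromorphic function on D is a total function which, around each point z0
   of D and away from z0, is h(z) / (z - z0)^n with h holomorphic; its values
   at a discrete set of points (e.g. the poles) are irrelevant. *)
Definition meromorphic_on (R : realType) (D : set (Cplx R))
    (f : Cplx R -> Cplx R) : Prop :=
  forall z0, D z0 ->
    exists (n : nat) (h : Cplx R -> Cplx R),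
      holomorphic_at h z0 /\
      \forall z \near z0^', f z = h z / (z - z0) ^+ n.

(* Equality of meromorphic functions, disregarding the values at discrete sets
   of points. *)
Definition mero_eq_on (R : realType) (D : set (Cplx R))
    (f g : Cplx R -> Cplx R) : Prop :=
  forall z0, D z0 -> \forall z \near z0^', f z = g z.

(* Let D be the domain of the meromorphic function F. The point z0 is a
   singularity of F when, for every open neighbourhood U of z0 and every
   connected component V of the intersection of U and D that is adherent to z0,
   the restriction of F to V has no meromorphic continuation to U. Components
   are taken one by one because D may lie on both sides of its boundary: a mere
   jump of F across a cut, as for the logarithm, is not a singularity. *)
Definition singularity (R : realType) (D : set (Cplx R)) (F : Cplx R -> Cplx R)
    (z0 : Cplx R) : Prop :=
  forall (U : set (Cplx R)) (v : Cplx R),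
    open U -> U z0 -> (U `&` D) v ->
    closure (connected_component (U `&` D) v) z0 ->
    ~ exists g : Cplx R -> Cplx R,
        meromorphic_on U g /\
        mero_eq_on (connected_component (U `&` D) v) g F.

Definition natural_boundary (R : realType) (D : set (Cplx R))
    (F : Cplx R -> Cplx R) (Gamma : set (Cplx R)) : Prop :=
  forall z0, Gamma z0 -> singularity D F z0.

Definition E0 (R : realType) : set (Cplx R) :=
  [set z | exists x y : R,
     [/\ z = x +i* y, 0 <= x &
         y ^+ 2 = (1 - x ^+ 2 - 2 * x ^+ 3) / (1 + 2 * x)]].

Arguments E0 R : clear implicits.

Definition real_interval (R : realType) (a b : R) : set (Cplx R) :=
  [set z | exists2 x : R, z = x%:C & a <= x <= b].

Definition E (R : realType) : set (Cplx R) :=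
  real_interval (- Num.sqrt 2 - 1) (- 1) `|`
  real_interval (Num.sqrt 2 - 1) 1 `|`
  E0 R.

Arguments E R : clear implicits.

(* Main.v *)
(** Set [F = sum_k t^k / G_k]. Off [E] the kernel equation
    [t (w^2 + 1) = w (1 - t + t^2 + t^3)] has a root with [|w| < 1], and
    [(1 - w^2) w^k G_k = t^k (P + Q w^(2k+1))] with [P = 1 - t - t w] and
    [Q = t - (1 - t) w], so that [F] converges geometrically up to finitely many
    terms, each of them rational. With [q = |t|^2 (1 + 2 Re t) - 1], which vanishes
    on [E_0], one has [|P| > |Q|] where [q < 0] and [|P| < |Q|] where [q > 0],
    near a generic point of [E_0].

    [F] is unbounded on both sides of [E_0], arbitrarily close to each of its points: for [q < 0],
    [F] is a Lambert series [sum_j u^j / (1 - w^(2j+1))], which blows up as [w] tends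
    radially to a root of unity of odd prime order; for [q > 0], the zeros of the
    polynomials [G_k] are dense near [E_0], since otherwise a discrete Jensen
    inequality on a small circle would contradict [|G_k| ~ |t / w|^k]. Hence [F]
    has no meromorphic continuation across [E_0].

    For [W = (1 + t F) / (1 + t + (t^2 - t) F)], the difference [W - 1 / (t - 1)] is
    small where [F] is large. A continuation of it would therefore vanish along
    [E_0], hence have a zero derivative there, whereas at points [t'] dense in [E_0]
    one finds [t -> t'] with [|F(t)| |t - t'|] bounded, that is
    [|W(t) - 1 / (t - 1)| >= c |t - t'|].

    If [F] or [W] were D-finite, the differential equation would hold along the
    segment from 0 to a point [t'] of [E_0] where the leading coefficient does not
    vanish, and a Taylor series at a point of the segment near [t'] would converge
    beyond [t'].

    The identification of [F] uses a linear system for the NES-walks in a strip,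
    and that of [W] the factorization of bridges into irreducible ones: an
    irreducible bridge is weakly directed if and only if it avoids E or avoids W. *)

Require Import Defs.
From mathcomp Require Import all_boot all_order all_algebra.
From mathcomp Require Import all_classical all_reals all_analysis.
From mathcomp Require Import complex cyclotomic cyclic separable.
From mathcomp Require Import ring lra zify.

Set Implicit Arguments.
Unset Strict Implicit.
Unset Printing Implicit Defensive.

Import Order.TTheory GRing.Theory Num.Theory.
Import numFieldNormedType.Exports.
Import ComplexField.Normc.

Local Open Scope classical_set_scope.
Local Open Scope ring_scope.
Local Open Scope complex_scope.

(** Multiplying the kernel equation by the conjugate of [t w] and taking imaginary parts gives
    [|t|^2 Im w (|w|^2 - 1) = |w|^2 Im t q]. This is the origin of [q]: [|w| = 1] forces [q = 0] or
    [t] real. The same identity ties the sign of [q] to that of [Im t Im w], hence to the comparison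
    of [|P|] and [|Q|].

    On the outer side the denominators [P + Q w^(2k+1)] do vanish: the poles of [F] accumulate on
    the curve, and [Fser] has a meaningless value at each of them. Bounds on [F], and its agreement
    with a hypothetical continuation, are therefore stated on punctured neighbourhoods. The
    continuation enters through complex differentiability alone: it gives local boundedness for [F]
    and a first-order expansion for [W].

    A Moebius transform of [F] may stay bounded where [F] blows up, so that large values of [F] only
    prescribe the value of a continuation of [W] on the curve; the contradiction comes from paths on
    which [F] grows no faster than [1 / |t - t'|]. On the inner side a radial approach in [w] has
    this property; on the outer side the path must also keep away from the poles. *)

Section Modulus.
Context {R : realType}.
Implicit Types (z w : Cplx R) (x y r : R).

(* The norm of [Cplx R] takes its values in [R[i]]; [nm] is its real-valued version. *)
Definition nm (z : Cplx R) : R := normc z.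

Lemma normE z : `|z| = (nm z)%:C.
Proof. by rewrite /nm normc_def; case: z. Qed.

Lemma nm_ge0 z : 0 <= nm z.
Proof. by rewrite -lecR -normE normr_ge0. Qed.

Lemma nmM z w : nm (z * w) = nm z * nm w. Proof. exact: normcM. Qed.
Lemma nmD z w : nm (z + w) <= nm z + nm w. Proof. exact: le_normcD. Qed.
Lemma nmN z : nm (- z) = nm z. Proof. exact: normcN. Qed.
Lemma nmV z : nm z^-1 = (nm z)^-1. Proof. exact: normcV. Qed.
Lemma nm0 : nm 0 = 0. Proof. exact: normc0. Qed.
Lemma nm1 : nm 1 = 1. Proof. exact: normc1. Qed.
Lemma nmB z w : nm (z - w) = nm (w - z). Proof. by rewrite -nmN opprB. Qed.

Lemma nmX z n : nm (z ^+ n) = nm z ^+ n.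
Proof. by elim: n => [|n IH]; rewrite ?expr0 ?nm1 // !exprS nmM IH. Qed.

Lemma nm_eq0 z : (nm z == 0) = (z == 0).
Proof. by apply/eqP/eqP => [/eq0_normc|->]; rewrite ?nm0. Qed.

Lemma nm_gt0 z : (0 < nm z) = (z != 0).
Proof. by rewrite lt0r nm_ge0 andbT nm_eq0. Qed.

Lemma nm_real x : nm x%:C = `|x|.
Proof. by rewrite /nm /= expr0n /= addr0 sqrtr_sqr. Qed.

Lemma nm_nat n : nm n%:R = n%:R.
Proof.
have -> : (n%:R : Cplx R) = (n%:R : R)%:C by rewrite rmorph_nat.
by rewrite nm_real ger0_norm.
Qed.

Lemma nm_sqr z : nm z ^+ 2 = complex.Re z ^+ 2 + complex.Im z ^+ 2.
Proof. by case: z => a b; rewrite /nm /= sqr_sqrtr // addr_ge0 // sqr_ge0. Qed.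

Lemma nm_Re z : `|complex.Re z| <= nm z.
Proof.
rewrite -(@ler_pXn2r _ 2) ?nnegrE ?nm_ge0// nm_sqr real_normK ?num_real//.
by rewrite lerDl sqr_ge0.
Qed.

Lemma nm_Im z : `|complex.Im z| <= nm z.
Proof.
rewrite -(@ler_pXn2r _ 2) ?nnegrE ?nm_ge0// nm_sqr real_normK ?num_real//.
by rewrite lerDr sqr_ge0.
Qed.

Lemma nm_ReIm z : nm z <= `|complex.Re z| + `|complex.Im z|.
Proof.
rewrite -(@ler_pXn2r _ 2) ?nnegrE ?nm_ge0 ?addr_ge0// nm_sqr sqrrD !real_normK ?num_real//.
by rewrite lerD2r lerDl mulrn_wge0 // mulr_ge0.
Qed.

Lemma nm_subD z w u : nm (z - u) <= nm (z - w) + nm (w - u).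
Proof. by apply: le_trans (nmD _ _); rewrite addrA subrK. Qed.

Lemma nm_subl z w : nm z - nm w <= nm (z - w).
Proof. by rewrite lerBlDr; apply: le_trans (nmD _ _); rewrite subrK. Qed.

Lemma nm_sub_abs z w : `|nm z - nm w| <= nm (z - w).
Proof. by rewrite ler_norml nm_subl andbT lerNl opprB nmB nm_subl. Qed.

Lemma nm_addl z w : nm z - nm w <= nm (z + w).
Proof. by rewrite -(nmN w) -{2}(opprK w) nm_subl. Qed.

Lemma nm_sum (I : Type) (s : seq I) (P : pred I) (f : I -> Cplx R) :
  nm (\sum_(i <- s | P i) f i) <= \sum_(i <- s | P i) nm (f i).
Proof.
elim/big_rec2: _ => [|i x y _ H]; first by rewrite nm0.
by apply: le_trans (nmD _ _) _; rewrite lerD2l.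
Qed.

Lemma nm_prod (I : Type) (s : seq I) (P : pred I) (f : I -> Cplx R) :
  nm (\prod_(i <- s | P i) f i) = \prod_(i <- s | P i) nm (f i).
Proof. by elim/big_rec2: _ => [|i x y _ <-]; rewrite ?nm1 ?nmM. Qed.

Lemma gt0_complex (e : Cplx R) : 0 < e -> exists2 r : R, 0 < r & e = r%:C.
Proof.
case: e => a b; rewrite ltcE /= => /andP[/eqP -> ra]; exists a => //.
Qed.

Lemma nbhs_nm (z : Cplx R) (P : set (Cplx R)) :
  (\forall w \near z, P w) <-> exists2 r : R, 0 < r & forall w, nm (w - z) < r -> P w.
Proof.
split.
  move/nbhs_ballP => [e /= /gt0_complex[r r0 ->] H]; exists r => // w wz.
  by apply: H; rewrite /ball /= distrC normE ltcR.
case=> r r0 H; apply/nbhs_ballP; exists r%:C => /=; first by rewrite ltcR.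
by move=> w /=; rewrite /ball /= distrC normE ltcR; apply: H.
Qed.

Lemma dnbhs_nm (z : Cplx R) (P : set (Cplx R)) :
  (\forall w \near z^', P w) <->
  exists2 r : R, 0 < r & forall w, w != z -> nm (w - z) < r -> P w.
Proof.
rewrite /dnbhs; split.
  by move/nbhs_nm => [r r0 H]; exists r => // w wz /H; apply.
by case=> r r0 H; apply/nbhs_nm; exists r => // w wz wz0; apply: H.
Qed.

Lemma cvgn_nm (u : nat -> Cplx R) (l : Cplx R) :
  (u @ \oo --> l) <-> forall e : R, 0 < e -> \forall n \near \oo, nm (u n - l) < e.
Proof.
split=> [/cvgrPdist_lt H e e0|H].
  have := H e%:C; rewrite ltcR => /(_ e0) /= [N _ HN]; exists N => // n /= /HN.
  by rewrite /= distrC normE ltcR.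
apply/cvgrPdist_lt => e /gt0_complex[r r0 ->].
have [N _ HN] := H r r0; exists N => // n /= /HN.
by rewrite /= distrC normE ltcR.
Qed.

Lemma open_nm (U : set (Cplx R)) z : open U -> U z ->
  exists2 r : R, 0 < r & forall w, nm (w - z) < r -> U w.
Proof. by rewrite openE => H /H; rewrite /interior => /nbhs_nm. Qed.

Lemma closure_nm (A : set (Cplx R)) z : closure A z ->
  forall r : R, 0 < r -> exists2 w, A w & nm (w - z) < r.
Proof.
move=> cA r r0; have : nbhs z [set w | nm (w - z) < r].
  by apply/nbhs_nm; exists r.
by move=> /cA [w [Aw /= wr]]; exists w.
Qed.

Lemma nm_lt0 z r : nm z < r -> 0 < r.
Proof. exact/le_lt_trans/nm_ge0. Qed.

Lemma eq_nm_small z : (forall e : R, 0 < e -> nm z <= e) -> z = 0.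
Proof.
move=> H; apply/eqP; rewrite -nm_eq0 eq_le nm_ge0 andbT.
by apply/ler_addgt0Pr => e e0; rewrite add0r; apply: H.
Qed.

End Modulus.

(** * Power series and analytic functions *)

Section GeometricSums.
Context {R : realType}.
Implicit Types (u v : nat -> Cplx R) (M q p e : R).

Lemma geo_small M q e : 0 <= q < 1 -> 0 < e -> exists N, forall n, (N <= n)%N -> `|M * q ^+ n| < e.
Proof.
move=> /andP[q0 q1] e0.
have /cvgrPdist_lt H : (fun n => M * q ^+ n) @ \oo --> (M * 0 : R).
  by apply: cvgMr; apply: cvg_expr; rewrite ger0_norm.
have [N _ HN] := H e e0; exists N => n Nn.
by have := HN n Nn; rewrite /= mulr0 sub0r normrN.
Qed.

Lemma geo_partial q n : 0 <= q < 1 -> \sum_(i < n) q ^+ i <= (1 - q)^-1.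
Proof.
move=> /andP[q0 q1]; rewrite -[leRHS]mul1r ler_pdivlMr ?subr_gt0//.
have -> : (\sum_(i < n) q ^+ i) * (1 - q) = 1 - q ^+ n.
  by rewrite mulrC -[in RHS](expr1n _ n) subrXX; congr (_ * _); apply: eq_bigr => i _; rewrite expr1n mul1r.
by rewrite lerBlDr lerDl exprn_ge0.
Qed.

(** Each of the [n + 1] terms [q^i], [i <= n], is at least [q^n]. This absorbs the linear factors
    created by products and derivatives of series. *)
Lemma natr_geo q n : 0 <= q < 1 -> n.+1%:R * q ^+ n <= (1 - q)^-1.
Proof.
move=> q01; apply: le_trans (geo_partial n.+1 q01).
rewrite -{1}(card_ord n.+1) mulr_natl -sumr_const; apply: ler_sum => i _.
case/andP: q01 => q0 q1; apply: ler_wiXn2l; rewrite ?(ltW q1)//.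
by rewrite -ltnS.
Qed.

Definition psums u n : Cplx R := \sum_(i < n) u i.

Definition sums u (s : Cplx R) := psums u @ \oo --> s.

(* Junk value when the series diverges. *)
Definition csum u : Cplx R := lim (psums u @ \oo).

Definition geo M q u := 0 <= q < 1 /\ forall n, nm (u n) <= M * q ^+ n.

Lemma geo_M0 M q u : geo M q u -> 0 <= M.
Proof. by case=> _ /(_ 0%N); rewrite expr0 mulr1; apply: le_trans (nm_ge0 _). Qed.

Lemma sums_csum u s : sums u s -> csum u = s.
Proof. by move=> H; apply: cvg_lim. Qed.

Lemma psums_diff M q u m n : geo M q u -> (n <= m)%N ->
  nm (psums u m - psums u n) <= M * q ^+ n / (1 - q).
Proof.
move=> H; have M0 := geo_M0 H; case: H => q01 H /subnKC <-.
rewrite /psums big_split_ord /= addrAC subrr add0r.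
apply: le_trans (nm_sum _ _ _) _; rewrite -mulrA.
apply: le_trans (_ : \sum_(i < m - n) M * q ^+ n * q ^+ i <= _).
  by apply: ler_sum => i _; rewrite -mulrA -exprD; apply: H.
rewrite -mulr_sumr mulrA; apply: ler_wpM2l; last exact: geo_partial.
by rewrite mulr_ge0 // exprn_ge0 //; case/andP: q01.
Qed.

Lemma real_geo_cvg M q (u : nat -> R) : 0 <= q < 1 -> (forall n, `|u n| <= M * q ^+ n) ->
  cvgn (fun n => \sum_(i < n) u i).
Proof.
move=> /andP[q0 q1] H.
have -> : (fun n => \sum_(i < n) u i) = series u.
  by apply/funext => n; rewrite /series /= big_mkord.
apply: normed_cvg; apply: (series_le_cvg (v_ := geometric M q)) => //.
- by move=> n; apply: normr_ge0.
- by move=> n; apply: le_trans (H n); apply: normr_ge0.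
- by apply: is_cvg_geometric_series; rewrite ger0_norm.
Qed.

Lemma geo_sums M q u : geo M q u -> sums u (csum u).
Proof.
case=> q01 H; have Hr : cvgn (fun n => \sum_(i < n) complex.Re (u i)).
  exact: (@real_geo_cvg M q (fun n => complex.Re (u n)) q01 (fun n => le_trans (nm_Re _) (H n))).
have Hi : cvgn (fun n => \sum_(i < n) complex.Im (u i)).
  exact: (@real_geo_cvg M q (fun n => complex.Im (u n)) q01 (fun n => le_trans (nm_Im _) (H n))).
suff S : sums u (lim ((fun n => \sum_(i < n) complex.Re (u i)) @ \oo) +i*
                lim ((fun n => \sum_(i < n) complex.Im (u i)) @ \oo)).
  by rewrite (sums_csum S).
move: Hr Hi; set a := lim _; set b := lim _ => /cvgrPdist_lt Hr /cvgrPdist_lt Hi.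
apply/cvgn_nm => e e0.
have e2 : 0 < e / 2 by rewrite divr_gt0.
have [N1 _ H1] := Hr _ e2; have [N2 _ H2] := Hi _ e2.
exists (maxn N1 N2) => // n /=; rewrite geq_max => /andP[n1 n2].
apply: le_lt_trans (nm_ReIm _) _; rewrite (splitr e) /psums.
have ReS k : complex.Re (\sum_(i < k) u i) = \sum_(i < k) complex.Re (u i).
  by elim: k => [|k IH]; rewrite ?big_ord0 // !big_ord_recr /= -IH; case: (\sum_(i < k) _) (u k) => [? ?] [? ?].
have ImS k : complex.Im (\sum_(i < k) u i) = \sum_(i < k) complex.Im (u i).
  by elim: k => [|k IH]; rewrite ?big_ord0 // !big_ord_recr /= -IH; case: (\sum_(i < k) _) (u k) => [? ?] [? ?].
apply: ltrD.
  by have := H1 n n1; rewrite /= distrC -ReS; case: (\sum_(i < n) u i).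
by have := H2 n n2; rewrite /= distrC -ImS; case: (\sum_(i < n) u i).
Qed.

Lemma csum_tail M q u n : geo M q u -> nm (csum u - psums u n) <= M * q ^+ n / (1 - q).
Proof.
move=> H; apply/ler_addgt0Pr => e e0.
have /cvgn_nm/(_ e e0)[N _ HN] := geo_sums H.
apply: le_trans (nm_subD _ (psums u (maxn N n)) _) _; rewrite addrC lerD//.
  by apply: psums_diff; rewrite ?leq_maxr.
by rewrite nmB ltW //; apply: HN; rewrite /= leq_maxl.
Qed.

Lemma csum_le M q u : geo M q u -> nm (csum u) <= M / (1 - q).
Proof. by move=> /(@csum_tail _ _ _ 0); rewrite /psums big_ord0 subr0 expr0 mulr1. Qed.

Lemma sumsD u v s t : sums u s -> sums v t -> sums (fun n => u n + v n) (s + t).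
Proof.
move=> hu hv; rewrite /sums.
have -> : psums (fun n => u n + v n) = (psums u \+ psums v).
  by apply/funext => n; rewrite /psums big_split.
by apply: cvgD; [exact: hu|exact: hv].
Qed.

Lemma sumsZ c u s : sums u s -> sums (fun n => c * u n) (c * s).
Proof.
move=> hu; rewrite /sums.
have -> : psums (fun n => c * u n) = (fun n => c * psums u n).
  by apply/funext => n; rewrite /psums mulr_sumr.
exact: cvgMr.
Qed.

Lemma sums_tail_le u s M q : 0 <= q < 1 ->
  (forall n, nm (psums u n - s) <= M * q ^+ n) -> sums u s.
Proof.
move=> q01 H; apply/cvgn_nm => e e0; have [N HN] := geo_small M q01 e0.
exists N => // n /= /HN; apply: le_lt_trans; apply: le_trans (H n) _.
exact: ler_norm.
Qed.

Lemma sums_shift u s k : sums (fun n => u (k + n)%N) s -> sums u (psums u k + s).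
Proof.
move=> /cvgn_nm H; apply/cvgn_nm => e /H[N _ HN]; exists (k + N)%N => // n /= kn.
have -> : psums u n = psums u k + psums (fun n => u (k + n)%N) (n - k).
  by rewrite /psums; move: (leq_trans (leq_addr N k) kn) => /subnKC E; rewrite -[in LHS]E big_split_ord.
by rewrite opprD addrACA subrr add0r; apply: HN; rewrite /= leq_subRL // (leq_trans _ kn)// leq_addr.
Qed.

Lemma sums_fin u k : (forall n, (k <= n)%N -> u n = 0) -> sums u (psums u k).
Proof.
move=> H; rewrite -[psums u k]addr0; apply: sums_shift.
have -> : (fun n => u (k + n)%N) = (fun=> 0).
  by apply/funext => n; apply: H; rewrite leq_addr.
rewrite /sums (_ : psums _ = fun=> 0); first exact: cvg_cst.
by apply/funext => n; rewrite /psums big1.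
Qed.

(** Fubini for a doubly geometric array. The column total minus the sum of the first [n] rows is a
    series over [j] of column tails, each at most [M p^n q^j / (1 - p)]. *)
Lemma csum_exchange (x : nat -> nat -> Cplx R) M p q : 0 <= p < 1 -> 0 <= q < 1 ->
  (forall i j, nm (x i j) <= M * p ^+ i * q ^+ j) ->
  sums (fun i => csum (x i)) (csum (fun j => csum (x^~ j))).
Proof.
move=> p01 q01 H.
have gr i : geo (M * p ^+ i) q (x i) by split.
have gc j : geo (M * q ^+ j) p (x^~ j) by split=> // n; rewrite mulrAC.
have M0 : 0 <= M by have := geo_M0 (gr 0%N); rewrite expr0 mulr1.
have p1 : 0 < 1 - p by rewrite subr_gt0; case/andP: p01.
have q1 : 0 < 1 - q by rewrite subr_gt0; case/andP: q01.
have gcs : geo (M / (1 - p)) q (fun j => csum (x^~ j)).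
  by split=> // j; rewrite mulrAC; apply: csum_le.
apply: (@sums_tail_le _ _ (M / (1 - p) / (1 - q)) p) => // n.
have S1 : sums (fun j => \sum_(i < n) x i j) (psums (fun i => csum (x i)) n).
  rewrite /psums; elim: n => [|n IH].
    rewrite big_ord0 (_ : (fun=> _) = fun=> 0).
      by have := @sums_fin (fun=> 0) 0%N; rewrite /psums big_ord0; apply.
    by apply/funext => j; rewrite big_ord0.
  rewrite big_ord_recr /= (_ : (fun=> _) = fun j => \sum_(i < n) x i j + x n j).
    by apply: sumsD; [exact: IH|apply: (geo_sums (gr n))].
  by apply/funext => j; rewrite big_ord_recr.
have S2 := sumsD S1 (@sumsZ (-1) _ _ (geo_sums gcs)).
rewrite mulN1r in S2; rewrite -(sums_csum S2).
have G : geo (M * p ^+ n / (1 - p)) q (fun j => \sum_(i < n) x i j + -1 * csum (x^~ j)).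
  split=> // j; rewrite mulN1r nmB.
  have := csum_tail n (gc j); rewrite /psums => /le_trans; apply.
  by rewrite [leRHS]mulrAC [M * p ^+ n * _]mulrAC.
apply: le_trans (csum_le G) _.
by rewrite [leRHS]mulrAC ler_pM2r ?invr_gt0// [leRHS]mulrAC.
Qed.

Lemma csum_cauchy (x : nat -> nat -> Cplx R) M p : 0 <= p < 1 ->
  (forall i j, nm (x i j) <= M * p ^+ i * p ^+ j) ->
  sums (fun n => \sum_(i < n.+1) x i (n - i)%N) (csum (fun i => csum (x i))).
Proof.
move=> p01 H; have p0 : 0 <= p by case/andP: p01.
have M0 : 0 <= M.
  by have := H 0%N 0%N; rewrite !expr0 !mulr1; apply: le_trans (nm_ge0 _).
(* On the triangle [i <= n] the diagonal terms are bounded by [M p^n <= M s^n s^i] with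
   [s = sqrt p]; this restores a product bound, to which the exchange of sums applies. *)
set s := Num.sqrt p; have s0 : 0 <= s by rewrite sqrtr_ge0.
have ss : s ^+ 2 = p by rewrite sqr_sqrtr.
have s1 : s < 1 by rewrite -(@ltr_pXn2r _ 2) ?nnegrE// ss expr1n; case/andP: p01.
have s01 : 0 <= s < 1 by rewrite s0.
pose y n i := if (i <= n)%N then x i (n - i)%N else 0.
have By i n : nm (y n i) <= M * s ^+ n * s ^+ i.
  rewrite /y; case: leqP => [ni|_]; last by rewrite nm0 !mulr_ge0 ?exprn_ge0.
  apply: le_trans (H _ _) _; rewrite -!mulrA ler_wpM2l// -!exprD subnKC//.
  by rewrite -ss -exprM; apply: ler_wiXn2l; rewrite ?(ltW s1)// mul2n -addnn leq_add2l.
have E1 := csum_exchange s01 s01 (fun n i => By i n).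
have -> : (fun n => \sum_(i < n.+1) x i (n - i)%N) = (fun n => csum (y n)).
  apply/funext => n; have F : forall i, (n.+1 <= i)%N -> y n i = 0.
    by move=> i; rewrite /y ltnNge => /negbTE ->.
  rewrite (sums_csum (sums_fin F)) /psums; apply: eq_bigr => i _.
  by rewrite /y -ltnS ltn_ord.
suff -> : (fun i => csum (x i)) = (fun j => csum (y^~ j)) by [].
apply/funext => i; apply/esym/sums_csum.
have G : geo (M * p ^+ i) p (x i) by split=> // j; apply: H.
rewrite -[csum (x i)]add0r.
have -> : 0 = psums (y^~ i) i :> Cplx R.
  by rewrite /psums big1 // => j _; rewrite /y leqNgt ltn_ord.
apply: sums_shift; rewrite (_ : (fun=> _) = x i); first exact: geo_sums G.
by apply/funext => j; rewrite /y leq_addr addKn.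
Qed.

End GeometricSums.

(** * Operations on power series inside the disc of convergence *)

Section PowerSeries.
Context {R : realType}.
Implicit Types (a b : nat -> Cplx R) (z h w : Cplx R) (r s M q p : R).

(* The radius of convergence is at least [r]. *)
Definition psrad a r := forall s, 0 < s < r -> exists M, forall n, nm (a n) * s ^+ n <= M.

Definition psum a h : Cplx R := csum (fun n => a n * h ^+ n).

Definition psconv a b n : Cplx R := \sum_(i < n.+1) a i * b (n - i)%N.

(* Coefficients of the re-expansion at [z] of the series [a]. *)
Definition ps_shift a z m : Cplx R :=
  csum (fun n => a n * ('C(n, m)%:R * z ^+ (n - m))).

Lemma psrad_le a r r' : r' <= r -> psrad a r -> psrad a r'.
Proof.
by move=> rr H s /andP[s0 sr]; apply: H; rewrite s0 /=; apply: lt_le_trans rr.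
Qed.

Lemma psrad_geo a r s : psrad a r -> 0 <= s < r ->
  exists M q, forall h, nm h <= s -> geo M q (fun n => a n * h ^+ n).
Proof.
move=> H /andP[s0 sr]; set t := (s + r) / 2.
have st : s < t by rewrite midf_lt.
have t0 : 0 < t by apply: le_lt_trans st.
have [|M HM] := H t; first by rewrite t0 midf_lt.
exists M, (s / t) => h hs; split.
  by rewrite divr_ge0 ?(ltW t0)//= ltr_pdivrMr// mul1r.
move=> n; rewrite nmM nmX; apply: (@le_trans _ _ (nm (a n) * s ^+ n)).
  by rewrite ler_wpM2l ?nm_ge0//; apply: lerXn2r; rewrite ?nnegrE ?nm_ge0.
rewrite expr_div_n mulrA ler_pdivlMr ?exprn_gt0// mulrAC.
by rewrite ler_wpM2r ?exprn_ge0.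
Qed.

Lemma psrad_sums a r h : psrad a r -> nm h < r -> sums (fun n => a n * h ^+ n) (psum a h).
Proof.
move=> H hr; have [|M [q /(_ h (lexx _)) G]] := psrad_geo (s := nm h) H.
  by rewrite nm_ge0.
exact: geo_sums G.
Qed.

Lemma psumD a b r h : psrad a r -> psrad b r -> nm h < r ->
  psum (fun n => a n + b n) h = psum a h + psum b h.
Proof.
move=> Ha Hb hr; apply: sums_csum.
rewrite (_ : (fun n => (a n + b n) * _) = fun n => a n * h ^+ n + b n * h ^+ n).
  by apply: sumsD; apply: psrad_sums; eauto.
by apply/funext => n; rewrite mulrDl.
Qed.

Lemma psradD a b r : psrad a r -> psrad b r -> psrad (fun n => a n + b n) r.
Proof.
move=> Ha Hb s sr; have [[M1 H1] [M2 H2]] := (Ha s sr, Hb s sr).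
exists (M1 + M2) => n; apply: le_trans (lerD (H1 n) (H2 n)).
rewrite -mulrDl ler_wpM2r ?nmD// exprn_ge0//; case/andP: sr => /ltW //.
Qed.

Lemma psumZ c a r h : psrad a r -> nm h < r -> psum (fun n => c * a n) h = c * psum a h.
Proof.
move=> Ha hr; apply: sums_csum.
rewrite (_ : (fun n => c * a n * _) = fun n => c * (a n * h ^+ n)).
  by apply: sumsZ; apply: psrad_sums; eauto.
by apply/funext => n; rewrite mulrA.
Qed.

Lemma psradZ c a r : psrad a r -> psrad (fun n => c * a n) r.
Proof.
move=> Ha s sr; have [M1 H1] := Ha s sr.
by exists (nm c * M1) => n; rewrite nmM -mulrA ler_wpM2l ?nm_ge0.
Qed.

Lemma psrad_fin a k r : (forall n, (k <= n)%N -> a n = 0) -> psrad a r.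
Proof.
move=> H s /andP[/ltW s0 _]; exists (\sum_(i < k) nm (a i) * s ^+ i) => n.
case: (ltnP n k) => nk.
  rewrite (bigD1 (Ordinal nk)) //= lerDl sumr_ge0 // => i _.
  by rewrite mulr_ge0 ?nm_ge0 ?exprn_ge0.
by rewrite H // nm0 mul0r sumr_ge0 // => i _; rewrite mulr_ge0 ?nm_ge0 ?exprn_ge0.
Qed.

Lemma psum_fin a k h : (forall n, (k <= n)%N -> a n = 0) ->
  psum a h = \sum_(i < k) a i * h ^+ i.
Proof.
move=> H; apply: sums_csum; apply: (@sums_fin _ (fun n => a n * h ^+ n) k).
by move=> n kn; rewrite H ?mul0r.
Qed.

Lemma psrad_poly (p : {poly Cplx R}) r : psrad (fun n => p`_n) r.
Proof. by apply: (@psrad_fin _ (size p)) => n; apply: nth_default. Qed.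

Lemma psum_poly (p : {poly Cplx R}) h : psum (fun n => p`_n) h = p.[h].
Proof. by rewrite (@psum_fin _ (size p)) ?horner_coef // => n; apply: nth_default. Qed.

Lemma psrad_conv a b r : psrad a r -> psrad b r -> psrad (psconv a b) r.
Proof.
move=> Ha Hb s /andP[s0 sr]; set t := (s + r) / 2.
have st : s < t by rewrite midf_lt.
have t0 : 0 < t by apply: lt_trans st.
have tr : 0 < t < r by rewrite t0 midf_lt.
clearbody t; have [[M1 H1] [M2 H2]] := (Ha t tr, Hb t tr).
have q01 : 0 <= s / t < 1 by rewrite divr_ge0 ?(ltW t0) ?(ltW s0)//= ltr_pdivrMr// mul1r.
exists (M1 * M2 * (1 - s / t)^-1) => n.
have M1p : 0 <= M1 by apply: le_trans (H1 0%N); rewrite mulr_ge0 ?nm_ge0 ?exprn_ge0 ?ltW.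
have M2p : 0 <= M2 by apply: le_trans (H2 0%N); rewrite mulr_ge0 ?nm_ge0 ?exprn_ge0 ?ltW.
have B : nm (psconv a b n) * t ^+ n <= n.+1%:R * (M1 * M2).
  have -> : n.+1%:R * (M1 * M2) = \sum_(i < n.+1) M1 * M2 by rewrite sumr_const card_ord mulr_natl.
  apply: (@le_trans _ _ ((\sum_(i < n.+1) nm (a i * b (n - i)%N)) * t ^+ n)).
    by rewrite ler_wpM2r ?nm_sum// exprn_ge0 ?ltW.
  rewrite mulr_suml; apply: ler_sum => i _.
  have -> : t ^+ n = t ^+ i * t ^+ (n - i) by rewrite -exprD subnKC // -ltnS.
  by rewrite nmM mulrACA; apply: ler_pM; rewrite ?mulr_ge0 ?nm_ge0 ?exprn_ge0 ?(ltW t0).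
have -> : nm (psconv a b n) * s ^+ n = nm (psconv a b n) * t ^+ n * (s / t) ^+ n.
  have aux (x y u : R) : u != 0 -> x * y = x * u * (y / u) by move=> u0; field.
  by rewrite expr_div_n; apply: aux; rewrite expf_neq0 // gt_eqF.
apply: le_trans (ler_wpM2r _ B) _; first by rewrite exprn_ge0 //; case/andP: q01.
by rewrite mulrAC [leRHS]mulrC ler_wpM2r ?mulr_ge0// natr_geo.
Qed.

Lemma psum_conv a b r h : psrad a r -> psrad b r -> nm h < r ->
  psum (psconv a b) h = psum a h * psum b h.
Proof.
move=> Ha Hb hr.
have hh : 0 <= nm h < r by rewrite nm_ge0.
have [M1 [q1 /(_ h (lexx _)) G1]] := psrad_geo Ha hh.
have [M2 [q2 /(_ h (lexx _)) G2]] := psrad_geo Hb hh.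
have M1p := geo_M0 G1; have M2p := geo_M0 G2.
case: (G1) => /andP[q10 q11] H1; case: (G2) => /andP[q20 q21] H2.
pose q := Num.max q1 q2.
have q0 : 0 <= q by rewrite le_max q10.
have q01 : 0 <= q < 1 by rewrite q0 gt_max q11.
pose x i j := a i * h ^+ i * (b j * h ^+ j).
have X i j : nm (x i j) <= M1 * M2 * q ^+ i * q ^+ j.
  rewrite /x nmM -[leRHS]mulrA [leRHS]mulrACA; apply: ler_pM; rewrite ?nm_ge0//.
    apply: le_trans (H1 i) _; apply: ler_wpM2l => //.
    by apply: lerXn2r; rewrite ?nnegrE// le_max lexx.
  apply: le_trans (H2 j) _; apply: ler_wpM2l => //.
  by apply: lerXn2r; rewrite ?nnegrE// le_max lexx orbT.
have S := csum_cauchy q01 X; apply: sums_csum.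
have -> : (fun n => psconv a b n * h ^+ n) = (fun n => \sum_(i < n.+1) x i (n - i)%N).
  apply/funext => n; rewrite /psconv mulr_suml; apply: eq_bigr => i _.
  by rewrite /x mulrACA -exprD subnKC // -ltnS.
suff -> : psum a h * psum b h = csum (fun i => csum (x i)) by [].
apply/esym/sums_csum; rewrite mulrC.
have -> : (fun i => csum (x i)) = (fun i => psum b h * (a i * h ^+ i)).
  apply/funext => i; rewrite mulrC; apply: sums_csum; apply: sumsZ.
  exact: geo_sums G2.
by apply: sumsZ; apply: geo_sums G1.
Qed.

(** A series of power series may be summed coefficientwise: the bound on the coefficients at radius
    [s] makes the array [a k n h^n] doubly geometric when [|h| < s]. *)
Lemma psum_csum (a : nat -> nat -> Cplx R) M s q h : 0 <= q < 1 ->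
  (forall k n, nm (a k n) * s ^+ n <= M * q ^+ k) -> nm h < s ->
  sums (fun k => psum (a k) h) (psum (fun n => csum (a^~ n)) h).
Proof.
move=> q01 H hs; have s0 : 0 < s by apply: nm_lt0 hs.
have p01 : 0 <= nm h / s < 1.
  by rewrite divr_ge0 ?nm_ge0 ?(ltW s0)//= ltr_pdivrMr// mul1r.
have B k n : nm (a k n * h ^+ n) <= M * q ^+ k * (nm h / s) ^+ n.
  rewrite nmM nmX expr_div_n mulrA ler_pdivlMr ?exprn_gt0// mulrAC.
  by rewrite ler_wpM2r ?exprn_ge0 ?nm_ge0.
have S := csum_exchange q01 p01 B; rewrite /sums /psum.
suff -> : (fun n => csum (a^~ n) * h ^+ n) = (fun n => csum (fun k => a k n * h ^+ n)) by [].
apply/funext => n; rewrite mulrC; apply/esym/sums_csum.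
rewrite (_ : (fun k => _) = fun k => h ^+ n * a k n); last by apply/funext => k; rewrite mulrC.
apply: sumsZ; apply: (@geo_sums _ (M / s ^+ n) q); split=> // k.
by rewrite mulrAC ler_pdivlMr ?exprn_gt0.
Qed.

Lemma psrad_csum (a : nat -> nat -> Cplx R) M s q : 0 < s -> 0 <= q < 1 ->
  (forall k n, nm (a k n) * s ^+ n <= M * q ^+ k) -> psrad (fun n => csum (a^~ n)) s.
Proof.
move=> s0 q01 H t /andP[t0 ts]; exists (M / (1 - q)) => n.
have G : geo (M / s ^+ n) q (a^~ n).
  by split=> // k; rewrite mulrAC ler_pdivlMr ?exprn_gt0.
apply: (@le_trans _ _ (nm (csum (a^~ n)) * s ^+ n)).
  by rewrite ler_wpM2l ?nm_ge0//; apply: lerXn2r; rewrite ?nnegrE ?ltW.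
rewrite -ler_pdivlMr ?exprn_gt0//; apply: le_trans (csum_le G) _.
by rewrite mulrAC.
Qed.

Lemma psrad_const a s : 0 < s -> (exists M, forall n, nm (a n) * s ^+ n <= M) -> psrad a s.
Proof.
move=> s0 [M H] t /andP[t0 ts]; exists M => n; apply: le_trans (H n).
by rewrite ler_wpM2l ?nm_ge0//; apply: lerXn2r; rewrite ?nnegrE ?ltW.
Qed.

Section Shift.
Variables (a : nat -> Cplx R) (r : R) (z : Cplx R).
Hypotheses (Ha : psrad a r) (zr : nm z < r).

Let x h n m := a n * ('C(n, m)%:R * z ^+ (n - m)) * h ^+ m.

(** A single term [C(n, m) |z|^(n-m) t^m] is at most the whole expansion of [(|z| + t)^n]. Taking
    [s < t < r - |z|] leaves the ratio [s / t] for the decay in [m]. *)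
Lemma ps_shift_bound s : 0 < s < r - nm z -> exists M p q, [/\ 0 <= p < 1, 0 <= q < 1 &
  forall h n m, nm h <= s -> nm (x h n m) <= M * p ^+ n * q ^+ m].
Proof.
move=> /andP[s0 sr]; pose t := (s + (r - nm z)) / 2.
have st : s < t by rewrite midf_lt.
have t0 : 0 < t by apply: lt_trans st.
have tr : t < r - nm z by rewrite midf_lt.
have zt : 0 <= nm z + t < r.
  by rewrite addr_ge0 ?nm_ge0 ?(ltW t0)//= -ltrBrDl.
have [M [p G]] := psrad_geo Ha zt.
have E : nm (nm z + t)%:C <= nm z + t by rewrite nm_real ger0_norm //; case/andP: zt.
have [p01 G'] := G _ E.
exists M, p, (s / t); split=> //.
  by rewrite divr_ge0 ?(ltW t0) ?(ltW s0)//= ltr_pdivrMr// mul1r.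
move=> h n m hs; have [mn|mn] := leqP m n; last first.
  have M0 := geo_M0 (G _ E); have p0 : 0 <= p by case/andP: p01.
  rewrite /x bin_small // mul0r mulr0 mul0r nm0; apply: mulr_ge0; first by rewrite mulr_ge0 ?exprn_ge0.
  by rewrite exprn_ge0 // divr_ge0 // ltW.
rewrite /x !nmM !nmX nm_nat expr_div_n [leRHS]mulrA ler_pdivlMr ?exprn_gt0//.
apply: (@le_trans _ _ (nm (a n) * (nm z + t) ^+ n * s ^+ m)); last first.
  rewrite ler_wpM2r ?exprn_ge0 ?(ltW s0)//.
  have := G' n; rewrite nmM nmX nm_real ger0_norm //; by case/andP: zt.
rewrite -!mulrA ler_wpM2l ?nm_ge0//.
have : 'C(n, m)%:R * (nm z ^+ (n - m) * t ^+ m) <= (nm z + t) ^+ n.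
  rewrite exprDn (bigD1 (inord m)) //= inordK ?ltnS// mulr_natl lerDl sumr_ge0 // => i _.
  by rewrite mulrn_wge0// mulr_ge0 ?exprn_ge0 ?nm_ge0 ?ltW.
move=> /(ler_wpM2r (exprn_ge0 m (ltW s0))) /(le_trans _); apply.
have aux (c A B S : R) : c * (A * B) * S = c * (A * (S * B)) by ring.
rewrite aux; apply: ler_wpM2l => //; apply: ler_wpM2l; rewrite ?exprn_ge0 ?nm_ge0//.
by apply: ler_wpM2r; rewrite ?exprn_ge0 ?(ltW t0)//; apply: lerXn2r; rewrite ?nnegrE ?nm_ge0 ?(ltW s0).
Qed.

Lemma ps_shift_term h m : csum (fun n => x h n m) = ps_shift a z m * h ^+ m.
Proof.
rewrite mulrC; apply: sums_csum.
rewrite (_ : (fun n => _) = fun n => h ^+ m * (a n * ('C(n, m)%:R * z ^+ (n - m)))); last first.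
  by apply/funext => n; rewrite mulrC.
apply: sumsZ.
have s0 : 0 < (r - nm z) / 2 < r - nm z by have d0 : 0 < r - nm z; [rewrite subr_gt0|apply/andP; split; lra].
have [M [p [q [p01 q01 B]]]] := ps_shift_bound s0.
move: s0; set s := (_ / 2) => /andP[s0 _].
apply: (@geo_sums _ (M * q ^+ m / s ^+ m) p); split=> // n.
have := B s%:C n m; rewrite nm_real ger0_norm ?(ltW s0)// => /(_ (lexx _)).
rewrite /x nmM nmX nm_real ger0_norm ?(ltW s0)// -ler_pdivlMr ?exprn_gt0//.
by move/le_trans; apply; rewrite le_eqVlt; apply/orP; left; apply/eqP; rewrite ?expr1; have aux (x1 y1 z1 w1 : R) : x1 * y1 * z1 * w1 = x1 * z1 * w1 * y1; [ring|exact: aux].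
Qed.

Lemma psrad_shift : psrad (ps_shift a z) (r - nm z).
Proof.
move=> s sr; have [M [p [q [p01 q01 B]]]] := ps_shift_bound sr.
case/andP: sr => s0 _; exists (M / (1 - p)) => m.
have ss : nm s%:C = s by rewrite nm_real ger0_norm ?(ltW s0).
have -> : nm (ps_shift a z m) * s ^+ m = nm (ps_shift a z m * s%:C ^+ m).
  by rewrite nmM nmX ss.
rewrite -ps_shift_term; apply: csum_le; split=> // n.
apply: le_trans (B _ _ _ _) _; rewrite ?ss// ler_piMr//.
  rewrite mulr_ge0 ?exprn_ge0//; last by case/andP: p01.
  by have := B 0 0%N 0%N; rewrite nm0 (ltW s0) !expr0 !mulr1 => /(_ isT); apply: le_trans (nm_ge0 _).
by case/andP: q01 => q0 q1; rewrite exprn_ile1 // ltW.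
Qed.

Lemma psum_shift h : nm h < r - nm z -> psum (ps_shift a z) h = psum a (z + h).
Proof.
move=> hr.
pose s := (nm h + (r - nm z)) / 2.
have hs : nm h < s by rewrite midf_lt.
have sr : 0 < s < r - nm z by rewrite midf_lt // andbT; apply: nm_lt0 hs.
have [M [p [q [p01 q01 B]]]] := ps_shift_bound sr.
have S := csum_exchange p01 q01 (fun n m => B h n m (ltW hs)).
rewrite /psum; have <- : (fun m => csum (fun n => x h n m)) = (fun n => ps_shift a z n * h ^+ n).
  by apply/funext => m; rewrite ps_shift_term.
rewrite -(sums_csum S); congr csum; apply/funext => n.
have F m : (n.+1 <= m)%N -> x h n m = 0 by move=> nm; rewrite /x bin_small ?mul0r ?mulr0 ?mul0r.
rewrite (sums_csum (sums_fin F)) /psums exprDn mulr_sumr; apply: eq_bigr => i _.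
by rewrite /x -mulrA; congr (_ * _); rewrite -[RHS]mulr_natl mulrA.
Qed.

(** The term of index 0 of the series defining the left side vanishes, so its partial sums are those
    of the derived series with an offset of one. *)
Lemma ps_shift1 : ps_shift a z 1 = psum (ps_deriv a) z.
Proof.
have E n : a n.+1 * ('C(n.+1, 1)%:R * z ^+ (n.+1 - 1)) = ps_deriv a n * z ^+ n.
  by rewrite bin1 subn1 /= /ps_deriv mulrA [a _ * _]mulrC.
pose u n := a n * ('C(n, 1)%:R * z ^+ (n - 1)).
have S : sums u (ps_shift a z 1).
  have s0 : 0 < (r - nm z) / 2 < r - nm z by have d0 : 0 < r - nm z; [rewrite subr_gt0|apply/andP; split; lra].
  have [M [p [q [p01 q01 B]]]] := ps_shift_bound s0.
  move: s0; set s := (_ / 2) => /andP[s0 _].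
  apply: (@geo_sums _ (M * q / s) p); split=> // n.
  have := B s%:C n 1%N; rewrite nm_real ger0_norm ?(ltW s0)// => /(_ (lexx _)).
  rewrite /x nmM nm_real ger0_norm ?(ltW s0)// -ler_pdivlMr//.
  by move/le_trans; apply; rewrite le_eqVlt; apply/orP; left; apply/eqP; rewrite ?expr1; have aux (x1 y1 z1 w1 : R) : x1 * y1 * z1 * w1 = x1 * z1 * w1 * y1; [ring|exact: aux].
apply/esym/sums_csum/cvgn_nm => e e0.
move/cvgn_nm/(_ e e0): S => [N _ HN]; exists N => // n /= Nn.
have := HN n.+1 (leqW Nn); rewrite /psums big_ord_recl /= {1}/u bin_small // mul0r mulr0 add0r.
by congr (nm (_ - _) < _); apply: eq_bigr => i _; rewrite -E.
Qed.

End Shift.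

Lemma psrad_deriv a r : psrad a r -> psrad (ps_deriv a) r.
Proof.
move=> Ha s /andP[s0 sr]; set t := (s + r) / 2.
have st : s < t by rewrite midf_lt.
have t0 : 0 < t by apply: lt_trans st.
have [|M HM] := Ha t; first by rewrite t0 midf_lt.
clearbody t; have q01 : 0 <= s / t < 1 by rewrite divr_ge0 ?(ltW t0) ?(ltW s0)//= ltr_pdivrMr// mul1r.
have Mp : 0 <= M by apply: le_trans (HM 0%N); rewrite mulr_ge0 ?nm_ge0 ?exprn_ge0 ?ltW.
exists ((1 - s / t)^-1 * (M / t)) => n.
rewrite /ps_deriv nmM nm_nat.
apply: (@le_trans _ _ (n.+1%:R * (s / t) ^+ n * (M / t))); last first.
  by apply: ler_wpM2r (natr_geo _ q01); rewrite divr_ge0 ?(ltW t0).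
rewrite -!mulrA ler_wpM2l // expr_div_n.
have -> : s ^+ n / t ^+ n * (M / t) = M / t ^+ n.+1 * s ^+ n.
  have aux (x u m v : R) : x * u * (m * v) = m * (u * v) * x by ring.
  by rewrite aux exprSr invfM.
by rewrite ler_wpM2r ?exprn_ge0 ?(ltW s0)// ler_pdivlMr ?exprn_gt0.
Qed.

Lemma psum0 a : psum a 0 = a 0%N.
Proof.
rewrite (_ : a 0%N = psums (fun n => a n * 0 ^+ n) 1).
  by apply/sums_csum/sums_fin => n; case: n => // n _; rewrite expr0n mulr0.
by rewrite /psums big_ord1 expr0 mulr1.
Qed.

Lemma psrad_drop a r k : psrad a r -> psrad (fun n => a (k + n)%N) r.
Proof.
move=> Ha t tr; have [M H] := Ha t tr; case/andP: tr => t0 _.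
exists (M / t ^+ k) => n; rewrite ler_pdivlMr ?exprn_gt0// -mulrA -exprD addnC.
exact: H.
Qed.

Lemma psum_split a r k h : psrad a r -> nm h < r ->
  psum a h = \sum_(i < k) a i * h ^+ i + h ^+ k * psum (fun n => a (k + n)%N) h.
Proof.
move=> Ha hr.
have Hs := @psrad_drop _ _ k Ha.
apply: sums_csum; apply: sums_shift.
rewrite (_ : (fun n => _) = fun n => h ^+ k * (a (k + n)%N * h ^+ n)).
  by apply: sumsZ; apply: psrad_sums Hs hr.
by apply/funext => n; rewrite mulrCA exprD.
Qed.

Lemma psum_tail a r s k : psrad a r -> 0 < s < r ->
  exists M, forall h, nm h <= s -> nm (psum a h - \sum_(i < k) a i * h ^+ i) <= M * nm h ^+ k.
Proof.
move=> Ha sr; move: (@psrad_drop _ _ k Ha) => Hs.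
have s0 : 0 <= s < r by case/andP: sr => /ltW -> ->.
have [M [q G]] := psrad_geo Hs s0.
exists (M / (1 - q)) => h hs; have H := csum_le (G h hs); rewrite -/(psum _ h) in H.
have hr : nm h < r by apply: le_lt_trans hs _; case/andP: sr.
rewrite (psum_split k Ha hr) addrAC subrr add0r nmM nmX mulrC.
by rewrite ler_wpM2r // exprn_ge0 // nm_ge0.
Qed.

End PowerSeries.

(** * Functions given locally by power series *)

Section Analytic.
Context {R : realType}.
Implicit Types (a b : nat -> Cplx R) (z h w : Cplx R) (r s M q p e : R) (f g : Cplx R -> Cplx R).

Lemma psum_cont0 a r e : psrad a r -> 0 < r -> 0 < e ->
  exists2 d, 0 < d & forall h, nm h < d -> nm (psum a h - a 0%N) < e.
Proof.
move=> Ha r0 e0; have sr : 0 < r / 2 < r by apply/andP; split; lra.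
have [M HM] := psum_tail 1 Ha sr; case/andP: sr => sr _.
have M1 : 0 < `|M| + 1 by rewrite ltr_wpDl.
exists (Num.min (r / 2) (e / (`|M| + 1))); first by rewrite lt_min sr divr_gt0.
move=> h; rewrite lt_min => /andP[h1 h2].
have := HM h (ltW h1); rewrite big_ord1 expr0 mulr1 expr1 => /le_lt_trans; apply.
rewrite ltr_pdivlMr// in h2; apply: le_lt_trans h2; rewrite mulrC ler_wpM2l ?nm_ge0//.
by apply: le_trans (ler_norm _) _; rewrite lerDl.
Qed.

Lemma psum_factor a r m h : psrad a r -> nm h < r -> (forall i, (i < m)%N -> a i = 0) ->
  psum a h = h ^+ m * psum (fun n => a (m + n)%N) h.
Proof.
move=> Ha hr H; rewrite (psum_split m Ha hr) big1 ?add0r // => i _.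
by rewrite H ?mul0r.
Qed.

Lemma ps_least a : (forall n, a n = 0) \/ exists2 m, a m != 0 & forall i, (i < m)%N -> a i = 0.
Proof.
case: (pselect (exists n, a n != 0)) => [H|H]; [right|left => n].
  case: (ex_minnP H) => m am min; exists m => // i im; apply: contraTeq im => /min.
  by rewrite -leqNgt.
by apply/eqP; apply: contraPT H => an; apply; exists n.
Qed.

(** If [m] is the first index of a nonzero coefficient, the series is [h^m] times a series that
    tends to [a m], and so is nonzero at a small positive real [h]. *)
Lemma psum_zero a r s : psrad a r -> 0 < r -> 0 < s ->
  (forall h, h != 0 -> nm h < s -> psum a h = 0) -> forall n, a n = 0.
Proof.
move=> Ha r0 s0 H; have [//|[m am min]] := ps_least a.
have Hs := @psrad_drop _ _ _ m Ha.
have e0 : 0 < nm (a m) by rewrite nm_gt0.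
have [d d0 Hd] := psum_cont0 Hs r0 e0; exfalso.
pose t := Num.min d (Num.min r s) / 2.
have [t0 td tr ts] : [/\ 0 < t, t < d, t < r & t < s].
  have m0 : 0 < Num.min d (Num.min r s) by rewrite !lt_min d0 r0.
  have lt : t < Num.min d (Num.min r s) by rewrite /t; lra.
  by move: lt; rewrite !lt_min => /and3P[? ? ?]; split=> //; rewrite divr_gt0.
have nt : nm t%:C = t by rewrite nm_real ger0_norm // ltW.
have tn : t%:C != 0 by rewrite -nm_gt0 nt.
have := H t%:C tn; rewrite nt => /(_ ts).
rewrite (psum_factor Ha _ min) ?nt// => /eqP; rewrite mulf_eq0 expf_eq0 (negPf tn) andbF /=.
move/eqP => E; have := Hd t%:C; rewrite nt E sub0r nmN addn0 ltxx => /(_ td) //.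
Qed.

Lemma psrad_opp a r : psrad a r -> psrad (fun n => - a n) r.
Proof. by move=> Ha s /Ha[M H]; exists M => n; rewrite nmN. Qed.

Lemma psum_opp a r h : psrad a r -> nm h < r -> psum (fun n => - a n) h = - psum a h.
Proof.
move=> Ha hr; rewrite -mulN1r -(psumZ _ Ha hr); congr csum; apply/funext => n.
by rewrite mulN1r.
Qed.

(** The radius is part of the data: sums of series of functions, and the continuation of a solution
    of a differential equation, need expansions valid in a prescribed disc. *)
Definition anal_ball f z r a := psrad a r /\ forall w, nm (w - z) < r -> f w = psum a (w - z).

Definition anal_at f z := exists r a, 0 < r /\ anal_ball f z r a.

Lemma anal_ball_le f z r r' a : r' <= r -> anal_ball f z r a -> anal_ball f z r' a.
Proof.
by move=> rr [H1 H2]; split=> [|w wr]; [apply: psrad_le H1|apply: H2; apply: lt_le_trans rr].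
Qed.

Lemma anal_ball_shift f z r a w : anal_ball f z r a -> nm (w - z) < r ->
  anal_ball f w (r - nm (w - z)) (ps_shift a (w - z)).
Proof.
move=> [Ha Hf] wr; split; first exact: psrad_shift.
move=> u ur; rewrite (psum_shift Ha wr ur) Hf; first by congr psum; ring.
by apply: le_lt_trans (nm_subD _ w _) _; rewrite -ltrBrDr.
Qed.

Lemma anal_near f z : anal_at f z -> \forall w \near z, anal_at f w.
Proof.
move=> [r [a [r0 H]]]; apply/nbhs_nm; exists r => // w wr.
by exists (r - nm (w - z)), (ps_shift a (w - z)); rewrite subr_gt0; split=> //; apply: anal_ball_shift.
Qed.

Lemma anal_ball_near f z r a w : anal_ball f z r a -> nm (w - z) < r -> anal_at f w.
Proof.
move=> H wr; exists (r - nm (w - z)), (ps_shift a (w - z)).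
by rewrite subr_gt0; split=> //; apply: anal_ball_shift.
Qed.

Lemma anal_ext f g z : (\forall w \near z, f w = g w) -> anal_at f z -> anal_at g z.
Proof.
move=> /nbhs_nm[s s0 E] [r [a [r0 [H1 H2]]]].
exists (Num.min r s), a; rewrite lt_min r0 s0; split=> //; split.
  by apply: psrad_le H1; rewrite ge_min lexx.
by move=> w; rewrite lt_min => /andP[wr ws]; rewrite -E // H2.
Qed.

Lemma anal_ball_uniq f z r a r' a' : 0 < r -> 0 < r' ->
  anal_ball f z r a -> anal_ball f z r' a' -> a =1 a'.
Proof.
move=> r0 r0' [H1 H2] [H1' H2'] n; apply/eqP; rewrite -subr_eq0; apply/eqP.
pose m := Num.min r r'.
have m0 : 0 < m by rewrite lt_min r0.
have Hm : psrad a m by apply: psrad_le H1; rewrite ge_min lexx.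
have Hm' : psrad a' m by apply: psrad_le H1'; rewrite ge_min lexx orbT.
have := psum_zero (psradD Hm (psrad_opp Hm')) m0 m0; apply => h _ hm.
rewrite (psumD Hm (psrad_opp Hm') hm) (psum_opp Hm' hm).
move: (hm); rewrite lt_min => /andP[hr hr'].
have := H2 (z + h); rewrite addrAC subrr add0r => /(_ hr) <-.
have := H2' (z + h); rewrite addrAC subrr add0r => /(_ hr') <-.
by rewrite subrr.
Qed.

Lemma anal_cst c z : anal_at (fun=> c) z.
Proof.
exists 1, (fun n => if n is 0%N then c else 0); split=> //.
have F n : (1 <= n)%N -> (if n is 0%N then c else 0) = 0 by case: n.
split; first exact: psrad_fin F.
by move=> w _; rewrite (psum_fin _ F) big_ord1 expr0 mulr1.
Qed.

Lemma anal_poly (P : {poly Cplx R}) z : anal_at (fun w => P.[w]) z.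
Proof.
exists 1, (fun n => (P \Po ('X + z%:P))`_n); split=> //; split; first exact: psrad_poly.
by move=> w _; rewrite psum_poly horner_comp hornerD hornerX hornerC subrK.
Qed.

Lemma anal_id z : anal_at (fun w => w) z.
Proof. by apply: anal_ext (anal_poly 'X z); apply/nbhs_nm; exists 1 => // w _; rewrite hornerX. Qed.

Lemma anal_ballD f g z r a b : anal_ball f z r a -> anal_ball g z r b ->
  anal_ball (fun w => f w + g w) z r (fun n => a n + b n).
Proof.
move=> [H1 H2] [H1' H2']; split; first exact: psradD.
by move=> w wr; rewrite (psumD H1 H1' wr) H2 // H2'.
Qed.

Lemma anal_ballM f g z r a b : anal_ball f z r a -> anal_ball g z r b ->
  anal_ball (fun w => f w * g w) z r (psconv a b).
Proof.
move=> [H1 H2] [H1' H2']; split; first exact: psrad_conv.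
by move=> w wr; rewrite (psum_conv H1 H1' wr) H2 // H2'.
Qed.

Lemma anal_common f g z : anal_at f z -> anal_at g z ->
  exists r a b, [/\ 0 < r, anal_ball f z r a & anal_ball g z r b].
Proof.
move=> [r [a [r0 H]]] [s [b [s0 H']]]; exists (Num.min r s), a, b.
by rewrite lt_min r0 s0; split=> //; [apply: anal_ball_le H|apply: anal_ball_le H']; rewrite ge_min lexx ?orbT.
Qed.

Lemma analD f g z : anal_at f z -> anal_at g z -> anal_at (fun w => f w + g w) z.
Proof.
move=> Hf Hg; have [r [a [b [r0 H1 H2]]]] := anal_common Hf Hg.
by exists r, (fun n => a n + b n); split=> //; apply: anal_ballD.
Qed.

Lemma analM f g z : anal_at f z -> anal_at g z -> anal_at (fun w => f w * g w) z.
Proof.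
move=> Hf Hg; have [r [a [b [r0 H1 H2]]]] := anal_common Hf Hg.
by exists r, (psconv a b); split=> //; apply: anal_ballM.
Qed.

Lemma anal_sum (I : Type) (s : seq I) (F : I -> Cplx R -> Cplx R) z :
  (forall i, anal_at (F i) z) -> anal_at (fun w => \sum_(i <- s) F i w) z.
Proof.
move=> H; elim: s => [|i s IH].
  apply: anal_ext (anal_cst 0 z); apply/nbhs_nm; exists 1 => // w _.
  by rewrite big_nil.
apply: anal_ext (analD (H i) IH); apply/nbhs_nm; exists 1 => // w _.
by rewrite big_cons.
Qed.

Lemma anal_exp f z n : anal_at f z -> anal_at (fun w => f w ^+ n) z.
Proof.
move=> H; elim: n => [|n IH].
  by apply: anal_ext (anal_cst 1 z); apply/nbhs_nm; exists 1 => // w _; rewrite expr0.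
by apply: anal_ext (analM H IH); apply/nbhs_nm; exists 1 => // w _; rewrite exprS.
Qed.

Lemma anal_sub z c : anal_at (fun w => w - c) z.
Proof. exact: analD (anal_id z) (anal_cst (- c) z). Qed.

Lemma anal_cont f z e : anal_at f z -> 0 < e ->
  exists2 d, 0 < d & forall w, nm (w - z) < d -> nm (f w - f z) < e.
Proof.
move=> [r [a [r0 [H1 H2]]]] e0; have [d d0 Hd] := psum_cont0 H1 r0 e0.
exists (Num.min d r); rewrite ?lt_min ?d0 // => w; rewrite lt_min => /andP[wd wr].
have -> : f z = a 0%N by rewrite H2 subrr ?nm0 // psum0.
by rewrite H2 //; apply: Hd.
Qed.

(** The reciprocal series is defined by course-of-values recursion: the list holds its coefficients
    of indices 0 to [n]. *)
Fixpoint ps_inv_seq a n : seq (Cplx R) :=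
  if n is m.+1 then
    let s := ps_inv_seq a m in
    rcons s (- (a 0%N)^-1 * \sum_(i < m.+1) a i.+1 * nth 0 s (m - i)%N)
  else [:: (a 0%N)^-1].

Definition ps_inv a n := nth 0 (ps_inv_seq a n) n.

Lemma size_ps_inv a n : size (ps_inv_seq a n) = n.+1.
Proof. by elim: n => //= n IH; rewrite size_rcons IH. Qed.

Lemma ps_inv_nth a m n : (n <= m)%N -> nth 0 (ps_inv_seq a m) n = ps_inv a n.
Proof.
move=> /subnK <-; elim: (m - n)%N => [//|k IH].
by rewrite addSn /= nth_rcons size_ps_inv ltnS leq_addl IH.
Qed.

Lemma ps_invS a n : ps_inv a n.+1 = - (a 0%N)^-1 * \sum_(i < n.+1) a i.+1 * ps_inv a (n - i)%N.
Proof.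
rewrite {1}/ps_inv /= nth_rcons size_ps_inv ltnn eqxx; congr (_ * _).
by apply: eq_bigr => i _; rewrite ps_inv_nth // leq_subr.
Qed.

Lemma conv_inv a n : a 0%N != 0 -> psconv a (ps_inv a) n = (n == 0%N)%:R.
Proof.
move=> a0; rewrite /psconv; case: n => [|n].
  by rewrite big_ord1 /ps_inv /= divff.
rewrite big_ord_recl /= subn0 ps_invS mulrA mulrN divff // mulN1r addrC.
by apply/eqP; rewrite subr_eq0; apply/eqP; apply: eq_bigr => i _; rewrite /bump leq0n.
Qed.

(** With [c n = |b_n| s^n] for the reciprocal series [b], the recursion gives
    [c (n+1) <= M (c 0 + ... + c n)]. Since [M (1 + K + ... + K^n) = K^(n+1) - 1] for [K = 1 + M],
    strong induction yields [c n <= c 0 K^n]. *)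
Lemma psrad_inv a r : psrad a r -> 0 < r -> a 0%N != 0 -> exists2 s, 0 < s & psrad (ps_inv a) s.
Proof.
move=> Ha r0 a0; have sr : 0 < r / 2 < r by apply/andP; split; lra.
have [M0 HM0] := Ha _ sr; case/andP: sr; set s := r / 2 => s0 _.
have na : 0 < nm (a 0%N) by rewrite nm_gt0.
pose M := M0 / nm (a 0%N).
have Mp : 0 <= M by rewrite divr_ge0 ?nm_ge0 //; apply: le_trans (HM0 0%N); rewrite mulr_ge0 ?nm_ge0 ?exprn_ge0 ?(ltW s0).
pose K := 1 + M; have K0 : 0 < K by rewrite ltr_pwDl.
pose c n := nm (ps_inv a n) * s ^+ n.
have c0 n : 0 <= c n by rewrite mulr_ge0 ?nm_ge0 ?exprn_ge0 ?(ltW s0).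
have step n : c n.+1 <= \sum_(i < n.+1) M * c (n - i)%N.
  rewrite /c ps_invS nmM nmN nmV -mulrA; apply: (@le_trans _ _ ((nm (a 0%N))^-1 *
     ((\sum_(i < n.+1) nm (a i.+1 * ps_inv a (n - i)%N)) * s ^+ n.+1))).
    by rewrite ler_wpM2l ?invr_ge0 ?nm_ge0// ler_wpM2r ?exprn_ge0 ?(ltW s0)// nm_sum.
  rewrite mulr_suml mulr_sumr; apply: ler_sum => i _.
  have E : s ^+ n.+1 = s ^+ i.+1 * s ^+ (n - i) by rewrite -exprD addSn subnKC // -ltnS.
  have aux (x y u v w : R) : x * (y * u * (v * w)) = y * v * x * (u * w) by ring.
  rewrite nmM E aux; apply: ler_wpM2r; first by rewrite mulr_ge0 ?nm_ge0 ?exprn_ge0 ?(ltW s0).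
  by apply: ler_wpM2r (HM0 _); rewrite invr_ge0 nm_ge0.
have bound n : c n <= c 0%N * K ^+ n.
  have [k] := ubnP n; elim: k n => // k IH [|n] nk; first by rewrite expr0 mulr1.
  apply: le_trans (step n) _.
  apply: (@le_trans _ _ (\sum_(i < n.+1) M * (c 0%N * K ^+ (n - i)))).
    apply: ler_sum => i _; apply: ler_wpM2l => //; apply: IH.
    by apply: leq_ltn_trans (leq_subr _ _) _.
  have -> : \sum_(i < n.+1) M * (c 0%N * K ^+ (n - i)) = c 0%N * (K ^+ n.+1 - 1).
    rewrite subrX1 /K addrAC subrr add0r -/K mulrCA mulr_sumr mulr_sumr.
    rewrite (reindex_inj rev_ord_inj) /=; apply: eq_bigr => i _.
    by rewrite subSS subKn // -ltnS.
  by apply: ler_wpM2l => //; rewrite lerBlDr lerDl.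
exists (s / K); first by rewrite divr_gt0.
apply: psrad_const; first by rewrite divr_gt0.
exists (c 0%N) => n; rewrite expr_div_n mulrA ler_pdivrMr ?exprn_gt0//.
exact: bound.
Qed.

Lemma anal_inv f z : anal_at f z -> f z != 0 -> anal_at (fun w => (f w)^-1) z.
Proof.
move=> [r [a [r0 [H1 H2]]]] fz.
have E : f z = a 0%N by rewrite H2 subrr ?nm0 // psum0.
rewrite E in fz; have [s s0 Hs] := psrad_inv H1 r0 fz.
exists (Num.min r s), (ps_inv a); rewrite lt_min r0 s0; split=> //.
have H1' : psrad a (Num.min r s) by apply: psrad_le H1; rewrite ge_min lexx.
have Hs' : psrad (ps_inv a) (Num.min r s) by apply: psrad_le Hs; rewrite ge_min lexx orbT.
split=> // w wr.
have P := psum_conv H1' Hs' wr.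
have P1 : psum (psconv a (ps_inv a)) (w - z) = 1.
  rewrite (@psum_fin _ _ 1) => [|n]; first by rewrite big_ord1 conv_inv // expr0 mulr1.
  by case: n => // n _; rewrite conv_inv.
rewrite P1 in P; rewrite H2; last by move: wr; rewrite lt_min => /andP[].
have nz : psum a (w - z) != 0 by apply/eqP => Z; move: P; rewrite Z mul0r => /eqP; rewrite oner_eq0.
by apply: (mulfI nz); rewrite -P divff.
Qed.

Lemma analM_div f g z : anal_at f z -> anal_at g z -> g z != 0 -> anal_at (fun w => f w / g w) z.
Proof. by move=> Hf Hg gz; apply: analM => //; apply: anal_inv. Qed.

Lemma anal_dich f z : anal_at f z -> (\forall w \near z, f w = 0) \/
  exists m (h : Cplx R -> Cplx R), [/\ anal_at h z, h z != 0 & \forall w \near z, f w = (w - z) ^+ m * h w].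
Proof.
move=> [r [a [r0 [H1 H2]]]]; have [Z|[m am min]] := ps_least a; [left|right].
  apply/nbhs_nm; exists r => // w wr; rewrite H2 // (@psum_fin _ _ 0) ?big_ord0//.
exists m, (fun w => psum (fun n => a (m + n)%N) (w - z)); split.
- by exists r, (fun n => a (m + n)%N); split=> //; split=> //; apply: psrad_drop.
- by rewrite subrr psum0 addn0.
- by apply/nbhs_nm; exists r => // w wr; rewrite H2 // (psum_factor H1 wr min).
Qed.

Lemma anal_nonzero f z : anal_at f z -> f z != 0 -> \forall w \near z, f w != 0.
Proof.
move=> H fz; have e0 : 0 < nm (f z) by rewrite nm_gt0.
have [d d0 Hd] := anal_cont H e0; apply/nbhs_nm; exists d => // w /Hd.
by apply: contraTneq => ->; rewrite sub0r nmN ltxx.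
Qed.

(* The complex derivative of an analytic function, 0 where [f] is not analytic. *)
Definition dz f z : Cplx R := xget 0 [set c | exists r a, [/\ 0 < r, anal_ball f z r a & c = a 1%N]].

Lemma dzE f z r a : 0 < r -> anal_ball f z r a -> dz f z = a 1%N.
Proof.
move=> r0 H; rewrite /dz; case: xgetP => [c -> [s [b [s0 Hb ->]]]|].
  exact: (anal_ball_uniq s0 r0 Hb H).
by move=> /(_ (a 1%N)) /= []; exists r, a.
Qed.

Lemma anal_ball_dz f z r a : anal_ball f z r a -> anal_ball (dz f) z r (ps_deriv a).
Proof.
move=> H; case: (H) => H1 H2; split; first exact: psrad_deriv.
move=> w wr; have S := anal_ball_shift H wr.
by rewrite (dzE _ S) ?subr_gt0// (ps_shift1 H1 wr).
Qed.

Lemma anal_dz f z : anal_at f z -> anal_at (dz f) z.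
Proof. by move=> [r [a [r0 H]]]; exists r, (ps_deriv a); split=> //; apply: anal_ball_dz. Qed.

Lemma dz_ext f g z : (\forall w \near z, f w = g w) -> anal_at f z -> dz f z = dz g z.
Proof.
move=> E H; have Hg := anal_ext E H; case: H => r [a [r0 Ha]].
case: Hg => s [b [s0 Hb]]; rewrite (dzE r0 Ha) (dzE s0 Hb).
move/nbhs_nm: E => [t t0 E].
pose m := Num.min r t; have m0 : 0 < m by rewrite lt_min r0.
have Ha' : anal_ball g z m a.
  split; first by apply: psrad_le Ha.1; rewrite ge_min lexx.
  by move=> w; rewrite lt_min => /andP[wr wt]; rewrite -E // Ha.2.
exact: (anal_ball_uniq m0 s0 Ha' Hb).
Qed.

Lemma dzM f g z : anal_at f z -> anal_at g z ->
  dz (fun w => f w * g w) z = dz f z * g z + f z * dz g z.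
Proof.
move=> Hf Hg; have [r [a [b [r0 H1 H2]]]] := anal_common Hf Hg.
rewrite (dzE r0 (anal_ballM H1 H2)) (dzE r0 H1) (dzE r0 H2) /psconv.
have -> : f z = a 0%N by rewrite H1.2 subrr ?nm0 // psum0.
have -> : g z = b 0%N by rewrite H2.2 subrr ?nm0 // psum0.
by rewrite big_ord_recl big_ord1 /= addrC.
Qed.

Lemma anal_diff f z : anal_at f z -> exists M d, 0 < d /\
  forall w, nm (w - z) <= d -> nm (f w - f z - dz f z * (w - z)) <= M * nm (w - z) ^+ 2.
Proof.
move=> [r [a [r0 H]]]; have sr : 0 < r / 2 < r by apply/andP; split; lra.
have [M HM] := psum_tail 2 H.1 sr; exists M, (r / 2); split; first by case/andP: sr.
move=> w wr; have := HM _ wr; rewrite big_ord_recl big_ord1 /= expr0 expr1 mulr1.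
rewrite -H.2; last by apply: le_lt_trans wr _; case/andP: sr.
have -> : f z = a 0%N by rewrite H.2 subrr ?nm0 // psum0.
by rewrite (dzE r0 H) opprD addrA.
Qed.

Lemma anal_derivable f z : anal_at f z -> derivable f z 1.
Proof.
move=> /anal_diff[M [d [d0 H]]]; rewrite /derivable.
apply/cvg_ex; exists (dz f z); apply/cvgrPdist_lt => e /gt0_complex[r r0 ->].
near=> h; rewrite distrC normE ltcR.
have h0 : h != 0 by near: h; apply: nbhs_dnbhs_neq.
have hd : nm h < Num.min d (r / (`|M| + 1)).
  near: h; apply/dnbhs_nm; exists (Num.min d (r / (`|M| + 1))).
    by rewrite lt_min d0 divr_gt0// ltr_wpDl.
  by move=> w _; rewrite subr0.
move: hd; rewrite lt_min => /andP[hd hr].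
have E : h^-1 *: (f (h *: 1 + z) - f z) - dz f z = h^-1 * (f (h + z) - f z - dz f z * h).
  have -> : h *: 1 = h :> Cplx R by rewrite /GRing.scale /= mulr1.
  rewrite [RHS]mulrBr; congr (_ - _).
  by have aux (x y : Cplx R) : y != 0 -> x = y^-1 * (x * y); [move=> y0; field|apply: aux].
change (nm (h^-1 *: (f (h *: 1 + z) - f z) - dz f z) < r).
rewrite E; have := H (h + z); rewrite addrK => /(_ (ltW hd)) H'.
rewrite nmM nmV mulrC; have nh : 0 < nm h by rewrite nm_gt0.
rewrite ltr_pdivrMr//; apply: le_lt_trans H' _.
rewrite expr2 mulrA ltr_pM2r//.
rewrite ltr_pdivlMr ?ltr_wpDl// in hr; apply: le_lt_trans hr; rewrite mulrC ler_wpM2l ?nm_ge0//.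
by apply: le_trans (ler_norm _) _; rewrite lerDl.
Unshelve. all: by end_near.
Qed.

Lemma anal_holomorphic f z : anal_at f z -> holomorphic_at f z.
Proof. by move/anal_near; apply: filterS => w; apply: anal_derivable. Qed.

End Analytic.

(** * Meromorphic functions *)

Lemma prod_sub_prim_root (F : fieldType) (x u y : F) N : (0 < N)%N -> N.-primitive_root x ->
  \prod_(j < N) (u - y * x ^+ j) = u ^+ N - y ^+ N.
Proof.
move=> N0 xN; have [->|y0] := eqVneq y 0.
  rewrite expr0n eqn0Ngt N0 subr0; under eq_bigr do rewrite mul0r subr0.
  by rewrite prodr_const card_ord.
have := factor_Xn_sub_1 xN => /(congr1 (fun p : {poly F} => p.[u / y])).
rewrite horner_prod big_mkord hornerD hornerN hornerXn hornerC => H.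
transitivity (y ^+ N * ((u / y) ^+ N - 1)); last first.
  by rewrite mulrBr mulr1 expr_div_n mulrC divfK ?expf_neq0.
have -> : y ^+ N = \prod_(j < N) y by rewrite prodr_const card_ord.
rewrite -H -big_split /=; apply: eq_bigr => j _.
by rewrite hornerXsubC mulrBr [y * (u / y)]mulrC divfK.
Qed.

Section Meromorphic.
Context {R : realType}.
Implicit Types (a b : nat -> Cplx R) (z w : Cplx R) (r s M q p e : R) (f g : Cplx R -> Cplx R).

Lemma near_nm (z : Cplx R) r (P : Cplx R -> Prop) : 0 < r -> (forall w, nm (w - z) < r -> P w) ->
  \forall w \near z, P w.
Proof. by move=> r0 H; apply/nbhs_nm; exists r. Qed.

Lemma near_all (z : Cplx R) (P : Cplx R -> Prop) : (forall w, P w) -> \forall w \near z, P w.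
Proof. by move=> H; apply: (@near_nm _ 1). Qed.

Lemma near_dnbhs (z : Cplx R) (P : Cplx R -> Prop) :
  (\forall w \near z, P w) -> \forall w \near z^', P w.
Proof. by move=> /nbhs_nm[r r0 H]; apply/dnbhs_nm; exists r => // w _; apply: H. Qed.

Lemma dnbhs_and (z : Cplx R) (P Q S : Cplx R -> Prop) :
  (\forall w \near z^', P w) -> (\forall w \near z^', Q w) -> (forall w, w != z -> P w -> Q w -> S w) ->
  \forall w \near z^', S w.
Proof.
move=> /dnbhs_nm[r r0 H1] /dnbhs_nm[s s0 H2] H; apply/dnbhs_nm; exists (Num.min r s).
  by rewrite lt_min r0.
by move=> w wz; rewrite lt_min => /andP[wr ws]; apply: H; [|apply: H1|apply: H2].
Qed.

Lemma dnbhs_ex (z : Cplx R) (P : Cplx R -> Prop) e : 0 < e ->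
  (\forall w \near z^', P w) -> exists w, [/\ w != z, nm (w - z) < e & P w].
Proof.
move=> e0 /dnbhs_nm[r r0 H]; pose t := Num.min r e / 2.
have m0 : 0 < Num.min r e by rewrite lt_min r0.
have t0 : 0 < t by rewrite divr_gt0.
have tl : t < Num.min r e by rewrite /t; lra.
have E : nm (z + t%:C - z) = t by rewrite addrAC subrr add0r nm_real ger0_norm // ltW.
have N : z + t%:C != z by rewrite -subr_eq0 -nm_gt0 E.
exists (z + t%:C); rewrite E; move: tl; rewrite lt_min => /andP[tr te].
by split=> //; apply: H; rewrite ?E.
Qed.

(** A stronger local form of [meromorphic_on], in which the numerator has a power series. It is
    established for [F] and [W]; a hypothetical continuation is only assumed to satisfy the weaker
    form. *)
Definition mero_at f z := exists n (h : Cplx R -> Cplx R), anal_at h z /\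
  \forall w \near z^', f w = h w / (w - z) ^+ n.

Lemma mero_meromorphic (D : set (Cplx R)) f : (forall z, D z -> mero_at f z) -> meromorphic_on D f.
Proof.
move=> H z /H[n [h [Hh E]]]; exists n, h; split=> //; exact: anal_holomorphic.
Qed.

Lemma anal_mero f z : anal_at f z -> mero_at f z.
Proof.
by move=> H; exists 0%N, f; split=> //; apply/near_dnbhs/near_all => w; rewrite expr0 divr1.
Qed.

Lemma mero_ext f g z : (\forall w \near z^', f w = g w) -> mero_at f z -> mero_at g z.
Proof.
move=> E [n [h [Hh H]]]; exists n, h; split=> //.
by apply: dnbhs_and E H _ => w _ -> .
Qed.

Lemma mero_add f g z : mero_at f z -> mero_at g z -> mero_at (fun w => f w + g w) z.
Proof.
move=> [n [h [Hh H]]] [m [k [Hk K]]].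
exists (n + m)%N, (fun w => h w * (w - z) ^+ m + k w * (w - z) ^+ n); split.
  by apply: analD; apply: analM => //; apply: anal_exp; apply: anal_sub.
apply: dnbhs_and H K _ => w wz -> ->; rewrite -subr_eq0 in wz.
by rewrite exprD; field; rewrite !expf_neq0.
Qed.

Lemma mero_mul f g z : mero_at f z -> mero_at g z -> mero_at (fun w => f w * g w) z.
Proof.
move=> [n [h [Hh H]]] [m [k [Hk K]]].
exists (n + m)%N, (fun w => h w * k w); split; first exact: analM.
apply: dnbhs_and H K _ => w wz -> ->; rewrite -subr_eq0 in wz.
by rewrite exprD; field; rewrite !expf_neq0.
Qed.

Lemma mero_sum (I : Type) (s : seq I) (F : I -> Cplx R -> Cplx R) z :
  (forall i, mero_at (F i) z) -> mero_at (fun w => \sum_(i <- s) F i w) z.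
Proof.
move=> H; elim: s => [|i s IH].
  apply: mero_ext (anal_mero (anal_cst 0 z)); apply/near_dnbhs/near_all => w.
  by rewrite big_nil.
apply: mero_ext (mero_add (H i) IH); apply/near_dnbhs/near_all => w.
by rewrite big_cons.
Qed.

(** If [f] vanishes around [z], so does its inverse, by the convention [0^-1 = 0]. Otherwise the
    numerator is a power of [w - z] times a function that does not vanish at [z]. *)
Lemma mero_inv f z : mero_at f z -> mero_at (fun w => (f w)^-1) z.
Proof.
move=> [n [h [Hh H]]]; have [Z|[m [k [Hk kz E]]]] := anal_dich Hh.
  apply: mero_ext (anal_mero (anal_cst 0 z)).
  by apply: dnbhs_and H (near_dnbhs Z) _ => w _ -> ->; rewrite mul0r invr0.
exists m, (fun w => (w - z) ^+ n / k w); split.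
  by apply: analM_div => //; apply: anal_exp; apply: anal_sub.
apply: dnbhs_and H (near_dnbhs E) _ => w wz -> ->; rewrite -subr_eq0 in wz.
by rewrite invfM invrK invfM mulrC [_ / k w * _]mulrAC mulrA.
Qed.

Lemma mero_div f g z : mero_at f z -> mero_at g z -> mero_at (fun w => f w / g w) z.
Proof. by move=> Hf Hg; apply: mero_mul => //; apply: mero_inv. Qed.

Lemma mero_dich f z : mero_at f z ->
  (\forall w \near z^', f w = 0) \/ (\forall w \near z^', f w != 0).
Proof.
move=> [n [h [Hh H]]]; have [Z|[m [k [Hk kz E]]]] := anal_dich Hh; [left|right].
  by apply: dnbhs_and H (near_dnbhs Z) _ => w _ -> ->; rewrite mul0r.
have NZ := anal_nonzero Hk kz.
apply: dnbhs_and (near_dnbhs E) (dnbhs_and H (near_dnbhs NZ) (fun w _ => @conj _ _)) _.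
move=> w wz E' [-> nk]; rewrite E' -subr_eq0 in wz *.
by rewrite !mulf_neq0 ?invr_eq0 ?expf_neq0.
Qed.

Lemma mero_anal_near f z : mero_at f z -> \forall w \near z^', anal_at f w.
Proof.
move=> [n [h [Hh H]]].
have /dnbhs_nm[r r0 {}H] := H; have /nbhs_nm[s s0 A] := anal_near Hh.
apply/dnbhs_nm; exists (Num.min r s); first by rewrite lt_min r0.
move=> w wz; rewrite lt_min => /andP[wr ws].
pose t := Num.min (r - nm (w - z)) (nm (w - z)).
have t0 : 0 < t by rewrite lt_min subr_gt0 wr nm_gt0 subr_eq0.
apply: (@anal_ext _ (fun u => h u / (u - z) ^+ n)).
  apply: near_nm t0 _ => u; rewrite lt_min => /andP[u1 u2]; rewrite H //.
    by apply: contraTneq u2 => ->; rewrite nmB ltxx.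
  by apply: le_lt_trans (nm_subD _ w _) _; rewrite -ltrBrDr.
apply: analM_div; rewrite ?expf_neq0 ?subr_eq0//; first exact: A.
by apply: anal_exp; apply: anal_sub.
Qed.

(** Differentiating [f k = h] with [k = (w - z)^n] gives the quotient rule, with denominator
    [k^2]. *)
Lemma mero_dz f z : mero_at f z -> mero_at (dz f) z.
Proof.
move=> mf; have [n [h [Hh H]]] := mf.
pose k w := (w - z) ^+ n.
have Hk w : anal_at k w by apply: anal_exp; apply: anal_sub.
exists (n + n)%N, (fun w => dz h w * k w + h w * (-1 * dz k w)); split.
  apply: analD; apply: analM => //; first exact: anal_dz.
  by apply: analM; [apply: anal_cst|apply: anal_dz].
have /dnbhs_nm[r r0 {}H] := H; have /nbhs_nm[s s0 A] := anal_near Hh.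
have /dnbhs_nm[s' s'0 A'] := mero_anal_near mf.
apply/dnbhs_nm; exists (Num.min r (Num.min s s')); first by rewrite !lt_min r0 s0.
move=> w wz; rewrite !lt_min => /and3P[wr ws ws'].
have k0 : k w != 0 by rewrite expf_neq0 ?subr_eq0.
pose t := Num.min (r - nm (w - z)) (nm (w - z)).
have t0 : 0 < t by rewrite lt_min subr_gt0 wr nm_gt0 subr_eq0.
have E : \forall u \near w, f u * k u = h u.
  apply: near_nm t0 _ => u; rewrite lt_min => /andP[u1 u2].
  have uz : u != z by apply: contraTneq u2 => ->; rewrite nmB ltxx.
  rewrite H; [by rewrite divfK // expf_neq0 ?subr_eq0|exact: uz|].
  by apply: le_lt_trans (nm_subD _ w _) _; rewrite -ltrBrDr.
have fw := A' w wz ws'.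
have := dz_ext E (analM fw (Hk w)); rewrite (dzM fw (Hk w)) => D.
rewrite -D H // exprD -/(k w); field; exact: k0.
Qed.

Lemma mero_iter_dz f z n : mero_at f z -> mero_at (iter n dz f) z.
Proof. by move=> H; elim: n => //= n IH; apply: mero_dz. Qed.

(** By [mero_dich], the points of [A] around which [f] vanishes and those around which it does not
    are complementary, and both conditions are open. *)
Lemma mero_identity (A : set (Cplx R)) f z0 : connected A -> (forall z, A z -> mero_at f z) ->
  A z0 -> (\forall w \near z0^', f w = 0) -> forall z, A z -> \forall w \near z^', f w = 0.
Proof.
move=> cA Hf A0 Z0.
pose C := [set z | \forall w \near z^', f w = 0].
pose C' := [set z | \forall w \near z^', f w != 0].
have opn (P : set (Cplx R)) : open [set z | \forall w \near z^', P w].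
  rewrite openE => z /= /dnbhs_nm[r r0 H]; apply/nbhs_nm; exists r => // w wr.
  have [->|wz] := eqVneq w z; first by apply/dnbhs_nm; exists r.
  apply/dnbhs_nm; exists (Num.min (r - nm (w - z)) (nm (w - z))).
    by rewrite lt_min subr_gt0 wr nm_gt0 subr_eq0.
  move=> u _; rewrite lt_min => /andP[u1 u2]; apply: H.
    by apply: contraTneq u2 => ->; rewrite nmB ltxx.
  by apply: le_lt_trans (nm_subD _ w _) _; rewrite -ltrBrDr.
suff E : A `&` C = A by move=> z; rewrite -E => -[].
apply: cA; first by exists z0.
  by exists C => //; apply: opn.
exists (~` C'); first by apply: open_closedC; apply: opn.
apply/seteqP; split=> z; move=> [Az H].
  split; [exact: Az|move=> H'].
  have [w [_ _ []]] := dnbhs_ex ltr01 (dnbhs_and H H' (fun w _ => @conj _ _)).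
  by move=> ->; rewrite eqxx.
split; [exact: Az|have [h|h] := mero_dich (Hf z Az)]; first exact: h.
by case: (H h).
Qed.

Lemma prim_root_ex N : (0 < N)%N -> exists x : Cplx R, N.-primitive_root x.
Proof.
move=> N0; pose P : {poly R[i]} := 'X^N - 1; have [rs Dp] := closed_field_poly_normal P.
rewrite (monicP _) ?monicXnsubC // scale1r in Dp.
have rn1 : all N.-unity_root rs by apply/allP=> z; rewrite -root_prod_XsubC -Dp.
have sz_r : (N < (size rs).+1)%N by rewrite -(size_prod_XsubC rs id) -Dp size_XnsubC.
have [|z] := hasP (has_prim_root N0 rn1 _ sz_r); last by exists z.
by rewrite -separable_prod_XsubC -Dp separable_Xn_sub_1 // pnatr_eq0 -lt0n.
Qed.

Lemma nm_root1 (x : Cplx R) N : (0 < N)%N -> x ^+ N = 1 -> nm x = 1.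
Proof.
move=> N0 E; have := nmX x N; rewrite E nm1 => /esym/eqP.
by rewrite pexpr_eq1 // ?nm_ge0 // => /eqP.
Qed.

Lemma sum_root1 (x : Cplx R) N : x ^+ N = 1 -> x != 1 -> \sum_(j < N) x ^+ j = 0.
Proof.
move=> E x1; apply/eqP; have := subrX1 x N; rewrite E subrr => /esym/eqP.
by rewrite mulf_eq0 subr_eq0 (negPf x1).
Qed.

(* The mean of [f(z + s x^j) / x^(jn)] over the [N]-th roots of unity [x^j] tends to [a_n s^n] as [N] grows, which replaces the integral formula. *)
Lemma cauchy_estimate f z r a s M : anal_ball f z r a -> 0 < s < r ->
  (forall w, nm (w - z) = s -> nm (f w) <= M) -> forall n, nm (a n) * s ^+ n <= M.
Proof.
move=> [H1 H2] /andP[s0 sr] HM n.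
have [|C [q G]] := psrad_geo (s := s) H1; first by rewrite (ltW s0).
have ss : nm s%:C = s by rewrite nm_real ger0_norm ?(ltW s0).
have ss' : nm s%:C <= s by rewrite ss.
have [q01 _] := G s%:C ss'.
apply/ler_addgt0Pr => e e0.
have [N0 HN] := geo_small (C / (1 - q)) q01 e0; pose N := maxn N0 n.+1.
have [|x xN] := @prim_root_ex N; first by rewrite leq_max orbT.
have xN1 := prim_expr_order xN.
have Np : (0 < N)%N by rewrite leq_max orbT.
have nx := nm_root1 Np xN1.
have x0 : x != 0 by rewrite -nm_gt0 nx.
pose T h := \sum_(i < N) a i * h ^+ i.
have E : \sum_(j < N) T (s%:C * x ^+ j) * (x ^+ j)^-1 ^+ n = N%:R * (a n * s%:C ^+ n).
  transitivity (\sum_(i < N) a i * s%:C ^+ i * \sum_(j < N) (x ^+ i / x ^+ n) ^+ j).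
    under eq_bigr => j _ do rewrite /T mulr_suml.
    rewrite exchange_big /=; apply: eq_bigr => i _; rewrite mulr_sumr; apply: eq_bigr => j _.
    have -> : (x ^+ i / x ^+ n) ^+ j = (x ^+ j) ^+ i * (x ^+ j)^-1 ^+ n.
      by rewrite expr_div_n exprVn -!exprM ![(_ * j)%N]mulnC.
    rewrite exprMn_comm; last exact: mulrC.
    by rewrite !mulrA.
  have nN : (n < N)%N by rewrite leq_max leqnn orbT.
  rewrite (bigD1 (Ordinal nN)) //= [X in _ + X]big1 ?addr0 => [|i ine].
    rewrite divff ?expf_neq0//; under eq_bigr do rewrite expr1n.
    by rewrite sumr_const card_ord mulrC -mulr_natl mulr1.
  rewrite sum_root1 ?mulr0 //.
    by rewrite expr_div_n -!exprM ![(_ * N)%N]mulnC !exprM xN1 !expr1n divr1.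
  apply: contraNneq ine => H; apply/eqP/val_inj => /=.
  have : x ^+ i = x ^+ n by rewrite -[LHS](divfK (expf_neq0 n x0)) H mul1r.
  by move/eqP; rewrite (eq_prim_root_expr xN) => /eqP; rewrite !modn_small.
have B j : nm (T (s%:C * x ^+ j) * (x ^+ j)^-1 ^+ n) <= M + e.
  have nj : nm (s%:C * x ^+ j) = s by rewrite nmM nmX nx expr1n mulr1.
  rewrite nmM nmX nmV nmX nx !expr1n invr1 expr1n mulr1.
  have nj' : nm (s%:C * x ^+ j) <= s by rewrite nj.
  have := G _ nj' => /(csum_tail N); rewrite -/(psum a _) /psums -/(T _).
  have -> : psum a (s%:C * x ^+ j) = f (z + s%:C * x ^+ j).
    by rewrite H2 addrAC subrr add0r // nj.
  move=> tl; rewrite -[T _](subrK (f (z + s%:C * x ^+ j))) addrC; apply: le_trans (nmD _ _) _.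
  apply: lerD; first by apply: HM; rewrite addrAC subrr add0r.
  rewrite nmB; apply: le_trans tl _.
  have := HN N; rewrite leq_maxl => /(_ isT) /ltW; apply: le_trans.
  by apply: le_trans (ler_norm _); rewrite mulrAC.
have : N%:R * (nm (a n) * s ^+ n) <= N%:R * (M + e).
  have -> : N%:R * (nm (a n) * s ^+ n) = nm (N%:R * (a n * s%:C ^+ n)).
    by rewrite !nmM nm_nat nmX ss.
  rewrite -E; apply: le_trans (nm_sum _ _ _) _.
  apply: (@le_trans _ _ (\sum_(j < N) (M + e))); first exact: ler_sum.
  by rewrite sumr_const card_ord mulr_natl.
by rewrite ler_pM2l // ltr0n.
Qed.

Lemma geo_series (x : Cplx R) : nm x < 1 -> sums (fun n => x ^+ n) (1 - x)^-1.
Proof.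
move=> x1; have xn1 : 1 - x != 0.
  by rewrite subr_eq0; apply: contraTneq x1 => <-; rewrite nm1 ltxx.
apply: (@sums_tail_le _ _ _ (nm (1 - x))^-1 (nm x)); first by rewrite nm_ge0.
move=> n; have -> : psums (fun n => x ^+ n) n - (1 - x)^-1 = - (x ^+ n / (1 - x)).
  have -> : psums (fun n => x ^+ n) n = (1 - x ^+ n) / (1 - x).
    apply: (mulIf xn1); rewrite divfK // /psums mulrC -opprB mulNr -subrX1 opprB //.
  by field.
by rewrite nmN nmM nmV nmX mulrC.
Qed.

Lemma anal_ball_invX (c z : Cplx R) r : 0 < r -> r <= nm (c - z) ->
  anal_ball (fun w => (w - c)^-1) z r (fun n => - ((c - z)^-1) ^+ n.+1).
Proof.
move=> r0 rc; have cz : c - z != 0 by rewrite -nm_gt0; apply: lt_le_trans rc.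
split.
  apply: psrad_const => //; exists (nm (c - z))^-1 => n.
  rewrite nmN nmX nmV exprS -mulrA ler_piMr ?invr_ge0 ?nm_ge0// exprVn -exprVn -exprMn.
  rewrite exprn_ile1 ?mulr_ge0 ?invr_ge0 ?nm_ge0 ?(ltW r0)//.
  by rewrite mulrC ler_pdivrMr ?mul1r // nm_gt0.
move=> w wr; apply/esym/sums_csum.
have x1 : nm ((w - z) / (c - z)) < 1.
  by rewrite nmM nmV ltr_pdivrMr ?nm_gt0// mul1r (lt_le_trans wr).
have -> : (w - c)^-1 = - (c - z)^-1 * (1 - (w - z) / (c - z))^-1.
  have wc : w - c != 0.
    by rewrite subr_eq0; apply: contraTneq wr => ->; rewrite -leNgt.
  have wc' : c - w != 0 by rewrite -opprB oppr_eq0.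
  have -> : 1 - (w - z) / (c - z) = (c - w) / (c - z) by field.
  by field; rewrite cz wc wc'.
rewrite (_ : (fun n => _) = fun n => - (c - z)^-1 * ((w - z) / (c - z)) ^+ n).
  by apply: sumsZ; apply: geo_series.
by apply/funext => n; rewrite exprS expr_div_n -exprVn; ring.
Qed.

(** The inverse of each linear factor is a geometric series on the whole disc. [anal_inv] would only
    give some smaller radius, depending on the polynomial. *)
Lemma anal_ball_inv_poly (P : {poly Cplx R}) z r : 0 < r ->
  (forall w, nm (w - z) < r -> P.[w] != 0) -> exists a, anal_ball (fun w => P.[w]^-1) z r a.
Proof.
move=> r0 HP; have [rs Dp] := closed_field_poly_normal (P : {poly R[i]}).
have Hrs c : c \in rs -> r <= nm (c - z).
  move=> crs; rewrite leNgt; apply/negP => /HP; rewrite Dp.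
  have : root (\prod_(z0 <- rs) ('X - z0%:P)) c by rewrite root_prod_XsubC.
  by rewrite /root hornerZ => /eqP ->; rewrite mulr0 eqxx.
have cst : anal_ball (fun=> (lead_coef P)^-1 : Cplx R) z r (fun n => if n is 0%N then (lead_coef P)^-1 else 0).
  have F n : (1 <= n)%N -> (if n is 0%N then (lead_coef P)^-1 : Cplx R else 0) = 0 by case: n.
  split; first exact: psrad_fin F.
  by move=> w _; rewrite (psum_fin _ F) big_ord1 expr0 mulr1.
have : exists a, anal_ball (fun w => (lead_coef P)^-1 * (\prod_(c <- rs) ('X - c%:P)).[w]^-1) z r a.
  move: Hrs {Dp}; elim: rs => [|c rs IH] Hrs.
    exists (fun n => if n is 0%N then (lead_coef P)^-1 else 0); case: cst => h1 h2; split=> // w /h2 <-.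
    by rewrite big_nil hornerC invr1 mulr1.
  have [|a Ha] := IH; first by move=> d drs; apply: Hrs; rewrite inE drs orbT.
  have Hc := @anal_ball_invX c z r r0; have {}Hc := Hc (Hrs c (mem_head _ _)).
  have := anal_ballM Ha Hc; set b := psconv _ _ => -[h1 h2]; exists b; split=> // w /h2 <-.
  by rewrite big_cons hornerM hornerXsubC invfM; ring.
move=> [a [h1 h2]]; exists a; split=> // w /h2 <-.
by rewrite {1}Dp hornerZ invfM.
Qed.

(** Weierstrass's theorem: the Cauchy estimates turn the bounds on the circle of radius [s] into
    bounds on the coefficients, and [psum_csum] sums coefficientwise. *)
Lemma anal_series (F : nat -> Cplx R -> Cplx R) (a : nat -> nat -> Cplx R) z r s M q :
  (forall k : nat, anal_ball (F k) z r (a k)) -> 0 < s < r -> 0 <= q < 1 ->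
  (forall (k : nat) w, nm (w - z) <= s -> nm (F k w) <= M * q ^+ k) ->
  anal_ball (fun w => csum (fun k => F k w)) z s (fun n => csum (a^~ n)).
Proof.
move=> HF sr q01 HM; have s0 : 0 < s by case/andP: sr.
have B (k n : nat) : nm (a k n) * s ^+ n <= M * q ^+ k.
  by apply: (cauchy_estimate (HF k) sr) => w ws; apply: HM; rewrite ws.
split; first exact: psrad_csum B.
move=> w ws; apply: sums_csum.
rewrite (_ : (fun k => F k w) = fun k => psum (a k) (w - z)); first exact: psum_csum B _.
apply/funext => k; apply: (HF k).2; apply: lt_trans ws _; by case/andP: sr.
Qed.

(* Each linear factor contributes [prod_j |y - t r x^j| = |y^N - (t r)^N|]. *)
Lemma poly_jensen (P : {poly Cplx R}) z r t N (x : Cplx R) : (0 < N)%N -> N.-primitive_root x ->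
  0 <= t -> 0 < r -> (forall c, root P c -> r <= nm (c - z)) ->
  \prod_(j < N) nm P.[z + (t * r)%:C * x ^+ j] <= nm P.[z] ^+ N * (1 + t ^+ N) ^+ (size P).-1.
Proof.
move=> N0 xN t0 r0 Hr; have [rs Dp] := closed_field_poly_normal (P : {poly R[i]}).
have [->|P0] := eqVneq P 0.
  under eq_bigr do rewrite horner0 nm0.
  by rewrite horner0 nm0 prodr_const card_ord !expr0n eqn0Ngt N0 mul0r.
have lP : lead_coef P != 0 by rewrite lead_coef_eq0.
have szP : (size P).-1 = size rs by rewrite Dp size_scale // size_prod_XsubC.
have Hrs c : c \in rs -> r <= nm (c - z).
  move=> crs; apply: Hr; rewrite Dp rootZ // root_prod_XsubC //.
have val w : nm P.[w] = nm (lead_coef P) * \prod_(c <- rs) nm (w - c).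
  rewrite {1}Dp hornerZ nmM horner_prod nm_prod; congr (_ * _).
  by apply: eq_bigr => c _; rewrite hornerXsubC.
under eq_bigr do rewrite val.
rewrite big_split /= prodr_const card_ord val exprMn -mulrA ler_wpM2l ?exprn_ge0 ?nm_ge0//.
rewrite exchange_big /= szP {szP val Dp}.
elim: rs Hrs => [|c rs IH] Hrs; first by rewrite !big_nil expr1n expr0 mulr1.
rewrite !big_cons /= exprMn exprS mulrACA; apply: ler_pM.
- by apply: prodr_ge0 => j _; rewrite nm_ge0.
- by apply: prodr_ge0 => d _; apply: prodr_ge0 => j _; rewrite nm_ge0.
- have rc := Hrs c (mem_head _ _).
  have E := @prod_sub_prim_root R[i] x (c - z) (t * r)%:C N N0 xN.
  have -> : \prod_(j < N) nm (z + (t * r)%:C * x ^+ j - c) = nm ((c - z) ^+ N - (t * r)%:C ^+ N).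
    rewrite -E nm_prod; apply: eq_bigr => j _; rewrite -nmN; congr nm; ring.
  apply: le_trans (nmD _ _) _; rewrite nmN !nmX nm_real ger0_norm ?mulr_ge0 ?(ltW r0)//.
  rewrite [nm (z - c)]nmB mulrDr mulr1 lerD2l exprMn mulrC ler_wpM2r ?exprn_ge0//.
  by apply: lerXn2r; rewrite ?nnegrE ?nm_ge0 ?(ltW r0).
by apply: IH => d drs; apply: Hrs; rewrite inE drs orbT.
Qed.

End Meromorphic.

(** * The series F off the set E *)

Section Kernel.
Context {R : realType}.
Implicit Types (t z w : Cplx R) (k : nat).

(* The pair (G_(k-1), G_k), with G_(-1) = 1. *)
Fixpoint Gpair k : {poly Cplx R} * {poly Cplx R} :=
  if k is j.+1 then
    let p := Gpair j in (p.2, (1 - 'X + 'X^2 + 'X^3) * p.2 - 'X^2 * p.1)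
  else (1, 1 - 'X).

Definition Gpol k := (Gpair k).2.
Definition G k t : Cplx R := (Gpol k).[t].

Lemma G0 t : G 0 t = 1 - t.
Proof. by rewrite /G /Gpol /= hornerD hornerN hornerX hornerC. Qed.

Lemma kerE t : (1 - 'X + 'X^2 + 'X^3 : {poly Cplx R}).[t] = 1 - t + t ^+ 2 + t ^+ 3.
Proof. by rewrite !hornerD hornerN hornerX !hornerXn hornerC. Qed.

Lemma G1 t : G 1 t = (1 - t + t ^+ 2 + t ^+ 3) * (1 - t) - t ^+ 2.
Proof.
rewrite /G /Gpol /= hornerD hornerM kerE hornerN hornerM hornerXn hornerC mulr1.
by rewrite hornerD hornerN hornerX hornerC.
Qed.

Lemma GSS k t : G k.+2 t = (1 - t + t ^+ 2 + t ^+ 3) * G k.+1 t - t ^+ 2 * G k t.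
Proof. by rewrite {1}/G /Gpol /= hornerD hornerM kerE hornerN hornerM hornerXn. Qed.

Lemma size_Gpol k : (size (Gpol k) <= 3 * k + 2)%N.
Proof.
have H : (size ((1 - 'X + 'X^2 + 'X^3)%R : {poly Cplx R}) <= 4)%N.
  apply: leq_trans (size_polyD _ _) _; rewrite size_polyXn geq_max andbT.
  apply: leq_trans (size_polyD _ _) _; rewrite size_polyXn geq_max andbT.
  apply: leq_trans (size_polyD _ _) _; rewrite size_polyC oner_eq0 size_polyN size_polyX //.
suff [] : (size (Gpair k).1 <= 3 * k + 1)%N /\ (size (Gpair k).2 <= 3 * k + 2)%N by [].
elim: k => [|k [IH1 IH2]] /=.
  rewrite size_polyC oner_eq0; split=> //.
  by apply: leq_trans (size_polyD _ _) _; rewrite size_polyC oner_eq0 size_polyN size_polyX.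
split; first by apply: leq_trans IH2 _; lia.
apply: leq_trans (size_polyD _ _) _; rewrite size_polyN geq_max; apply/andP; split.
  apply: leq_trans (size_polyMleq _ _) _; have := leq_add H IH2; move: (_ + size _)%N => n; lia.
apply: leq_trans (size_polyMleq _ _) _; rewrite size_polyXn; move: IH1; move: (size _) => n; lia.
Qed.

(** The value is 0 at the zeros of [G k], by the convention on division; this is why [Fser] is
    defined, with a meaningless value, at its poles. *)
Definition fk k t : Cplx R := t ^+ k / G k t.
Definition Fser t : Cplx R := csum (fk^~ t).

Definition kern t w : Prop := t * (w ^+ 2 + 1) = w * (1 - t + t ^+ 2 + t ^+ 3).
Definition Pf t w : Cplx R := 1 - t - t * w.
Definition Qf t w : Cplx R := t - (1 - t) * w.
Definition qf t : R := nm t ^+ 2 * (1 + 2 * complex.Re t) - 1.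

(** The recurrence of [G] has characteristic roots [t w] and [t / w] when [w] solves the kernel
    equation; [Pf] and [Qf] are fixed by the two initial values. The induction carries two
    consecutive indices. *)
Lemma G_formula t w k : kern t w ->
  G k t * (1 - w ^+ 2) * w ^+ k = t ^+ k * (Pf t w + Qf t w * w ^+ (2 * k).+1).
Proof.
move=> kt; suff [] : G k t * (1 - w ^+ 2) * w ^+ k = t ^+ k * (Pf t w + Qf t w * w ^+ (2 * k).+1)
   /\ G k.+1 t * (1 - w ^+ 2) * w ^+ k.+1 = t ^+ k.+1 * (Pf t w + Qf t w * w ^+ (2 * k.+1).+1) by [].
elim: k => [|k [IH0 IH1]].
  rewrite G0 G1 /Pf /Qf muln0 muln1 !expr1 !expr0; split; first by ring.
  have -> : ((1 - t + t ^+ 2 + t ^+ 3) * (1 - t) - t ^+ 2) * (1 - w ^+ 2) * w =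
    (w * (1 - t + t ^+ 2 + t ^+ 3)) * (1 - t) * (1 - w ^+ 2) - t ^+ 2 * w * (1 - w ^+ 2) by ring.
  by rewrite -kt; ring.
split=> //; rewrite GSS.
have -> : ((1 - t + t ^+ 2 + t ^+ 3) * G k.+1 t - t ^+ 2 * G k t) * (1 - w ^+ 2) * w ^+ k.+2 =
   (w * (1 - t + t ^+ 2 + t ^+ 3)) * (G k.+1 t * (1 - w ^+ 2) * w ^+ k.+1)
   - t ^+ 2 * w ^+ 2 * (G k t * (1 - w ^+ 2) * w ^+ k) by rewrite !exprS; ring.
rewrite -kt IH0 IH1.
have -> : (2 * k.+2).+1 = ((2 * k).+1 + 4)%N by lia.
have -> : (2 * k.+1).+1 = ((2 * k).+1 + 2)%N by lia.
by rewrite !exprS !exprD; move: (w ^+ (2 * k).+1) (t ^+ k) => u v; ring.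
Qed.

Lemma PQ_prod t w : kern t w -> Pf t w * Qf t w = - t ^+ 4 * w.
Proof.
move=> kt; rewrite /Pf /Qf.
have -> : (1 - t - t * w) * (t - (1 - t) * w) =
  t * (1 - t) * (w ^+ 2 + 1) - t ^+ 2 * w - (1 - t) ^+ 2 * w by ring.
have -> : t * (1 - t) * (w ^+ 2 + 1) = (1 - t) * (t * (w ^+ 2 + 1)) by ring.
by rewrite kt; ring.
Qed.

Lemma nm_PQ t w : nm (Pf t w) ^+ 2 - nm (Qf t w) ^+ 2 =
  (1 - nm w ^+ 2) * (1 - 2 * complex.Re t) + 4 * (complex.Im t * complex.Im w).
Proof. by rewrite !nm_sqr /Pf /Qf; case: t w => [x y] [a b] /=; ring. Qed.

(** Imaginary and real parts of the kernel equation multiplied by the conjugate of [t w]. *)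
Lemma kern_conj t w : kern t w ->
  nm t ^+ 2 * (complex.Im w * (nm w ^+ 2 - 1)) = nm w ^+ 2 * (complex.Im t * qf t) /\
  nm t ^+ 2 * (complex.Re w * (nm w ^+ 2 + 1)) =
   nm w ^+ 2 * (complex.Re t - nm t ^+ 2 + nm t ^+ 2 * complex.Re t
      + nm t ^+ 2 * (complex.Re t ^+ 2 - complex.Im t ^+ 2)).
Proof.
rewrite /kern /qf !nm_sqr; case: t w => [x y] [a b] /= H.
have [Hr Hi] := (congr1 (@complex.Re R) H, congr1 (@complex.Im R) H); move: Hr Hi.
rewrite !exprS !expr0 /= => Hr Hi.
split.
  transitivity ((x * a - y * b) * (x * (a * b + b * a) + y * (a * a - b * b + 1))
    - (x * b + y * a) * (x * (a * a - b * b + 1) - y * (a * b + b * a))).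
    by ring.
  have Hr' : x * (a * a - b * b + 1) - y * (a * b + b * a) =
    a * (1 - x + (x * x - y * y) + (x * (x * x - y * y) - y * (x * y + y * x))) -
    b * (- y + (x * y + y * x) + (x * (x * y + y * x) + y * (x * x - y * y))) by lra.
  have Hi' : x * (a * b + b * a) + y * (a * a - b * b + 1) =
    a * (- y + (x * y + y * x) + (x * (x * y + y * x) + y * (x * x - y * y))) +
    b * (1 - x + (x * x - y * y) + (x * (x * x - y * y) - y * (x * y + y * x))) by lra.
  by rewrite Hr' Hi'; ring.
transitivity ((x * a - y * b) * (x * (a * a - b * b + 1) - y * (a * b + b * a))
    + (x * b + y * a) * (x * (a * b + b * a) + y * (a * a - b * b + 1))).
  by ring.
have Hr' : x * (a * a - b * b + 1) - y * (a * b + b * a) =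
    a * (1 - x + (x * x - y * y) + (x * (x * x - y * y) - y * (x * y + y * x))) -
    b * (- y + (x * y + y * x) + (x * (x * y + y * x) + y * (x * x - y * y))) by lra.
have Hi' : x * (a * b + b * a) + y * (a * a - b * b + 1) =
    a * (- y + (x * y + y * x) + (x * (x * y + y * x) + y * (x * x - y * y))) +
    b * (1 - x + (x * x - y * y) + (x * (x * x - y * y) - y * (x * y + y * x))) by lra.
by rewrite Hr' Hi'; ring.
Qed.

(** The kernel equation is quadratic in [w] and its roots have product 1, so one of them lies in the
    closed unit disc. *)
Lemma kern_ex t : t != 0 -> exists w, [/\ kern t w, w != 0 & nm w <= 1].
Proof.
move=> t0; pose s := 1 - t + t ^+ 2 + t ^+ 3; pose d : Cplx R := sqrtc (s ^+ 2 - 4 * t ^+ 2).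
have dd : d ^+ 2 = s ^+ 2 - 4 * t ^+ 2 by rewrite sqr_sqrtc.
pose w := (s + d) / (2 * t).
have n2 : (2 : Cplx R) != 0 by rewrite pnatr_eq0.
have kw : kern t w.
  rewrite /kern -/s /w; apply: (mulfI (_ : 4 * t != 0)); first by rewrite mulf_neq0 ?pnatr_eq0.
  have -> : 4 * t * (t * (((s + d) / (2 * t)) ^+ 2 + 1)) = s ^+ 2 + 2 * s * d + d ^+ 2 + 4 * t ^+ 2 by field.
  by rewrite dd; field.
have w0 : w != 0 by apply: contra_neq t0 => Z; move: kw; rewrite /kern Z expr0n /= add0r mulr1 mul0r.
have [le1|gt1] := leP (nm w) 1; first by exists w.
exists w^-1; split; rewrite ?invr_eq0//.
  apply: (mulfI (expf_neq0 2 w0)); move: kw; rewrite /kern -/s => kw.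
  have -> : w ^+ 2 * (t * (w^-1 ^+ 2 + 1)) = t * (w ^+ 2 + 1) by field.
  by rewrite kw; field.
by rewrite nmV invf_le1 ?ltW // nm_gt0.
Qed.

Lemma qf_E0 t : 0 <= complex.Re t -> qf t = 0 -> E0 R t.
Proof.
case: t => x y /= x0; rewrite /qf nm_sqr /= => q; exists x, y; split=> //.
have u0 : 1 + 2 * x != 0 by rewrite gt_eqF //; lra.
by apply: (mulIf u0); rewrite divfK //; lra.
Qed.

(** For [|w| = 1], [kern_conj] leaves [Im t = 0] or [q = 0]. If [q = 0], the real part of the
    equation and [|Re w| <= 1] exclude [Re t < 0]. If [t = x] is real, the equation requires
    [|1 - x + x^2 + x^3| <= 2 |x|]; the two resulting inequalities involve [(1 + x)(1 + x^2)] and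
    [(1 - x)(1 - 2 x - x^2)], whose real roots are the ends of the intervals. *)
Lemma kern_unit_E t w : t != 0 -> kern t w -> nm w = 1 -> E R t.
Proof.
move=> t0 /kern_conj[] + + w1; rewrite w1 !expr1n subrr mulr0 mulr0 !mul1r => /esym/eqP.
have aw : `|complex.Re w| <= 1 by rewrite -w1 nm_Re.
have n0 : 0 < nm t ^+ 2 by rewrite exprn_gt0 // nm_gt0.
rewrite mulf_eq0 => /orP[/eqP y0|/eqP q0]; last first.
  move=> Hr; right; apply: qf_E0 => //.
  move: Hr q0 n0; rewrite /qf nm_sqr; move: aw; rewrite ler_norml => /andP[].
  case: t {t0} => x y /=; move: (complex.Re w) => a a1 a2 Hr q0 n0.
  have q1 : (x ^+ 2 + y ^+ 2) * (1 + 2 * x) = 1 by lra.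
  have u0 : 0 < 1 + 2 * x by rewrite -(pmulr_rgt0 _ n0) q1.
  have H2 : (x ^+ 2 + y ^+ 2) * (x * (1 + 2 * x) - 1 + x + (x ^+ 2 - y ^+ 2) - 2 * a) = 0.
    have -> : (x ^+ 2 + y ^+ 2) * (x * (1 + 2 * x) - 1 + x + (x ^+ 2 - y ^+ 2) - 2 * a) =
      x * ((x ^+ 2 + y ^+ 2) * (1 + 2 * x)) - (x ^+ 2 + y ^+ 2) + (x ^+ 2 + y ^+ 2) * x
      + (x ^+ 2 + y ^+ 2) * (x ^+ 2 - y ^+ 2) - (x ^+ 2 + y ^+ 2) * (a * (1 + 1)) by ring.
    by rewrite q1 Hr; ring.
  move/eqP: H2; rewrite mulf_eq0 (gt_eqF n0) /= => /eqP H2.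
  have H3 : x ^+ 2 + y ^+ 2 <= 4 * x ^+ 2 + 2 * x + 1 by lra.
  have H4 : 1 <= (4 * x ^+ 2 + 2 * x + 1) * (1 + 2 * x) by rewrite -{1}q1 ler_wpM2r // ltW.
  rewrite leNgt; apply/negP => xn; nra.
move=> Hr; left.
have x0 : complex.Re t != 0.
  by apply: contra_neq t0 => x0; move: x0 y0; case: (t) => x y /= -> ->.
have n1 : nm t ^+ 2 = complex.Re t ^+ 2 by rewrite nm_sqr y0 expr0n addr0.
have tE : t = (complex.Re t)%:C by rewrite [LHS]complexE y0 mulr0 addr0.
move: Hr; rewrite n1 y0 expr0n subr0 /=.
move: (complex.Re t) x0 tE aw {n0 n1 y0} => x x0 tE; rewrite ler_norml => /andP[a1 a2].
move: (complex.Re w) a1 a2 => a a1 a2 Hr.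
have H : 2 * a * x = 1 - x + x ^+ 2 + x ^+ 3.
  apply: (mulfI x0); rewrite -[RHS](_ : x - x ^+ 2 + x ^+ 2 * x + x ^+ 2 * x ^+ 2 = _); last by ring.
  by rewrite -Hr; ring.
have s2 : Num.sqrt 2 ^+ 2 = 2 :> R by rewrite sqr_sqrtr.
have s0 : 0 < Num.sqrt 2 :> R by rewrite sqrtr_gt0.
move: (Num.sqrt 2 : R) s2 s0 => s s2 s0.
have s1 : 1 < s by nra.
case: (ltrgtP x 0) x0 => // xs _.
  left; exists x => //.
  have h1 : (1 + x) * (1 + x ^+ 2) <= 0 by nra.
  have x1 : x <= -1 by rewrite leNgt; apply/negP => ?; nra.
  have h2 : 0 <= (1 - x) * (1 - 2 * x - x ^+ 2) by nra.
  have h3 : 0 <= 1 - 2 * x - x ^+ 2 by rewrite -(pmulr_rge0 _ (_ : 0 < 1 - x)) //; lra.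
  apply/andP; split=> //; rewrite leNgt; apply/negP => ?; nra.
right; exists x => //.
have h1 : (1 - x) * (1 - 2 * x - x ^+ 2) <= 0 by nra.
apply/andP; split; rewrite leNgt; apply/negP => hx.
  have h2 : 0 < 1 - 2 * x - x ^+ 2 by nra.
  have h3 : x < 1 by nra.
  nra.
have h2 : 1 - 2 * x - x ^+ 2 < 0 by nra.
nra.
Qed.

Lemma notE_kern t : t != 0 -> ~ E R t -> exists w, [/\ kern t w, 0 < nm w & nm w < 1].
Proof.
move=> t0 tE; have [w [kw w0 w1]] := kern_ex t0; exists w; rewrite nm_gt0; split=> //.
by rewrite lt_neqAle w1 andbT; apply/eqP => /(kern_unit_E t0 kw).
Qed.

Lemma kern_E t w : kern t w -> t != 0 -> nm w < 1 -> 0 < nm w -> Pf t w != 0 /\ Qf t w != 0.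
Proof.
move=> /PQ_prod H t0 w1; rewrite nm_gt0 => w0.
by apply/andP; rewrite -negb_or -mulf_eq0 H mulf_neq0 // oppr_eq0 expf_neq0.
Qed.

Lemma fk_formula t w k : kern t w -> t != 0 -> 0 < nm w < 1 ->
  fk k t = (1 - w ^+ 2) * w ^+ k / (Pf t w + Qf t w * w ^+ (2 * k).+1).
Proof.
move=> kt t0 /andP[w0 w1]; rewrite nm_gt0 in w0.
have H := G_formula k kt.
have w2 : 1 - w ^+ 2 != 0.
  by rewrite subr_eq0; apply: contraTneq w1 => /(congr1 nm); rewrite nmX nm1 => /esym/eqP; rewrite pexpr_eq1 ?nm_ge0 // => /eqP ->; rewrite ltxx.
rewrite /fk; have [Z|Z] := eqVneq (Pf t w + Qf t w * w ^+ (2 * k).+1) 0.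
  rewrite Z mulr0 in H; move/eqP: H; rewrite !mulf_eq0 (negPf w2) expf_eq0 (negPf w0) andbF !orbF.
  by move=> /eqP ->; rewrite Z !invr0 !mulr0.
have G0 : G k t != 0.
  by apply: contra_neq Z => Z; move/esym/eqP: H; rewrite Z !mul0r mulf_eq0 expf_eq0 (negPf t0) andbF => /eqP.
by apply/eqP; rewrite eqr_div //; apply/eqP; rewrite -H; ring.
Qed.

Lemma G_eq0 t w k : kern t w -> t != 0 -> 0 < nm w < 1 ->
  (G k t == 0) = (Pf t w + Qf t w * w ^+ (2 * k).+1 == 0).
Proof.
move=> kt t0 /andP[w0 w1]; rewrite nm_gt0 in w0.
have w2 : 1 - w ^+ 2 != 0.
  by rewrite subr_eq0; apply: contraTneq w1 => /(congr1 nm); rewrite nmX nm1 => /esym/eqP; rewrite pexpr_eq1 ?nm_ge0 // => /eqP ->; rewrite ltxx.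
have /eqP := G_formula k kt; rewrite -subr_eq0 => /eqP H; apply/eqP/eqP => Z.
  move/eqP: H; rewrite Z !mul0r sub0r oppr_eq0 mulf_eq0 expf_eq0 (negPf t0) andbF => /eqP //.
by move/eqP: H; rewrite Z mulr0 subr0 !mulf_eq0 (negPf w2) expf_eq0 (negPf w0) andbF !orbF => /eqP.
Qed.

End Kernel.

(** * Local convergence, poles and meromorphy of F *)

Section LocalF.
Context {R : realType}.
Implicit Types (t z w : Cplx R) (k : nat) (e r d : R).

Lemma odd_index_step k : ((2 * k).+1 + 2 = (2 * k.+1).+1)%N. Proof. by lia. Qed.
Lemma odd_index_le k : (k <= (2 * k).+1)%N. Proof. by lia. Qed.
Lemma odd_index_sub j k : (j <= k)%N -> ((2 * j).+1 + 2 * (k - j) = (2 * k).+1)%N.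
Proof. by lia. Qed.

(** The kernel equation reads [cf t = w + 1/w]. The normalized ratios [rk] are iterates of the
    Moebius map [r -> cf t - 1/r], whose fixed points are [w] and [1/w], the second one attracting
    for [|w| < 1]. *)
Definition cf t : Cplx R := t^-1 - 1 + t + t ^+ 2.
Definition rk k t : Cplx R := G k.+1 t / (t * G k t).

Lemma kern_cf t w : t != 0 -> w != 0 -> (kern t w <-> cf t = w + w^-1).
Proof.
move=> t0 w0; have E : t * w * (cf t - (w + w^-1)) = w * (1 - t + t ^+ 2 + t ^+ 3) - t * (w ^+ 2 + 1).
  by rewrite /cf; field; rewrite t0 w0.
rewrite /kern; split=> H.
  by move/eqP: E; rewrite H subrr !mulf_eq0 (negPf t0) (negPf w0) /= subr_eq0 => /eqP.
by move: E; rewrite H subrr mulr0 => /esym/eqP; rewrite subr_eq0 => /eqP.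
Qed.

Lemma rk_rec k t : t != 0 -> G k t != 0 -> G k.+1 t != 0 -> rk k.+1 t = cf t - (rk k t)^-1.
Proof.
move=> t0 g0 g1; rewrite /rk /cf GSS; move: (G k t) (G k.+1 t) g0 g1 => a b a0 b0.
by field; rewrite t0 a0 b0.
Qed.

Lemma anal_G k z : anal_at (G k) z.
Proof. exact: anal_poly. Qed.

Lemma anal_cf z : z != 0 -> anal_at cf z.
Proof.
move=> z0; rewrite /cf; apply: analD; last by apply: anal_exp; apply: anal_id.
apply: analD; last exact: anal_id.
by apply: analD; [apply: anal_inv => //; apply: anal_id|apply: anal_cst].
Qed.

Lemma anal_rk k z : z != 0 -> G k z != 0 -> anal_at (rk k) z.
Proof.
move=> z0 g0; apply: analM_div; first exact: anal_G.
  by apply: analM; [apply: anal_id|apply: anal_G].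
by rewrite mulf_neq0.
Qed.

Lemma anal_fk k z : G k z != 0 -> anal_at (fk k) z.
Proof.
move=> g0; apply: analM_div => //; last exact: anal_G.
by apply: anal_exp; apply: anal_id.
Qed.

Lemma mero_fk k z : mero_at (fk k) z.
Proof.
apply: mero_div; apply: anal_mero; last exact: anal_G.
by apply: anal_exp; apply: anal_id.
Qed.

Lemma rk_limit z w e : z != 0 -> kern z w -> 0 < nm w -> nm w < 1 -> 0 < e ->
  exists K, G K z != 0 /\ nm (rk K z - w^-1) < e.
Proof.
move=> z0 kz w0 w1 e0; have [P0 Q0] := kern_E kz z0 w1 w0.
have w01 : 0 <= nm w < 1 by rewrite w1 ltW.
have wn : w != 0 by rewrite -nm_gt0.
have p0 : 0 < nm (Pf z w) by rewrite nm_gt0.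
pose b := Num.min (nm (Pf z w) / 2) (e * nm w * nm (Pf z w) / 4).
have b0 : 0 < b by rewrite lt_min !divr_gt0 ?mulr_gt0.
have [K HK] := geo_small (nm (Qf z w)) w01 b0.
exists K; pose X := Qf z w * w ^+ (2 * K).+1.
have XB : nm X < b.
  apply: le_lt_trans (HK K (leqnn _)); rewrite ger0_norm ?mulr_ge0 ?exprn_ge0 ?nm_ge0//.
  rewrite /X nmM nmX ler_wpM2l ?nm_ge0//; apply: ler_wiXn2l; rewrite ?nm_ge0 ?ltW//.
  exact: odd_index_le.
move: XB; rewrite lt_min => /andP[X1 X2].
have D0 : nm (Pf z w) / 2 <= nm (Pf z w + X).
  apply: le_trans (nm_addl _ _); lra.
have Dn : Pf z w + X != 0 by rewrite -nm_gt0; apply: lt_le_trans D0; rewrite divr_gt0.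
have gn : G K z != 0 by rewrite (G_eq0 K kz z0) // w0.
split=> //.
have w2 : 1 - w ^+ 2 != 0.
  by rewrite subr_eq0; apply: contraTneq w1 => /(congr1 nm); rewrite nmX nm1 => /esym/eqP; rewrite pexpr_eq1 ?nm_ge0 // => /eqP ->; rewrite ltxx.
have E1 := G_formula K kz; have E2 := G_formula K.+1 kz.
have X' : Qf z w * w ^+ (2 * K.+1).+1 = X * w ^+ 2.
  by rewrite /X -mulrA -exprD odd_index_step.
rewrite X' in E2; rewrite -/X in E1.
have Er : rk K z = (Pf z w + X * w ^+ 2) / (w * (Pf z w + X)).
  apply/eqP; rewrite /rk eqr_div ?mulf_neq0//; apply/eqP.
  apply: (mulfI (mulf_neq0 (expf_neq0 K z0) (mulf_neq0 w2 (expf_neq0 K wn)))).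
  transitivity (z ^+ K * (Pf z w + X) * (G K.+1 z * (1 - w ^+ 2) * w ^+ K.+1)).
    by rewrite [w ^+ K.+1]exprS; ring.
  by rewrite -E1 E2 [z ^+ K.+1]exprS; ring.
clearbody X; have -> : rk K z - w^-1 = X * (w ^+ 2 - 1) / (w * (Pf z w + X)).
  by rewrite Er; field; rewrite wn Dn.
rewrite !nmM nmV nmM ltr_pdivrMr ?mulr_gt0 ?nm_gt0//.
have w22 : nm (w ^+ 2 - 1) <= 2.
  apply: le_trans (nmD _ _) _; rewrite nmN nm1 nmX.
  have w2' : nm w ^+ 2 <= 1 by rewrite exprn_ile1 ?nm_ge0 // ltW.
  by move: w2'; move: (nm w ^+ 2) => u; lra.
apply: (@le_lt_trans _ _ (nm X * 2)); first by rewrite ler_wpM2l ?nm_ge0.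
have ew : 0 < e * nm w by rewrite mulr_gt0.
apply: (@lt_le_trans _ _ (e * nm w * (nm (Pf z w) / 2))); last by rewrite [leRHS]mulrA ler_wpM2l // ltW.
move: X2; move: (e * nm w) (nm (Pf z w)) (nm X) => u v x; lra.
Qed.

(** Uniformity in [t] is obtained with the root [w] taken at [z] only. A small disc around [1/w]
    lies in [|r| >= L > 1] and is mapped into itself by [r -> cf t - 1/r] for every [t] near [z].
    Once [rk K] is in this disc all later ratios are, and each step divides the term [fk] by a
    number of modulus at least [L]. *)
Lemma fk_geo z : z != 0 -> ~ E R z -> exists K r A q, [/\ 0 < r, 0 <= q < 1 &
  forall j t, nm (t - z) < r -> [/\ t != 0, G (K + j) t != 0 & nm (fk (K + j) t) <= A * q ^+ j]].
Proof.
move=> z0 zE; have [w [kz w0 w1]] := notE_kern z0 zE.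
have wn : w != 0 by rewrite -nm_gt0.
pose L := (nm w^-1 + 1) / 2; pose e := (nm w^-1 - 1) / 2.
have l1 : 1 < nm w^-1 by rewrite nmV invf_gt1.
have L1 : 1 < L by rewrite /L; lra.
have e0 : 0 < e by rewrite /e; lra.
have eL : e + L = nm w^-1 by rewrite /e /L; lra.
clearbody L e.
have [K [gK rK]] := rk_limit z0 kz w0 w1 e0.
have L0 : 0 < L by lra.
(* Margin left for the variation of [cf]: the Moebius map shrinks the distance to [1/w] from [e] to
   at most [e / L], and [e / L + e (1 - 1/L) = e]. *)
have dd : 0 < e * (1 - L^-1) by rewrite mulr_gt0 // subr_gt0 invf_lt1.
have [d1 d10 H1] := anal_cont (anal_cf z0) dd.
have er : 0 < e - nm (rk K z - w^-1) by rewrite subr_gt0.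
have [d2 d20 H2] := anal_cont (anal_rk z0 gK) er.
have [d3 d30 H3] := anal_cont (anal_fk gK) ltr01.
have [d4 d40 H4] : exists2 d, 0 < d & forall t, nm (t - z) < d -> G K t != 0.
  by have /nbhs_nm := anal_nonzero (anal_G K z) gK.
pose r := Num.min (Num.min d1 d2) (Num.min (Num.min d3 d4) (nm z)).
exists K, r, (nm (fk K z) + 1), L^-1; split.
- by rewrite !lt_min d10 d20 d30 d40 nm_gt0.
- by rewrite invr_ge0 (ltW L0) /= invf_lt1.
move=> j t; rewrite !lt_min -!andbA => /and5P[t1 t2 t3 t4 tz].
have t0 : t != 0 by apply: contraTneq tz => ->; rewrite sub0r nmN ltxx.
suff [gj rj fj] : [/\ G (K + j) t != 0, nm (rk (K + j) t - w^-1) <= e & nm (fk (K + j) t) <= (nm (fk K z) + 1) * L^-1 ^+ j] by [].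
elim: j => [|j [gj rj fj]].
  rewrite addn0 expr0 mulr1; split; first exact: H4.
    apply: le_trans (nm_subD _ (rk K z) _) _.
    by have := H2 t t2; move: (nm _) (nm _) => u v; lra.
  have := nm_subl (fk K t) (fk K z); have := H3 t t3.
  by move: (nm _) (nm _) (nm _) => u v x; lra.
have rL : L <= nm (rk (K + j) t).
  have := nm_subl w^-1 (rk (K + j) t); rewrite nmB; move: rj eL.
  by move: (nm _) (nm _) (nm _) => u v x; lra.
have rn : rk (K + j) t != 0 by rewrite -nm_gt0; apply: lt_le_trans rL.
have gj1 : G (K + j.+1) t != 0.
  by rewrite addnS; apply: contra_neq rn => Z; rewrite /rk Z mul0r.
split=> //.
  rewrite addnS rk_rec // -?addnS//.
  have cz : cf z = w + w^-1 by apply/kern_cf.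
  have -> : cf t - (rk (K + j) t)^-1 - w^-1 = (cf t - cf z) + (rk (K + j) t - w^-1) / (rk (K + j) t * w^-1).
    by rewrite cz; field; rewrite wn rn.
  apply: le_trans (nmD _ _) _; rewrite nmM nmV nmM.
  have h1 := H1 t t1.
  have h2 : nm (rk (K + j) t - w^-1) / (nm (rk (K + j) t) * nm w^-1) <= e / L.
    apply: ler_pM => //; rewrite ?nm_ge0 ?invr_ge0 ?mulr_ge0 ?nm_ge0//.
    rewrite lef_pV2 ?posrE ?mulr_gt0 ?nm_gt0 ?invr_eq0//.
    by apply: le_trans rL _; rewrite ler_peMr ?nm_ge0 ?ltW.
  apply: le_trans (lerD (ltW h1) h2) _.
  by rewrite mulrBr mulr1 subrK.
have -> : fk (K + j.+1) t = fk (K + j) t / rk (K + j) t.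
  rewrite addnS /fk /rk exprS; move: gj gj1; rewrite addnS.
  move: (G (K + j) t) (G (K + j).+1 t) => a b a0 b0.
  by field; rewrite t0 a0 b0.
rewrite nmM nmV exprSr mulrA; apply: ler_pM; rewrite ?nm_ge0 ?invr_ge0 ?nm_ge0//.
by rewrite lef_pV2 ?posrE ?nm_gt0.
Qed.

Lemma F_split z : z != 0 -> ~ E R z -> exists K (h : Cplx R -> Cplx R),
  [/\ anal_at h z, forall k, (K <= k)%N -> G k z != 0 &
   \forall t \near z, Fser t = \sum_(k < K) fk k t + h t].
Proof.
move=> z0 zE; have [K [r [A [q [r0 q01 H]]]]] := fk_geo z0 zE.
exists K, (fun t => csum (fun j => fk (K + j) t)).
have HG j : exists a, anal_ball (fk (K + j)) z r a.
  have [|a Ha] := @anal_ball_inv_poly R (Gpol (K + j)) z r r0; first by move=> t /(H j)[].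
  have Hp : anal_ball (fun t => t ^+ (K + j)) z r (fun n => ('X^(K + j) \Po ('X + z%:P))`_n).
    split; first exact: psrad_poly.
    by move=> t _; rewrite psum_poly horner_comp hornerD hornerX hornerC subrK hornerXn.
  by exists (psconv (fun n => ('X^(K + j) \Po ('X + z%:P))`_n) a); apply: anal_ballM Hp Ha.
have [a Ha] := choice HG.
have rr : 0 < r / 2 < r by apply/andP; split; lra.
split.
- exists (r / 2), (fun n => csum (a^~ n)); split; first by case/andP: rr.
  apply: (anal_series Ha rr q01 (M := A)) => j t tr.
  by have [|_ _] := H j t => //; apply: le_lt_trans tr _; case/andP: rr.
- move=> k Kk; have [|_ + _] := H (k - K)%N z; first by rewrite subrr nm0.
  by rewrite subnKC.
- apply: near_nm r0 _ => t tr.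
  have G : geo A q (fun j => fk (K + j) t) by split=> // j; have [] := H j t tr.
  by apply: sums_csum; apply: (@sums_shift _ (fk^~ t) _ K); apply: geo_sums G.
Qed.

Lemma F_mero z : z != 0 -> ~ E R z -> mero_at (@Fser R) z.
Proof.
move=> z0 zE; have [K [h [Hh _ HF]]] := F_split z0 zE.
apply: (@mero_ext _ (fun t => \sum_(k < K) fk k t + h t)).
  by apply: near_dnbhs; move: HF; apply: filterS => t ->.
by apply: mero_add; [apply: mero_sum => i; apply: mero_fk|apply: anal_mero].
Qed.

Lemma F_anal z : z != 0 -> ~ E R z -> (forall k, G k z != 0) -> anal_at (@Fser R) z.
Proof.
move=> z0 zE g0; have [K [h [Hh _ HF]]] := F_split z0 zE.
apply: (@anal_ext _ (fun t => \sum_(k < K) fk k t + h t)).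
  by move: HF; apply: filterS => t ->.
by apply: analD => //; apply: anal_sum => i; apply: anal_fk.
Qed.

(** The moduli of [Q w^(2j+1)] are pairwise distinct for [0 < |w| < 1], so at most one of these
    numbers equals [- P]. *)
Lemma G_disjoint z j k : z != 0 -> ~ E R z -> G j z = 0 -> G k z = 0 -> j = k.
Proof.
move=> z0 zE gj gk; have [w [kz w0 w1]] := notE_kern z0 zE.
have [P0 Q0] := kern_E kz z0 w1 w0.
wlog jk : j k gj gk / (j <= k)%N.
  by move=> H; case/orP: (leq_total j k) => ?; [apply: H|apply/esym/H].
have /eqP := gj; rewrite (G_eq0 j kz z0) ?w0// => /eqP ej.
have /eqP := gk; rewrite (G_eq0 k kz z0) ?w0// => /eqP ek.
have : Qf z w * w ^+ (2 * j).+1 * (1 - w ^+ (2 * (k - j))) = 0.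
  rewrite mulrBr mulr1 -mulrA -exprD.
  rewrite (odd_index_sub jk).
  by rewrite -[RHS](subrr (Pf z w + Qf z w * w ^+ (2 * k).+1)) {1}ek -{1}ej; ring.
move/eqP; rewrite !mulf_eq0 (negPf Q0) expf_eq0 /= -nm_eq0 (gt_eqF w0) /= subr_eq0 eq_sym => /eqP H.
have := congr1 nm H; rewrite nmX nm1 => /eqP.
case: (posnP (k - j)%N) => [/eqP|kj0]; first by rewrite subn_eq0 => kj _; apply/eqP; rewrite eqn_leq jk.
by rewrite pexpr_eq1 ?nm_ge0 ?muln_gt0 ?kj0// (lt_eqF w1).
Qed.

Lemma G_at0 k : G k (0 : Cplx R) = 1.
Proof.
suff [] : G k (0 : Cplx R) = 1 /\ G k.+1 (0 : Cplx R) = 1 by [].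
elim: k => [|i [i1 i2]]; first by rewrite G0 G1 !subr0 !expr0n /= !addr0 mulr1 subr0.
by split=> //; rewrite GSS i1 i2 !expr0n /= subr0 !addr0 mul0r mulr1 subr0.
Qed.

Lemma poly_punctured (p : {poly Cplx R}) z : p != 0 -> \forall t \near z^', p.[t] != 0.
Proof.
move=> p0; have [m [q qz ->]] := multiplicity_XsubC p z.
rewrite p0 /= in qz.
have := near_dnbhs (anal_nonzero (anal_poly q z) qz) => /dnbhs_nm[r r0 H].
apply/dnbhs_nm; exists r => // t tz /H; rewrite hornerM horner_exp hornerXsubC => /(_ tz) qt.
by rewrite mulf_neq0 // expf_neq0 // subr_eq0.
Qed.

(** By [G_disjoint] a single term of the series is infinite at [z], so that no cancellation can
    occur. *)
Lemma F_pole z k A : z != 0 -> ~ E R z -> G k z = 0 -> \forall t \near z^', A <= nm (Fser t).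
Proof.
move=> z0 zE gk; have [K [h [Hh HK HF]]] := F_split z0 zE.
have kK : (k < K)%N by rewrite ltnNge; apply/negP => /HK; rewrite gk eqxx.
pose g t := \sum_(i < K) (if val i == k then 0 else fk i t) + h t.
have Hg : anal_at g z.
  apply: analD => //; apply: anal_sum => i; case: eqP => [_|ik]; first exact: anal_cst.
  by apply: anal_fk; apply/eqP => gi; apply: ik; apply: (G_disjoint z0 zE).
have gF t : \sum_(i < K) fk i t + h t = fk k t + g t.
  rewrite /g addrA; congr (_ + _); rewrite (bigD1 (Ordinal kK)) //=; congr (_ + _).
  rewrite [RHS](bigD1 (Ordinal kK)) //= eqxx add0r; apply: eq_bigr => i ik.
  by rewrite -(inj_eq val_inj) /= in ik; rewrite (negPf ik).
have [d1 d10 H1] := anal_cont Hg ltr01.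
pose B := nm (g z) + 1 + `|A| + 1.
have B0 : 0 < B by rewrite ltr_wpDl // !addr_ge0 ?nm_ge0.
have zk : 0 < nm (z ^+ k) by rewrite nm_gt0 expf_neq0.
have zk2 : 0 < nm (z ^+ k) / 2 by rewrite divr_gt0.
have [d2 d20 H2] := anal_cont (anal_exp k (anal_id z)) zk2.
have e3 : 0 < nm (z ^+ k) / 2 / B by rewrite divr_gt0.
have [d3 d30 H3] := anal_cont (anal_G k z) e3.
have gp : (Gpol k : {poly Cplx R}) != 0.
  by apply/eqP => S; have := G_at0 k; rewrite /G S horner0 => /esym/eqP; rewrite oner_eq0.
have /dnbhs_nm[d4 d40 H4] := poly_punctured z gp.
move/nbhs_nm: HF => [d5 d50 H5].
apply/dnbhs_nm; exists (Num.min (Num.min d1 d2) (Num.min d3 (Num.min d4 d5))).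
  by rewrite !lt_min d10 d20 d30 d40.
move=> t tz; rewrite !lt_min -!andbA => /and5P[t1 t2 t3 t4 t5].
have gt : G k t != 0 by apply: H4.
rewrite H5 // gF.
have h1 := nm_subl (g t) (g z); have h1' := H1 t t1.
have h2 := nm_subl (z ^+ k) (t ^+ k); rewrite nmB in h2; have h2' := H2 t t2.
have h3 := H3 t t3; rewrite gk subr0 in h3.
have h4 : B <= nm (fk k t).
  rewrite /fk nmM nmV ler_pdivlMr ?nm_gt0//.
  rewrite ltr_pdivlMr// mulrC in h3; apply: le_trans (ltW h3) _.
  by move: h2 h2'; move: (nm _) (nm _) (nm _) => u v x; lra.
have h5 := nm_addl (fk k t) (g t); have h6 := ler_norm A.
move: h1 h1' h4 h5 h6; rewrite /B; move: (nm (fk k t + g t)) (nm (fk k t)) (nm (g t - g z)) (nm (g t)) (nm (g z)) => a b c d e; lra.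
Qed.

End LocalF.

(** * The series F near the curve *)

Lemma cubic_eval (F : fieldType) (c t : F) :
  ('X^3 + ('X^2 - (1 + c)%:P * 'X + 1)).[t] = t ^+ 3 + t ^+ 2 - (1 + c) * t + 1.
Proof. by rewrite !hornerE. Qed.

(** If [q < p], then [(p - q) 2 M >= (p - q)(p + q) >= 2 b], and [k] is at most [b / M]. *)
Lemma gap_sqr (F : realFieldType) (p q k M b : F) : 0 <= p -> 0 <= q -> p <= M -> q <= M ->
  0 < b -> 0 < M -> k * (2 * M) <= 2 * b -> 2 * b <= p ^+ 2 - q ^+ 2 -> q + k <= p.
Proof.
move=> p0 q0 pM qM b0 M0 kM D; rewrite leNgt; apply/negP => hh.
have [pq|qp] := leP p q.
  have : p ^+ 2 <= q ^+ 2 by apply: lerXn2r; rewrite ?nnegrE.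
  by lra.
have h1 : (p - q) * (p + q) <= (p - q) * (2 * M) by rewrite ler_wpM2l //; lra.
have h2 : (p - q) * (2 * M) < k * (2 * M) by rewrite ltr_pM2r ?mulr_gt0 //; lra.
by move: D; rewrite subr_sqr; lra.
Qed.

Section Arc.
Context {R : realType}.
Implicit Types (t z w : Cplx R) (k : nat) (e r d : R).

(* The points of [E_0] other than i, -i and its real point. *)
Definition generic z := [/\ 0 < complex.Re z, complex.Im z != 0 & qf z = 0].

Lemma Im_neq0 z : complex.Im z != 0 -> z != 0.
Proof. by apply: contra_neq => ->. Qed.

Lemma kern_inv t w : w != 0 -> kern t w -> kern t w^-1.
Proof.
move=> w0; rewrite /kern; move: (1 - t + t ^+ 2 + t ^+ 3) => s kw.
apply: (mulfI (expf_neq0 2 w0)).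
have -> : w ^+ 2 * (t * (w^-1 ^+ 2 + 1)) = t * (w ^+ 2 + 1) by field.
by rewrite kw; field.
Qed.

Lemma Im_inv w : nm w = 1 -> complex.Im w^-1 = - complex.Im w.
Proof.
move=> w1; have := nm_sqr w; rewrite w1 expr1n; case: w {w1} => a b /= <-.
by rewrite invr1 !mulr1 ?mulrN ?divr1.
Qed.

(** As [q = 0], either [|w| = 1] or [w] is real. A real root [m] would satisfy [m^2 + 1 = m l] with
    [|l| < 2], an equation of negative discriminant. *)
Lemma generic_kern z : generic z -> exists w, [/\ kern z w, nm w = 1 & complex.Im w != 0].
Proof.
case=> x0 y0 q0; have z0 := Im_neq0 y0; have [w [kw w0 w1]] := kern_ex z0.
have [H1 H2] := kern_conj kw; rewrite q0 !mulr0 in H1.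
have n0 : 0 < nm z ^+ 2 by rewrite exprn_gt0 // nm_gt0.
have wn : 0 < nm w by rewrite nm_gt0.
have b0 : complex.Im w != 0.
  apply/eqP => b0; move: H2 n0 q0 wn; rewrite /qf !nm_sqr b0.
  have -> : nm w = `|complex.Re w|.
    by rewrite -nm_real; congr nm; rewrite [LHS]complexE b0 mulr0 addr0.
  rewrite normr_gt0 expr0n /= addr0.
  case: z x0 y0 {z0 kw H1} => x y /= x0 y0; move: (complex.Re w) => m H2 n0 q0 m0.
  have y2 : 0 < y ^+ 2 by rewrite exprn_even_gt0 //= y0.
  have m2 : 0 < m ^+ 2 by rewrite exprn_even_gt0 //= m0.
  have q1 : (x ^+ 2 + y ^+ 2) * (1 + 2 * x) = 1 by lra.
  pose n := x ^+ 2 + y ^+ 2; rewrite -/n in H2 n0 q1.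
  have H3 : m ^+ 2 + 1 = m * (2 * x + 4 * x ^+ 2 - 1 - n).
    apply: (mulfI (lt0r_neq0 n0)); apply: (mulfI m0).
    transitivity (n * (m * (m ^+ 2 + 1))); first by ring.
    rewrite H2; transitivity (m ^+ 2 * (x * (n * (1 + 2 * x)) - n + n * x + n * (x ^+ 2 - y ^+ 2))); first by rewrite q1; ring.
    by rewrite /n; ring.
  pose l := 2 * x + 4 * x ^+ 2 - 1 - n; rewrite -/l in H3.
  have n1 : n < 1 by rewrite -q1 ltr_pMr // ; lra.
  have l1 : -2 < l by rewrite /l; nra.
  have xx : x ^+ 2 < 2^-1.
    have h : (1 + 2 * x) * x ^+ 2 < 1 by rewrite -q1 /n; nra.
    rewrite ltNge; apply/negP => h2; nra.
  have l2 : l < 2.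
    have : 1 < (3 - (2 * x + 4 * x ^+ 2) + 0) * (1 + 2 * x) \/ True by right.
    move=> _; rewrite /l ltNge; apply/negP => h.
    have h3 : n <= 2 * x + 4 * x ^+ 2 - 3 by lra.
    have h4 : n * (1 + 2 * x) <= (2 * x + 4 * x ^+ 2 - 3) * (1 + 2 * x) by rewrite ler_wpM2r //; lra.
    rewrite q1 in h4; nra.
  have s1 := sqr_ge0 (2 * m - l); have s2 : 0 < (2 - l) * (2 + l) by rewrite mulr_gt0 //; lra.
  by clearbody l; clear -s1 s2 H3; nra.
exists w; split=> //.
move/eqP: H1; rewrite mulf_eq0 (gt_eqF n0) /= mulf_eq0 (negPf b0) /= subr_eq0.
by rewrite pexpr_eq1 ?nm_ge0 // => /eqP.
Qed.

(** On the unit circle the roots [w] and [1/w] are conjugate. The sign that is selected decides, by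
    [kern_side], from which side [t] approaches [E_0] when [w] moves into the unit disc. *)
Lemma generic_kern_sgn z (s : bool) : generic z -> exists w, [/\ kern z w, nm w = 1 &
  if s then 0 < complex.Im z * complex.Im w else complex.Im z * complex.Im w < 0].
Proof.
move=> gz; have [w [kw w1 b0]] := generic_kern gz; have [_ y0 _] := gz.
have wn : w != 0 by rewrite -nm_gt0 w1.
have kw' := kern_inv wn kw; have w1' : nm w^-1 = 1 by rewrite nmV w1 invr1.
have i' := Im_inv w1.
have p0 : complex.Im z * complex.Im w != 0 by rewrite mulf_neq0.
case: s; case: (ltrgtP (complex.Im z * complex.Im w) 0) p0 => // h _.
- by exists w^-1; split=> //; rewrite i' mulrN oppr_gt0.
- by exists w.
- by exists w.
- by exists w^-1; split=> //; rewrite i' mulrN oppr_lt0.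
Qed.

Lemma kern_side t w : kern t w -> w != 0 -> complex.Im t != 0 -> nm w < 1 ->
  (0 < complex.Im t * complex.Im w -> qf t < 0) /\
  (complex.Im t * complex.Im w < 0 -> 0 < qf t).
Proof.
move=> kw w0 y0 w1; have [H _] := kern_conj kw.
have n0 : 0 < nm t ^+ 2 by rewrite exprn_gt0 // nm_gt0 Im_neq0.
have m0 : 0 < nm w ^+ 2 by rewrite exprn_gt0 // nm_gt0.
have m1 : nm w ^+ 2 - 1 < 0 by rewrite subr_lt0 expr_lt1 ?nm_ge0.
have H' : nm t ^+ 2 * (complex.Im t * complex.Im w * (nm w ^+ 2 - 1)) = nm w ^+ 2 * (complex.Im t ^+ 2 * qf t).
  transitivity (complex.Im t * (nm w ^+ 2 * (complex.Im t * qf t))); last by ring.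
  by rewrite -H; ring.
have y2 : 0 < complex.Im t ^+ 2 by rewrite exprn_even_gt0 //= y0.
split=> h.
  have : nm w ^+ 2 * (complex.Im t ^+ 2 * qf t) < 0 by rewrite -H' pmulr_rlt0 // pmulr_rlt0.
  by rewrite (pmulr_rlt0 _ m0) (pmulr_rlt0 _ y2).
have : 0 < nm w ^+ 2 * (complex.Im t ^+ 2 * qf t) by rewrite -H' pmulr_rgt0 // nmulr_rgt0.
by rewrite (pmulr_rgt0 _ m0) (pmulr_rgt0 _ y2).
Qed.

Lemma E_generic t : E R t -> 0 < complex.Re t -> complex.Im t != 0 -> qf t = 0.
Proof.
move=> [[[x -> _]|[x -> _]]|[x [y [-> x0 yE]]]] /=; rewrite ?eqxx // => x1 _.
rewrite /qf nm_sqr /= yE; have u0 : 1 + 2 * x != 0 by rewrite gt_eqF //; lra.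
by field.
Qed.

(** The product of the distances from [z] to the three roots is the modulus of the cubic at [z], so
    one distance is less than [d]. This provides [t] as a function of [w]. *)
Lemma cubic_root (c z : Cplx R) d : 0 < d -> nm (z ^+ 3 + z ^+ 2 - (1 + c) * z + 1) < d ^+ 3 ->
  exists2 t, nm (t - z) < d & t ^+ 3 + t ^+ 2 - (1 + c) * t + 1 = 0.
Proof.
move=> d0 H; pose p : {poly R[i]} := 'X^3 + ('X^2 - (1 + c : R[i])%:P * 'X + 1).
have pE t : p.[t] = t ^+ 3 + t ^+ 2 - (1 + c) * t + 1.
  exact: cubic_eval.
have sp : (size (('X^2 - (1 + c : R[i])%:P * 'X + 1)%R : {poly R[i]}) < 4)%N.
  apply: leq_ltn_trans (size_polyD _ _) _; rewrite size_polyC oner_eq0 gtn_max andbT.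
  apply: leq_ltn_trans (size_polyD _ _) _; rewrite size_polyXn size_polyN gtn_max /=.
  apply: leq_ltn_trans (size_polyMleq _ _) _; rewrite size_polyX addn2 /=.
  by rewrite !ltnS; apply: leq_trans (size_polyC_leq1 _) _.
have lp : lead_coef p = 1 by rewrite /p lead_coefDl ?size_polyXn // lead_coefXn.
have [rs Dp] := closed_field_poly_normal p; rewrite lp scale1r in Dp.
have szr : size rs = 3.
  have := size_prod_XsubC rs id; rewrite -Dp /p size_polyDl ?size_polyXn //.
  by move=> [] <-.
have [[t trs tz]|no] := pselect (exists2 t, t \in rs & nm (t - z) < d).
  exists t => //; rewrite -pE; apply/eqP; change (root p t); by rewrite Dp root_prod_XsubC.
exfalso; move: H; rewrite -pE Dp horner_prod nm_prod ltNge; apply/negP/negPn.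
have H t : t \in rs -> d <= nm (('X - t%:P).[z]).
  by move=> trs; rewrite hornerXsubC nmB leNgt; apply/negP => h; apply: no; exists t.
clear -H szr d0; move: rs szr H => [|a [|b [|c [|//]]]] //= _ H.
rewrite !big_cons big_nil mulr1 !exprS expr0 mulr1.
have ha := H a; have hb := H b; have hc := H c; rewrite !inE !eqxx ?orbT in ha hb hc.
move: (ha isT) (hb isT) (hc isT) => {}ha {}hb {}hc.
by rewrite !ler_pM // ?mulr_ge0 // (ltW d0).
Qed.

Lemma kern_cubic t w : w != 0 -> t ^+ 3 + t ^+ 2 - (1 + (w + w^-1)) * t + 1 = 0 -> kern t w.
Proof.
move=> w0 H; rewrite /kern; apply/eqP; rewrite -subr_eq0; apply/eqP.
have -> : t * (w ^+ 2 + 1) - w * (1 - t + t ^+ 2 + t ^+ 3) =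
  - w * (t ^+ 3 + t ^+ 2 - (1 + (w + w^-1)) * t + 1) by field.
by rewrite H mulr0.
Qed.

(** The left side is the derivative of [cf] at [z]. Its zeros satisfy [z^2 (1 + 2 z) = 1];
    eliminating [Im z] leaves [x (1 + 4 x)^2 = -1], impossible for [x > 0]. *)
Lemma dcf_neq0 z : generic z -> 1 + z + z - (z * z)^-1 != 0.
Proof.
case=> x0 y0 q0; have z0 := Im_neq0 y0.
apply/eqP => H; have : z ^+ 2 * (1 + 2 * z) = 1.
  have : z ^+ 2 * (1 + z + z - (z * z)^-1) = z ^+ 2 * (1 + 2 * z) - 1 by field.
  by rewrite H mulr0 => /esym/eqP; rewrite subr_eq0 => /eqP.
move: x0 y0 {q0 z0 H}; case: z => x y /= x0 y0 H.
have [Hr Hi] := (congr1 (@complex.Re R) H, congr1 (@complex.Im R) H); move: Hr Hi.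
rewrite !exprS !expr0 /= => Hr Hi.
have Hi' : y * (2 * x + 6 * x ^+ 2 - 2 * y ^+ 2) = 0 by rewrite -[RHS]Hi; ring.
move/eqP: Hi'; rewrite mulf_eq0 (negPf y0) /= => /eqP y2.
have Hr' : x ^+ 2 - y ^+ 2 + 2 * (x ^+ 3 - 3 * x * y ^+ 2) = 1 by rewrite -[RHS]Hr; ring.
have y3 : y ^+ 2 = x + 3 * x ^+ 2 by lra.
have := Hr'; rewrite y3.
have -> : x ^+ 2 - (x + 3 * x ^+ 2) + 2 * (x ^+ 3 - 3 * x * (x + 3 * x ^+ 2)) = - (x * (1 + 8 * x + 16 * x ^+ 2)) by ring.
have : 0 < x * (1 + 8 * x + 16 * x ^+ 2) by rewrite mulr_gt0 //; nra.
move=> ? ?; lra.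
Qed.

(** A local inverse of [cf] with a Lipschitz bound. In the proof [m t] is the divided difference of
    [cf] between [t] and [z]; it is close to the derivative [m z], hence bounded away from 0, while
    [w + 1/w] is Lipschitz near [w0]. *)
Lemma root_near z w0 : generic z -> kern z w0 -> nm w0 = 1 -> exists2 C, 0 < C &
  forall d, 0 < d -> exists2 e, 0 < e & forall w, nm (w - w0) < e ->
   exists t, [/\ nm (t - z) < d, kern t w & nm (t - z) <= C * nm (w - w0)].
Proof.
move=> gz kz w01; have z0 : z != 0 by case: gz => _ /Im_neq0.
have wn : w0 != 0 by rewrite -nm_gt0 w01.
have dn := dcf_neq0 gz.
pose m t := 1 + t + z - (t * z)^-1.
have Hm : anal_at m z.
  apply: analD; first by apply: analD; [apply: analD; [apply: anal_cst|apply: anal_id]|apply: anal_cst].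
  apply: (@anal_ext _ (fun t => -1 * (t * z)^-1)); first by apply: near_all => t; rewrite mulN1r.
  apply: analM; first exact: anal_cst.
  apply: anal_inv; last by rewrite mulf_neq0.
  by apply: analM; [apply: anal_id|apply: anal_cst].
have m0 : 0 < nm (m z) by rewrite nm_gt0.
have m2 : 0 < nm (m z) / 2 by rewrite divr_gt0.
have [d1 d10 H1] := anal_cont Hm m2.
exists (3 / (nm (m z) / 2)); first by rewrite divr_gt0.
move=> d d0; pose b := Num.min (Num.min d d1) (nm z).
have b0 : 0 < b by rewrite !lt_min d0 d10 nm_gt0.
have Hc : anal_at (fun w => z ^+ 3 + z ^+ 2 - (1 + (w + w^-1)) * z + 1) w0.
  apply: (@anal_ext _ (fun w => (z ^+ 3 + z ^+ 2 + 1 - z) + (w + w^-1) * (- z))).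
    by apply: near_all => w; ring.
  apply: analD; first exact: anal_cst.
  apply: analM; last exact: anal_cst.
  by apply: analD; [apply: anal_id|apply: anal_inv => //; apply: anal_id].
have Z0 : z ^+ 3 + z ^+ 2 - (1 + (w0 + w0^-1)) * z + 1 = 0.
  have -> : z ^+ 3 + z ^+ 2 - (1 + (w0 + w0^-1)) * z + 1 =
    w0^-1 * (w0 * (1 - z + z ^+ 2 + z ^+ 3) - z * (w0 ^+ 2 + 1)) by field.
  by rewrite kz subrr mulr0.
have [e e0 He] := anal_cont Hc (exprn_gt0 3 b0).
exists (Num.min e 2^-1); first by rewrite lt_min e0 invr_gt0 ltr0n.
move=> w; rewrite lt_min => /andP[we w2].
have w12 : 2^-1 <= nm w by have := nm_subl w0 w; rewrite nmB w01; move: w2; move: (nm (w - w0)) (nm w) => u v; lra.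
have w0' : w != 0 by rewrite -nm_gt0; apply: lt_le_trans w12; rewrite invr_gt0.
have := He w we; rewrite Z0 subr0 => /(cubic_root b0)[t tz tw].
have kt := kern_cubic w0' tw.
move: tz; rewrite !lt_min -andbA => /and3P[td td1 tzz].
have t0 : t != 0 by apply: contraTneq tzz => ->; rewrite sub0r nmN ltxx.
exists t; split=> //.
have E : (t - z) * m t = (w - w0) * (1 - (w * w0)^-1).
  have ct := (kern_cf t0 w0').1 kt; have cz := (kern_cf z0 wn).1 kz.
  transitivity (cf t - cf z); first by rewrite /cf /m; field; rewrite t0 z0.
  by rewrite ct cz; field; rewrite w0' wn.
have := congr1 nm E; rewrite !nmM => E'.
have mt : nm (m z) / 2 <= nm (m t).
  by have := nm_subl (m z) (m t); have := H1 t td1; rewrite nmB; move: (nm (m z - m t)) (nm (m z)) (nm (m t)) => u v x; lra.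
have h3 : nm (1 - (w * w0)^-1) <= 3.
  apply: le_trans (nmD _ _) _; rewrite nmN nm1 nmV nmM w01 mulr1.
  have : (nm w)^-1 <= 2 by rewrite -[leRHS]invrK lef_pV2 ?posrE ?nm_gt0 ?invr_gt0.
  by move=> ?; lra.
rewrite mulrAC ler_pdivlMr//.
apply: (@le_trans _ _ (nm (t - z) * nm (m t))); first by rewrite ler_wpM2l ?nm_ge0.
by rewrite E' mulrC ler_wpM2r ?nm_ge0.
Qed.

(* The sign of [|P|^2 - |Q|^2 = (1 - |w|^2) (1 - 2 Re t) + 4 Im t Im w] near [E_0] is that of its second term. *)
Lemma arc_local z : generic z -> exists d kap M, [/\ 0 < d, 0 < kap, kap < M &
  forall t, nm (t - z) < d -> [/\ t != 0, 0 < complex.Re t, complex.Im t != 0, nm z / 2 <= nm t &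
   forall w, kern t w -> w != 0 -> nm w <= 1 ->
    [/\ nm (Pf t w) <= M, nm (Qf t w) <= M, 2^-1 <= nm w, kap <= `|complex.Im w| &
    [/\ qf t < 0 -> nm w < 1 /\ nm (Qf t w) + kap <= nm (Pf t w),
        0 < qf t -> nm w < 1 /\ nm (Pf t w) + kap <= nm (Qf t w) &
        qf t = 0 -> nm w = 1 /\ kap <= `|nm (Pf t w) - nm (Qf t w)| ]]]].
Proof.
move=> gz; have [x0 y0 q0] := gz; have z0 := Im_neq0 y0.
have [w1 [kz w11 b0]] := generic_kern gz.
have w1n : w1 != 0 by rewrite -nm_gt0 w11.
pose a := `|complex.Im w1|; have a0 : 0 < a by rewrite normr_gt0.
have a1 : a <= 1 by rewrite -w11 nm_Im.
pose Y := `|complex.Im z|; have Y0 : 0 < Y by rewrite normr_gt0.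
pose T := nm z + 1; have T1 : 1 <= T by rewrite lerDr nm_ge0.
pose M := 1 + 2 * T.
(* [b] is a lower bound of [|Im t Im w|], so the main term of [|P|^2 - |Q|^2] is at least [4 b] in
   modulus; [e] is chosen to keep the other term below [2 b]. *)
pose b := Y / 2 * (a / 2); have bb : 0 < b by rewrite mulr_gt0 // divr_gt0.
pose e := Num.min (a / 4) (b / (2 * M)).
have M0 : 0 < M by rewrite /M; lra.
have e0 : 0 < e by rewrite lt_min !divr_gt0 // mulr_gt0.
have ea : e <= a / 4 by rewrite ge_min lexx.
have eb : e * (2 * M) <= b by rewrite -ler_pdivlMr ?mulr_gt0 // ge_min lexx orbT.
have [d1 d10 H1] := anal_cont (anal_cf z0) (exprn_gt0 2 e0).
have YT : Y <= nm z by rewrite nm_Im.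
pose kap := Num.min (b / M) (a / 2).
have k0 : 0 < kap by rewrite lt_min !divr_gt0.
have kb : kap <= b / M by rewrite ge_min lexx.
have ka : kap <= a / 2 by rewrite ge_min lexx orbT.
exists (Num.min d1 (Num.min (Num.min (nm z / 2) 1) (Num.min (Y / 2) (complex.Re z)))), kap, M.
split=> //.
- by rewrite !lt_min d10 ltr01 x0 !divr_gt0 // nm_gt0.
- by apply: le_lt_trans ka _; rewrite /M; lra.
move=> t; rewrite !lt_min => /and3P[t1 /andP[t2 t3] /andP[t4 t5]].
have [TE ME bE] : [/\ T = nm z + 1, M = 1 + 2 * T & b = Y / 2 * (a / 2)] by [].
clearbody e kap b M T.
have tz : nm z / 2 <= nm t by have := nm_subl z t; rewrite nmB; move: t2; move: (nm (t - z)) (nm z) (nm t) => u v x; lra.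
have tn : t != 0 by rewrite -nm_gt0; apply: lt_le_trans tz; rewrite divr_gt0 // nm_gt0.
have ReB u v : complex.Re (u - v) = complex.Re u - complex.Re v :> R by case: u v => [? ?] [? ?].
have ImB u v : complex.Im (u - v) = complex.Im u - complex.Im v :> R by case: u v => [? ?] [? ?].
have tx : 0 < complex.Re t.
  have := nm_Re (t - z); rewrite ReB ler_norml => /andP[+ _]; move: t5.
  by move: (nm _) => u; lra.
have ty : Y / 2 <= `|complex.Im t|.
  have := nm_Im (t - z); rewrite ImB => h.
  have h' : Y - `|complex.Im t| <= `|complex.Im t - complex.Im z| by rewrite distrC lerB_dist.
  have := le_trans h' h; move: t4; move: (nm (t - z)) `|complex.Im t| => u v; lra.
have tyn : complex.Im t != 0 by rewrite -normr_gt0; apply: lt_le_trans ty; rewrite divr_gt0.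
have tT : nm t <= T.
  by have := nm_subl t z; move: t3; rewrite TE; move: (nm _) (nm _) (nm _) => u v x; lra.
split=> // w kt wn w1'.
(* The kernel roots at [z] are [w1] and [1/w1]. The product of the distances from [w] to them is at
   most [e^2], so that [w] is within [e] of one of them. *)
have cE : (w - w1) * (w - w1^-1) = w * (cf t - cf z).
  rewrite ((kern_cf tn wn).1 kt) ((kern_cf z0 w1n).1 kz); field; by rewrite wn w1n.
have Pr : nm (w - w1) * nm (w - w1^-1) <= e ^+ 2.
  rewrite -nmM cE nmM; apply: le_trans (ltW (H1 t t1)); rewrite ler_piMl ?nm_ge0//.
have [near1 near2] : 1 - e <= nm w /\ a - e <= `|complex.Im w|.
  have [u [u1 uI ue]] : exists u, [/\ nm u = 1, `|complex.Im u| = a & nm (w - u) <= e].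
    have [h|h] := leP (nm (w - w1)) e; first by exists w1.
    exists w1^-1; split; rewrite ?nmV ?w11 ?invr1 ?Im_inv ?normrN//.
    rewrite leNgt; apply/negP => h'; move: Pr; rewrite leNgt => /negP; apply.
    by rewrite expr2 ltr_pM // ltW.
  split; first by have := nm_subl u w; rewrite nmB u1; move: ue; move: (nm _) (nm _) => v x; lra.
  have := nm_Im (w - u); rewrite ImB => h.
  have h' : a - `|complex.Im w| <= `|complex.Im w - complex.Im u| by rewrite distrC -uI lerB_dist.
  have := le_trans h' h; move: ue; move: (nm (w - u)) `|complex.Im w| => v x; lra.
have PM : nm (Pf t w) <= M.
  rewrite /Pf; apply: le_trans (nmD _ _) _; rewrite nmN nmM.
  have h1 : nm (1 - t) <= 1 + T by apply: le_trans (nmD _ _) _; rewrite nm1 nmN lerD2l.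
  have h2 : nm t * nm w <= T by apply: le_trans tT; rewrite ler_piMr ?nm_ge0.
  by rewrite ME; move: h1 h2; clear; lra.
have QM : nm (Qf t w) <= M.
  rewrite /Qf; apply: le_trans (nmD _ _) _; rewrite nmN nmM.
  have h1 : nm (1 - t) <= 1 + T by apply: le_trans (nmD _ _) _; rewrite nm1 nmN lerD2l.
  have h2 : nm (1 - t) * nm w <= 1 + T by apply: le_trans h1; rewrite ler_piMr ?nm_ge0.
  by rewrite ME; move: tT h2; clear; lra.
have yI : b <= `|complex.Im t * complex.Im w|.
  rewrite normrM bE ler_pM // ?divr_ge0 ?(ltW Y0) ?(ltW a0)//.
  by apply: le_trans near2; move: ea a0; clear; lra.
have sm : `|(1 - nm w ^+ 2) * (1 - 2 * complex.Re t)| <= 2 * b.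
  rewrite normrM; have h1 : `|1 - nm w ^+ 2| <= 2 * e.
    rewrite ger0_norm; last by rewrite subr_ge0 exprn_ile1 ?nm_ge0.
    by move: near1 (nm_ge0 w) w1' e0; move: (nm w) => v; clear; nra.
  have h2 : `|1 - 2 * complex.Re t| <= M.
    apply: le_trans (ler_normB _ _) _; rewrite normr1 normrM ger0_norm // ME lerD2l ler_wpM2l //.
    exact: le_trans (nm_Re t) tT.
  apply: (@le_trans _ _ (2 * e * M)); first by rewrite ler_pM.
  by move: eb bb; clear; lra.
have D := nm_PQ t w.
have Pn := nm_ge0 (Pf t w); have Qn := nm_ge0 (Qf t w).
have kM : kap * (2 * M) <= 2 * b by rewrite mulrCA ler_wpM2l // -ler_pdivlMr.
have [S _] := kern_conj kt.
have n0 : 0 < nm t ^+ 2 by rewrite exprn_gt0 // nm_gt0.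
have m0 : 0 < nm w ^+ 2 by rewrite exprn_gt0 // nm_gt0.
have wI0 : complex.Im w != 0 by rewrite -normr_gt0; apply: lt_le_trans near2; move: ea a0; clear; lra.
have w1E : nm w < 1 \/ nm w = 1 by move: w1'; rewrite le_eqVlt => /orP[/eqP|]; [right|left].
have pos : 0 < complex.Im t * complex.Im w -> nm (Qf t w) + kap <= nm (Pf t w).
  move=> h; rewrite (gtr0_norm h) in yI.
  have DD : 2 * b <= nm (Pf t w) ^+ 2 - nm (Qf t w) ^+ 2.
    by rewrite D; move: sm yI; rewrite ler_norml => /andP[+ _]; clear; lra.
  exact: gap_sqr kM DD.
have neg : complex.Im t * complex.Im w < 0 -> nm (Pf t w) + kap <= nm (Qf t w).
  move=> h; rewrite (ltr0_norm h) in yI.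
  have DD : 2 * b <= nm (Qf t w) ^+ 2 - nm (Pf t w) ^+ 2.
    by rewrite -opprB D opprD; move: sm yI; rewrite ler_norml => /andP[_]; clear; lra.
  exact: gap_sqr kM DD.
have tw0 : complex.Im t * complex.Im w != 0 by rewrite mulf_neq0.
have tw : complex.Im t * complex.Im w < 0 \/ 0 < complex.Im t * complex.Im w.
  by apply/orP; rewrite -neq_lt.
split=> //; [by move: near1 e0 ea a1; clear; lra|by move: near2 ea ka a0; clear; lra|split].
- move=> q; case: w1E => w1E; last first.
    move/eqP: S; rewrite w1E expr1n subrr !mulr0 mul1r eq_sym mulf_eq0 (negPf tyn) /= => /eqP qq.
    by rewrite qq ltxx in q.
  have [_ sd] := kern_side kt wn tyn w1E; split=> //; apply: pos.
  by case: tw => // h; have := lt_trans q (sd h); rewrite ltxx.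
- move=> q; case: w1E => w1E; last first.
    move/eqP: S; rewrite w1E expr1n subrr !mulr0 mul1r eq_sym mulf_eq0 (negPf tyn) /= => /eqP qq.
    by rewrite qq ltxx in q.
  have [sd _] := kern_side kt wn tyn w1E; split=> //; apply: neg.
  by case: tw => // h; have := lt_trans q (sd h); rewrite ltxx.
- move=> q; case: w1E => w1E.
    have [sd1 sd2] := kern_side kt wn tyn w1E; exfalso.
    by case: tw => h; [have := sd2 h|have := sd1 h]; rewrite q ltxx.
  split=> //; case: tw => h.
    by rewrite distrC; apply: le_trans (ler_norm _); rewrite lerBrDl; apply: neg.
  by apply: le_trans (ler_norm _); rewrite lerBrDl; apply: pos.
Qed.

End Arc.

(** * The unit circle and roots of unity *)

Section Unit.
Context {R : realType}.
Implicit Types (t z w u : Cplx R) (k : nat) (e r d x y : R).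

Definition cis x : Cplx R := cos x +i* sin x.

Lemma cisD x y : cis (x + y) = cis x * cis y.
Proof. by rewrite /cis cosD sinD; congr (_ +i* _); rewrite addrC [cos x * sin y]mulrC [sin x * _]mulrC; ring. Qed.

Lemma nm_cis x : nm (cis x) = 1.
Proof. by apply/eqP; rewrite -(pexpr_eq1 (n := 2)) ?nm_ge0 // nm_sqr /= cos2Dsin2. Qed.

Lemma cis0 : cis 0 = 1.
Proof. by rewrite /cis cos0 sin0. Qed.

Lemma cisM x n : cis (x * n%:R) = cis x ^+ n.
Proof. by elim: n => [|n IH]; rewrite ?mulr0 ?cis0 ?expr0 // -natr1 mulrDr mulr1 cisD IH exprSr. Qed.

Lemma cis2pi : cis (pi *+ 2) = 1.
Proof. by rewrite /cis cos2pi sin2pi. Qed.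

Lemma sin_cos_lip x : `|sin x| <= `|x| /\ `|cos x - 1| <= `|x|.
Proof.
wlog x0 : x / 0 <= x.
  move=> H; case: (leP 0 x) => [|x0]; first exact: H.
  by have := H (- x); rewrite sinN cosN !normrN; apply; rewrite oppr_ge0 ltW.
split.
  have [|c _] := @MVT_segment R sin cos 0 x x0.
    exact/continuous_subspaceT/continuous_sin.
  rewrite sin0 !subr0 => ->; rewrite normrM ler_piMl //.
  by rewrite ler_norml cos_geN1 cos_le1.
have [|c _] := @MVT_segment R cos (fun x => - sin x) 0 x x0.
  exact/continuous_subspaceT/continuous_cos.
rewrite cos0 !subr0 => ->; rewrite normrM normrN ler_piMl //.
by rewrite ler_norml sin_geN1 sin_le1.
Qed.

Lemma cis_lip x y : nm (cis x - cis y) <= 2 * `|x - y|.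
Proof.
have -> : cis x - cis y = cis y * (cis (x - y) - 1) by rewrite mulrBr mulr1 -cisD subrKC.
rewrite nmM nm_cis mul1r; apply: le_trans (nm_ReIm _) _.
have [h1 h2] := sin_cos_lip (x - y).
by rewrite mulr_natl mulr2n; apply: lerD => //=; rewrite oppr0 addr0.
Qed.

Lemma polar w : nm w = 1 -> exists2 x, 0 <= x & w = cis x.
Proof.
move=> w1; have := nm_sqr w; rewrite w1 expr1n; case: w w1 => a b w1 /= E.
have a1 : -1 <= a <= 1 by rewrite -ler_norml -w1; apply: (@nm_Re _ (a +i* b)).
have ca : cos (acos a) = a by apply: acosK; rewrite in_itv /=.
have sa : sin (acos a) = `|b|.
  by rewrite sin_acos // E addrAC subrr add0r sqrtr_sqr.
have [b0|b0] := leP 0 b.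
  by exists (acos a); rewrite ?acos_ge0 // /cis ca sa ger0_norm.
exists (pi *+ 2 - acos a).
  by rewrite subr_ge0 (le_trans (acos_lepi a1)) // mulr2n lerDl pi_ge0.
by rewrite addrC /cis cosD2pi sinD2pi cosN sinN ca sa ltr0_norm // opprK.
Qed.

(** The multiples of [2 pi / m] approach the argument of [w] within [2 pi / m]. The order is taken
    prime so that, for [x] other than 1, [x^n = 1] occurs only when [m] divides [n]. *)
Lemma root_dense w d N : nm w = 1 -> 0 < d ->
  exists m (x : Cplx R), [/\ prime m, (N < m)%N, x ^+ m = 1 & nm (x - w) < d].
Proof.
move=> w1 d0; have [th th0 ->] := polar w1.
have p0 : 0 < pi *+ 2 :> R by rewrite pmulrn_lgt0 // pi_gt0.
pose b : R := 2 * (pi *+ 2) / d.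
have b0 : 0 <= b by rewrite divr_ge0 // ltW // mulr_gt0.
have [m mN mp] := prime_above (maxn N (Num.truncn b).+1).
have m0 : 0 < m%:R :> R by rewrite ltr0n prime_gt0.
have mb : b < m%:R.
  have /andP[_ h] := truncn_itv b0; apply: lt_trans h _.
  by rewrite ltr_nat (leq_ltn_trans _ mN) // leq_maxr.
pose p := Num.truncn (th * m%:R / (pi *+ 2)).
have q0 : 0 <= th * m%:R / (pi *+ 2) by rewrite divr_ge0 ?mulr_ge0 // ltW.
have /andP[p1 p2] := truncn_itv q0; rewrite -/p in p1 p2.
exists m, (cis (pi *+ 2 * p%:R / m%:R)); split=> //.
- by rewrite (leq_ltn_trans _ mN) // leq_maxl.
- by rewrite -cisM divfK ?gt_eqF // cisM cis2pi expr1n.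
apply: le_lt_trans (cis_lip _ _) _.
have h : `|pi *+ 2 * p%:R / m%:R - th| <= pi *+ 2 / m%:R.
  rewrite distrC ger0_norm; last first.
    by rewrite subr_ge0 ler_pdivrMr // mulrC -ler_pdivlMr.
  rewrite lerBlDr -mulrDl ler_pdivlMr // -{1}[pi *+ 2]mulr1 -mulrDr addrC natr1.
  by rewrite [leRHS]mulrC -ler_pdivrMr // ltW.
apply: (@le_lt_trans _ _ (2 * (pi *+ 2 / m%:R))); first by rewrite ler_wpM2l.
by rewrite mulrA ltr_pdivrMr // -ltr_pdivrMl // mulrC.
Qed.

Lemma prime_root_dvd (x : Cplx R) m n : prime m -> x ^+ m = 1 -> x != 1 -> x ^+ n = 1 -> (m %| n)%N.
Proof.
move=> mp xm x1 xn; apply/negPn/negP; rewrite -prime_coprime // => cop.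
have m0 : (0 < m)%N by rewrite prime_gt0.
have /(coprimeP _ m0)[[a b] /= E] := cop.
have E' : (m * a = n * b + 1)%N by move: E; rewrite ![(_ * m)%N]mulnC ![(_ * n)%N]mulnC; clear; lia.
have := congr1 (fun i => x ^+ i) E'; rewrite exprD !exprM xm xn !expr1n mul1r expr1.
by move/esym/eqP; rewrite (negPf x1).
Qed.

Lemma nm_1subX (x : Cplx R) n : nm x <= 1 -> nm (1 - x ^+ n) <= n%:R * nm (1 - x).
Proof.
move=> x1; have -> : 1 - x ^+ n = 1 ^+ n - x ^+ n by rewrite expr1n.
rewrite subrXX nmM mulrC.
rewrite ler_wpM2r ?nm_ge0 //; apply: le_trans (nm_sum _ _ _) _.
apply: (@le_trans _ _ (\sum_(i < n) 1)); last by rewrite sumr_const card_ord.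
by apply: ler_sum => i _; rewrite expr1n mul1r nmX exprn_ile1 ?nm_ge0.
Qed.

(** The powers of [x] sum to 0, so the [m] numbers [1 - x^i] sum to [m], and each has modulus at
    most [m |1 - x|]. *)
Lemma root1_gap (x : Cplx R) m : (0 < m)%N -> x ^+ m = 1 -> x != 1 -> m%:R^-1 <= nm (1 - x).
Proof.
move=> m0 xm x1; have nx := nm_root1 m0 xm.
have m0' : 0 < m%:R :> R by rewrite ltr0n.
have E : (m%:R : Cplx R) = \sum_(i < m) (1 - x ^+ i).
  by rewrite sumrB (sum_root1 xm x1) subr0 sumr_const card_ord.
have := nm_nat (R := R) m; rewrite E => E'.
have : m%:R <= \sum_(i < m) m%:R * nm (1 - x).
  rewrite -{1}E'; apply: le_trans (nm_sum _ _ _) _; apply: ler_sum => i _.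
  apply: le_trans (nm_1subX _ _) _; first by rewrite nx.
  by rewrite ler_wpM2r ?nm_ge0 // ler_nat ltnW.
rewrite sumr_const card_ord -[leRHS]mulr_natl mulrA -ler_pdivrMl ?mulr_gt0//.
by rewrite invfM mulfVK ?gt_eqF.
Qed.

Lemma nm_radial (x : Cplx R) r : nm x = 1 -> 0 <= r -> r <= 1 -> nm (1 - x) <= 2 * nm (1 - r%:C * x).
Proof.
move=> x1 r0 r1; have h1 : 1 - r <= nm (1 - r%:C * x).
  by have := nm_subl 1 (r%:C * x); rewrite nm1 nmM x1 mulr1 nm_real ger0_norm.
have -> : 1 - x = (1 - r%:C * x) - (1 - r)%:C * x by rewrite rmorphB rmorph1; ring.
apply: le_trans (nmD _ _) _; rewrite nmN nmM x1 mulr1 nm_real ger0_norm ?subr_ge0//.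
by move: h1; move: (nm _) => v; lra.
Qed.

End Unit.

(** * The inner side of the curve *)

Section Inner.
Context {R : realType}.
Implicit Types (t z w u : Cplx R) (k : nat) (e r d x y : R).

(* [true] is the inner side of [E_0], the one of the origin. *)
Definition side (s : bool) t := if s then qf t < 0 else 0 < qf t.

Lemma side_notE s t : side s t -> 0 < complex.Re t -> complex.Im t != 0 -> ~ E R t.
Proof. by move=> st x0 y0 /E_generic /(_ x0 y0) q0; move: st; rewrite /side q0 ltxx; case: s. Qed.

Lemma nm_1subsqr_Im w : `|complex.Im w| ^+ 2 <= nm (1 - w ^+ 2).
Proof.
have -> : 1 - w ^+ 2 = (1 - w) * (1 + w) by ring.
rewrite nmM expr2; apply: ler_pM => //.
  by have := nm_Im (1 - w); case: w => a b /=; rewrite sub0r normrN.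
by have := nm_Im (1 + w); case: w => a b /=; rewrite add0r.
Qed.

Lemma nm_1subsqr_le2 w : nm w <= 1 -> nm (1 - w ^+ 2) <= 2.
Proof.
move=> w1; apply: le_trans (nmD _ _) _; rewrite nm1 nmN nmX.
have : nm w ^+ 2 <= 1 by rewrite exprn_ile1 ?nm_ge0.
by move: (nm w ^+ 2) => v; lra.
Qed.

(** A lower bound for the denominators that is uniform in [k] reduces [F] to a geometric series in
    [|w|]. The rate [1 / (1 - |w|)] is what the growth estimates along paths rely on. *)
Lemma F_bound t w kap : kern t w -> t != 0 -> 0 < nm w < 1 -> 0 < kap ->
  (forall k, kap <= nm (Pf t w + Qf t w * w ^+ (2 * k).+1)) ->
  nm (Fser t) <= 2 / kap / (1 - nm w) /\ forall k, G k t != 0.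
Proof.
move=> kt t0 w01 k0 H; have /andP[w0 w1] := w01.
have H0 k : Pf t w + Qf t w * w ^+ (2 * k).+1 != 0 by rewrite -nm_gt0; apply: lt_le_trans (H k).
split; last by move=> k; rewrite (G_eq0 k kt t0 w01).
apply: (@csum_le R (2 / kap) (nm w)); split; first by rewrite (ltW w0).
move=> k; rewrite (fk_formula k kt t0 w01) !nmM nmV nmX mulrAC.
apply: ler_wpM2r; first by rewrite exprn_ge0 ?nm_ge0.
apply: ler_pM; rewrite ?invr_ge0 ?nm_ge0 ?nm_1subsqr_le2 ?(ltW w1)//.
by rewrite lef_pV2 ?posrE // nm_gt0.
Qed.

Lemma F_near_le t e : t != 0 -> ~ E R t -> (forall k, G k t != 0) -> 0 < e ->
  \forall t' \near t^', nm (Fser t') <= nm (Fser t) + e /\ nm (Fser t) - e <= nm (Fser t').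
Proof.
move=> t0 tE g0 e0; have [d d0 H] := anal_cont (F_anal t0 tE g0) e0.
apply: near_dnbhs; apply: near_nm d0 _ => t' /H h.
have h1 := nm_subl (Fser t') (Fser t); have h2 := nm_subl (Fser t) (Fser t').
by rewrite nmB in h2; split; lra.
Qed.

Lemma sgn_near z w1 t w : nm (t - z) < `|complex.Im z| -> nm (w - w1) < `|complex.Im w1| ->
  0 < (complex.Im z * complex.Im w1) * (complex.Im t * complex.Im w).
Proof.
have S (a b : Cplx R) : nm (a - b) < `|complex.Im b| -> 0 < complex.Im b * complex.Im a.
  move=> h; have := le_lt_trans (nm_Im _) h; case: a b {h} => a1 a [b1 b] /=.
  rewrite ltr_norml => /andP[]; case: (ltrgtP b 0) => [b0|b0|->]; rewrite ?normr0.
  - by rewrite ltr0_norm // => h1 h2; rewrite nmulr_rgt0 //; lra.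
  - by rewrite gtr0_norm // => h1 h2; rewrite pmulr_rgt0 //; lra.
  - by move=> h1 h2; lra.
move=> /S h1 /S h2; rewrite mulrACA; exact: mulr_gt0.
Qed.

Lemma inner_kap t w kap k : nm w <= 1 -> nm (Qf t w) + kap <= nm (Pf t w) ->
  kap <= nm (Pf t w + Qf t w * w ^+ (2 * k).+1).
Proof.
move=> w1 H; apply: le_trans (nm_addl _ _); rewrite nmM nmX.
have : nm (Qf t w) * nm w ^+ (2 * k).+1 <= nm (Qf t w).
  by rewrite ler_piMr ?nm_ge0 // exprn_ile1 ?nm_ge0.
by move=> H'; lra.
Qed.

(** Up to a constant factor the terms of [F] are [w^k / (1 - u w^(2k))]; they are expanded in powers
    of [u] and summed over [k] before [j]. *)
Lemma lambert t w u : kern t w -> t != 0 -> 0 < nm w < 1 -> Pf t w != 0 ->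
  Qf t w * w = - u * Pf t w -> nm u < 1 ->
  Fser t = (1 - w ^+ 2) / Pf t w * csum (fun j => u ^+ j / (1 - w ^+ (2 * j).+1)).
Proof.
move=> kt t0 w01 P0 uE u1; have /andP[w0 w1] := w01.
pose x k j : Cplx R := w ^+ k * (u * w ^+ (2 * k)) ^+ j.
have xE k j : x k j = u ^+ j * (w ^+ (2 * j).+1) ^+ k.
  rewrite /x exprMn_comm; last exact: mulrC.
  rewrite -!exprM mulrCA; congr (_ * _); rewrite -exprD; congr (_ ^+ _).
  by clear; lia.
have wk k : nm (u * w ^+ (2 * k)) < 1.
  by rewrite nmM nmX (le_lt_trans _ u1) // ler_piMr ?nm_ge0 // exprn_ile1 ?nm_ge0 ?ltW.
have X k j : nm (x k j) <= 1 * nm w ^+ k * nm u ^+ j.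
  rewrite mul1r /x nmM !nmX ler_wpM2l ?exprn_ge0 ?nm_ge0 // nmM nmX.
  apply: lerXn2r; rewrite ?nnegrE ?mulr_ge0 ?exprn_ge0 ?nm_ge0 //.
  by rewrite ler_piMr ?nm_ge0 // exprn_ile1 ?nm_ge0 ?ltW.
have w01' : 0 <= nm w < 1 by rewrite w1 ltW.
have u01' : 0 <= nm u < 1 by rewrite u1 nm_ge0.
have S := csum_exchange w01' u01' X.
have E1 : (fun k => csum (x k)) = fun k => w ^+ k / (1 - u * w ^+ (2 * k)).
  by apply/funext => k; apply: sums_csum; apply: sumsZ; apply: geo_series.
have E2 : (fun j => csum (x^~ j)) = fun j => u ^+ j / (1 - w ^+ (2 * j).+1).
  apply/funext => j; apply: sums_csum.
  rewrite (_ : x^~ j = fun k => u ^+ j * (w ^+ (2 * j).+1) ^+ k); last by apply/funext => k.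
  by apply: sumsZ; apply: geo_series; rewrite nmX exprn_ilt1 ?nm_ge0.
rewrite E1 E2 in S; apply: sums_csum.
rewrite (_ : fk^~ t = fun k => (1 - w ^+ 2) / Pf t w * (w ^+ k / (1 - u * w ^+ (2 * k)))).
  exact: sumsZ S.
apply/funext => k; rewrite (fk_formula k kt t0 w01).
have d0 : 1 - u * w ^+ (2 * k) != 0.
  by rewrite subr_eq0; apply: contraTneq (wk k) => <-; rewrite nm1 ltxx.
have -> : Pf t w + Qf t w * w ^+ (2 * k).+1 = Pf t w * (1 - u * w ^+ (2 * k)).
  by rewrite exprS mulrA uE; ring.
by rewrite invfM; move: (Pf t w)^-1 (1 - u * _)^-1 (1 - w ^+ 2) (w ^+ k) => a b c d'; ring.
Qed.

(** Here [2 j + 1 < 3 m], so the only possible odd multiple of [m] is [m] itself. *)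
Lemma odd_multiple m j : odd m -> (m %| (2 * j).+1)%N -> (j < m./2 + m)%N -> j = m./2.
Proof.
move=> mo /dvdnP[q E] jm; have m2 : m = (2 * m./2).+1 by rewrite -{1}(odd_double_half m) mo mul2n.
have : odd q by have := congr1 odd E; rewrite /= mul2n odd_double oddM mo andbT => <-.
case: q E => [|[|[|q]]] // E _; first lia.
by move: E jm m2; move: (m./2) => h; nia.
Qed.

(* The term [j = m./2], where [w^(2j+1) = r^m], dominates the other terms of the Lambert series: the first [m./2 + m] of them are bounded, and the remaining ones carry the factor [rho ^+ m]. *)
Lemma lambert_peak w u m (zt : Cplx R) r (S : Cplx R) rho sig :
  prime m -> odd m -> zt ^+ m = 1 -> zt != 1 -> 0 < r -> r < 1 -> w = r%:C * zt ->
  0 < sig -> sig <= nm u -> nm u <= rho -> rho < 1 -> rho ^+ m <= (1 - rho) / 4 ->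
  (m./2 + m)%:R * (2 * m%:R * (1 - r ^+ m)) <= sig ^+ m./2 / 4 ->
  2 * m%:R * (1 - r ^+ m) <= 1 ->
  S = csum (fun j => u ^+ j / (1 - w ^+ (2 * j).+1)) ->
  sig ^+ m./2 / 2 / (1 - r ^+ m) <= nm S.
Proof.
move=> mp mo zm z1 r0 r1 wE s0 su ur rho1 H1 H2 H3 SE.
have m0 := prime_gt0 mp; have nz := nm_root1 m0 zm.
have m0' : 0 < m%:R :> R by rewrite ltr0n.
pose y := 1 - r ^+ m; rewrite -/y in H2 H3 *.
have y0 : 0 < y by rewrite subr_gt0 exprn_ilt1 ?(ltW r0) // -lt0n.
have nw : nm w = r by rewrite wE nmM nz mulr1 nm_real gtr0_norm.
have u1 : nm u < 1 by apply: le_lt_trans rho1.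
have rho0 : 0 < rho by apply: lt_le_trans ur; apply: lt_le_trans su.
have wm : 1 - w ^+ m = y%:C by rewrite wE exprMn_comm ?zm ?mulr1 ?rmorphB ?rmorph1 ?rmorphXn //; apply: mulrC.
have u0 : 0 < nm u by apply: lt_le_trans su.
(* The factor [1 - w^m = 1 - r^m] turns the peak, at [2 j + 1 = m], into [u^j] exactly. *)
pose Y j := (1 - w ^+ m) * (u ^+ j / (1 - w ^+ (2 * j).+1)).
have wj j : 1 - r <= nm (1 - w ^+ (2 * j).+1).
  apply: le_trans (nm_subl _ _); rewrite nm1 nmX nw lerD2l lerN2 exprS ler_piMr ?(ltW r0) //.
  by rewrite exprn_ile1 // ltW.
have wj0 j : 1 - w ^+ (2 * j).+1 != 0 by rewrite -nm_gt0; apply: lt_le_trans (wj j); rewrite subr_gt0.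
have Yn j : ~~ (m %| (2 * j).+1)%N -> nm (Y j) <= 2 * m%:R * y * nm u ^+ j.
  move=> ndv; have x1 : zt ^+ (2 * j).+1 != 1 by apply: contra ndv => /eqP; apply: prime_root_dvd.
  have xm : (zt ^+ (2 * j).+1) ^+ m = 1 by rewrite -exprM mulnC exprM zm expr1n.
  have g1 := root1_gap m0 xm x1.
  have g2 : nm (1 - zt ^+ (2 * j).+1) <= 2 * nm (1 - w ^+ (2 * j).+1).
    have -> : w ^+ (2 * j).+1 = (r ^+ (2 * j).+1)%:C * zt ^+ (2 * j).+1.
      by rewrite wE exprMn_comm ?rmorphXn //; apply: mulrC.
    apply: nm_radial; rewrite ?nmX ?nz ?expr1n ?exprn_ge0 ?(ltW r0) ?exprn_ile1 ?(ltW r0) ?(ltW r1)//.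
  have g3 : (nm (1 - w ^+ (2 * j).+1))^-1 <= 2 * m%:R.
    rewrite -[leRHS]invrK lef_pV2 ?posrE ?invr_gt0 ?mulr_gt0 ?nm_gt0 // invfM.
    by move: g1 g2; move: (m%:R^-1) (nm _) (nm _) => a b c; clear; lra.
  rewrite /Y wm !nmM nmV nm_real (gtr0_norm y0) nmX.
  have aux (a b c : R) : a * b * c = b * (c * a) by ring.
  by rewrite aux ler_wpM2l ?(ltW y0) // ler_wpM2l ?exprn_ge0 ?nm_ge0.
have Yd j : (m %| (2 * j).+1)%N -> nm (Y j) <= nm u ^+ j.
  move=> /dvdnP[q qE]; have q0 : (0 < q)%N by case: q qE.
  have -> : Y j = u ^+ j * ((1 - w ^+ m) / (1 - w ^+ (2 * j).+1)) by rewrite /Y mulrCA.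
  rewrite nmM nmX ler_piMr ?exprn_ge0 ?nm_ge0 // nmM nmV ler_pdivrMr ?nm_gt0 // mul1r.
  have -> : 1 - w ^+ (2 * j).+1 = (1 - r ^+ (q * m))%:C.
    rewrite qE wE exprMn_comm; last exact: mulrC.
    by rewrite [in zt ^+ _]mulnC [zt ^+ _]exprM zm expr1n mulr1 rmorphB rmorph1 rmorphXn.
  have rq : r ^+ (q * m) <= r ^+ m by apply: ler_wiXn2l; rewrite ?(ltW r0) ?(ltW r1) // leq_pmull.
  rewrite wm !nm_real gtr0_norm // ger0_norm; first by rewrite lerD2l lerN2.
  by rewrite subr_ge0 exprn_ile1 // ltW.
have Yall j : nm (Y j) <= 1 * nm u ^+ j.
  rewrite mul1r; have [/Yd //|/Yn h] := boolP (m %| (2 * j).+1)%N.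
  by apply: le_trans h _; rewrite ler_piMl ?exprn_ge0 ?nm_ge0.
have GY : geo 1 (nm u) Y by split=> //; rewrite nm_ge0.
have m2 : m = (2 * m./2).+1 by rewrite -{1}(odd_double_half m) mo mul2n.
have YJ : Y m./2 = u ^+ m./2.
  by rewrite /Y -m2 mulrC divfK // m2.
have CY : csum Y = (1 - w ^+ m) * S.
  rewrite SE; apply: sums_csum; apply: sumsZ; apply: (@geo_sums _ (1 - r)^-1 (nm u)); split; rewrite ?nm_ge0 //.
  move=> j; rewrite nmM nmV nmX mulrC ler_wpM2r ?exprn_ge0 ?nm_ge0 //.
  by rewrite lef_pV2 ?posrE ?subr_gt0 ?nm_gt0.
have T := csum_tail (m./2 + m) GY.
have uJ : sig ^+ m./2 <= nm u ^+ m./2 by apply: lerXn2r; rewrite ?nnegrE ?nm_ge0 ?(ltW s0).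
have T1 : 1 * nm u ^+ (m./2 + m) / (1 - nm u) <= nm u ^+ m./2 / 4.
  rewrite mul1r exprD -mulrA ler_wpM2l ?exprn_ge0 ?nm_ge0 //.
  rewrite ler_pdivrMr ?subr_gt0 //; apply: (@le_trans _ _ (rho ^+ m)).
    by apply: lerXn2r; rewrite ?nnegrE ?nm_ge0 ?(ltW rho0).
  by apply: le_trans H1 _; move: ur; move: (nm u) => v; lra.
have T2 : nm (psums Y (m./2 + m) - Y m./2) <= sig ^+ m./2 / 4.
  have hm : (m./2 < m./2 + m)%N by rewrite -{1}[m./2]addn0 ltn_add2l.
  rewrite /psums (bigD1 (Ordinal hm)) //= addrAC subrr add0r.
  apply: le_trans (nm_sum _ _ _) _; apply: le_trans H2.
  apply: (@le_trans _ _ (\sum_(i < m./2 + m) 2 * m%:R * y)); last by rewrite sumr_const card_ord -[leLHS]mulr_natl.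
  rewrite [leRHS](bigD1 (Ordinal hm)) //= ler_wpDl ?mulr_ge0 ?(ltW y0) //.
  apply: ler_sum => i ih; apply: le_trans (Yn i _) _.
    apply: contra ih => dv; apply/eqP/val_inj => /=; exact: odd_multiple mo dv (ltn_ord i).
  by rewrite ler_piMr ?mulr_ge0 ?(ltW y0) // exprn_ile1 ?nm_ge0 // ltW.
have : sig ^+ m./2 / 2 <= nm (csum Y).
  have := nm_subl (Y m./2) (csum Y); have := nm_subD (csum Y) (psums Y (m./2 + m)) (Y m./2).
  rewrite YJ nmX in T2 *; rewrite [nm (u ^+ _ - csum Y)]nmB.
  have := le_trans T T1; move: T2 uJ.
  move: (nm (csum Y - psums _ _)) (nm (psums _ _ - _)) (nm (csum Y - u ^+ _)) (nm (csum Y)) => a b c d'.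
  by move: (sig ^+ _) (nm u ^+ _) => v1 v2; lra.
by rewrite CY nmM wm nm_real gtr0_norm // => h; rewrite ler_pdivrMr // [leRHS]mulrC.
Qed.

Lemma Fser_large_inner z d A : generic z -> 0 < d -> exists t, [/\ nm (t - z) < d, side true t &
  \forall t' \near t^', A <= nm (Fser t')].
Proof.
move=> gz d0; have [x0 y0 _] := gz; have z0 := Im_neq0 y0.
have [d1 [kap [M [d10 k0 kM L]]]] := arc_local gz.
have [w1 [kz w11 sg]] := generic_kern_sgn true gz.
have [C C0 RN] := root_near gz kz w11.
have w1I : complex.Im w1 != 0 by apply: contraTneq sg => ->; rewrite mulr0 ltxx.
pose D := Num.min (Num.min d d1) `|complex.Im z|.
have D0 : 0 < D by rewrite !lt_min d0 d10 normr_gt0.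
have [e0 e00 RE] := RN D D0.
pose e := Num.min e0 `|complex.Im w1|.
have ep : 0 < e by rewrite lt_min e00 normr_gt0.
have M0 : 0 < M by apply: lt_trans kM.
(* [rho] and [sig] bound [|u| = |Q w / P|]: from above by the gap between [|P|] and [|Q|], from
   below by [|P Q| = |t|^4 |w|]. *)
pose rho := 1 - kap / M.
have kM1 : kap / M < 1 by rewrite ltr_pdivrMr // mul1r.
have kM0 : 0 < kap / M by rewrite divr_gt0.
have rho0 : 0 < rho by rewrite /rho; lra.
have rho1 : rho < 1 by rewrite /rho; lra.
pose sig := (nm z / 2) ^+ 4 * 4^-1 / M ^+ 2.
have sig0 : 0 < sig by rewrite !divr_gt0 ?mulr_gt0 ?exprn_gt0 ?divr_gt0 ?nm_gt0 ?invr_gt0.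
have r01 : 0 <= rho < 1 by rewrite (ltW rho0).
have g0 : 0 < (1 - rho) / 4 by rewrite divr_gt0 ?subr_gt0.
have [N HN] := geo_small 1 r01 g0.
have e20 : 0 < Num.min (e / 2) (nm (1 - w1)).
  rewrite lt_min divr_gt0 // nm_gt0 subr_eq0; apply: contra_neq w1I => <- //.
have [m [zt [mp mN zm]]] := root_dense (N + 2) w11 e20.
rewrite lt_min => /andP[zw zw1].
have zt1 : zt != 1 by apply: contraTneq zw1 => ->; rewrite ltxx.
have m2 : (2 < m)%N by apply: leq_ltn_trans mN; rewrite leq_addl.
have mo : odd m by case: (even_prime mp) => // mE; rewrite mE in m2.
have Nm : (N <= m)%N by apply: leq_trans (ltnW mN); rewrite leq_addr.
have nz := nm_root1 (prime_gt0 mp) zm.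
have m0' : 0 < m%:R :> R by rewrite ltr0n prime_gt0.
have H1 : rho ^+ m <= (1 - rho) / 4.
  by have := HN m Nm; rewrite mul1r ger0_norm ?exprn_ge0 ?(ltW rho0) // => /ltW.
pose sj := sig ^+ m./2.
have sj0 : 0 < sj by rewrite exprn_gt0.
(* The prime [m] is fixed before the radius [r], and [b] is the bound required of [1 - r^m]. Its
   entries make the non-peak terms among the first [m./2 + m] small in total, keep all terms
   bounded, and raise the peak above [|A| + 1]. *)
pose b := Num.min (Num.min (sj / 4 / ((m./2 + m)%:R * (2 * m%:R))) (2 * m%:R)^-1)
    (kap ^+ 2 / M * (sj / 2) / (`|A| + 1)).
have A1 : 0 < `|A| + 1 by rewrite ltr_wpDl.
have hm0 : 0 < (m./2 + m)%:R :> R by rewrite ltr0n addn_gt0 (prime_gt0 mp) orbT.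
have b0 : 0 < b by rewrite !lt_min ?invr_gt0 !divr_gt0 ?mulr_gt0 ?exprn_gt0 ?invr_gt0.
have b1 : b <= sj / 4 / ((m./2 + m)%:R * (2 * m%:R)) by rewrite !ge_min lexx.
have b2 : b <= (2 * m%:R)^-1 by rewrite !ge_min lexx orbT.
have b3 : b <= kap ^+ 2 / M * (sj / 2) / (`|A| + 1) by rewrite !ge_min lexx !orbT.
clearbody b; have bm0 : 0 < b / m%:R by rewrite divr_gt0.
have ee0 : 0 < e / 2 by rewrite divr_gt0.
pose tau := Num.min (Num.min (e / 2) (b / m%:R)) 1 / 2.
have mi0 : 0 < Num.min (Num.min (e / 2) (b / m%:R)) 1 by rewrite !lt_min ee0 bm0 ltr01.
have tau0 : 0 < tau by rewrite divr_gt0.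
have : tau < Num.min (Num.min (e / 2) (b / m%:R)) 1 by rewrite /tau; lra.
rewrite !lt_min -andbA => /and3P[tau1 tau2 tau3].
clearbody tau; have [r rE] : exists r, r = 1 - tau by exists (1 - tau).
have r0 : 0 < r by rewrite rE subr_gt0.
have r1 : r < 1 by rewrite rE gtrBl.
have yb : 1 - r ^+ m <= b.
  have := @nm_1subX R r%:C m; rewrite nm_real gtr0_norm // => /(_ (ltW r1)).
  have -> : 1 - r%:C ^+ m = (1 - r ^+ m)%:C by rewrite rmorphB rmorph1 rmorphXn.
  have -> : 1 - r%:C = (1 - r)%:C by rewrite rmorphB rmorph1.
  rewrite !nm_real => h; apply: le_trans (ler_norm _) _; apply: le_trans h _.
  rewrite rE opprB addrC subrK gtr0_norm // mulrC -ler_pdivlMr // ltW //.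
have y0' : 0 < 1 - r ^+ m by rewrite subr_gt0 exprn_ilt1 ?(ltW r0) // -lt0n prime_gt0.
have [w wE] : exists w : Cplx R, w = r%:C * zt by exists (r%:C * zt).
have nw : nm w = r by rewrite wE nmM nz mulr1 nm_real gtr0_norm.
have : nm (w - w1) < e.
  apply: le_lt_trans (nm_subD _ zt _) _; rewrite (splitr e); apply: ltrD => //.
  have -> : w - zt = (- tau%:C) * zt by rewrite wE rE rmorphB rmorph1; ring.
  by rewrite nmM nz mulr1 nmN nm_real gtr0_norm.
rewrite lt_min => /andP[we wI]; have [t [tD kt _]] := RE w we.
move: tD; rewrite !lt_min -andbA => /and3P[td td1 tI].
have [tn tx ty tz Lt] := L t td1.
have w0 : w != 0 by rewrite -nm_gt0 nw.
have w1' : nm w < 1 by rewrite nw.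
have tw : 0 < complex.Im t * complex.Im w by have := sgn_near tI wI; rewrite pmulr_rgt0.
have [sd _] := kern_side kt w0 ty w1'; have st : side true t := sd tw.
have [PM QM w2 kI [L1 _ _]] := Lt w kt w0 (ltW w1').
have [_ QP] := L1 st.
have tE := side_notE st tx ty.
have w0n : 0 < nm w by rewrite nw.
have [P0 Q0] := kern_E kt tn w1' w0n.
have Pn : 0 < nm (Pf t w) by rewrite nm_gt0.
have w01 : 0 < nm w < 1 by rewrite nw r0.
pose u := - (Qf t w * w) / Pf t w.
have uE : Qf t w * w = - u * Pf t w by rewrite /u !mulNr opprK divfK.
have QPr : nm (Qf t w) / nm (Pf t w) <= rho.
  rewrite ler_pdivrMr // /rho mulrBl mul1r lerBrDr; apply: le_trans QP; rewrite lerD2l.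
  by rewrite mulrAC ler_pdivrMr // ler_wpM2l ?(ltW k0).
have un : nm u = nm (Qf t w) / nm (Pf t w) * nm w by rewrite /u nmM nmN nmM nmV mulrAC.
have ur : nm u <= rho by rewrite un (le_trans _ QPr) // ler_piMr ?divr_ge0 ?nm_ge0 ?(ltW w1').
have us : sig <= nm u.
  have PQ := congr1 nm (PQ_prod kt); rewrite !nmM nmN nmX in PQ.
  have -> : nm u = nm t ^+ 4 * nm w ^+ 2 / nm (Pf t w) ^+ 2.
    rewrite un; move/lt0r_neq0: Pn PQ; move: (nm (Pf t w)) (nm (Qf t w)) => p q p0 PQ.
    have -> : nm t ^+ 4 * nm w ^+ 2 = p * q * nm w by rewrite PQ expr2 mulrA.
    by field.
  apply: ler_pM; rewrite ?mulr_ge0 ?exprn_ge0 ?divr_ge0 ?nm_ge0 ?invr_ge0 ?exprn_ge0 ?(ltW M0) //.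
    apply: ler_pM; rewrite ?exprn_ge0 ?divr_ge0 ?nm_ge0 ?invr_ge0 //.
      by apply: lerXn2r; rewrite ?nnegrE ?divr_ge0 ?nm_ge0.
    have -> : 4^-1 = 2^-1 ^+ 2 :> R by rewrite expr2 -invfM -natrM.
    by apply: lerXn2r; rewrite ?nnegrE ?nm_ge0 ?invr_ge0.
  rewrite lef_pV2 ?posrE ?exprn_gt0 //.
  by apply: lerXn2r; rewrite ?nnegrE ?nm_ge0 ?(ltW M0).
have u1 : nm u < 1 by apply: le_lt_trans rho1.
pose S := csum (fun j => u ^+ j / (1 - w ^+ (2 * j).+1)).
have FE := lambert kt tn w01 P0 uE u1; rewrite -/S in FE.
have hb1 : (m./2 + m)%:R * (2 * m%:R * (1 - r ^+ m)) <= sj / 4.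
  by rewrite mulrA -ler_pdivlMl ?mulr_gt0 // mulrC (le_trans yb).
have hb2 : 2 * m%:R * (1 - r ^+ m) <= 1.
  by rewrite -ler_pdivlMl ?mulr_gt0 // mulr1 (le_trans yb).
have pk := lambert_peak mp mo zm zt1 r0 r1 wE sig0 us ur rho1 H1 hb1 hb2 (erefl S).
have FA : `|A| + 1 <= nm (Fser t).
  rewrite FE !nmM nmV.
  have h1 : kap ^+ 2 / M <= nm (1 - w ^+ 2) / nm (Pf t w).
    apply: ler_pM; rewrite ?exprn_ge0 ?invr_ge0 ?(ltW k0) ?(ltW M0) //.
      by apply: le_trans (nm_1subsqr_Im w); apply: lerXn2r; rewrite ?nnegrE ?(ltW k0).
    by rewrite lef_pV2 ?posrE.
  have km0 : 0 < kap ^+ 2 / M by rewrite divr_gt0 ?exprn_gt0.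
  apply: (@le_trans _ _ (kap ^+ 2 / M * (sj / 2 / (1 - r ^+ m)))).
    rewrite mulrA ler_pdivlMr // mulrC -ler_pdivlMr //; exact: le_trans yb b3.
  by apply: ler_pM; rewrite ?(ltW km0) ?divr_ge0 ?(ltW sj0) ?(ltW y0').
have kk k : kap <= nm (Pf t w + Qf t w * w ^+ (2 * k).+1) by apply: inner_kap => //; apply: ltW.
have [_ g0'] := F_bound kt tn w01 k0 kk.
exists t; split=> //.
have := F_near_le tn tE g0' ltr01; apply: filterS => t' [_].
by have := ler_norm A; move: (nm (Fser t)) (nm (Fser t')) FA => a c; clear; lra.
Qed.

(** [|F|] is at most a multiple of [1 / (1 - |w|)] while [|t - z|] is at most a multiple of
    [1 - |w|]. *)
Lemma path_bound z (C0 kap : R) t w : t != 0 -> ~ E R t -> kern t w -> 0 < nm w < 1 -> 0 < kap ->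
  (forall k, kap <= nm (Pf t w + Qf t w * w ^+ (2 * k).+1)) ->
  nm (t - z) <= C0 * (1 - nm w) -> nm (t - z) <= 1 ->
  \forall t' \near t^', nm (Fser t') * nm (t - z) <= 2 / kap * C0 + 1.
Proof.
move=> t0 tE kt w01 k0 kk h1 h2; have [FB g0] := F_bound kt t0 w01 k0 kk.
have := F_near_le t0 tE g0 ltr01; apply: filterS => t' [h _].
apply: (@le_trans _ _ ((2 / kap / (1 - nm w) + 1) * nm (t - z))).
  by rewrite ler_wpM2r ?nm_ge0 // (le_trans h) // lerD2r.
rewrite mulrDl mul1r; apply: lerD => //.
have w1 : 0 < 1 - nm w by rewrite subr_gt0; case/andP: w01.
rewrite -mulrA; apply: ler_wpM2l; first by rewrite divr_ge0 ?(ltW k0).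
by rewrite mulrC ler_pdivrMr.
Qed.

Lemma Fser_order_inner z d : generic z -> 0 < d -> exists z' C, [/\ generic z', nm (z' - z) < d &
  forall e, 0 < e -> exists t, [/\ nm (t - z') < e, side true t &
  \forall t' \near t^', nm (Fser t') * nm (t - z') <= C]].
Proof.
move=> gz d0; have [x0 y0 _] := gz; have z0 := Im_neq0 y0.
have [d1 [kap [M [d10 k0 kM L]]]] := arc_local gz.
have [w1 [kz w11 sg]] := generic_kern_sgn true gz.
have [C C0 RN] := root_near gz kz w11.
have w1I : complex.Im w1 != 0 by apply: contraTneq sg => ->; rewrite mulr0 ltxx.
exists z, (2 / kap * C + 1); split=> //; first by rewrite subrr nm0.
move=> e e0.
pose D := Num.min (Num.min e d1) (Num.min `|complex.Im z| 1).
have D0 : 0 < D by rewrite !lt_min e0 d10 normr_gt0 y0 ltr01.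
have [e1 e10 RE] := RN D D0.
pose tau := Num.min (Num.min e1 `|complex.Im w1|) 1 / 2.
have mi0 : 0 < Num.min (Num.min e1 `|complex.Im w1|) 1 by rewrite !lt_min e10 normr_gt0 w1I ltr01.
have tau0 : 0 < tau by rewrite divr_gt0.
have : tau < Num.min (Num.min e1 `|complex.Im w1|) 1 by rewrite /tau; lra.
rewrite !lt_min -andbA => /and3P[tau1 tau2 tau3]; clearbody tau.
pose w := (1 - tau)%:C * w1.
have ww : w - w1 = (- tau%:C) * w1 by rewrite /w rmorphB rmorph1; ring.
have nww : nm (w - w1) = tau by rewrite ww nmM w11 mulr1 nmN nm_real gtr0_norm.
have nw : nm w = 1 - tau by rewrite /w nmM w11 mulr1 nm_real gtr0_norm // subr_gt0.
have [|t [tD kt tC]] := RE w; first by rewrite nww.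
rewrite nww in tC.
move: tD; rewrite !lt_min -!andbA => /and4P[te td1 tI t1].
have [tn tx ty tz Lt] := L t td1.
have w01 : 0 < nm w < 1 by rewrite nw; apply/andP; split; [rewrite subr_gt0|rewrite gtrBl].
have [w0 w1'] := andP w01; rewrite nm_gt0 in w0.
have wI : nm (w - w1) < `|complex.Im w1| by rewrite nww.
have tw : 0 < complex.Im t * complex.Im w by have := sgn_near tI wI; rewrite pmulr_rgt0.
have [sd _] := kern_side kt w0 ty w1'; have st : side true t := sd tw.
have [PM QM w2 kI [L1 _ _]] := Lt w kt w0 (ltW w1').
have [_ QP] := L1 st.
exists t; split=> //.
apply: (@path_bound z C kap t w) => //; first exact: side_notE st tx ty.
- by move=> k; apply: inner_kap => //; apply: ltW.
- by have -> : 1 - nm w = tau by rewrite nw; ring.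
- exact: ltW.
Qed.

End Inner.

Lemma expr_pred_le (T : numDomainType) (u : T) n k :
  1 <= u -> (n <= 3 * k + 2)%N -> u ^+ n.-1 <= u * (u ^+ 3) ^+ k.
Proof.
move=> u1 nk; rewrite -exprM -exprS; apply: ler_weXn2l => //.
by case: n nk => [//|n]; rewrite addn2 ltnS.
Qed.

(** * The outer side of the curve: poles of F *)

Section Outer.
Context {R : realType}.
Implicit Types (t z w u : Cplx R) (k : nat) (e r d x y : R).

Lemma pow_unbounded (a B : R) : 1 < a -> exists K, forall k, (K <= k)%N -> B < a ^+ k.
Proof.
move=> a1; have a0 : 0 < a by lra.
have q01 : 0 <= a^-1 < 1 by rewrite invr_ge0 (ltW a0) invf_lt1.
have B0 : 0 < `|B| + 1 by rewrite ltr_wpDl.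
have [K HK] := geo_small (`|B| + 1) q01 ltr01; exists K => k /HK.
rewrite exprVn ger0_norm; last by rewrite divr_ge0 ?exprn_ge0 // ltW.
rewrite ltr_pdivrMr ?exprn_gt0 // mul1r; apply: le_lt_trans.
by rewrite (le_trans (ler_norm _)) // lerDl.
Qed.

(** For [|w| < 1] the term [Q w^(2k+1)] becomes negligible before [P]. For [|w| = 1] it has constant
    modulus, and the gap between [|P|] and [|Q|] prevents cancellation. *)
Lemma G_lower p w kap : p != 0 -> kern p w -> w != 0 -> nm w <= 1 -> 1 - w ^+ 2 != 0 -> 0 < kap ->
  (nm w < 1 \/ nm w = 1 /\ kap <= `|nm (Pf p w) - nm (Qf p w)|) ->
  exists c K, 0 < c /\ forall k, (K <= k)%N -> c * (nm p / nm w) ^+ k <= nm (G k p).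
Proof.
move=> p0 kp w0 w1 w20 k0 H; have nw : 0 < nm w by rewrite nm_gt0.
have [c [K [c0 Hc]]] : exists c K, 0 < c /\ forall k, (K <= k)%N -> c <= nm (Pf p w + Qf p w * w ^+ (2 * k).+1).
  case: H => [lt1|[e1 H]].
    have [P0 _] := kern_E kp p0 lt1 nw.
    have Pn : 0 < nm (Pf p w) / 2 by rewrite divr_gt0 // nm_gt0.
    have w01 : 0 <= nm w < 1 by rewrite lt1 ltW.
    have [K HK] := geo_small (nm (Qf p w)) w01 Pn.
    exists (nm (Pf p w) / 2), K; split=> // k /HK; rewrite ger0_norm ?mulr_ge0 ?exprn_ge0 ?nm_ge0 // => h.
    have h2 : nm (Qf p w * w ^+ (2 * k).+1) <= nm (Qf p w) * nm w ^+ k.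
      rewrite nmM nmX ler_wpM2l ?nm_ge0 //; apply: ler_wiXn2l; rewrite ?nm_ge0 ?(ltW lt1) //.
      exact: odd_index_le.
    by have := nm_addl (Pf p w) (Qf p w * w ^+ (2 * k).+1); lra.
  exists kap, 0%N; split=> // k _; apply: le_trans H _.
  have := nm_sub_abs (Pf p w) (- (Qf p w * w ^+ (2 * k).+1)).
  by rewrite nmN nmM nmX e1 expr1n mulr1 opprK.
exists (c / 2), K; split; first by rewrite divr_gt0.
move=> k /Hc h; have := congr1 nm (G_formula k kp); rewrite !nmM !nmX => E.
have w2 := nm_1subsqr_le2 w1.
rewrite expr_div_n mulrA ler_pdivrMr ?exprn_gt0 //.
have h1 : nm (G k p) * nm (1 - w ^+ 2) * nm w ^+ k <= nm (G k p) * 2 * nm w ^+ k.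
  by rewrite ler_wpM2r ?exprn_ge0 ?nm_ge0 // ler_wpM2l ?nm_ge0.
rewrite E in h1.
have h2 : c * nm p ^+ k <= nm p ^+ k * nm (Pf p w + Qf p w * w ^+ (2 * k).+1).
  by rewrite mulrC ler_wpM2l ?exprn_ge0 ?nm_ge0.
by lra.
Qed.

(** Moving right from [E_0] leads to the outer side. This supplies the point of the circle around
    [z] at which [|w| < 1] strictly. *)
Lemma qf_shift z s : qf z = 0 -> 0 < complex.Re z -> 0 < s -> 0 < qf (z + s%:C).
Proof.
rewrite /qf !nm_sqr; case: z => x y /= q x0 s0; rewrite addr0.
have u0 : 0 < 1 + 2 * x by lra.
have -> : ((x + s) ^+ 2 + y ^+ 2) * (1 + 2 * (x + s)) - 1 =
  ((x ^+ 2 + y ^+ 2) * (1 + 2 * x) - 1) + ((2 * x * s + s ^+ 2) * (1 + 2 * x) + ((x + s) ^+ 2 + y ^+ 2) * (2 * s)) by ring.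
rewrite q add0r; apply: ltr_pwDl.
  by apply: mulr_gt0 => //; apply: addr_gt0; [rewrite !mulr_gt0|rewrite exprn_gt0].
by rewrite mulr_ge0 ?addr_ge0 ?sqr_ge0 // mulr_ge0 // ltW.
Qed.

(* If [F] had no poles near [z], the [G_k] would have no zeros there; Jensen on a circle around [z] would then contradict the growth of [G_k] at the points of the circle off [E_0]. *)
Lemma Fser_large_outer z d A : generic z -> 0 < d -> exists t, [/\ nm (t - z) < d, side false t &
  \forall t' \near t^', A <= nm (Fser t')].
Proof.
move=> gz d0; have [x0 y0 q0] := gz; have z0 := Im_neq0 y0.
have [d1 [kap [M [d10 k0 kM L]]]] := arc_local gz.
have zn : 0 < nm z by rewrite nm_gt0.
pose D := Num.min (Num.min d d1) (nm z).
have D0 : 0 < D by rewrite !lt_min d0 d10.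
have Dd : D <= d by rewrite !ge_min lexx.
have Dd1 : D <= d1 by rewrite !ge_min lexx orbT.
have Dz : D <= nm z by rewrite !ge_min lexx !orbT.
clearbody D.
suff [k [t [tk tD]]] : exists k t, G k t = 0 /\ nm (t - z) < D.
  have td1 := lt_le_trans tD Dd1; have [tn tx ty tz Lt] := L t td1.
  have [w [kt w0 w1]] := kern_ex tn.
  have [PM QM w2 kI [L1 L2 L3]] := Lt w kt w0 w1.
  have Z : Pf t w + Qf t w * w ^+ (2 * k).+1 = 0.
    have /esym/eqP := G_formula k kt; rewrite tk !mul0r mulf_eq0 expf_eq0 (negPf tn) andbF /=.
    by move/eqP.
  have q1 : 0 < qf t.
    have [q|q|q] := ltrgtP (qf t) 0 => //.
      have [w1' QP] := L1 q; have := inner_kap k w1 QP; rewrite Z nm0 leNgt k0 //.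
    have [w1' PQ] := L3 q; have := nm_sub_abs (Pf t w) (- (Qf t w * w ^+ (2 * k).+1)).
    by rewrite opprK Z nm0 nmN nmM nmX w1' expr1n mulr1 => h; have := le_trans PQ h; rewrite leNgt k0.
  exists t; split=> //; first exact: lt_le_trans tD Dd.
  by apply: (@F_pole R t k) => //; apply: (@side_notE R false).
apply: contrapT => no.
have Hroot k c : root (Gpol k) c -> D <= nm (c - z).
  by move=> /eqP rc; rewrite leNgt; apply/negP => h; apply: no; exists k, c.
have [w1 [kz w11 b0]] := generic_kern gz.
(* At the centre [|w1| = 1], so that [|G_k|] is only of order [|z|^k] there. *)
pose C := (nm (Pf z w1) + nm (Qf z w1)) / nm (1 - w1 ^+ 2).
have w120 : 0 < nm (1 - w1 ^+ 2).
  by apply: lt_le_trans (nm_1subsqr_Im w1); rewrite exprn_gt0 // normr_gt0.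
have up k : nm (G k z) <= C * nm z ^+ k.
  rewrite mulrAC ler_pdivlMr //; have := congr1 nm (G_formula k kz); rewrite !nmM !nmX w11 expr1n mulr1 => ->.
  rewrite mulrC ler_wpM2r ?exprn_ge0 ?nm_ge0 //; apply: le_trans (nmD _ _) _.
  by rewrite nmM nmX w11 expr1n mulr1.
have s0 : 0 < 2^-1 * D by rewrite mulr_gt0 ?invr_gt0.
have sD : 2^-1 * D < d1 by lra.
have pt (x : Cplx R) : nm x = 1 -> nm (z + (2^-1 * D)%:C * x - z) < d1.
  by move=> nx; rewrite addrAC subrr add0r nmM nx mulr1 nm_real gtr0_norm.
have low (x : Cplx R) : nm x = 1 -> exists c La K, [/\ 0 < c, 1 <= La,
    (x = 1 -> 1 < La) & forall k, (K <= k)%N -> c * (nm (z + (2^-1 * D)%:C * x) * La) ^+ k <= nm (G k (z + (2^-1 * D)%:C * x))].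
  move=> nx; have [tn tx ty tz Lt] := L _ (pt x nx).
  move: tn tx ty tz Lt; set p := z + _ => tn tx ty tz Lt.
  have [w [kt w0 w1']] := kern_ex tn.
  have [PM QM w2 kI [L1 L2 L3]] := Lt w kt w0 w1'.
  have nw : 0 < nm w by rewrite nm_gt0.
  have w20 : 1 - w ^+ 2 != 0.
    by rewrite -nm_gt0; apply: lt_le_trans (nm_1subsqr_Im w); rewrite exprn_gt0 // (lt_le_trans k0).
  have [|c [K [c0 Hc]]] := G_lower tn kt w0 w1' w20 k0.
    by have [q|q|q] := ltrgtP (qf p) 0; [left; have [] := L1 q|left; have [] := L2 q|right; apply: L3].
  exists c, (nm w)^-1, K; split=> //; first by rewrite invf_ge1.
  move=> x1; have q : 0 < qf p by rewrite /p x1 mulr1; apply: qf_shift.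
  by have [w1'' _] := L2 q; rewrite invf_gt1.
have [La0 HLa] : exists La, 1 < La /\ exists c K, 0 < c /\ forall k, (K <= k)%N ->
   c * (nm (z + (2^-1 * D)%:C * 1) * La) ^+ k <= nm (G k (z + (2^-1 * D)%:C * 1)).
  by have [c [l [K [h1 h2 h3 h4]]]] := low 1 nm1; exists l; split; [exact: h3|exists c, K].
case: HLa => La01 HLa.
have h01 : 0 <= (2^-1 : R) < 1 by apply/andP; split; lra.
(* With [h = 2^-N], Jensen costs [(1 + h)^(3 k)] through the degree of [G_k], and the product of the
   points of the circle costs [(1 - h)^k]. For large [N] both are beaten by the factor [La0^k]
   gained at the point [j = 0]; the 7 comes from [(1 + h)^3 <= 1 + 7 h]. *)
have e0 : 0 < (La0 - 1) / (La0 + 7) by rewrite divr_gt0; lra.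
have [N' HN'] := geo_small 1 h01 e0.
pose N := N'.+1; pose h := (2^-1 : R) ^+ N.
have hb : h < (La0 - 1) / (La0 + 7).
  have := HN' N (leqnSn _); rewrite mul1r ger0_norm // exprn_ge0 //; by case/andP: h01.
have h0 : 0 < h by rewrite exprn_gt0 // invr_gt0.
have h1 : h < 1.
  by apply: lt_trans hb _; rewrite ltr_pdivrMr; lra.
have hL : (1 + h) ^+ 3 < La0 * (1 - h).
  rewrite ltr_pdivlMr in hb; last by lra.
  have : (1 + h) ^+ 3 <= 1 + 7 * h by nra.
  by move: hb; nra.
have [x xN] := @prim_root_ex R N isT.
have xN1 := prim_expr_order xN.
have nxj j : nm (x ^+ j) = 1 by rewrite nmX (nm_root1 (isT : (0 < N)%N) xN1) expr1n.
pose p (j : 'I_N) := z + (2^-1 * D)%:C * x ^+ j.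
have HJ (j : 'I_N) : exists cLK : R * R * nat, [/\ 0 < cLK.1.1, 1 <= cLK.1.2, j = ord0 -> cLK.1.2 = La0 &
   forall k, (cLK.2 <= k)%N -> cLK.1.1 * (nm (p j) * cLK.1.2) ^+ k <= nm (G k (p j))].
  have [->|j0] := eqVneq j ord0.
    have [c [K [c0 Hc]]] := HLa; exists (c, La0, K); split=> //=; first exact: ltW.
  have [c [l [K [g1 g2 _ g4]]]] := low (x ^+ j) (nxj j).
  by exists (c, l, K); split=> // jj; rewrite jj eqxx in j0.
have [f Hf] := choice HJ.
pose K := (\max_(j < N) (f j).2)%N.
pose c := \prod_(j < N) (f j).1.1.
have c0 : 0 < c by apply: prodr_gt0 => j _; have [] := Hf j.
have pp : nm z ^+ N * (1 - h) <= \prod_(j < N) nm (p j).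
  rewrite -nm_prod.
  have -> : \prod_(j < N) p j = \prod_(j < N) (z - (- (2^-1 * D)%:C) * x ^+ j).
    by apply: eq_bigr => j _; rewrite mulNr opprK.
  rewrite (@prod_sub_prim_root R[i]) //; apply: le_trans (nm_subl _ _).
  rewrite !nmX nmN nm_real gtr0_norm // mulrBr mulr1 lerD2l lerN2 exprMn mulrC /h.
  by apply: ler_wpM2r; rewrite ?exprn_ge0 ?invr_ge0 //; apply: lerXn2r; rewrite ?nnegrE ?(ltW D0) ?nm_ge0.
have Lp : La0 <= \prod_(j < N) (f j).1.2.
  rewrite (bigD1 ord0) //=; have [_ _ -> // _] := Hf ord0.
  rewrite ler_peMr ?(ltW (lt_trans ltr01 La01)) //.
  by elim/big_rec: _ => // j v _ v1; have [_ g _ _] := Hf j; apply: mulr_ege1.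
pose a := La0 * (1 - h) / (1 + h) ^+ 3.
have hh : 0 < (1 + h) ^+ 3 by rewrite exprn_gt0 //; lra.
have a1 : 1 < a by rewrite ltr_pdivlMr // mul1r.
have Cp : 0 <= C by rewrite divr_ge0 ?addr_ge0 ?nm_ge0.
have [K' HK'] := pow_unbounded (C ^+ N * (1 + h) / c) a1.
pose k := maxn K K'.
have := HK' k (leq_maxr _ _); rewrite ltNge => /negP; apply.
have t0 : 0 <= (2^-1 : R) by case/andP: h01.
have J := poly_jensen (P := Gpol k) (isT : (0 < N)%N) xN t0 D0 (@Hroot k).
rewrite -/h in J.
have J1 : c * (nm z ^+ N * (1 - h) * La0) ^+ k <= \prod_(j < N) nm (Gpol k).[z + (2^-1 * D)%:C * x ^+ j].
  apply: (@le_trans _ _ (\prod_(j < N) ((f j).1.1 * (nm (p j) * (f j).1.2) ^+ k))).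
    rewrite big_split /= ler_wpM2l ?(ltW c0) // prodrXl big_split /=.
    apply: lerXn2r; rewrite ?nnegrE ?mulr_ge0 ?exprn_ge0 ?nm_ge0 ?subr_ge0 ?(ltW h1) ?(ltW (lt_trans ltr01 La01)) //.
      by apply: prodr_ge0 => j _; apply: nm_ge0.
    - by apply: prodr_ge0 => j _; have [_ /(le_trans ler01)] := Hf j.
    by apply: ler_pM => //; rewrite ?mulr_ge0 ?exprn_ge0 ?nm_ge0 ?subr_ge0 ?(ltW h1) ?(ltW (lt_trans ltr01 La01)).
  apply: ler_prod => j _; have [g1 g2 _ g4] := Hf j; apply/andP; split.
    by rewrite mulr_ge0 ?(ltW g1) // exprn_ge0 // mulr_ge0 ?nm_ge0 // (le_trans ler01).
  by apply: g4; apply: leq_trans (leq_maxl _ _); apply: (@leq_bigmax _ (fun j => (f j).2) j).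
have J2 : nm (Gpol k).[z] ^+ N * (1 + h) ^+ (size (Gpol k : {poly Cplx R})).-1 <=
   (C * nm z ^+ k) ^+ N * ((1 + h) * ((1 + h) ^+ 3) ^+ k).
  apply: ler_pM; rewrite ?exprn_ge0 ?nm_ge0 ?addr_ge0 ?(ltW h0) //.
    by apply: lerXn2r (up k); rewrite nnegrE; [exact: nm_ge0|exact: mulr_ge0 Cp (exprn_ge0 _ (nm_ge0 _))].
  by apply: expr_pred_le (@size_Gpol R k); rewrite lerDl (ltW h0).
have := le_trans (le_trans J1 J) J2.
have zNk : 0 < (nm z ^+ N) ^+ k by rewrite !exprn_gt0.
have -> : c * (nm z ^+ N * (1 - h) * La0) ^+ k = (nm z ^+ N) ^+ k * (c * (La0 * (1 - h)) ^+ k).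
  by rewrite -mulrA [(1 - h) * _]mulrC exprMn mulrCA.
have -> : (C * nm z ^+ k) ^+ N * ((1 + h) * ((1 + h) ^+ 3) ^+ k) =
  (nm z ^+ N) ^+ k * (C ^+ N * (1 + h) * ((1 + h) ^+ 3) ^+ k).
  by rewrite exprMn -!exprM [(k * N)%N]mulnC; move: (C ^+ N) (nm z ^+ _) ((1 + h) ^+ _) => u v w; ring.
rewrite ler_pM2l // => F.
by rewrite ler_pdivlMr // /a expr_div_n mulrAC (ler_pdivrMr _ _ (exprn_gt0 k hh)) mulrC.
Qed.

End Outer.

(** * The outer side of the curve: paths avoiding the poles *)

Section Spiral.
Context {R : realType}.
Implicit Types (t z w u : Cplx R) (k : nat) (e r d x y : R).

(** [v^j - 1] is [v - 1] times the sum of the [v^i], and [1 - |v|^j] is [1 - |v|] times the sum of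
    the [|v|^i]: a Stolz angle at 1 is stable under powers. *)
Lemma stolz_pow (v : Cplx R) (C : R) j : nm v <= 1 -> nm (v - 1) <= C * (1 - nm v) ->
  nm (v ^+ j - 1) <= C * (1 - nm v ^+ j).
Proof.
move=> v1 H; rewrite subrX1 nmM -[1 - nm v ^+ j]opprB subrX1 -mulNr opprB mulrA.
apply: ler_pM; rewrite ?nm_ge0 //; apply: le_trans (nm_sum _ _ _) _.
by apply: ler_sum => i _; rewrite nmX.
Qed.

(** Taking [m]-th powers removes [zt]: if [U (zt v)^(2k)] is too close to 1, so is
    [V = U^m v^(2km)], whereas [X = U^m v^(2nm)] is close to -1. One of [X], [V] is the other times
    a power of [v], and this power has modulus near 1 because [|X|] and [|V|] are. By the Stolz
    condition it is then near 1 itself, so that [|X - V| <= 1], against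
    [|X - V| >= 2 - 2 e >= 3/2]. *)
Lemma stolz_gap (zt v U : Cplx R) n m (C e B : R) : nm v <= 1 -> 0 <= C -> nm (v - 1) <= C * (1 - nm v) ->
  e = (4 * (1 + C))^-1 -> nm (U ^+ m * v ^+ (2 * n * m) + 1) <= e -> nm U <= B -> 1 <= B ->
  zt ^+ m = 1 -> (0 < m)%N -> forall k, e / (m%:R * B ^+ m) <= nm (1 - U * (zt * v) ^+ (2 * k)).
Proof.
move=> v1 C0 vC eE Xe UB B1 zm m0 k.
have B0 : 0 < B by lra.
have C4 : 0 < 4 * (1 + C) by lra.
have e0 : 0 < e by rewrite eE invr_gt0.
have eC : e * (4 * (1 + C)) = 1 by rewrite eE mulVf // gt_eqF.
have m0' : 0 < m%:R :> R by rewrite ltr0n.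
set s := U * _.
have s1 : nm s <= B.
  rewrite /s nmM nmX nmM (nm_root1 m0 zm) mul1r; apply: le_trans UB.
  by rewrite ler_piMr ?nm_ge0 // exprn_ile1 ?nm_ge0.
pose V := U ^+ m * v ^+ (2 * k * m).
have sV : s ^+ m = V.
  rewrite /s /V [LHS]exprMn_comm; last exact: mulrC.
  rewrite [(zt * v) ^+ _]exprMn_comm; last exact: mulrC.
  rewrite [(_ * v ^+ _) ^+ m]exprMn_comm; last exact: mulrC.
  by rewrite -!exprM (_ : zt ^+ _ = 1) ?mul1r // mulnC exprM zm expr1n.
have h1 : nm (1 - V) <= nm (1 - s) * (m%:R * B ^+ m).
  have -> : 1 - V = 1 ^+ m - s ^+ m by rewrite sV expr1n.
  rewrite subrXX nmM ler_wpM2l ?nm_ge0 //; apply: le_trans (nm_sum _ _ _) _.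
  apply: (@le_trans _ _ (\sum_(i < m) B ^+ m)); last by rewrite sumr_const card_ord -[leLHS]mulr_natl.
  apply: ler_sum => i _; rewrite expr1n mul1r nmX.
  apply: (@le_trans _ _ (B ^+ i)); first by apply: lerXn2r; rewrite ?nnegrE ?nm_ge0 ?(ltW B0).
  by apply: ler_weXn2l => //; apply: ltnW.
rewrite ler_pdivrMr ?mulr_gt0 ?exprn_gt0 //; apply: le_trans h1.
clear s s1 sV; rewrite leNgt; apply/negP => hV.
pose X := U ^+ m * v ^+ (2 * n * m); rewrite -/X in Xe.
have X1 : 1 - e <= nm X /\ nm X <= 1 + e.
  have a1 := nm_subl 1 (X + 1); have a2 := nm_subl (X + 1) 1.
  have a3 : 1 - (X + 1) = - X by ring.
  rewrite a3 nmN nm1 in a1; have a4 := nm_addl X 1; rewrite nm1 in a4; split; lra.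
have V1 : 1 - e <= nm V /\ nm V <= 1 + e.
  have a1 := nm_subl 1 V; have a2 := nm_subl V 1; rewrite [nm (V - 1)]nmB nm1 in a1 a2; split; lra.
have X2 : 2 - 2 * e <= nm (X - V).
  have E : 2 = (X + 1) + (1 - V) - (X - V) :> Cplx R by ring.
  have := nm_nat (R := R) 2; rewrite E => E2.
  have := nmD ((X + 1) + (1 - V)) (- (X - V)); rewrite E2 nmN => a1.
  by have := nmD (X + 1) (1 - V); lra.
have e4 : e <= 4^-1 by rewrite eE lef_pV2 ?posrE //; lra.
have key : forall (a b : Cplx R) j, a = b * v ^+ j -> 1 - e <= nm a -> nm b <= 1 + e -> nm (a - b) <= 1.
  move=> a b j ab a1 b1; have bp := nm_ge0 b.
  have -> : a - b = b * (v ^+ j - 1) by rewrite ab; ring.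
  have sp := stolz_pow j v1 vC; have y1 : nm v ^+ j <= 1 by rewrite exprn_ile1 ?nm_ge0.
  have y0 : 0 <= nm v ^+ j by rewrite exprn_ge0 ?nm_ge0.
  rewrite ab nmM nmX in a1; rewrite nmM.
  move: (nm v ^+ j) (nm b) (nm (v ^+ j - 1)) (nm_ge0 (v ^+ j - 1)) sp y1 y0 a1 b1 bp => y b' q q0 sp y1 y0 a1 b1 bp.
  have y2 : 1 - 2 * e <= y by nra.
  have q1 : q <= C * (2 * e) by apply: le_trans sp _; rewrite ler_wpM2l //; lra.
  have : b' * q <= 2 * (C * (2 * e)).
    by apply: ler_pM => //; lra.
  move/le_trans; apply; have eC' : 4 * (e * C) + 4 * e = 1 by rewrite -[RHS]eC; ring.
  by move: eC' e0; clear; lra.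
have [kn|nk] := leqP n k.
  have E : V = X * v ^+ (2 * (k - n) * m).
    by rewrite /V /X -mulrA -exprD; congr (_ * _ ^+ _); rewrite -mulnDl -mulnDr subnKC.
  have := key V X _ E V1.1 X1.2; rewrite nmB => h; lra.
have E : X = V * v ^+ (2 * (n - k) * m).
  by rewrite /V /X -mulrA -exprD; congr (_ * _ ^+ _); rewrite -mulnDl -mulnDr subnKC // ltnW.
have := key X V _ E X1.1 V1.2; lra.
Qed.

(* Its [2n]-th power does not depend on [n], and it tends to 1 within a Stolz angle of the unit disc. *)
Definition spiral (L ph : R) n : Cplx R := (expR (- L / (2 * n)%:R))%:C * cis (ph / (2 * n)%:R).

Lemma spiral_pow L ph n : (0 < n)%N -> spiral L ph n ^+ (2 * n) = (expR (- L))%:C * cis ph.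
Proof.
move=> n0; have d0 : (2 * n)%:R != 0 :> R by rewrite pnatr_eq0 muln_eq0 /= -lt0n.
rewrite /spiral exprMn_comm; last exact: mulrC.
by rewrite -rmorphXn -cisM -expRM_natr !divfK.
Qed.

Lemma nm_spiral L ph n : nm (spiral L ph n) = expR (- L / (2 * n)%:R).
Proof. by rewrite /spiral nmM nm_cis mulr1 nm_real gtr0_norm // expR_gt0. Qed.

(** Both [1 - |v|] and the argument [ph / (2 n)] are of order [1 / n], with constants depending on
    [L] and [ph] only. *)
Lemma spiral_stolz L ph : 0 < L -> exists C C', [/\ 0 <= C, 0 <= C' & forall n, (0 < n)%N ->
  [/\ 0 < nm (spiral L ph n) < 1, nm (spiral L ph n - 1) <= C * (1 - nm (spiral L ph n)) &
      nm (spiral L ph n - 1) <= C' / n%:R]].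
Proof.
move=> L0; pose C := 1 + 2 * `|ph| * (1 + L) / L.
have C0 : 0 <= C by rewrite addr_ge0 // divr_ge0 ?mulr_ge0 ?(ltW L0) //; lra.
exists C, (C * L); split=> //; first by rewrite mulr_ge0 // ltW.
move=> n n0; rewrite nm_spiral.
have n0' : 0 < n%:R :> R by rewrite ltr0n.
pose s : R := ((2 * n)%:R)^-1.
have s0 : 0 < s by rewrite invr_gt0 ltr0n muln_gt0.
have s1 : s <= n%:R^-1 by rewrite lef_pV2 ?posrE ?ltr0n ?muln_gt0 // ler_nat leq_pmull.
have s2 : s <= 1 by apply: le_trans s1 _; rewrite invf_le1 // ler1n.
set E := expR _; have EE : E = expR (- (L * s)) by rewrite /E mulNr.
have E0 : 0 < E by rewrite expR_gt0.
have E1 : E < 1 by rewrite EE expR_lt1 oppr_lt0 mulr_gt0.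
have E2 : 1 - L * s <= E by rewrite EE; apply: expR_ge1Dx.
have E3 : E * (1 + L * s) <= 1.
  by rewrite EE expRN mulrC ler_pdivrMr ?expR_gt0 // mul1r expR_ge1Dx.
have St : nm (spiral L ph n - 1) <= C * (1 - E).
  have -> : spiral L ph n - 1 = E%:C * (cis (ph / (2 * n)%:R) - cis 0) + (E - 1)%:C.
    by rewrite /spiral -/E cis0 rmorphB rmorph1; ring.
  apply: le_trans (nmD _ _) _; rewrite nmM !nm_real (gtr0_norm E0).
  rewrite ler0_norm; last by lra.
  have h := cis_lip (ph / (2 * n)%:R) 0; rewrite subr0 normrM (gtr0_norm s0) in h.
  have h2 : E * nm (cis (ph / (2 * n)%:R) - cis 0) <= 2 * `|ph| * s.
    rewrite -mulrA; apply: le_trans h; rewrite ler_piMl ?nm_ge0 // ltW //.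
  have h3 : 2 * `|ph| * s <= 2 * `|ph| * (1 + L) / L * (1 - E).
    rewrite -!mulrA ler_wpM2l // ler_wpM2l //.
    rewrite mulrCA ler_pdivlMl // ; nra.
  by rewrite /C mulrDl mul1r; lra.
rewrite E0 E1; split=> //; apply: le_trans St _.
rewrite -mulrA ler_wpM2l //; apply: (@le_trans _ _ (L * s)); first by lra.
by rewrite ler_wpM2l // ltW.
Qed.

Lemma cvg_Pf (t w : nat -> Cplx R) (t0 w0 : Cplx R) : t @ \oo --> t0 -> w @ \oo --> w0 ->
  (fun i => Pf (t i) (w i)) @ \oo --> Pf t0 w0.
Proof.
move=> ct cw; apply: cvgB; first by apply: cvgB; [exact: cvg_cst|exact: ct].
by apply: cvgM; [exact: ct|exact: cw].
Qed.

Lemma cvg_Qf (t w : nat -> Cplx R) (t0 w0 : Cplx R) : t @ \oo --> t0 -> w @ \oo --> w0 ->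
  (fun i => Qf (t i) (w i)) @ \oo --> Qf t0 w0.
Proof.
move=> ct cw; apply: cvgB; first exact: ct.
apply: cvgM; last exact: cw.
by apply: cvgB; [exact: cvg_cst|exact: ct].
Qed.

Lemma cvg_pow (t : nat -> Cplx R) (t0 : Cplx R) n : t @ \oo --> t0 ->
  (fun i => t i ^+ n) @ \oo --> t0 ^+ n.
Proof.
move=> ct; elim: n => [|n IH]; first exact: cvg_cst.
rewrite exprS (_ : (fun i => _) = fun i => t i * t i ^+ n); first exact: cvgM ct IH.
by apply/funext => i; rewrite exprS.
Qed.

(* The path is [w = zt v_n], where [v_n] is chosen so that [(U w^(2n))^m] tends to -1 for [U = - Q w / P]; this keeps [P + Q w^(2k+1) = P (1 - U w^(2k))] away from 0 uniformly in [k]. *)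
Lemma Fser_order_outer z d : generic z -> 0 < d -> exists z' C, [/\ generic z', nm (z' - z) < d &
  forall e, 0 < e -> exists t, [/\ nm (t - z') < e, side false t &
  \forall t' \near t^', nm (Fser t') * nm (t - z') <= C]].
Proof.
move=> gz d0; have [x0 y0 _] := gz.
have [d1 [kap [M [d10 k0 kM L]]]] := arc_local gz.
have [w1 [kz w11 sg]] := generic_kern_sgn false gz.
have [C0 C00 RN] := root_near gz kz w11.
have w1I : complex.Im w1 != 0 by apply: contraTneq sg => ->; rewrite mulr0 ltxx.
pose D := Num.min (Num.min d d1) `|complex.Im z|.
have D0 : 0 < D by rewrite !lt_min d0 d10 normr_gt0.
have [e1 e10 RE] := RN D D0.
have e20 : 0 < Num.min e1 `|complex.Im w1| by rewrite lt_min e10 normr_gt0.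
have [m [zt [mp m2 zm]]] := root_dense 2 w11 e20.
rewrite lt_min => /andP[ze zI].
have mo : odd m by case: (even_prime mp) => // mE; rewrite mE in m2.
have m0 := prime_gt0 mp; have nz := nm_root1 m0 zm.
have ztn : zt != 0 by rewrite -nm_gt0 nz.
have [z' [zD kz' _]] := RE zt ze.
move: zD; rewrite !lt_min -andbA => /and3P[zd zd1 zIm].
have [zn zx zy _ _] := L z' zd1.
have q' : qf z' = 0.
  have [/esym/eqP + _] := kern_conj kz'; rewrite nz expr1n subrr !mulr0 mul1r mulf_eq0 (negPf zy) /=.
  by move/eqP.
have gz' : generic z' by split.
have sg' : complex.Im z' * complex.Im zt < 0.
  by have := sgn_near zIm zI; rewrite nmulr_rgt0.
have ztI : complex.Im zt != 0 by apply: contraTneq sg' => ->; rewrite mulr0 ltxx.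
have [d2 [kap2 [M2 [d20 k20 kM2 L2]]]] := arc_local gz'.
have [C2 C20 RN2] := root_near gz' kz' nz.
have /eqP PQ0 := PQ_prod kz'.
have P0 : Pf z' zt != 0.
  apply/eqP => Z; move: PQ0; rewrite Z mul0r eq_sym mulf_eq0 oppr_eq0 expf_eq0 (negPf zn) (negPf ztn) andbF //.
have p0 : 0 < nm (Pf z' zt) by rewrite nm_gt0.
have PQ : nm (Pf z' zt) < nm (Qf z' zt).
  have := nm_PQ z' zt; rewrite nz expr1n subrr mul0r add0r => h.
  rewrite ltNge; apply/negP => h2; have : nm (Qf z' zt) ^+ 2 <= nm (Pf z' zt) ^+ 2 by apply: lerXn2r; rewrite ?nnegrE ?nm_ge0.
  by lra.
pose us := - (Qf z' zt * zt) / Pf z' zt.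
have nus : 1 < nm us by rewrite /us nmM nmN nmM nz mulr1 nmV ltr_pdivlMr // mul1r.
have usn : us != 0 by rewrite -nm_gt0; apply: lt_trans nus.
(* [us] is the limit of [U] at the end of the path. The parameters [L = ln |us|] and [ph] are those
   for which [v_n^(2n) = - 1 / us]; [L > 0] expresses [|P| < |Q|] at that end. *)
have L0 : 0 < ln (nm us) by rewrite ln_gt0.
have [ph _ phE] : exists2 ph, 0 <= ph & (- us^-1 * (nm us)%:C) = cis ph.
  apply: polar; rewrite nmM nmN nmV nm_real gtr0_norm ?(lt_trans ltr01) // mulVf // gt_eqF // (lt_trans ltr01) //.
have nusC : (nm us)%:C != 0 :> Cplx R by rewrite -nm_gt0 nm_real normr_gt0 gt_eqF // (lt_trans ltr01).
have [C3 [C4 [C30 C40 SP]]] := spiral_stolz ph L0.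
pose v n := spiral (ln (nm us)) ph n.
have vpow n : (0 < n)%N -> v n ^+ (2 * n) = - us^-1.
  move=> n0; rewrite /v spiral_pow // expRN lnK ?posrE ?(lt_trans ltr01) // -phE.
  by rewrite fmorphV mulrCA mulVf // mulr1.
have ex (i : nat) : exists nt : nat * Cplx R, [/\ (0 < nt.1)%N, nm (nt.2 - z') < i.+1%:R^-1,
   nm (zt * v nt.1 - zt) < i.+1%:R^-1, kern nt.2 (zt * v nt.1) & nm (nt.2 - z') <= C2 * nm (zt * v nt.1 - zt)].
  have i0 : 0 < i.+1%:R^-1 :> R by rewrite invr_gt0 ltr0n.
  have [e3 e30 RE3] := RN2 _ i0.
  have b0 : 0 < Num.min e3 i.+1%:R^-1 by rewrite lt_min e30.
  have q0 : 0 <= C4 / Num.min e3 i.+1%:R^-1 by rewrite divr_ge0 // ltW.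
  pose n := (Num.truncn (C4 / Num.min e3 i.+1%:R^-1)).+1.
  have vn : nm (zt * v n - zt) < Num.min e3 i.+1%:R^-1.
    have -> : zt * v n - zt = zt * (v n - 1) by ring.
    rewrite nmM nz mul1r; have [_ _ h] := SP n isT; apply: le_lt_trans h _.
    rewrite ltr_pdivrMr ?ltr0n // mulrC -ltr_pdivrMr //.
    by have /andP[] := truncn_itv q0.
  move: (vn); rewrite lt_min => /andP[vn1 vn2].
  by have [t [t1 t2 t3]] := RE3 _ vn1; exists (n, t).
have [f Hf] := choice ex.
pose tt i := (f i).2; pose ww i := zt * v (f i).1.
have small (g : nat -> Cplx R) (l : Cplx R) : (forall i, nm (g i - l) < i.+1%:R^-1) -> g @ \oo --> l.
  move=> H; apply/cvgn_nm => e e0.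
  exists (Num.truncn e^-1) => // i /= Ni; apply: lt_trans (H i) _.
  rewrite -[ltRHS]invrK ltf_pV2 ?posrE ?invr_gt0 ?ltr0n //.
  have ei : 0 <= e^-1 by rewrite invr_ge0 ltW.
  by have /andP[_ /lt_le_trans] := truncn_itv ei; apply; rewrite ler_nat ltnS.
have ct : tt @ \oo --> z' by apply: small => i; have [] := Hf i.
have cw : ww @ \oo --> zt by apply: small => i; have [] := Hf i.
have cP : (fun i => Pf (tt i) (ww i)) @ \oo --> Pf z' zt.
  exact: (cvg_Pf ct cw).
have cQ : (fun i => Qf (tt i) (ww i)) @ \oo --> Qf z' zt.
  exact: (cvg_Qf ct cw).
pose U i := - (Qf (tt i) (ww i) * ww i) / Pf (tt i) (ww i).
have cU : U @ \oo --> us.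
  exact: cvgM (cvgN (cvgM cQ cw)) (cvgV P0 cP).
pose X i := U i ^+ m * v (f i).1 ^+ (2 * (f i).1 * m).
have XE i : X i = U i ^+ m * (- us^-1) ^+ m.
  by rewrite /X exprM vpow //; have [] := Hf i.
have cX : X @ \oo --> (-1 : Cplx R).
  have -> : X = (fun i => U i ^+ m * (- us^-1) ^+ m) by apply/funext.
  (* The sign survives because [m] is odd. *)
  have -> : -1 = us ^+ m * (- us^-1) ^+ m :> Cplx R.
    rewrite -exprMn_comm; last exact: mulrC.
    by rewrite mulrN divff // -signr_odd mo expr1.
  by apply: cvgM; [exact: cvg_pow|exact: cvg_cst].
pose ep := (4 * (1 + C3))^-1.
have ep0 : 0 < ep by rewrite invr_gt0; move: C30; clear; lra.
have p2 : 0 < nm (Pf z' zt) / 2 by rewrite divr_gt0.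
have [N1 _ HX] := (cvgn_nm _ _).1 cX _ ep0.
have [N2 _ HU] := (cvgn_nm _ _).1 cU _ ltr01.
have [N3 _ HP] := (cvgn_nm _ _).1 cP _ p2.
pose B := nm us + 1.
have B1 : 1 <= B by rewrite lerDr nm_ge0.
pose kk := nm (Pf z' zt) / 2 * (ep / (m%:R * B ^+ m)).
have kk0 : 0 < kk.
  by rewrite mulr_gt0 // divr_gt0 // mulr_gt0 ?ltr0n // exprn_gt0 // (lt_le_trans ltr01).
exists z', (2 / kk * (C2 * C3) + 1); split=> //.
move=> e e0.
pose De := Num.min (Num.min e d2) (Num.min (Num.min `|complex.Im z'| 1) `|complex.Im zt|).
have De0 : 0 < De by rewrite !lt_min e0 d20 !normr_gt0 zy ztI ltr01.
pose i := maxn (Num.truncn De^-1) (maxn N1 (maxn N2 N3)).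
have iDe : i.+1%:R^-1 < De.
  rewrite -[ltRHS]invrK ltf_pV2 ?posrE ?invr_gt0 ?ltr0n //.
  have ei : 0 <= De^-1 by rewrite invr_ge0 ltW.
  by have /andP[_ /lt_le_trans] := truncn_itv ei; apply; rewrite ler_nat ltnS leq_maxl.
have [n0 h1 h2 kt h3] := Hf i; rewrite -/(tt i) -/(ww i) in h1 h2 kt h3.
have {}HX : nm (X i - -1) < ep by apply: HX; rewrite /= /i !leq_max leqnn !orbT.
have {}HU : nm (U i - us) < 1 by apply: HU; rewrite /= /i !leq_max leqnn !orbT.
have {}HP : nm (Pf (tt i) (ww i) - Pf z' zt) < nm (Pf z' zt) / 2 by apply: HP; rewrite /= /i !leq_max leqnn !orbT.
have := lt_trans h1 iDe; have := lt_trans h2 iDe.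
rewrite /De !lt_min => /andP[_ /andP[_ wI]] /andP[/andP[te td2] /andP[/andP[tI t1] _]].
have [tn tx ty tz Lt] := L2 _ td2.
have [v01 vS _] := SP _ n0; rewrite -/(v (f i).1) in v01 vS.
have nww : nm (ww i) = nm (v (f i).1) by rewrite /ww nmM nz mul1r.
have w01 : 0 < nm (ww i) < 1 by rewrite nww.
have [wn w1'] := andP w01; rewrite nm_gt0 in wn.
have tw : complex.Im (tt i) * complex.Im (ww i) < 0.
  by have := sgn_near tI wI; rewrite nmulr_rgt0.
have [_ sd] := kern_side kt wn ty w1'; have st : side false (tt i) := sd tw.
have Pn : nm (Pf z' zt) / 2 <= nm (Pf (tt i) (ww i)).
  by have := nm_subl (Pf z' zt) (Pf (tt i) (ww i)); move: HP; rewrite nmB; clear; lra.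
have Pn0 : Pf (tt i) (ww i) != 0 by rewrite -nm_gt0; apply: lt_le_trans Pn.
exists (tt i); split=> //.
have [v0 v1] := andP v01.
have UB : nm (U i) <= B by have := nm_subl (U i) us; move: HU; rewrite /B; clear; lra.
rewrite opprK in HX.
have gap := stolz_gap (ltW v1) C30 vS erefl (ltW HX) UB B1 zm m0.
apply: (@path_bound R z' (C2 * C3) kk (tt i) (ww i)) => //; first exact: side_notE st tx ty.
- move=> k; have -> : Pf (tt i) (ww i) + Qf (tt i) (ww i) * ww i ^+ (2 * k).+1 =
    Pf (tt i) (ww i) * (1 - U i * ww i ^+ (2 * k)).
    rewrite exprS /U; move: (ww i) (ww i ^+ _) (Pf _ _) (Qf _ _) Pn0 => w w' p q pn; by field.
  rewrite nmM /kk; apply: ler_pM; [by rewrite divr_ge0 ?nm_ge0| |exact: Pn|exact: gap].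
  by rewrite divr_ge0 ?(ltW ep0) // mulr_ge0 ?ler0n // exprn_ge0 // (le_trans ler01).
- apply: le_trans h3 _; rewrite -mulrA ler_wpM2l ?(ltW C20) // nww.
  have -> : ww i - zt = zt * (v (f i).1 - 1) by rewrite /ww; ring.
  by rewrite nmM nz mul1r.
- exact: ltW.
Qed.

End Spiral.

(** * Components adherent to the curve *)

Section Topology.
Context {R : realType}.
Implicit Types (t z p q : Cplx R) (a b c d e h r s x y : R).

Lemma convex_gt0 s x y : 0 <= s <= 1 -> 0 < x -> 0 < y -> 0 < (1 - s) * x + s * y.
Proof.
move=> /andP[s0 s1] x0 y0; have [->|s1'] := eqVneq s 1; first by rewrite subrr mul0r add0r mul1r.
by rewrite ltr_pwDl ?mulr_ge0 ?(ltW y0) // mulr_gt0 // subr_gt0 lt_neqAle s1'.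
Qed.

Definition seg p q s : Cplx R := p + s%:C * (q - p).

Lemma seg_continuous p q : continuous (seg p q).
Proof.
move=> s A /nbhs_nm[r r0 H]; apply/nbhs_ballP.
have d0 : 0 < nm (q - p) + 1 by rewrite ltr_wpDl ?nm_ge0.
exists (r / (nm (q - p) + 1)) => /=; first by rewrite divr_gt0.
move=> t; rewrite /ball /= ltr_pdivlMr // => st; apply: H.
have -> : seg p q t - seg p q s = (t - s)%:C * (q - p) by rewrite /seg rmorphB; ring.
rewrite nmM nm_real distrC.
by apply: le_lt_trans st; rewrite ler_wpM2l // lerDl.
Qed.

Lemma seg_connected p q : connected (seg p q @` `[0, 1]).
Proof.
apply: connected_continuous_connected; first exact: segment_connected.
exact/continuous_subspaceT/seg_continuous.
Qed.

Lemma seg0 p q : seg p q 0 = p.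
Proof. by rewrite /seg rmorph0 mul0r addr0. Qed.

Lemma seg1 p q : seg p q 1 = q.
Proof. by rewrite /seg rmorph1 mul1r addrC subrK. Qed.

Lemma segM p q s s' : seg p (seg p q s) s' = seg p q (s' * s).
Proof. by rewrite /seg [p + _ - p]addrAC subrr add0r rmorphM mulrA. Qed.

Lemma seg_component (A : set (Cplx R)) v p q : connected_component A v p ->
  (forall s, 0 <= s <= 1 -> A (seg p q s)) -> connected_component A v q.
Proof.
move=> Vp H; apply: connected_component_trans Vp _.
apply: (@connected_component_max _ _ (seg p q @` `[0, 1])).
- by exists 0; rewrite ?seg0 //= in_itv /= lexx ler01.
- by move=> _ [s /= + <-]; rewrite in_itv /=; apply: H.
- exact: seg_connected.
by exists 1; rewrite ?seg1 //= in_itv /= lexx ler01.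
Qed.

Lemma seg_ball p q z r s : nm (p - z) < r -> nm (q - z) < r -> 0 <= s <= 1 ->
  nm (seg p q s - z) < r.
Proof.
move=> pz qz /andP[s0 s1].
have -> : seg p q s - z = (1 - s)%:C * (p - z) + s%:C * (q - z).
  by rewrite /seg rmorphB rmorph1; ring.
apply: le_lt_trans (nmD _ _) _; rewrite !nmM !nm_real ger0_norm ?subr_ge0 // ger0_norm //.
have [->|s1'] := eqVneq s 1; first by rewrite subrr mul0r add0r mul1r.
have s2 : 0 < 1 - s by rewrite subr_gt0 lt_neqAle s1'.
nra.
Qed.

Lemma seg_hor a b c s : seg (a +i* b) (c +i* b) s = (a + s * (c - a)) +i* b.
Proof. by apply/eqP; rewrite eq_complex /=; apply/andP; split; apply/eqP; ring. Qed.

Lemma seg_ver a b c s : seg (a +i* b) (a +i* c) s = a +i* (b + s * (c - b)).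
Proof. by apply/eqP; rewrite eq_complex /=; apply/andP; split; apply/eqP; ring. Qed.

Lemma nm_subC a b c d : nm ((a +i* b : Cplx R) - (c +i* d)) <= `|a - c| + `|b - d|.
Proof. exact: nm_ReIm. Qed.

Lemma nm_subC_lt a b c d r : nm ((a +i* b : Cplx R) - (c +i* d)) < r -> `|a - c| < r /\ `|b - d| < r.
Proof.
move=> H; split; apply: le_lt_trans H.
  exact: (nm_Re ((a +i* b : Cplx R) - (c +i* d))).
exact: (nm_Im ((a +i* b : Cplx R) - (c +i* d))).
Qed.

Lemma qfE x y : qf (x +i* y) = (x ^+ 2 + y ^+ 2) * (1 + 2 * x) - 1.
Proof. by rewrite /qf nm_sqr. Qed.

Lemma E_qf t : E R t -> complex.Im t != 0 -> 0 <= complex.Re t /\ qf t = 0.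
Proof.
move=> [[[x -> _]|[x -> _]]|[x [y [-> x0 yE]]]] /=; rewrite ?eqxx // => y0; split=> //.
rewrite qfE yE; have u0 : 1 + 2 * x != 0 by rewrite gt_eqF //; lra.
by field.
Qed.

(** [q] depends on the ordinate through its square, which stays between [b^2] and [c^2] on a
    vertical segment that does not cross the real axis. *)
Lemma side_seg sg a b c s : 0 <= a -> 0 < b * c -> 0 <= s <= 1 ->
  side sg (a +i* b : Cplx R) -> side sg (a +i* c : Cplx R) ->
  side sg (a +i* (b + s * (c - b)) : Cplx R) /\ 0 < b * (b + s * (c - b)).
Proof.
move=> a0 bc /andP[s0 s1].
have y0 : 0 < b * (b + s * (c - b)).
  have [->|s1'] := eqVneq s 1; first by rewrite mul1r subrKC.
  have s2 : 0 < 1 - s by rewrite subr_gt0 lt_neqAle s1'.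
  have b2 : 0 < b ^+ 2 by rewrite exprn_even_gt0 //=; apply: contraTneq bc => ->; rewrite mul0r ltxx.
  have : 0 < (1 - s) * b ^+ 2 by rewrite mulr_gt0.
  have : 0 <= s * (b * c) by rewrite mulr_ge0 // ltW.
  by lra.
have [y [yE]] : exists y, y = b + s * (c - b) by exists (b + s * (c - b)).
rewrite -yE in y0 *.
have H : (b ^+ 2 <= y ^+ 2 <= c ^+ 2) || (c ^+ 2 <= y ^+ 2 <= b ^+ 2).
  have cy : 0 < c * y.
    have : 0 < (b * c) * (b * y) by rewrite mulr_gt0.
    have -> : (b * c) * (b * y) = b ^+ 2 * (c * y) by ring.
    by rewrite pmulr_rgt0 // exprn_even_gt0 //=; apply: contraTneq bc => ->; rewrite mul0r ltxx.
  have e1 : (y ^+ 2 - b ^+ 2) * (c ^+ 2 - b ^+ 2) = s * ((c - b) ^+ 2 * (y * c + b * y + b * c + b ^+ 2)) by rewrite yE; ring.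
  have e2 : (c ^+ 2 - y ^+ 2) * (c ^+ 2 - b ^+ 2) = (1 - s) * ((c - b) ^+ 2 * (c ^+ 2 + b * c + y * c + b * y)) by rewrite yE; ring.
  have b2 := sqr_ge0 b; have c2 := sqr_ge0 c.
  have g1 : 0 <= (y ^+ 2 - b ^+ 2) * (c ^+ 2 - b ^+ 2).
    by rewrite e1 mulr_ge0 // mulr_ge0 ?sqr_ge0 //; lra.
  have g2 : 0 <= (c ^+ 2 - y ^+ 2) * (c ^+ 2 - b ^+ 2).
    by rewrite e2 mulr_ge0 ?subr_ge0 // mulr_ge0 ?sqr_ge0 //; lra.
  have [l|l|l] := ltrgtP (b ^+ 2) (c ^+ 2).
  - have l' : 0 < c ^+ 2 - b ^+ 2 by lra.
    by rewrite !pmulr_lge0 // !subr_ge0 in g1 g2; rewrite g1 g2.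
  - have l' : c ^+ 2 - b ^+ 2 < 0 by lra.
    by rewrite !nmulr_lge0 // !subr_le0 in g1 g2; rewrite g1 g2 orbT.
  have /eqP := l; rewrite eqf_sqr => /orP[/eqP bE|/eqP bE].
    have -> : y = b by rewrite yE bE; ring.
    by rewrite l lexx.
  by move: bc; rewrite bE; have := sqr_ge0 c; nra.
have u : 0 < 1 + 2 * a by lra.
move=> k1 k2; split=> //; move: H k1 k2; rewrite /side !qfE; clear -u.
by case: sg => /orP[] /andP[h1 h2] k1 k2; nra.
Qed.

(** Two points on the same side are joined by a vertical, a horizontal and a vertical segment. The
    horizontal one lies at the ordinate [h], the ordinate of [z] scaled by [1 - e] or [1 + e], where
    the required side holds on a whole interval of abscissas. *)
Lemma side_local (U : set (Cplx R)) z sg : generic z -> open U -> U z -> exists2 r, 0 < r &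
  forall t1 t2 v, nm (t1 - z) < r -> nm (t2 - z) < r -> side sg t1 -> side sg t2 ->
  connected_component (U `&` ~` E R) v t1 -> connected_component (U `&` ~` E R) v t2.
Proof.
case: z => x y [/= x0 y0 q0] oU Uz; have [r0 r00 HU] := open_nm oU Uz; clear oU Uz.
rewrite qfE in q0.
have y0' : 0 < `|y| by rewrite normr_gt0.
have y2 : 0 < y ^+ 2 by rewrite exprn_even_gt0.
pose e := r0 / (2 * (`|y| + r0)).
have e0 : 0 < e by rewrite divr_gt0 // mulr_gt0 // addr_gt0.
have ye : `|y| * e < r0 / 2.
  by rewrite /e mulrA ltr_pdivrMr ?mulr_gt0 ?addr_gt0 //; nra.
have e1 : e <= 2^-1.
  by rewrite /e ler_pdivrMr ?mulr_gt0 ?addr_gt0 //; nra.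
clearbody e.
pose h := y * (1 + if sg then - e else e).
have hy : 0 < y * h by rewrite /h mulrA -expr2 mulr_gt0 //; case: (sg); lra.
have hE : `|h - y| = `|y| * e.
  rewrite /h; have -> : y * (1 + (if sg then - e else e)) - y = y * (if sg then - e else e) by ring.
  by rewrite normrM; case: (sg); rewrite ?normrN (gtr0_norm e0).
have u0 : 0 < 1 + 2 * x by lra.
have [g [g0 Hg]] : exists g, 0 < g /\ forall d, `|d| < g -> side sg ((x + d) +i* h : Cplx R).
  have [G0 [G00 HG]] : exists G0, 0 < G0 /\ (x ^+ 2 + h ^+ 2) * (1 + 2 * x) - 1 = if sg then - G0 else G0.
    rewrite /h; case: (sg).
      exists (y ^+ 2 * (e * (2 - e)) * (1 + 2 * x)); split.
        by do ![apply: mulr_gt0 => //]; lra.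
      by rewrite -[RHS]addr0 -q0; ring.
    exists (y ^+ 2 * (e * (2 + e)) * (1 + 2 * x)); split; first by do ![apply: mulr_gt0 => //]; lra.
    by rewrite -[RHS]addr0 -q0; ring.
  pose K := 4 * x ^+ 2 + 8 * x + 3 + 2 * (x ^+ 2 + h ^+ 2).
  have h2 := sqr_ge0 h; have x2 := sqr_ge0 x.
  have K0 : 0 < K by rewrite /K; lra.
  exists (Num.min 1 (G0 / K)); split; first by rewrite lt_min ltr01 divr_gt0.
  move=> d; rewrite lt_min => /andP[d1]; rewrite ltr_pdivlMr // => dK.
  pose S := 4 * x ^+ 2 + 2 * x + 6 * (x * d) + d + 2 * d ^+ 2 + 2 * (x ^+ 2 + h ^+ 2).
  have SK : `|S| <= K.
    rewrite ler_norml; move: d1; rewrite ltr_norml => /andP[d1 d2].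
    have := sqr_ge0 d; rewrite /S /K; clear -d1 d2 x0 h2 x2 => d3.
    have d4 : d ^+ 2 <= 1 by nra.
    have p1 : 0 <= x * (1 - d) by rewrite mulr_ge0; lra.
    have p2 : 0 <= x * (1 + d) by rewrite mulr_ge0; lra.
    by apply/andP; split; lra.
  have dS : `|d * S| < G0.
    by rewrite normrM; apply: le_lt_trans dK; rewrite ler_wpM2l.
  have E1 : ((x + d) ^+ 2 + h ^+ 2) * (1 + 2 * (x + d)) - 1 = (x ^+ 2 + h ^+ 2) * (1 + 2 * x) - 1 + d * S.
    by rewrite /S; ring.
  rewrite /side qfE E1 HG; move: dS; rewrite ltr_norml => /andP[]; clear; case: (sg); lra.
exists (Num.min (Num.min g x) (Num.min `|y| (r0 / 2))).
  by rewrite !lt_min g0 x0 y0' divr_gt0.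
have half t : nm (t - (x +i* y)) < r0 / 2 -> nm (t - (x +i* y)) < r0 by move=> t1; lra.
have near t : nm (t - (x +i* y)) < Num.min (Num.min g x) (Num.min `|y| (r0 / 2)) -> side sg t ->
  exists a b, [/\ t = a +i* b, `|a - x| < g, 0 < a, nm ((a +i* h : Cplx R) - (x +i* y)) < r0 &
    forall s, 0 <= s <= 1 -> (U `&` ~` E R) (seg t (a +i* h) s) /\ (U `&` ~` E R) (seg (a +i* h) t s)].
  case: t => a b; rewrite !lt_min => /andP[/andP[t1 t2] /andP[t3 t4]] st.
  have [a1 _] := nm_subC_lt t1; have [a2 _] := nm_subC_lt t2; have [_ b3] := nm_subC_lt t3.
  have [a4 _] := nm_subC_lt t4.
  have a0 : 0 < a by move: a2; rewrite ltr_norml => /andP[]; lra.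
  have by0 : 0 < y * b.
    move: b3; rewrite -(ltr_pXn2r (n := 2)) ?nnegrE // !real_normK ?num_real //.
    by have := sqr_ge0 b; nra.
  have bh : 0 < b * h.
    rewrite -(pmulr_rgt0 _ y2); have -> : y ^+ 2 * (b * h) = (y * b) * (y * h) by ring.
    exact: mulr_gt0.
  have sh : side sg (a +i* h : Cplx R) by have := Hg _ a1; rewrite subrKC.
  have ah : nm ((a +i* h : Cplx R) - (x +i* y)) < r0.
    by apply: le_lt_trans (nm_subC _ _ _ _) _; rewrite hE; lra.
  have tr := half _ t4.
  exists a, b; split=> // s s01; split; split.
  - by apply: HU; apply: seg_ball.
  - rewrite seg_ver; have [sd yn] := side_seg (ltW a0) bh s01 st sh.
    by apply: side_notE sd _ _ => //=; apply: contraTneq yn => ->; rewrite mulr0 ltxx.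
  - by apply: HU; apply: seg_ball.
  rewrite mulrC in bh.
  rewrite seg_ver; have [sd yn] := side_seg (ltW a0) bh s01 sh st.
  by apply: side_notE sd _ _ => //=; apply: contraTneq yn => ->; rewrite mulr0 ltxx.
move=> t1 t2 v /near{}N1 /near{}N2 /N1[a1 [b1 [_ g1 p1 n1 H1]]] /N2[a2 [b2 [_ g2 p2 n2 H2]]] Vt1.
apply: (seg_component (p := a2 +i* h)); last by move=> s /H2[].
apply: (seg_component (p := a1 +i* h)).
  by apply: seg_component Vt1 _ => s /H1[].
move=> s s01; split; first by apply: HU; apply: seg_ball.
rewrite seg_hor; have /andP[s0 s1] := s01.
have xx : a1 + s * (a2 - a1) = x + (a1 + s * (a2 - a1) - x) by ring.
have sd : side sg ((a1 + s * (a2 - a1)) +i* h : Cplx R).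
  rewrite xx; apply: Hg; move: g1 g2; rewrite !ltr_norml => /andP[g1 g1'] /andP[g2 g2'].
  have [->|s1'] := eqVneq s 1; first by apply/andP; split; lra.
  have s2 : 0 < 1 - s by rewrite subr_gt0 lt_neqAle s1'.
  by clear -g1 g1' g2 g2' s0 s1 s2; apply/andP; split; nra.
apply: side_notE sd _ _ => /=; last by apply: contraTneq hy => ->; rewrite mulr0 ltxx.
have [->|s1'] := eqVneq s 1; first by rewrite mul1r subrKC.
have s2 : 0 < 1 - s by rewrite subr_gt0 lt_neqAle s1'.
have h1 : 0 < (1 - s) * a1 by rewrite mulr_gt0.
have h2 : 0 <= s * a2 by rewrite mulr_ge0 // ltW.
by lra.
Qed.

(** Along the vertical segment towards the curve, [q] vanishes only at the far end; the segment
    without that end remains in the component. *)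
Lemma ver_closure (U : set (Cplx R)) v a b y : 0 < a -> 0 < b * y -> qf (a +i* y) = 0 ->
  connected_component (U `&` ~` E R) v (a +i* b) ->
  (forall s, 0 <= s <= 1 -> U (seg (a +i* b) (a +i* y) s)) ->
  closure (connected_component (U `&` ~` E R) v) (a +i* y).
Proof.
move=> a0 b_y qy Vb HU B /nbhs_nm[r r0 HB].
pose p : Cplx R := a +i* b; pose q : Cplx R := a +i* y.
have nE : ~ E R p by have [] := connected_component_sub Vb.
have b0 : b != 0 by apply: contraTneq b_y => ->; rewrite mul0r ltxx.
have neq : b != y.
  by apply/eqP => bE; apply: nE; right; apply: qf_E0; rewrite /p ?bE //= ltW.
have d0 : 0 < nm (p - q) + r by rewrite ltr_wpDl ?nm_ge0.
pose s := nm (p - q) / (nm (p - q) + r).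
have s0 : 0 <= s by rewrite divr_ge0 ?nm_ge0 // ltW.
have s1 : s < 1 by rewrite ltr_pdivrMr // mul1r ltrDl.
exists (seg p q s); split.
  apply: (seg_component Vb) => s' /andP[s'0 s'1]; rewrite segM.
  have sle : s' * s <= s by rewrite ler_piMl.
  have sge : 0 <= s' * s by rewrite mulr_ge0.
  have s3 : s' * s < 1 by apply: le_lt_trans s1.
  split; first by apply: HU; rewrite sge ltW.
  rewrite seg_ver => hE.
  move: (s' * s) sge s3 hE => {sle s'0 s'1 s s0 s1 s'} s s0 s1.
  have s2 : 0 < 1 - s by rewrite subr_gt0.
  have b2 : 0 < b ^+ 2 by rewrite exprn_even_gt0.
  have y0 : 0 < b * (b + s * (y - b)).
    have : 0 < (1 - s) * b ^+ 2 by rewrite mulr_gt0.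
    have : 0 <= s * (b * y) by rewrite mulr_ge0 // ltW.
    by lra.
  move/E_qf => /= [|_].
    by apply: contraTneq y0 => ->; rewrite mulr0 ltxx.
  rewrite qfE => e1; rewrite qfE in qy.
  have /eqP : (1 - s) * (b - y) * ((b + s * (y - b)) + y) * (1 + 2 * a) = 0.
    by have := congr2 (fun u w => u - w) e1 qy; rewrite /= subrr => <-; ring.
  rewrite !mulf_eq0 (gt_eqF s2) subr_eq0 (negPf neq) /=.
  rewrite [1 + _ == 0]gt_eqF ?orbF; last by lra.
  move=> /eqP H; have : b * (b + s * (y - b) + y) = 0 by rewrite H mulr0.
  by lra.
apply: HB; have -> : seg p q s - q = (1 - s)%:C * (p - q) by rewrite /seg rmorphB rmorph1; ring.
rewrite nmM nm_real gtr0_norm ?subr_gt0 //.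
have -> : 1 - s = r / (nm (p - q) + r) by rewrite /s; field; rewrite gt_eqF.
by rewrite mulrAC ltr_pdivrMr // ltr_pM2l // ltrDl.
Qed.

Lemma qf_mono x x' b : 0 <= x -> x <= x' -> qf (x +i* b) <= qf (x' +i* b).
Proof.
move=> x0 xx'; rewrite !qfE lerD2r; have b2 := sqr_ge0 b.
by apply: ler_pM; rewrite ?addr_ge0 ?sqr_ge0 //; nra.
Qed.

(** The ordinate has square [1 / (1 + 2 a) - a^2] and the sign of [b]. It is [(y - y0)^2], rather
    than [|y - y0|], that is compared with [|a - x0|], because the tangent is vertical at the real
    point of the curve. *)
Lemma arc_point a b y0 x0 : 0 < a -> b != 0 -> a ^+ 2 * (1 + 2 * a) < 1 -> 0 <= b * y0 ->
  0 <= x0 -> (x0 ^+ 2 + y0 ^+ 2) * (1 + 2 * x0) = 1 -> a <= 1 -> x0 <= 1 ->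
  exists y, [/\ 0 < b * y, qf (a +i* y) = 0 & (y - y0) ^+ 2 <= 4 * `|a - x0|].
Proof.
move=> a0 b0 aE by0 x00 E a1 x1.
have u0 : 0 < 1 + 2 * a by lra.
pose Y := (1 + 2 * a)^-1 - a ^+ 2.
have Y0 : 0 < Y by rewrite subr_gt0 -[ltRHS]mul1r ltr_pdivlMr.
have YE : (a ^+ 2 + Y) * (1 + 2 * a) = 1 by rewrite /Y subrKC mulVf // gt_eqF.
clearbody Y.
pose y := Num.sg b * Num.sqrt Y.
have y2 : y ^+ 2 = Y by rewrite exprMn sqr_sg b0 mul1r sqr_sqrtr // ltW.
have bpos : 0 < b * y by rewrite /y mulrA [b * _]mulrC -normrEsg mulr_gt0 ?normr_gt0 ?sqrtr_gt0.
have yy0 : 0 <= y * y0.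
  have : 0 <= (b * y) * (b * y0) by rewrite mulr_ge0 // ltW.
  have -> : (b * y) * (b * y0) = b ^+ 2 * (y * y0) by ring.
  have b2 : 0 < b ^+ 2 by rewrite lt0r expf_eq0 /= b0 sqr_ge0.
  by rewrite (pmulr_rge0 _ b2).
clearbody y; exists y; split=> //; first by rewrite qfE y2 YE subrr.
pose u := a ^+ 2 + Y; pose w := x0 ^+ 2 + y0 ^+ 2.
have w0 : 0 <= w by rewrite addr_ge0 ?sqr_ge0.
have w1 : w <= 1 by rewrite -E -/w ler_peMr //; lra.
have uw : (u - w) * (1 + 2 * a) = w * (2 * (x0 - a)).
  by rewrite mulrBl (YE : u * _ = 1) -{1}(E : w * _ = 1); ring.
have uw' : `|u - w| <= 2 * `|a - x0|.
  have : `|u - w| * (1 + 2 * a) = w * (2 * `|a - x0|).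
    rewrite -[1 + 2 * a]gtr0_norm // -normrM uw normrM (ger0_norm w0) normrM distrC.
    by rewrite [`|2|]ger0_norm.
  have := normr_ge0 (u - w); have := normr_ge0 (a - x0); clear -a0 w0 w1; nra.
have ax : `|a ^+ 2 - x0 ^+ 2| <= 2 * `|a - x0|.
  have -> : a ^+ 2 - x0 ^+ 2 = (a + x0) * (a - x0) by ring.
  rewrite normrM ler_wpM2r // ger0_norm ?addr_ge0 ?(ltW a0) //; lra.
have yd : `|y ^+ 2 - y0 ^+ 2| <= 4 * `|a - x0|.
  have -> : y ^+ 2 - y0 ^+ 2 = (u - w) - (a ^+ 2 - x0 ^+ 2) by rewrite y2 /u /w; ring.
  by apply: le_trans (ler_normB _ _) _; lra.
apply: le_trans yd.
have [l|l] := lerP (y0 ^+ 2) (y ^+ 2).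
  have : y0 ^+ 2 <= y * y0.
    rewrite -(@ler_pXn2r _ 2) ?nnegrE ?sqr_ge0 // [leRHS]exprMn [leLHS]expr2.
    by apply: ler_wpM2r; rewrite ?sqr_ge0.
  by lra.
have : y ^+ 2 <= y * y0.
  rewrite -(@ler_pXn2r _ 2) ?nnegrE ?sqr_ge0 // [leRHS]exprMn [leLHS]expr2.
  by apply: ler_wpM2l; rewrite ?sqr_ge0 // ltW.
by lra.
Qed.

Lemma cub_lt a b : 0 < a -> a < b -> a ^+ 2 * (1 + 2 * a) < b ^+ 2 * (1 + 2 * b).
Proof.
move=> a0 ab; rewrite -subr_gt0.
have -> : b ^+ 2 * (1 + 2 * b) - a ^+ 2 * (1 + 2 * a) =
  (b - a) * ((b + a) + 2 * (b * b + b * a + a * a)) by ring.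
have b0 := lt_trans a0 ab; rewrite mulr_gt0 ?subr_gt0 //.
by have := mulr_gt0 b0 b0; have := mulr_gt0 b0 a0; have := mulr_gt0 a0 a0; lra.
Qed.

(* The points i, -i and the real point of [E_0] need not be treated: any component adherent to them is adherent to a generic point nearby. *)
Lemma E0_closure z0 (U : set (Cplx R)) v : E0 R z0 -> open U -> U z0 ->
  closure (connected_component (U `&` ~` E R) v) z0 ->
  exists z1, [/\ generic z1, U z1 & closure (connected_component (U `&` ~` E R) v) z1].
Proof.
move=> [x0 [y0 [-> x00 yE]]] oU Uz cV.
have EQ : (x0 ^+ 2 + y0 ^+ 2) * (1 + 2 * x0) = 1.
  by rewrite yE; field; rewrite gt_eqF //; lra.
clear yE; have [r r0 HU] := open_nm oU Uz; clear oU.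
pose V := connected_component (U `&` ~` E R) v; rewrite -/V in cV *.
have VE p : V p -> ~ E R p by move=> /connected_component_sub[].
have [/andP[x0p y0n]|/nandP xy0] := boolP ((0 < x0) && (y0 != 0)).
  by exists (x0 +i* y0); split=> //; split=> //=; rewrite qfE EQ subrr.
have x1 : x0 <= 1 by have := sqr_ge0 y0; nra.
suff Near d : 0 < d -> d <= r -> d <= 20^-1 -> exists a b, [/\ V (a +i* b), nm ((a +i* b : Cplx R) - (x0 +i* y0)) < d,
    0 < a, b != 0 & a ^+ 2 * (1 + 2 * a) < 1 /\ 0 <= b * y0 /\ a <= 1].
  pose d := Num.min 20^-1 (Num.min (r / 2) ((r / 2) ^+ 2 / 4)).
  have r2 : 0 < r / 2 by lra.
  have r4 : 0 < (r / 2) ^+ 2 by exact: exprn_gt0.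
  have d0 : 0 < d by rewrite !lt_min; apply/and3P; split; [lra|exact: r2|lra].
  have [d1 d2 d3] : [/\ d <= 20^-1, d <= r / 2 & 4 * d <= (r / 2) ^+ 2].
    split; rewrite ?ge_min ?lexx ?orbT // mulrC -ler_pdivlMr //.
    by rewrite /d !ge_min lexx !orbT.
  have [a [b [Vp pd a0 b0 [aY [by0 a1]]]]] := Near d d0 ltac:(lra) d1.
  have [y [b_y qy yd]] := arc_point a0 b0 aY by0 x00 EQ a1 x1.
  have [ad _] := nm_subC_lt pd.
  have yr : `|y - y0| < r / 2.
    rewrite -(@ltr_pXn2r _ 2) ?nnegrE ?normr_ge0 ?divr_ge0 ?(ltW r0) //.
    by rewrite real_normK ?num_real //; lra.
  have zr : nm ((a +i* y : Cplx R) - (x0 +i* y0)) < r.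
    by apply: le_lt_trans (nm_subC _ _ _ _) _; lra.
  exists (a +i* y); split; last 1 first.
  - apply: ver_closure a0 b_y qy Vp _ => s s01; apply: HU; apply: seg_ball => //; lra.
  - by split=> //=; apply: contraTneq b_y => ->; rewrite mulr0 ltxx.
  exact: HU.
move=> d0 dr d20.
have Hor a b c : V (a +i* b) -> nm ((a +i* b : Cplx R) - (x0 +i* y0)) < d ->
    nm ((c +i* b : Cplx R) - (x0 +i* y0)) < d -> b != 0 ->
    (forall s, 0 <= s <= 1 -> 0 <= a + s * (c - a) -> qf ((a + s * (c - a)) +i* b) != 0) -> V (c +i* b).
  move=> Vp pd qd b0 H; apply: (seg_component Vp) => s s01; split.
    by apply: HU; apply: lt_le_trans dr; apply: seg_ball.
  by rewrite seg_hor => /E_qf/(_ b0)/= [h /eqP]; apply/negP; apply: H.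
(* At i and -i the curve ends and a component can turn around it: a point with [a <= 0] and
   [b^2 <= 1] is moved to an ordinate with [b^2 > 1] inside [Re < 0], where [E] has no point nearby,
   and then to the right on the outer side. *)
have [x0E|x0p] : x0 = 0 \/ 0 < x0 by have [->|] := eqVneq x0 0; [left|rewrite lt0r => ->; right].
  rewrite x0E mulr0 addr0 mulr1 expr0n add0r in EQ.
  rewrite x0E in HU cV Hor *; clear x0E x00 x1 xy0.
  have near b : `|b - y0| < d -> 0 < b * y0.
    by move=> h; have h2 : `|b - y0| < 20^-1 by [lra]; move: h2; rewrite ltr_norml => /andP[]; nra.
  have b0 b : `|b - y0| < d -> b != 0.
    by move=> /near; apply: contraTneq => ->; rewrite mul0r ltxx.
  have nmle a b e : `|a| + `|b - y0| < e -> nm ((a +i* b : Cplx R) - (0 +i* y0)) < e.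
    by apply: le_lt_trans; apply: le_trans (nm_subC _ _ _ _) _; rewrite subr0.
  suff S1 : exists a b, [/\ V (a +i* b), nm ((a +i* b : Cplx R) - (0 +i* y0)) < d, `|b - y0| < d / 2 & 0 < a \/ 1 < b ^+ 2].
    have [a [b [Vp pd bd ab]]] := S1; have [ad bd'] := nm_subC_lt pd; rewrite subr0 in ad.
    have fin c : 0 < c -> c < d -> V (c +i* b) -> nm ((c +i* b : Cplx R) - (0 +i* y0)) < d ->
      exists a b, [/\ V (a +i* b), nm ((a +i* b : Cplx R) - (0 +i* y0)) < d,
       0 < a, b != 0 & a ^+ 2 * (1 + 2 * a) < 1 /\ 0 <= b * y0 /\ a <= 1].
      move=> c0 cd Vc ncd; exists c, b; split=> //; first exact: b0.
      have c1 : c < 20^-1 by lra.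
      by split; [clear -c0 c1; nra|split; [apply/ltW/near|lra]].
    have [a0|a0] := ltP 0 a; first by apply: (fin a) => //; move: ad; rewrite ltr_norml => /andP[].
    have b1 : 1 < b ^+ 2 by case: ab => //; lra.
    have nd : nm (((d / 4) +i* b : Cplx R) - (0 +i* y0)) < d.
      by apply: nmle; rewrite gtr0_norm ?divr_gt0 //; lra.
    apply: (fin (d / 4)) => //; try lra.
    apply: Hor Vp pd nd (b0 _ bd') _ => s s01; move: (a + _) => x x0'.
    by rewrite qfE gt_eqF //; have := sqr_ge0 x; nra.
  have d4 : 0 < d / 4 by lra.
  have [[a b] Vp pd] := closure_nm cV d4.
  have [ad bd] := nm_subC_lt pd; rewrite subr0 in ad.
  have bd' : `|b - y0| < d by lra.
  have [b1|b1] := ltP 1 (b ^+ 2); first by exists a, b; split; [|lra|lra|right].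
  have [a0|a0] := ltP 0 a; first by exists a, b; split; [|lra|lra|left].
  have [c [c0 cd Vc]] : exists c, [/\ c < 0, nm ((c +i* b : Cplx R) - (0 +i* y0)) < d / 2 & V (c +i* b)].
    have [a0'|a0'] := ltP a 0; first by exists a; split=> //; lra.
    have aE : a = 0 by lra.
    have cd : nm (((- d / 4) +i* b : Cplx R) - (0 +i* y0)) < d / 2.
      by apply: nmle; rewrite mulNr normrN gtr0_norm //; lra.
    exists (- d / 4); split=> //; first lra.
    apply: (Hor _ _ _ Vp _ _ (b0 _ bd')); [lra|lra|].
    move=> s /andP[s0 s1]; rewrite aE subr0 add0r => h.
    have -> : s * (- d / 4) = 0 by nra.
    apply/eqP => q0; apply: (VE _ Vp); right; rewrite aE; exact: qf_E0.
  have yn : 0 < 1 + d / 8 by lra.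
  have ny : `|y0| = 1.
    by apply/eqP; rewrite -(@eqrXn2 _ 2) // real_normK ?num_real // EQ expr1n.
  have nb : `|y0 * (1 + d / 8) - y0| = d / 8.
    have -> : y0 * (1 + d / 8) - y0 = y0 * (d / 8) by ring.
    by rewrite normrM ny mul1r gtr0_norm //; lra.
  have [cd1 _] := nm_subC_lt cd; rewrite subr0 in cd1.
  have pd2 : nm ((c +i* (y0 * (1 + d / 8)) : Cplx R) - (0 +i* y0)) < d.
    by apply: nmle; rewrite nb; lra.
  exists c, (y0 * (1 + d / 8)); split=> //; last 1 first.
  - by right; rewrite exprMn EQ mul1r; nra.
  - apply: (seg_component Vc) => s s01; split.
      by apply: HU; apply: lt_le_trans dr; apply: seg_ball => //; lra.
    rewrite seg_ver => hE.
    have h0 : 0 < b * (y0 * (1 + d / 8)) by rewrite mulrA mulr_gt0 // near.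
    have h1 : b + s * (y0 * (1 + d / 8) - b) != 0.
      have bb : b ^+ 2 != 0 by rewrite expf_eq0 /= b0.
      have b2 : 0 < b ^+ 2 by rewrite lt0r bb sqr_ge0.
      have /andP[s0 s1] := s01.
      apply/eqP => Z; have : b * (b + s * (y0 * (1 + d / 8) - b)) = 0 by rewrite Z mulr0.
      move: h0; set w := y0 * (1 + d / 8) => h0.
      have -> : b * (b + s * (w - b)) = (1 - s) * b ^+ 2 + s * (b * w) by ring.
      by apply/eqP; rewrite gt_eqF // convex_gt0.
    by have [/= h2 _] := E_qf hE h1; lra.
  by lra.
have y00 : y0 = 0 by case: xy0 => [/negP//|/negPn/eqP].
rewrite y00 in EQ Hor HU cV *; rewrite expr0n addr0 in EQ.
have [xl xu] : 2^-1 < x0 /\ x0 < 9/10 by clear -EQ x0p; split; nra.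
have d2 : 0 < d / 2 by lra.
have [[a b] Vp pd] := closure_nm cV d2.
have [ad bd] := nm_subC_lt pd; rewrite subr0 in bd.
have [al au] : 45 / 100 < a /\ a < 95 / 100 by move: ad; rewrite ltr_norml => /andP[]; clear -xl xu d20; lra.
have pd' : nm ((a +i* b : Cplx R) - (x0 +i* 0)) < d by move: pd d0; clear; lra.
(* The real point of the curve is interior to the interval [[sqrt 2 - 1, 1]], so that near it every
   point off [E] is off the real axis. *)
have b0 : b != 0.
  apply/eqP => bE; apply: (VE _ Vp); rewrite bE; left; right; exists a => //.
  have s2 : Num.sqrt 2 <= 145 / 100 :> R.
    by rewrite -(@ler_pXn2r _ 2) ?nnegrE ?sqrtr_ge0 // ?sqr_sqrtr //; clear; lra.
  by move: s2 al au; clear; move: (Num.sqrt _) => q h1 h2 h3; apply/andP; split; lra.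
have [aY|aY] := ltP (a ^+ 2 * (1 + 2 * a)) 1.
  exists a, b; split; [exact: Vp|exact: pd'|by move: al; clear; lra|exact: b0|].
  by rewrite mulr0; split; [exact: aY|split; [exact: lexx|by move: au; clear; lra]].
have b2 : 0 < b ^+ 2 by rewrite exprn_even_gt0.
have a0 : 0 < a by move: al; clear; lra.
have ax : x0 <= a by rewrite leNgt; apply/negP => h; have := cub_lt a0 h; rewrite EQ; move: aY; clear; lra.
(* Here the vertical line at abscissa [a] misses the curve off the real axis. The point is moved
   left, just past [x0], by at most [b^2 / 10] so as to stay on the outer side. *)
pose e := Num.min (d / 4) (b ^+ 2 / 10).
have e0 : 0 < e by rewrite lt_min !divr_gt0.
have [ed eb] : e <= d / 4 /\ e <= b ^+ 2 / 10 by split; rewrite /e ge_min lexx ?orbT.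
clearbody e.
have cd : nm (((x0 - e) +i* b : Cplx R) - (x0 +i* 0)) < d.
  apply: le_lt_trans (nm_subC _ _ _ _) _; rewrite subr0.
  have -> : x0 - e - x0 = - e by [ring].
  by rewrite normrN gtr0_norm //; move: ed bd d0; clear; lra.
have qe : 0 < qf ((x0 - e) +i* b : Cplx R).
  rewrite qfE.
  have -> : ((x0 - e) ^+ 2 + b ^+ 2) * (1 + 2 * (x0 - e)) - 1 = (x0 ^+ 2 * (1 + 2 * x0) - 1) +
    (b ^+ 2 * (1 + 2 * (x0 - e)) + e ^+ 2 * (1 + 2 * x0 + 4 * x0 - 2 * e) - e * (2 * x0 + 6 * x0 ^+ 2)) by ring.
  rewrite EQ subrr add0r.
  have h1 : 0 <= e ^+ 2 * (1 + 2 * x0 + 4 * x0 - 2 * e) by rewrite mulr_ge0 ?sqr_ge0 //; move: xl e0 ed d20; clear; lra.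
  have h2 : e * (2 * x0 + 6 * x0 ^+ 2) <= b ^+ 2 / 10 * 8.
    by apply: ler_pM; rewrite ?(ltW e0) //; clear -xu xl; nra.
  have h3 : b ^+ 2 <= b ^+ 2 * (1 + 2 * (x0 - e)) by rewrite ler_peMr ?(ltW b2) //; move: xl ed d20; clear; lra.
  by move: h1 h2 h3 b2; clear; lra.
exists (x0 - e), b; split; [|exact: cd|by move: xl ed d20; clear; lra|exact: b0|]; last first.
  split; last by rewrite mulr0; split=> //; move: xu e0; clear; lra.
  have e1 : 0 < x0 - e by move: xl ed d20; clear; lra.
  have e2 : x0 - e < x0 by move: e0; clear; lra.
  by have := cub_lt e1 e2; rewrite EQ.
apply: Hor Vp pd' cd b0 _ => s /andP[s0 s1] _.
rewrite gt_eqF //; apply: lt_le_trans qe _; apply: qf_mono; first lra.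
by clear -s0 s1 ax e0; nra.
Qed.

End Topology.

(** * The natural boundary *)

Section Singularity.
Context {R : realType}.
Implicit Types (t z w : Cplx R) (d e r s x y : R) (g : Cplx R -> Cplx R).

(** Complex differentiability as a first-order expansion: the form in which a hypothetical
    continuation is used. *)
Definition cdiff g z := exists c, forall e, 0 < e -> exists2 d, 0 < d &
  forall t, nm (t - z) < d -> nm (g t - g z - c * (t - z)) <= e * nm (t - z).

Lemma derivable_cdiff g z : derivable g z 1 -> cdiff g z.
Proof.
rewrite /derivable => /cvg_ex[c /cvgrPdist_lt H]; exists c => e e0.
have ec : 0 < e%:C :> R[i] by rewrite ltcR.
have /dnbhs_nm[d d0 Hd] := H _ ec; exists d => // t td.
have [->|tz] := eqVneq t z; first by rewrite !subrr mulr0 subr0 nm0 mulr0.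
have tz0 : t - z != 0 by rewrite subr_eq0.
have := Hd (t - z) tz0; rewrite subr0 => /(_ td).
rewrite normE ltcR => /ltW.
have -> : (t - z)^-1 *: (g ((t - z) *: 1 + z) - g z) = (g t - g z) / (t - z) :> Cplx R.
  by rewrite /GRing.scale /= mulr1 subrK mulrC.
move=> h; have EQ : - (g t - g z - c * (t - z)) / (t - z) = c - (g t - g z) / (t - z).
  by move: (g t) (g z) => u v; field.
by rewrite -nmN -(divfK tz0 (- (_ - _))) nmM EQ; apply: ler_wpM2r; [exact: nm_ge0|exact: h].
Qed.

Lemma cdiff_ext g h z : (\forall w \near z, g w = h w) -> cdiff g z -> cdiff h z.
Proof.
move=> /nbhs_nm[r r0 H] [c Hc]; exists c => e /Hc[d d0 Hd].
exists (Num.min r d); first by rewrite lt_min r0.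
move=> t; rewrite lt_min => /andP[tr td]; rewrite -(H _ tr) -(H z) ?subrr ?nm0 //; exact: Hd.
Qed.

Lemma cdiffD g h z : cdiff g z -> cdiff h z -> cdiff (fun w => g w + h w) z.
Proof.
move=> [c Hc] [b Hb]; exists (c + b) => e e0; have e2 : 0 < e / 2 by rewrite divr_gt0.
have [d1 d10 H1] := Hc _ e2; have [d2 d20 H2] := Hb _ e2.
exists (Num.min d1 d2); first by rewrite lt_min d10.
move=> t; rewrite lt_min => /andP[/H1 h1 /H2 h2].
have -> : g t + h t - (g z + h z) - (c + b) * (t - z) =
  (g t - g z - c * (t - z)) + (h t - h z - b * (t - z)) by ring.
by apply: le_trans (nmD _ _) _; lra.
Qed.

Lemma cdiff_cont g z e : cdiff g z -> 0 < e ->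
  exists2 d, 0 < d & forall t, nm (t - z) < d -> nm (g t - g z) < e.
Proof.
move=> [c Hc] e0; have [d d0 Hd] := Hc _ ltr01.
have p0 : 0 < 1 + nm c by rewrite ltr_pwDl ?nm_ge0.
exists (Num.min d (e / (1 + nm c))); first by rewrite lt_min d0 divr_gt0.
move=> t; rewrite lt_min => /andP[/Hd]; rewrite mul1r ltr_pdivlMr // => h1 h2.
have -> : g t - g z = (g t - g z - c * (t - z)) + c * (t - z) by ring.
by apply: le_lt_trans (nmD _ _) _; rewrite nmM; lra.
Qed.

Lemma mero_cdiff (U : set (Cplx R)) g z : meromorphic_on U g -> U z ->
  exists2 r, 0 < r & forall w, w != z -> nm (w - z) < r -> cdiff g w.
Proof.
move=> H /H[n [h [/nbhs_nm[r r0 Hh] /dnbhs_nm[s s0 Hs]]]].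
exists (Num.min r s); first by rewrite lt_min r0.
move=> w wz; rewrite lt_min => /andP[wr ws].
apply: (@cdiff_ext (fun w => h w * ((w - z) ^+ n)^-1)).
  have d0 : 0 < Num.min (s - nm (w - z)) (nm (w - z)).
    by rewrite lt_min subr_gt0 ws nm_gt0 subr_eq0.
  apply: near_nm d0 _ => t; rewrite lt_min => /andP[t1 t2]; rewrite Hs //.
    by apply: contraTneq t2 => ->; rewrite nmB ltxx.
  by apply: le_lt_trans (nm_subD t w z) _; lra.
apply: derivable_cdiff; apply: derivableM; first exact: Hh.
apply: anal_derivable; apply: anal_inv; last by rewrite expf_neq0 // subr_eq0.
by apply: anal_exp; apply: anal_sub.
Qed.

Lemma generic_near z d : generic z -> 0 < d -> exists z', [/\ generic z', z' != z & nm (z' - z) < d].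
Proof.
case: z => x y [/= x0 y0]; rewrite qfE => q0 d0.
have y2 : 0 < y ^+ 2 by rewrite lt0r expf_eq0 /= y0 sqr_ge0.
have E1 : (x ^+ 2 + y ^+ 2) * (1 + 2 * x) = 1 by lra.
have x3 : x ^+ 2 * (1 + 2 * x) < 1.
  have u0 : 0 < 1 + 2 * x by lra.
  by have := mulr_gt0 y2 u0; lra.
have x1 : x <= 1 by rewrite leNgt; apply/negP => h; have := cub_lt ltr01 h; lra.
pose e := Num.min (x / 2) (Num.min (d / 4) ((d / 2) ^+ 2 / 4)).
have d2 : 0 < d / 2 by lra.
have d4 : 0 < (d / 2) ^+ 2 by exact: exprn_gt0.
have e0 : 0 < e by rewrite !lt_min; apply/and3P; split; lra.
have [e1 e2 e3] : [/\ e <= x / 2, e <= d / 4 & 4 * e <= (d / 2) ^+ 2].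
  split; rewrite ?ge_min ?lexx ?orbT // mulrC -ler_pdivlMr //.
  by rewrite /e !ge_min lexx !orbT.
clearbody e.
have a0 : 0 < x - e by lra.
have ax : x - e < x by lra.
have aY := lt_trans (cub_lt a0 ax) x3.
have [y' [yy' q' ye]] := arc_point a0 y0 aY (ltW y2 : 0 <= y * y) (ltW x0) E1 ltac:(lra) x1.
exists ((x - e) +i* y'); split.
- by split=> //=; apply: contraTneq yy' => ->; rewrite mulr0 ltxx.
- by rewrite eq_complex /= negb_and lt_eqF.
have xe : `|x - e - x| = e.
  by have -> : x - e - x = - e by [ring]; rewrite normrN gtr0_norm.
rewrite xe in ye.
have yr : `|y' - y| <= d / 2.
  by rewrite -(@ler_pXn2r _ 2) ?nnegrE ?normr_ge0 ?(ltW d2) // real_normK ?num_real //; lra.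
apply: le_lt_trans (nm_subC _ _ _ _) _; rewrite xe; lra.
Qed.

Lemma Fser_large sg z d A : generic z -> 0 < d -> exists t, [/\ nm (t - z) < d, side sg t &
  \forall t' \near t^', A <= nm (Fser t')].
Proof. by case: sg; [apply: Fser_large_inner|apply: Fser_large_outer]. Qed.

Lemma Fser_order sg z d : generic z -> 0 < d -> exists z' C, [/\ generic z', nm (z' - z) < d &
  forall e, 0 < e -> exists t, [/\ nm (t - z') < e, side sg t &
  \forall t' \near t^', nm (Fser t') * nm (t - z') <= C]].
Proof. by case: sg; [apply: Fser_order_inner|apply: Fser_order_outer]. Qed.

(* Near a generic point, a component of [U \ E] adherent to it contains a whole side of [E_0]. *)
Lemma natural_boundary_generic (Phi : Cplx R -> Cplx R) :
  (forall z sg r g, generic z -> 0 < r -> (forall w, w != z -> nm (w - z) < r -> cdiff g w) ->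
    (forall t, nm (t - z) < r -> side sg t -> \forall w \near t^', g w = Phi w) -> False) ->
  natural_boundary (~` E R) Phi (E0 R).
Proof.
move=> H z0 z0E U v oU Uz _ cV [g [mg eg]].
have [z1 [gz Uz1 cV1]] := E0_closure z0E oU Uz cV.
have [r1 r10 H1] := mero_cdiff mg Uz1.
have [rt rt0 Ht] := side_local true gz oU Uz1.
have [rf rf0 Hf] := side_local false gz oU Uz1.
have [x0 y0 _] := gz.
have [d1 [kap [K [d10 _ _ L]]]] := arc_local gz.
pose r := Num.min (Num.min r1 d1) (Num.min rt rf).
have r0 : 0 < r by rewrite !lt_min r10 d10 rt0 rf0.
have [p Vp pr] := closure_nm cV1 r0.
have rlt t : nm (t - z1) < r -> [/\ nm (t - z1) < r1, nm (t - z1) < d1, nm (t - z1) < rt & nm (t - z1) < rf].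
  by rewrite !lt_min => /andP[/andP[-> ->] /andP[-> ->]].
have [_ pd pt pf] := rlt _ pr.
have [_ px _ _ _] := L p pd.
have [sg sp] : exists sg, side sg p.
  have [q|q|q] := ltrgtP (qf p) 0; [by exists true|by exists false|].
  by have [_ []] := connected_component_sub Vp; right; apply: qf_E0; rewrite // ltW.
apply: (H z1 sg r g gz r0) => [w wz /rlt[wr _ _ _]|t tr st]; first exact: H1.
apply: eg; have [_ _ tt tf] := rlt _ tr.
by case: sg sp st => sp st; [apply: Ht Vp|apply: Hf Vp].
Qed.

Lemma dnbhs_both t e (P Q : Cplx R -> Prop) : 0 < e -> (\forall w \near t^', P w) ->
  (\forall w \near t^', Q w) -> exists w, [/\ nm (w - t) < e, P w & Q w].
Proof.
move=> e0 HP HQ; have [w [_ we [Pw Qw]]] := dnbhs_ex e0 (dnbhs_and HP HQ (fun w _ p q => conj p q)).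
by exists w.
Qed.

(** The continuation [g] may have a pole at [z], so the argument takes place at another generic
    point [z'] nearby: [g] is bounded around [z'], but [F] is not on the side where they agree. *)
Lemma Fser_boundary : natural_boundary (~` E R) (@Fser R) (E0 R).
Proof.
apply: natural_boundary_generic => z sg r g gz r0 Hg Eg.
have [z' [gz' zz' zr]] := generic_near gz r0.
have [d d0 Hd] := cdiff_cont (Hg _ zz' zr) ltr01.
have rd : 0 < Num.min (d / 2) (r - nm (z' - z)) by rewrite lt_min subr_gt0 zr divr_gt0.
have [t [tz st Ht]] := Fser_large sg (nm (g z') + 1) gz' rd.
move: tz; rewrite lt_min => /andP[td tr].
have tzr : nm (t - z) < r by apply: le_lt_trans (nm_subD t z' z) _; lra.
have d2 : 0 < d / 2 by lra.
have [w [wt Aw gw]] := dnbhs_both d2 Ht (Eg t tzr st).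
have wd : nm (w - z') < d by apply: le_lt_trans (nm_subD w t z') _; lra.
by have := Hd w wd; rewrite gw; have := nm_subl (Fser w) (g z'); lra.
Qed.

(** Obtained by clearing the inner denominator in [1 / (1 + w - 2 w b / (1 + w b))]. *)
Definition Wden w (b : Cplx R) := 1 + w + (w ^+ 2 - w) * b.
Definition Wof w (b : Cplx R) := (1 + w * b) / Wden w b.

Lemma Wof_pole w b : w != 1 -> Wden w b != 0 -> Wof w b - (w - 1)^-1 = - 2 / ((w - 1) * Wden w b).
Proof.
rewrite /Wof /Wden -subr_eq0 => w1 D; field.
by rewrite w1 D.
Qed.

(* [W - 1 / (w - 1) = -2 / ((w - 1) (1 + w + (w^2 - w) b))]. *)
Lemma Wof_small m M e : 0 < m -> 0 < M -> 0 < e -> exists A, forall w b, m <= nm (w - 1) -> m <= nm w -> nm w <= M ->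
  A <= nm b -> nm (Wof w b - (w - 1)^-1) <= e.
Proof.
move=> m0 M0 e0; have me : 0 < m * e by rewrite mulr_gt0.
have B0 : 0 < 2 / (m * e) by rewrite divr_gt0.
exists ((1 + M + 2 / (m * e)) / (m * m)) => w b h1 h2 h3.
rewrite ler_pdivrMr ?mulr_gt0 // => h4.
have DB : 2 / (m * e) <= nm (Wden w b).
  rewrite /Wden; have -> : 1 + w + (w ^+ 2 - w) * b = w * (w - 1) * b + (1 + w) by ring.
  have k1 := nm_addl (w * (w - 1) * b) (1 + w); have k2 := nmD 1 w; rewrite nm1 in k2.
  have k3 : nm b * (m * m) <= nm (w * (w - 1) * b).
    by rewrite !nmM mulrC ler_wpM2r ?nm_ge0 // ler_pM // ltW.
  by lra.
have D0 : 0 < nm (Wden w b) by apply: lt_le_trans DB.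
rewrite Wof_pole; [|by rewrite -subr_eq0 -nm_gt0; apply: lt_le_trans h1|by rewrite -nm_gt0].
rewrite nmM nmN nmV nmM nm_nat ler_pdivrMr; last by rewrite mulr_gt0 // (lt_le_trans m0).
apply: (@le_trans _ _ (e * (m * (2 / (m * e))))).
  by rewrite (_ : e * (m * (2 / (m * e))) = 2) //; field; rewrite !gt_eqF.
by rewrite ler_pM2l // ler_pM // ltW.
Qed.

(** The difference is [-2 / ((w - 1) Wden w b)], and [Wden] is affine in [b]: with [|b| <= C / s],
    its modulus is at most a multiple of [1 / s]. *)
Lemma Wof_large M C : 0 < M -> 0 <= C -> exists2 k, 0 < k & forall w b s, w != 1 -> nm w <= M -> nm (w - 1) <= M ->
  0 < s -> s <= 1 -> nm b * s <= C -> k * s <= nm (Wof w b - (w - 1)^-1).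
Proof.
move=> M0 C0; pose K := 1 + M + M * M * C.
have K1 : 1 <= K by rewrite /K -addrA lerDl addr_ge0 ?(ltW M0) // mulr_ge0 // mulr_ge0 // ltW.
have K0 : 0 < K by lra.
exists (M * K)^-1; first by rewrite invr_gt0 mulr_gt0.
move=> w b s w1 h1 h2 s0 s1 h3.
have w0 : 0 < nm (w - 1) by rewrite nm_gt0 subr_eq0.
rewrite mulrC ler_pdivrMr ?mulr_gt0 //.
(* Where the denominator vanishes, [Wof] is 0 by convention, and the bound comes from [1 / (w - 1)]
   alone. *)
have [D|D] := eqVneq (Wden w b) 0.
  rewrite /Wof D invr0 mulr0 sub0r nmN nmV.
  have h4 : 1 <= (nm (w - 1))^-1 * M by rewrite mulrC ler_pdivlMr // mul1r.
  by rewrite mulrA; apply: le_trans s1 _; apply: mulr_ege1.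
have D0 : 0 < nm (Wden w b) by rewrite nm_gt0.
rewrite Wof_pole // nmM nmN nmV nmM nm_nat mulrAC ler_pdivlMr ?mulr_gt0 //.
have DK : s * nm (Wden w b) <= K.
  have k1 : nm (Wden w b) <= 1 + M + M * M * nm b.
    apply: le_trans (nmD _ _) _; apply: lerD.
      by apply: le_trans (nmD _ _) _; rewrite nm1 lerD2l.
    have -> : (w ^+ 2 - w) * b = w * (w - 1) * b by ring.
    by rewrite !nmM ler_wpM2r ?nm_ge0 // ler_pM ?nm_ge0.
  have k2 : M * M * (nm b * s) <= M * M * C by rewrite ler_wpM2l // mulr_ge0 // ltW.
  have k3 : s * (1 + M) <= 1 + M by rewrite ler_piMl //; lra.
  have k4 : s * nm (Wden w b) <= s * (1 + M + M * M * nm b) by rewrite ler_wpM2l // ltW.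
  by rewrite /K; lra.
have -> : s * (nm (w - 1) * nm (Wden w b)) = nm (w - 1) * (s * nm (Wden w b)) by ring.
have q1 : nm (w - 1) * (s * nm (Wden w b)) <= M * K.
  by rewrite ler_pM ?nm_ge0 // mulr_ge0 ?nm_ge0 // ltW.
have MK : 0 < M * K by rewrite mulr_gt0.
by lra.
Qed.

Definition WF w := Wof w (Fser w).

Lemma WF_boundary : natural_boundary (~` E R) WF (E0 R).
Proof.
apply: natural_boundary_generic => z sg r0 g gz r00 Hg0 Eg0.
have [x0 y0 _] := gz.
pose m := `|complex.Im z| / 2; have m0 : 0 < m by rewrite divr_gt0 // normr_gt0.
pose r := Num.min r0 (Num.min m 1).
have rp : 0 < r by rewrite !lt_min r00 m0 ltr01.
have [rr rm r1] : [/\ r <= r0, r <= m & r <= 1] by rewrite /r !ge_min !lexx !orbT.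
have Hg w : w != z -> nm (w - z) < r -> cdiff g w by move=> wz wr; apply: Hg0 => //; lra.
have Eg t : nm (t - z) < r -> side sg t -> \forall w \near t^', g w = WF w.
  by move=> tr; apply: Eg0; lra.
clear Hg0 Eg0 r00; clearbody r; clear rr.
pose M := nm z + 2.
have M0 : 0 < M by have := nm_ge0 z; rewrite /M; lra.
have near w : nm (w - z) < r -> [/\ m <= nm (w - 1), m <= nm w, nm w <= M & nm (w - 1) <= M].
  move=> wr; have h1 := nm_Im (w - z); have h2 := nm_subl w z.
  have I1 := nm_Im (w - 1); have I0 := nm_Im w.
  have E1 : complex.Im (w - 1) = complex.Im w by case: (w) => a b /=; rewrite subr0.
  have E2 : complex.Im (w - z) = complex.Im w - complex.Im z by case: (w); case: (z).
  rewrite E1 in I1; rewrite E2 in h1; have h3 := ler_dist_dist (complex.Im w) (complex.Im z).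
  have h4 : `|complex.Im z| - `|complex.Im w| <= `|complex.Im w - complex.Im z| by rewrite distrC lerB_dist.
  have h5 := nmD w (-1); rewrite nmN nm1 in h5.
  by move: wr rm r1 h4 h1 h2 I1 I0 h5; rewrite /m /M; clear; move=> *; split; lra.
have w1 w : nm (w - z) < r -> w != 1.
  by move=> /near[h _ _ _]; rewrite -subr_eq0 -nm_gt0; apply: lt_le_trans h.
pose D w := g w - (w - 1)^-1.
have HD w : w != z -> nm (w - z) < r -> cdiff D w.
  move=> wz wr; apply: cdiffD; first exact: Hg.
  apply: derivable_cdiff; apply: anal_derivable.
  apply: (@anal_ext _ (fun w => (-1) * (w - 1)^-1)); first by apply: near_all => t; rewrite mulN1r.
  apply: analM; first exact: anal_cst.
  by apply: anal_inv; [apply: anal_sub|rewrite subr_eq0 w1].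
have D0 w : generic w -> w != z -> nm (w - z) < r -> D w = 0.
  move=> gw wz wr; apply: eq_nm_small => e e0; have e2 : 0 < e / 2 by lra.
  have [d d0 Hd] := cdiff_cont (HD _ wz wr) e2.
  have [A HA] := Wof_small m0 M0 e2.
  have rd : 0 < Num.min (d / 2) ((r - nm (w - z)) / 2) by rewrite lt_min !divr_gt0 // subr_gt0.
  have [t [+ st Ht]] := Fser_large sg A gw rd.
  rewrite lt_min => /andP[td tr].
  have tzr : nm (t - z) < r by apply: le_lt_trans (nm_subD t w z) _; lra.
  have [u [+ Au gu]] := dnbhs_both rd Ht (Eg t tzr st).
  rewrite lt_min => /andP[ut ur].
  have ud : nm (u - w) < d by apply: le_lt_trans (nm_subD u t w) _; lra.
  have uz : nm (u - z) < r.
    by have h1 := nm_subD u t z; have h2 := nm_subD t w z; lra.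
  have [n1 n2 n3 _] := near u uz.
  have := HA u (Fser u) n1 n2 n3 Au; rewrite -/(WF u) -gu -/(D u) => h.
  by have := Hd u ud; rewrite nmB; have := nm_subl (D w) (D u); lra.
have [z'' [gz'' zz'' zr'']] := generic_near gz rp.
have d2 : 0 < Num.min (nm (z'' - z)) (r - nm (z'' - z)).
  by rewrite lt_min subr_gt0 zr'' nm_gt0 subr_eq0 zz''.
have [z' [C [gz' + HC]]] := Fser_order sg gz'' d2.
rewrite lt_min => /andP[z1 z2].
have zz' : z' != z by apply: contraTneq z1 => ->; rewrite nmB ltxx.
have zr' : nm (z' - z) < r by have := nm_subD z' z'' z; lra.
have Dz' := D0 _ gz' zz' zr'.
have [c Hc] := HD _ zz' zr'.
have C0 : 0 <= `|C| by [].
(* [D] vanishes at generic points accumulating at [z'], so its difference quotients along them are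
   0. *)
have c0 : c = 0.
  apply: eq_nm_small => e e0; have [d d0 Hd] := Hc _ e0.
  have dd : 0 < Num.min d (Num.min (nm (z' - z)) (r - nm (z' - z))).
    by rewrite !lt_min d0 subr_gt0 zr' nm_gt0 subr_eq0 zz'.
  have [u [gu uz' +]] := generic_near gz' dd.
  rewrite !lt_min => /and3P[ud u1 u2].
  have uz : u != z by apply: contraTneq u1 => ->; rewrite nmB ltxx.
  have ur : nm (u - z) < r by have := nm_subD u z' z; move: u2; clear; lra.
  have := Hd u ud; rewrite (D0 u) // Dz' subrr sub0r nmN nmM ler_pM2r //.
  by rewrite nm_gt0 subr_eq0.
have [k k0 Hk] := Wof_large M0 C0.
(* With slope 0 and [|u - z'| <= 2 |t - z'|], the expansion gives [|D u| <= (k / 2) |t - z'|],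
   against the lower bound [k |t - z'|]. *)
have k4 : 0 < k / 4 by lra.
have [d d0 Hd] := Hc _ k4.
have dd : 0 < Num.min (d / 2) (Num.min 1 ((r - nm (z' - z)) / 2)).
  by rewrite !lt_min ltr01 !divr_gt0 // subr_gt0.
have [t [+ st Ht]] := HC _ dd.
rewrite !lt_min => /and3P[td t1 tr].
have tz' : 0 < nm (t - z').
  rewrite nm_gt0 subr_eq0; apply: contraTneq st => ->; rewrite /side.
  by have [_ _ ->] := gz'; case: (sg); rewrite ltxx.
have tzr : nm (t - z) < r by have := nm_subD t z' z; move: tr zr'; clear; lra.
have [u [ut Cu gu]] := dnbhs_both tz' Ht (Eg t tzr st).
have uz' : nm (u - z') <= 2 * nm (t - z') by have := nm_subD u t z'; move: ut; clear; lra.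
have ud : nm (u - z') < d by move: uz' td; clear; lra.
have uz : nm (u - z) < r by have := nm_subD u z' z; move: uz' tr zr'; clear; lra.
have [n1 n2 n3 n4] := near u uz.
have := Hk u (Fser u) (nm (t - z')) (w1 _ uz) n3 n4 tz' (ltW t1) (le_trans Cu (ler_norm _)).
rewrite -/(WF u) -gu -/(D u); have := Hd u ud; rewrite c0 mul0r subr0 Dz' subr0.
have : k / 4 * nm (u - z') <= k / 4 * (2 * nm (t - z')) by rewrite ler_pM2l.
have : 0 < k * nm (t - z') by rewrite mulr_gt0.
by lra.
Qed.

End Singularity.

(** * Differential equations *)

Section ODE.
Context {R : realType}.
Implicit Types (a b : nat -> Cplx R) (t z w : Cplx R) (e r s x y K M : R) (f g : Cplx R -> Cplx R).

Lemma iter_ps_deriv i b n : iter i (@ps_deriv R) b n = ((n + i) ^_ i)%:R * b (n + i)%N.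
Proof.
elim: i n => [|i IH] n; first by rewrite ffactn0 mul1r addn0.
by rewrite iterS /ps_deriv IH mulrA -natrM addnS addSn ffactnSr -addSn addnK mulnC.
Qed.

Lemma anal_ball_iter_dz i f z r a : anal_ball f z r a ->
  anal_ball (iter i dz f) z r (iter i (@ps_deriv R) a).
Proof. by move=> H; elim: i => [//|i IH]; rewrite !iterS; apply: anal_ball_dz. Qed.

Lemma anal_ball_sum m (F : nat -> Cplx R -> Cplx R) z r (A : nat -> nat -> Cplx R) :
  (forall i, (i < m)%N -> anal_ball (F i) z r (A i)) ->
  anal_ball (fun w => \sum_(i < m) F i w) z r (fun n => \sum_(i < m) A i n).
Proof.
elim: m => [|m IH] H.
  have -> : (fun n => \sum_(i < 0) A i n) = fun n => (0 : {poly Cplx R})`_n.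
    by apply/funext => n; rewrite big_ord0 coef0.
  by split=> [|w wr]; rewrite ?psum_poly ?horner0 ?big_ord0 //; apply: psrad_poly.
have [H1 H2] := anal_ballD (IH (fun i im => H i (ltnW im))) (H m (ltnSn m)).
rewrite (_ : (fun n => _) = fun n => \sum_(i < m) A i n + A m n); last first.
  by apply/funext => n; rewrite big_ord_recr.
by split=> // w wr; rewrite big_ord_recr; apply: H2.
Qed.

Lemma anal_ball_poly (P : {poly Cplx R}) z r : exists A, anal_ball (fun w => P.[w]) z r A.
Proof.
exists (fun n => (P \Po ('X + z%:P))`_n); split; first exact: psrad_poly.
by move=> w _; rewrite psum_poly horner_comp hornerD hornerX hornerC subrK.
Qed.

Lemma anal_ball_zero f z r a r' : 0 < r -> anal_ball f z r a -> 0 < r' ->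
  (forall w, w != z -> nm (w - z) < r' -> f w = 0) -> forall n, a n = 0.
Proof.
move=> r0 [H1 H2] r'0 H.
have s0 : 0 < Num.min r r' by rewrite lt_min r0.
apply: (psum_zero H1 r0 s0) => h h0; rewrite lt_min => /andP[hr hr'].
have E1 : h + z - z = h by rewrite addrK.
rewrite -[h in psum _ h]E1 -H2 ?E1 //; apply: H; rewrite ?E1 //.
by rewrite -subr_eq0 E1.
Qed.

Lemma leq_ffact2 m n k : (m <= n)%N -> (m ^_ k <= n ^_ k)%N.
Proof. by move=> mn; elim: k => [//|k IH]; rewrite !ffactnSr leq_mul // leq_sub2r. Qed.

(* [(n + d) ... (n + 1) b_(n+d)] is compared with terms carrying falling factorials of order at most [d - 1], which gains a factor [n + d]. *)
Lemma ode_step (b : nat -> Cplx R) d (A : nat -> nat -> Cplx R) s q K M n : 0 < s -> 0 <= q < 1 -> 0 <= K -> 0 <= M ->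
  (forall i l, (i < d.+1)%N -> nm (A i l) * s ^+ l <= K * q ^+ l) ->
  iter d.+1 (@ps_deriv R) b n = - \sum_(i < d.+1) psconv (A i) (iter i (@ps_deriv R) b) n ->
  (forall j, (j < n + d.+1)%N -> nm (b j) * s ^+ j <= M) ->
  (n + d.+1)%:R * (nm (b (n + d.+1)%N) * s ^+ (n + d.+1)) <= M * (d.+1%:R * (K * (1 + s) ^+ d.+1 / (1 - q))).
Proof.
move=> s0 q01 K0 M0 HA HE HM; have [q0 q1] := andP q01.
have S1 : 1 <= 1 + s by rewrite lerDl ltW.
have F0 : 0 < ((n + d) ^_ d)%:R :> R by rewrite ltr0n ffact_gt0 leq_addl.
have term (i l : nat) : (i < d.+1)%N -> (l < n.+1)%N ->
    nm (A i l) * nm (iter i (@ps_deriv R) b (n - l)%N) * s ^+ (n + d.+1) <=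
    ((n + d) ^_ d)%:R * (M * (K * (1 + s) ^+ d.+1)) * q ^+ l.
  move=> id ln; rewrite iter_ps_deriv nmM nm_nat.
  have ff : ((n - l + i) ^_ i <= (n + d) ^_ d)%N.
    apply: (@leq_trans ((n + i) ^_ i)); first by apply: leq_ffact2; rewrite leq_add2r leq_subr.
    rewrite ltnS in id; move: id => /subnK <-; elim: (d - i)%N => [//|k IH].
    apply: leq_trans IH _; rewrite addSn addnS ffactSS leq_pmull //.
  have e1 : (n + d.+1 = (n - l + i) + (l + (d.+1 - i)))%N by clear -id ln; lia.
  have hb : nm (b (n - l + i)%N) * s ^+ (n - l + i) <= M by apply: HM; clear -id ln; lia.
  have hs : s ^+ (d.+1 - i) <= (1 + s) ^+ d.+1.
    apply: (@le_trans _ _ ((1 + s) ^+ (d.+1 - i))).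
      by apply: lerXn2r; rewrite ?nnegrE ?addr_ge0 ?(ltW s0) // lerDr.
    by apply: ler_weXn2l => //; apply: leq_subr.
  rewrite e1 !exprD.
  have -> : nm (A i l) * (((n - l + i) ^_ i)%:R * nm (b (n - l + i)%N)) *
     (s ^+ (n - l) * s ^+ i * (s ^+ l * s ^+ (d.+1 - i))) =
     ((n - l + i) ^_ i)%:R * ((nm (b (n - l + i)%N) * (s ^+ (n - l) * s ^+ i)) * ((nm (A i l) * s ^+ l) * s ^+ (d.+1 - i))).
    by ring.
  rewrite -[leRHS]mulrA; apply: ler_pM; rewrite ?ler_nat //.
    by rewrite !mulr_ge0 ?nm_ge0 ?exprn_ge0 ?(ltW s0).
  rewrite -exprD -[leRHS]mulrA; apply: ler_pM => //.
  - by rewrite mulr_ge0 ?nm_ge0 ?exprn_ge0 ?(ltW s0).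
  - by rewrite !mulr_ge0 ?nm_ge0 ?exprn_ge0 ?(ltW s0).
  rewrite [leRHS]mulrAC; apply: ler_pM => //; last exact: HA.
  - by rewrite mulr_ge0 ?nm_ge0 ?exprn_ge0 ?(ltW s0).
  by rewrite exprn_ge0 ?(ltW s0).
have tot : nm (iter d.+1 (@ps_deriv R) b n) * s ^+ (n + d.+1) <=
    \sum_(i < d.+1) \sum_(l < n.+1) ((n + d) ^_ d)%:R * (M * (K * (1 + s) ^+ d.+1)) * q ^+ l.
  rewrite HE nmN; apply: le_trans (ler_wpM2r _ (nm_sum _ _ _)) _; first by rewrite exprn_ge0 // ltW.
  rewrite mulr_suml; apply: ler_sum => i _; rewrite /psconv.
  apply: le_trans (ler_wpM2r _ (nm_sum _ _ _)) _; first by rewrite exprn_ge0 // ltW.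
  rewrite mulr_suml; apply: ler_sum => l _; rewrite nmM; exact: term.
have qs := geo_partial n.+1 q01.
move: tot; rewrite sumr_const card_ord -mulr_sumr iter_ps_deriv nmM nm_nat addnS ffactSS natrM -[leRHS]mulr_natl.
set V := nm _ * s ^+ _; set P := M * _ => tot.
have P0 : 0 <= P by rewrite /P !mulr_ge0 // exprn_ge0 // (le_trans ler01).
have t2 : ((n + d) ^_ d)%:R * ((n + d).+1%:R * V) <= ((n + d) ^_ d)%:R * (d.+1%:R * (P * (1 - q)^-1)).
  have -> : ((n + d) ^_ d)%:R * ((n + d).+1%:R * V) = (n + d).+1%:R * ((n + d) ^_ d)%:R * nm (b (n + d).+1) * s ^+ (n + d).+1.
    by rewrite /V; ring.
  apply: le_trans tot _.
  have -> : ((n + d) ^_ d)%:R * (d.+1%:R * (P * (1 - q)^-1)) = d.+1%:R * (((n + d) ^_ d)%:R * P * (1 - q)^-1) by ring.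
  by rewrite ler_wpM2l // ler_wpM2l // mulr_ge0 // ltW.
rewrite ler_pM2l // in t2; apply: le_trans t2 _.
by rewrite /P le_eqVlt; apply/orP; left; apply/eqP; ring.
Qed.

(** A solution of a monic linear equation converges as far as the coefficients do. By [ode_step] the
    term of index [m] is at most [M C / m], where [M] bounds the earlier ones; the bound [M] on the
    first [N >= C] terms therefore persists. *)
Lemma ode_bound (b : nat -> Cplx R) d (A : nat -> nat -> Cplx R) r : 0 < r ->
  (forall i, (i < d)%N -> psrad (A i) r) ->
  (forall n, iter d (@ps_deriv R) b n = - \sum_(i < d) psconv (A i) (iter i (@ps_deriv R) b) n) ->
  psrad b r.
Proof.
move=> r0; case: d => [|d] HA HE.
  move=> s _; exists 0 => n; have := HE n; rewrite big_ord0 oppr0 /= => ->.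
  by rewrite nm0 mul0r.
move=> s /andP[s0 sr].
pose u := (s + r) / 2; have [su ur] : s < u /\ u < r by rewrite /u; split; lra.
have u0 : 0 < u by lra.
have ex (i : 'I_d.+1) : exists M, forall l, nm (A i l) * u ^+ l <= M.
  by apply: HA; [apply: ltn_ord|rewrite u0].
have [f Hf] := choice ex.
pose K := \sum_(i < d.+1) f i.
have f0 i : 0 <= f i by apply: le_trans (Hf i 0%N); rewrite mulr_ge0 ?nm_ge0 ?exprn_ge0 ?(ltW u0).
have K0 : 0 <= K by apply: sumr_ge0.
have HK i l : (i < d.+1)%N -> nm (A i l) * u ^+ l <= K.
  move=> id; apply: le_trans (Hf (Ordinal id) l) _; rewrite /K (bigD1 (Ordinal id)) //= lerDl.
  exact: sumr_ge0.
pose q := s / u.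
have q01 : 0 <= q < 1 by rewrite divr_ge0 ?(ltW s0) ?(ltW u0) //= ltr_pdivrMr // mul1r.
have HA' i l : (i < d.+1)%N -> nm (A i l) * s ^+ l <= K * q ^+ l.
  move=> id; have -> : s ^+ l = u ^+ l * q ^+ l by rewrite -exprMn /q mulrC divfK // gt_eqF.
  by rewrite mulrA ler_wpM2r ?HK // exprn_ge0 //; case/andP: q01.
pose C := d.+1%:R * (K * (1 + s) ^+ d.+1 / (1 - q)).
pose N := maxn d.+1 (Num.truncn `|C|).+1.
have CN : C <= N%:R.
  apply: le_trans (ler_norm _) _; have /andP[_ /ltW h] := truncn_itv (normr_ge0 C).
  by apply: le_trans h _; rewrite ler_nat leq_maxr.
pose M := \sum_(j < N) nm (b j) * s ^+ j.
have M0 : 0 <= M by apply: sumr_ge0 => j _; rewrite mulr_ge0 ?nm_ge0 // exprn_ge0 // ltW.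
exists M; elim/ltn_ind => m IH; have [mN|Nm] := ltnP m N.
  rewrite /M (bigD1 (Ordinal mN)) //= lerDl; apply: sumr_ge0 => j _.
  by rewrite mulr_ge0 ?nm_ge0 // exprn_ge0 // ltW.
have dm : (d.+1 <= m)%N by apply: leq_trans Nm; apply: leq_maxl.
have m0 : 0 < m%:R :> R by rewrite ltr0n; apply: leq_ltn_trans dm.
have HEm := HE (m - d.+1)%N.
have := ode_step s0 q01 K0 M0 HA' HEm; rewrite subnK // => /(_ IH); rewrite -/C => h.
rewrite -(ler_pM2l m0); apply: le_trans h _; rewrite mulrC ler_wpM2r //.
by apply: le_trans CN _; rewrite ler_nat.
Qed.

Lemma generic_ex : generic ((2^-1 +i* 2^-1) : Cplx R).
Proof.
split=> /=; first by rewrite invr_gt0.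
  by rewrite invr_eq0 pnatr_eq0.
by rewrite qfE; field.
Qed.

(** [q(z) - q(s z)] is positive for [s < 1], so [q] is negative on the segment before its end on the
    curve. *)
Lemma notE_seg z s : generic z -> 0 <= s -> s < 1 -> ~ E R (seg 0 z s).
Proof.
case: z => x y [/= x0 y0]; rewrite qfE => q0 s0 s1.
have -> : seg 0 (x +i* y) s = (s * x) +i* (s * y).
  by rewrite /seg add0r subr0; apply/eqP; rewrite eq_complex /=; apply/andP; split; apply/eqP; ring.
have [->|s0'] := eqVneq s 0.
  rewrite !mul0r; move=> [[[v [vE] /andP[v1 v2]]|[v [vE] /andP[v1 v2]]]|[v [w [[vE wE] v0 wv]]]].
  - by lra.
  - have : Num.sqrt (1 : R) < Num.sqrt 2 by rewrite ltr_sqrt //; lra.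
    by rewrite sqrtr1; lra.
  move: wv; rewrite -vE -wE !expr0n /= !mulr0 !subr0 addr0 divr1 => /eqP.
  by rewrite eq_sym oner_eq0.
have sp : 0 < s by rewrite lt0r s0' s0.
have ss : s ^+ 2 < 1 by rewrite expr_lt1.
move/E_qf => /= [|_]; first by rewrite mulf_neq0.
rewrite qfE => q1.
have y2 : 0 < y ^+ 2 by rewrite lt0r expf_eq0 /= y0 sqr_ge0.
have x2 : 0 < x ^+ 2 by rewrite exprn_gt0.
have : (x ^+ 2 + y ^+ 2) * (1 + 2 * x) * (1 - s ^+ 2) + s ^+ 2 * (x ^+ 2 + y ^+ 2) * (2 * x) * (1 - s) = 0.
  by have := congr2 (fun u v => u - v) q0 q1; rewrite /= subrr => <-; ring.
have h1 : 0 < (x ^+ 2 + y ^+ 2) * (1 + 2 * x) * (1 - s ^+ 2).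
  by apply: mulr_gt0; [apply: mulr_gt0|]; lra.
have h2 : 0 <= s ^+ 2 * (x ^+ 2 + y ^+ 2) * (2 * x) * (1 - s).
  apply: mulr_ge0; last by lra.
  by apply: mulr_ge0; [apply: mulr_ge0; [exact: sqr_ge0|lra]|lra].
by lra.
Qed.

Lemma generic_poly (p : {poly Cplx R}) : p != 0 -> exists2 z, generic z & p.[z] != 0.
Proof.
move=> p0; have /dnbhs_nm[r r0 H] := poly_punctured (2^-1 +i* 2^-1) p0.
by have [z [gz zn zr]] := generic_near generic_ex r0; exists z => //; apply: H.
Qed.

Lemma not_D_finite (Phi : Cplx R -> Cplx R) (a : nat -> Cplx R) r : 0 < r -> anal_ball Phi 0 r a ->
  (forall z, ~ E R z -> mero_at Phi z) -> natural_boundary (~` E R) Phi (E0 R) -> ~ D_finite a.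
Proof.
move=> r0 HP mP nb [p [hp HE]].
have [d [dp pd0 pz]] : exists d, [/\ (d < size p)%N, p`_d != 0 & forall i, (d < i)%N -> p`_i = 0].
  have ex : exists d, p`_d != 0 by have /hasP[q /(nthP 0)[i _ <-] q0] := hp; exists i.
  have ub i : p`_i != 0 -> (i <= size p)%N.
    by apply: contraNT; rewrite -ltnNge => /ltnW h; rewrite nth_default.
  case: (ex_maxnP ex ub) => d pd0 dmax; exists d; split=> //.
    by rewrite ltnNge; apply: contra pd0 => h; rewrite nth_default.
  by move=> i di; apply/eqP; apply: contraTT di => /dmax; rewrite -leqNgt.
pose P i : {poly Cplx R} := p`_i.
have HE' n : \sum_(i < d.+1) psconv (fun m => (P i)`_m) (iter i (@ps_deriv R) a) n = 0.
  rewrite -[RHS](HE n).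
  rewrite (big_ord_widen _ (fun i => psconv (fun m => (P i)`_m) (iter i (@ps_deriv R) a) n) dp).
  rewrite big_mkcond; apply: eq_bigr => i _; case: ltnP => // di.
  rewrite /P pz // /ps_polymul big1 // => j _; by rewrite coef0 mul0r.
pose L (w : Cplx R) := \sum_(i < d.+1) (P i).[w] * iter i dz Phi w.
have L0 w : nm w < r -> L w = 0.
  move=> wr; have [_ HL] : anal_ball L 0 r (fun n => \sum_(i < d.+1) psconv (fun m => (P i)`_m) (iter i (@ps_deriv R) a) n).
    apply: (@anal_ball_sum _ (fun i w => (P i).[w] * iter i dz Phi w) 0 r
      (fun i => psconv (fun m => (P i)`_m) (iter i (@ps_deriv R) a))) => i _.
    apply: anal_ballM; last exact: anal_ball_iter_dz.
    by split=> [|u _]; [apply: psrad_poly|rewrite psum_poly subr0].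
  rewrite HL ?subr0 //.
  rewrite /psum (_ : (fun n => _) = fun n => (0 : {poly Cplx R})`_n * w ^+ n).
    by have := psum_poly (0 : {poly Cplx R}) w; rewrite horner0.
  by apply/funext => n; rewrite HE' coef0.
have mL z : ~ E R z -> mero_at L z.
  move=> zE; apply: mero_sum => i; apply: mero_mul; first exact/anal_mero/anal_poly.
  exact/mero_iter_dz/mP.
have [z1 gz1 pz1] := generic_poly pd0.
have /nbhs_nm[rho rho0 Hrho] := anal_nonzero (anal_poly (P d) z1) pz1.
have z1n : 0 < nm z1 by rewrite nm_gt0; case: gz1 => _ /Im_neq0.
pose s0 := 1 - Num.min 1 (rho / (8 * nm z1)).
have [s00 s01 s0r] : [/\ 0 <= s0, s0 < 1 & (1 - s0) * nm z1 <= rho / 8].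
  rewrite /s0 subr_ge0 ge_min lexx; split=> //.
    by rewrite ltrBlDr ltrDl lt_min ltr01 divr_gt0 // mulr_gt0.
  rewrite subKr; apply: le_trans (_ : rho / (8 * nm z1) * nm z1 <= _).
    by rewrite ler_pM2r // ge_min lexx orbT.
  by rewrite le_eqVlt; apply/orP; left; apply/eqP; field; rewrite gt_eqF.
clearbody s0.
have segd s : nm (seg 0 z1 s - z1) = `|s - 1| * nm z1.
  have -> : seg 0 z1 s - z1 = (s - 1)%:C * z1 by rewrite /seg rmorphB rmorph1; ring.
  by rewrite nmM nm_real.
have segE s : 0 <= s -> s < 1 -> ~ E R (seg 0 z1 s) by apply: notE_seg.
(* [Phi] may have a pole at the parameter [s0]; a slight move along the segment avoids it. *)
have [s [s10 s11 s1r an]] : exists s, [/\ 0 <= s, s < 1, (1 - s) * nm z1 <= rho / 8 & anal_at Phi (seg 0 z1 s)].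
  have /dnbhs_nm[e e0 He] := mero_anal_near (mP _ (segE _ s00 s01)).
  pose e' := Num.min ((1 - s0) / 2) (e / (2 * nm z1)).
  have e'0 : 0 < e' by rewrite lt_min !divr_gt0 ?subr_gt0 // mulr_gt0.
  have [e'1 e'2] : e' <= (1 - s0) / 2 /\ e' * nm z1 <= e / 2.
    split; first by rewrite ge_min lexx.
    rewrite -ler_pdivlMr // -mulrA -invfM; by rewrite ge_min lexx orbT.
  clearbody e'; exists (s0 + e'); split; [lra|lra| |].
    by apply: le_trans (_ : (1 - s0) * nm z1 <= _); [rewrite ler_pM2r //; lra|lra].
  have E1 : seg 0 z1 (s0 + e') - seg 0 z1 s0 = e'%:C * z1 by rewrite /seg rmorphD; ring.
  have E2 : nm (seg 0 z1 (s0 + e') - seg 0 z1 s0) = e' * nm z1 by rewrite E1 nmM nm_real gtr0_norm.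
  apply: He; last by rewrite E2; lra.
  by rewrite -subr_eq0 -nm_gt0 E2 mulr_gt0.
pose t0 := seg 0 z1 s; rewrite -/t0 in an.
have t0z : nm (z1 - t0) <= rho / 8.
  by rewrite nmB /t0 segd ler0_norm ?opprB //; lra.
(* [L] is meromorphic off [E] and vanishes around 0; the identity theorem carries the equation along
   the segment, across any poles of [Phi] on it. *)
have Lt0 : \forall w \near t0^', L w = 0.
  apply: (@mero_identity _ (seg 0 t0 @` `[0, 1]) L 0 _ _ _ _ t0).
  - exact: seg_connected.
  - move=> ? [u /= + <-]; rewrite in_itv /= => /andP[u0 u1]; apply: mL.
    rewrite /t0 segM; apply: segE; first by rewrite mulr_ge0.
    by apply: le_lt_trans s11; rewrite ler_piMl.
  - by exists 0; rewrite ?seg0 //= in_itv /= lexx ler01.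
  - by apply/near_dnbhs; apply: near_nm r0 _ => w; rewrite subr0; apply: L0.
  by exists 1; rewrite ?seg1 //= in_itv /= lexx ler01.
have rho2 : 0 < rho / 2 by lra.
have pn w : nm (w - t0) < rho / 2 -> (P d).[w] != 0.
  by move=> wt; apply: Hrho; have := nm_subD w t0 z1; rewrite [nm (t0 - z1)]nmB; lra.
have [Q HQ] := anal_ball_inv_poly rho2 pn.
have [r1 [b [r10 Hb]]] := an.
have exA (i : nat) : exists A, anal_ball (fun w => (P i).[w] * (P d).[w]^-1) t0 (rho / 2) A.
  by have [A HA] := anal_ball_poly (P i) t0 (rho / 2); exists (psconv A Q); apply: anal_ballM.
have [A HA] := choice exA.
have /dnbhs_nm[r2 r20 HL2] := Lt0.
pose r3 := Num.min r1 (Num.min (rho / 2) r2).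
have r30 : 0 < r3 by rewrite !lt_min r10 rho2.
have [r31 r32 r33] : [/\ r3 <= r1, r3 <= rho / 2 & r3 <= r2] by rewrite /r3 !ge_min !lexx !orbT.
have HS := anal_ballD (@anal_ball_sum d (fun i w => (P i).[w] * (P d).[w]^-1 * iter i dz Phi w) t0 r3
  (fun i => psconv (A i) (iter i (@ps_deriv R) b))
  (fun i _ => anal_ballM (anal_ball_le r32 (HA i)) (anal_ball_iter_dz i (anal_ball_le r31 Hb))))
  (anal_ball_iter_dz d (anal_ball_le r31 Hb)).
have HZ := anal_ball_zero r30 HS r30 _.
have {}HZ n : iter d (@ps_deriv R) b n = - \sum_(i < d) psconv (A i) (iter i (@ps_deriv R) b) n.
  apply/eqP; rewrite -addr_eq0 addrC; apply/eqP; apply: HZ => w wt wr.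
  have pw : (P d).[w] != 0 by apply: pn; lra.
  have : L w = 0 by apply: HL2 => //; lra.
  rewrite /L big_ord_recr /= => LW.
  apply: (mulfI pw); rewrite mulr0 -[RHS]LW mulrDr; congr (_ + _).
  rewrite mulr_sumr; apply: eq_bigr => i _.
  by move: (iter i dz Phi w) ((P i).[w]) ((P d).[w]) pw => x y v v0; field.
(* After division by the leading coefficient, the equation is analytic in the disc of radius
   [rho / 2] about [t0], and so is its solution. This disc contains [z1], as [|z1 - t0| <= rho / 8],
   and is the open set [U] that contradicts the natural boundary. *)
have Rb := ode_bound rho2 (fun i _ => (HA i).1) HZ.
pose g (w : Cplx R) := psum b (w - t0).
have Hg : anal_ball g t0 (rho / 2) b by split.
pose U : set (Cplx R) := [set w | nm (w - t0) < rho / 2].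
have oU : open U.
  rewrite openE => w /= wU; rewrite /interior; apply/nbhs_nm.
  exists (rho / 2 - nm (w - t0)); first by rewrite subr_gt0.
  by move=> v; rewrite ltrBrDr; apply: le_lt_trans; apply: nm_subD.
have Uz1 : U z1 by rewrite /U /=; lra.
have Ut0 : U t0 by rewrite /U /= subrr nm0.
have t0E : ~ E R t0 by apply: segE.
apply: (nb z1 _ U t0 oU Uz1 _ _ _).
- by case: gz1 => x0 _ q0; apply: qf_E0; rewrite // ltW.
- by split.
- move=> B /nbhs_nm[e e0 HB].
  pose u := 1 - Num.min (1 - s) (e / (2 * nm z1)).
  have m0 : 0 < Num.min (1 - s) (e / (2 * nm z1)) by rewrite lt_min subr_gt0 s11 divr_gt0 // mulr_gt0.
  have [us u1 ue] : [/\ s <= u, u < 1 & (1 - u) * nm z1 <= e / 2].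
    rewrite /u; split; [|lra|].
      by rewrite lerBrDr -lerBrDl ge_min lexx.
    by rewrite subKr -ler_pdivlMr // -mulrA -invfM ge_min lexx orbT.
  clearbody u; exists (seg 0 z1 u); split; last first.
    by apply: HB; rewrite segd ler0_norm ?opprB; move: ue e0 u1; clear; lra.
  apply: (seg_component (p := t0)) => [|v v01]; first by apply: connected_component_refl; split.
  have [/andP[v0 v1]] := v01.
  have -> : seg t0 (seg 0 z1 u) v = seg 0 z1 (s + v * (u - s)).
    by rewrite /t0 /seg rmorphD rmorphM rmorphB; ring.
  have h1 : 0 <= v * (u - s) by rewrite mulr_ge0 // subr_ge0.
  have h2 : v * (u - s) <= u - s by rewrite ler_piMl // subr_ge0.
  split; last by apply: segE; move: s10 h1 h2 u1; clear; lra.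
  rewrite /U /=; apply: le_lt_trans (nm_subD _ z1 _) _; rewrite segd ler0_norm ?opprB; last by move: h2 u1; clear; lra.
  have : (1 - (s + v * (u - s))) * nm z1 <= (1 - s) * nm z1 by rewrite ler_pM2r //; move: h1; clear; lra.
  by move: s1r t0z rho0; clear; lra.
exists g; split.
  apply: mero_meromorphic => w wU; apply: anal_mero; exact: anal_ball_near Hg wU.
move=> w Vw.
have H1 v : connected_component (U `&` ~` E R) t0 v -> mero_at (fun w => g w + (-1) * Phi w) v.
  move=> /connected_component_sub[Uv Ev]; apply: mero_add; first exact/anal_mero/(anal_ball_near Hg Uv).
  by apply: mero_mul; [apply/anal_mero/anal_cst|apply: mP].
have H2 : \forall v \near t0^', g v + (-1) * Phi v = 0.
  apply/near_dnbhs; apply: near_nm r30 _ => v vr; case: Hb => _ ->; last by lra.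
  by rewrite /g mulN1r subrr.
have H3 : connected_component (U `&` ~` E R) t0 t0 by apply: connected_component_refl; split.
have cV : connected (connected_component (U `&` ~` E R) t0) by apply: component_connected.
have := mero_identity cV H1 H3 H2 Vw; apply: filterS => v /eqP; rewrite mulN1r subr_eq0 => /eqP; exact.
Qed.

End ODE.

(** * NES-walks in a strip *)

Definition vec (w : seq step) : int * int := \sum_(s <- w) step_vec s.
Definition hs (w : seq step) : int := (vec w).2.
Definition xs (w : seq step) : int := (vec w).1.

Lemma vec_nil : vec [::] = 0. Proof. exact: big_nil. Qed.
Lemma vec_cons s w : vec (s :: w) = step_vec s + vec w. Proof. exact: big_cons. Qed.
Lemma vec_cat u w : vec (u ++ w) = vec u + vec w. Proof. exact: big_cat. Qed.
Lemma hs_nil : hs [::] = 0. Proof. by rewrite /hs vec_nil. Qed.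
Lemma hs_cons s w : hs (s :: w) = (step_vec s).2 + hs w. Proof. by rewrite /hs vec_cons. Qed.
Lemma hs_cat u w : hs (u ++ w) = hs u + hs w. Proof. by rewrite /hs vec_cat. Qed.
Lemma xs_nil : xs [::] = 0. Proof. by rewrite /xs vec_nil. Qed.
Lemma xs_cons s w : xs (s :: w) = (step_vec s).1 + xs w. Proof. by rewrite /xs vec_cons. Qed.

Lemma hs_nseq k s : hs (nseq k s) = (step_vec s).2 * k%:Z.
Proof. by elim: k => [|k IH]; rewrite ?hs_nil ?mulr0 // hs_cons IH intS mulrDr mulr1. Qed.

Lemma heightE w i : height w i = hs (take i w). Proof. by []. Qed.
Lemma height0 w : height w 0 = 0. Proof. by rewrite heightE take0 hs_nil. Qed.
Lemma height_size w : height w (size w) = hs w. Proof. by rewrite heightE take_size. Qed.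

Lemma step_eqE (s t : step) : (s == t) =
  match s, t with North, North | East, East | South, South | West, West => true | _, _ => false end.
Proof. by apply/eqP; case: s; case: t. Qed.

Lemma split3 (w : seq step) i j : (i < j)%N -> w = take i w ++ drop i (take j w) ++ drop j w.
Proof. by move=> ij; rewrite catA -{1}(take_takel w (ltnW ij)) cat_take_drop cat_take_drop. Qed.

Lemma split3_neq0 (w : seq step) i j : (i < j)%N -> (j < (size w).+1)%N -> drop i (take j w) != [::].
Proof. by move=> ij jw; rewrite -size_eq0 size_drop size_takel // -lt0n subn_gt0. Qed.

Lemma saP w : self_avoiding w <-> forall a u b, w = a ++ u ++ b -> u != [::] -> vec u != 0.
Proof.
rewrite /self_avoiding; have -> : [seq vertex w i | i <- iota 0 (size w).+1] = mkseq (vertex w) (size w).+1 by [].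
split=> [/mkseq_uniqP H a u b wE u0|H].
  apply: contra_neq u0 => vu; have := H (size a) (size (a ++ u)).
  rewrite !inE wE !size_cat => /(_ _ _ _)/eqP.
  rewrite -[X in X == _]addn0 eqn_add2l eq_sym size_eq0 => E0; apply/eqP/E0; [lia|lia|].
  by rewrite /vertex take_size_cat // catA -size_cat take_size_cat // -!/(vec _) vec_cat vu addr0.
have key i j : (i < j)%N -> (j < (size w).+1)%N -> vertex w i <> vertex w j.
  move=> ij jw E0; have /eqP := H (take i w) (drop i (take j w)) (drop j w) (split3 w ij) (split3_neq0 ij jw); apply.
  have := vec_cat (take i (take j w)) (drop i (take j w)); rewrite cat_take_drop (take_takel w (ltnW ij)).
  have -> : vec (take i w) = vec (take j w) by exact: E0.
  by move/eqP; rewrite -[X in X == _]addr0 (inj_eq (addrI _)) eq_sym => /eqP.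
apply/mkseq_uniqP => i j; rewrite !inE => iw jw E0.
by have [ij|ij|//] := ltngtP i j; [case: (key i j)|case: (key j i)].
Qed.

Lemma sa_infix a u b : self_avoiding (a ++ u ++ b) -> self_avoiding u.
Proof.
move=> /saP H; apply/saP => a' u' b' uE; apply: (H (a ++ a') u' (b' ++ b)).
by rewrite uE -!catA.
Qed.

Lemma sa_take m w : self_avoiding w -> self_avoiding (take m w).
Proof. by rewrite -{1}(cat_take_drop m w) -[_ ++ _]/([::] ++ _); apply: sa_infix. Qed.

Lemma sa_drop m w : self_avoiding w -> self_avoiding (drop m w).
Proof. by rewrite -{1}(cat_take_drop m w) => h; apply: (@sa_infix (take m w) _ [::]); rewrite cats0. Qed.

Lemma bridgeP w : bridge w <-> self_avoiding w /\
  forall a b, w = a ++ b -> b != [::] -> 0 <= hs a < hs w.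
Proof.
rewrite /bridge; split=> [/andP[sw /forallP H]|[sw H]].
  split=> // a b wE b0.
  have aw : (size a < size w)%N by rewrite wE size_cat -addn1 leq_add2l lt0n size_eq0.
  have h1 : height w (size a) = hs a by rewrite heightE wE take_size_cat.
  by have := H (Ordinal aw); rewrite height0 height_size /= h1.
rewrite sw; apply/forallP => i; rewrite height0 height_size heightE.
apply: (H _ (drop i w)); first by rewrite cat_take_drop.
by rewrite -size_eq0 size_drop -lt0n subn_gt0.
Qed.

Lemma pseudo_bridgeP w : pseudo_bridge w <-> self_avoiding w /\
  forall a b, w = a ++ b -> 0 <= hs a <= hs w.
Proof.
rewrite /pseudo_bridge; split=> [/andP[sw /forallP H]|[sw H]].
  split=> // a b wE.
  have aw : (size a < (size w).+1)%N by rewrite wE size_cat ltnS leq_addr.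
  have h1 : height w (size a) = hs a by rewrite heightE wE take_size_cat.
  by have := H (Ordinal aw); rewrite height0 height_size /= h1.
rewrite sw; apply/forallP => i; rewrite height0 height_size heightE.
by apply: (H _ (drop i w)); rewrite cat_take_drop.
Qed.

Lemma weakly_directedP w : weakly_directed w <-> self_avoiding w /\
  forall a u b, w = a ++ u ++ b -> u != [::] -> hs u = 0 -> exists s, s \notin u.
Proof.
rewrite /weakly_directed; split=> [/andP[sw /forallP H]|[sw H]].
  split=> // a u b wE u0 hu.
  have i1 : (size a < (size w).+1)%N by rewrite wE size_cat ltnS leq_addr.
  have j1 : (size (a ++ u) < (size w).+1)%N by rewrite wE catA [size (_ ++ b)]size_cat ltnS leq_addr.
  have := H (Ordinal i1) => /forallP/(_ (Ordinal j1)) /=.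
  rewrite !heightE {1}wE take_size_cat // {1}wE catA take_size_cat // hs_cat hu addr0 eqxx andbT.
  rewrite size_cat -[X in (X < _)%N]addn0 ltn_add2l lt0n size_eq0 u0 /= => /existsP[s].
  by rewrite -size_cat wE catA take_size_cat // drop_size_cat //; exists s.
rewrite sw; apply/forallP => i; apply/forallP => j; apply/implyP => /andP[ij /eqP hij].
have jw : (j <= size w)%N by rewrite -ltnS.
apply/existsP; apply: (H (take i w) _ (drop j w) (split3 w ij) (split3_neq0 ij jw)).
have := hs_cat (take i (take j w)) (drop i (take j w)); rewrite cat_take_drop (take_takel w (ltnW ij)).
by rewrite !heightE in hij; rewrite -hij => /eqP; rewrite -[X in X == _]addr0 (inj_eq (addrI _)) eq_sym => /eqP.
Qed.

Definition turn_ok (x y : step) : bool := step_vec x + step_vec y != 0.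

Lemma path_split (r : rel step) x w : ~~ path r x w ->
  exists a y z b, x :: w = a ++ y :: z :: b /\ ~~ r y z.
Proof.
elim: w x => [//|y w IH] x /=; rewrite negb_and => /orP[h|/IH[a [y' [z [b [E h]]]]]].
  by exists [::], x, y, w.
by exists (x :: a), y', z, b; rewrite E.
Qed.

Lemma sa_path s w : self_avoiding (s :: w) -> path turn_ok s w.
Proof.
move=> /saP H; apply: contraT => /path_split[a [y [z [b [E h]]]]].
have := H a [:: y; z] b; rewrite E => /(_ erefl isT).
by rewrite !vec_cons vec_nil addr0 => h2; move: h; rewrite /turn_ok h2.
Qed.

Lemma turn_vertical s t : turn_ok s t -> s \in [:: North; South] -> t \in [:: North; South] -> t = s.
Proof. by rewrite !inE !step_eqE; case: s; case: t. Qed.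

Lemma vertical_run s w : path turn_ok s w -> all (mem [:: North; South]) (s :: w) ->
  s :: w = nseq (size w).+1 s.
Proof.
elim: w s => [//|t w IH] s /= /andP[st tw] /and3P[sv tv wv].
have ts : t = s by apply: turn_vertical.
by rewrite -{2}ts (IH t) ?ts //= -?ts ?tv.
Qed.

(** The abscissa never decreases, so a closed factor has no E step; without reversal it is then a
    straight vertical run, of nonzero height. A path starting from [East] allows any of the three
    directions as first step. *)
Lemma nes_saP w : all (mem [:: North; East; South]) w ->
  self_avoiding w = path turn_ok East w.
Proof.
move=> aw; apply/idP/idP => [sw|pw].
  case: w aw sw => [//|s w] /= /andP[sN _] /sa_path ->; rewrite andbT.
  by move: sN; rewrite !inE !step_eqE; case: s.
apply/saP => a u b wE u0; move: pw aw; rewrite wE !cat_path !all_cat => /and3P[_ pu _] /and3P[_ au _].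
case: u u0 pu au {wE} => [//|s u] _ /= /andP[_ pu] /andP[sv uv].
apply/eqP => v0.
have xge v : all (mem [:: North; East; South]) v -> 0 <= xs v /\ (xs v = 0 -> all (mem [:: North; South]) v).
  elim: v => [|t v IH] /=; first by rewrite xs_nil.
  move=> /andP[tv /IH[x0 x1]]; rewrite xs_cons; split; first by move: tv; rewrite !inE !step_eqE; case: t => //= _; lia.
  by move: tv; rewrite !inE !step_eqE; case: t => //= _ h; [apply: x1; lia|lia|apply: x1; lia].
have [_ h] := xge (s :: u) (introT andP (conj sv uv)).
have {}h := h (congr1 fst v0).
have := hs_nseq (size u).+1 s; rewrite -(vertical_run pu h) /hs v0 /=.
by move: h => /= /andP[+ _]; rewrite !inE !step_eqE; case: (s) => //=; lia.
Qed.

(* The walk [w], preceded by a step [p] ending at height [i], is a NES-walk in the strip [0..k] that ends at height [k]. *)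
Fixpoint run k (p : step) i (w : seq step) : bool :=
  if w is s :: w' then
    match s with
    | North => [&& p != South, (i < k)%N & run k North i.+1 w']
    | East => run k East i w'
    | South => [&& p != North, (0 < i)%N & run k South i.-1 w']
    | West => false
    end
  else i == k.

Lemma runP k p i w : (i <= k)%N -> p != West ->
  run k p i w <-> [/\ all (mem [:: North; East; South]) w, path turn_ok p w,
    forall a b, w = a ++ b -> 0 <= i%:Z + hs a <= k%:Z & i%:Z + hs w = k%:Z].
Proof.
elim: w p i => [|s w IH] p i ik pW /=.
  split=> [/eqP ->|[_ _ _]]; last by rewrite hs_nil addr0 => /eqP.
  by split=> //; [case=> // b _|]; rewrite hs_nil addr0 // lexx andbT.
have split_cons (P : seq step -> Prop) : P [::] -> (forall a b, w = a ++ b -> P (s :: a)) ->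
   forall a b, s :: w = a ++ b -> P a.
  by move=> P0 Ps [//|t a] b [<- /Ps].
have Hi : 0 <= i%:Z + hs [::] <= k%:Z by rewrite hs_nil addr0; lia.
have shift j : (forall a, i%:Z + hs (s :: a) = j%:Z + hs a) -> turn_ok p s -> s != West ->
   (j <= k)%N -> run k s j w <-> [/\ (s \in [:: North; East; South]) && all (mem [:: North; East; South]) w,
    turn_ok p s && path turn_ok s w,
    forall a b, s :: w = a ++ b -> 0 <= i%:Z + hs a <= k%:Z & i%:Z + hs (s :: w) = k%:Z].
  move=> hj ps sW jk; rewrite (IH s j) //; have sN : s \in [:: North; East; South] by move: sW; rewrite !inE !step_eqE; case: (s).
  rewrite ps sN hj /=; split=> -[h1 h2 H h3]; split=> //.
    by apply: split_cons => // a b; rewrite hj; apply: H.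
  by move=> a b wE; rewrite -hj; apply: (H _ b); rewrite wE.
case: s split_cons shift => split_cons shift.
- have [->|pS] := eqVneq p South; first by split=> [//|[_]].
  have [ik'|ki] := ltnP i k; last first.
    split=> [//|[_ _ /(_ [:: North] w erefl) + _]].
    by rewrite hs_cons hs_nil /=; lia.
  rewrite /= shift ?step_eqE //; first by move=> a; rewrite hs_cons /=; lia.
  by move: pS pW; rewrite !step_eqE; case: (p).
- rewrite shift ?step_eqE //; first by move=> a; rewrite hs_cons /=; lia.
  by move: pW; rewrite !step_eqE; case: (p).
- have [->|pN] := eqVneq p North; first by split=> [//|[_]].
  have [i0|i0] := posnP i.
    rewrite i0; split=> [//|[_ _ /(_ [:: South] w erefl) + _]].
    by rewrite hs_cons hs_nil /=; lia.
  rewrite /= shift ?step_eqE //; [|by move: pN pW; rewrite !step_eqE; case: (p)|by lia].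
  by move=> a; rewrite hs_cons /=; lia.
by rewrite !inE !step_eqE; split=> [//|[]].
Qed.

Lemma nes_pseudo_bridge_run k w :
  [&& nes_walk w, pseudo_bridge w & height w (size w) - height w 0 == k%:Z] = run k East 0 w.
Proof.
rewrite height0 height_size subr0; apply/idP/idP.
  move=> /and3P[/andP[sw aw] /pseudo_bridgeP[_ H] /eqP hk]; apply/runP; rewrite ?step_eqE //; split=> //.
  - by rewrite -nes_saP.
  - by move=> a b wE; rewrite add0r -hk; apply: H wE.
  by rewrite add0r.
move=> /runP[]; rewrite ?step_eqE // => aw pw H; rewrite add0r => hk.
have sw : self_avoiding w by rewrite nes_saP.
apply/and3P; split; [by rewrite /nes_walk sw aw| |exact/eqP].
by apply/pseudo_bridgeP; split=> // a b /H; rewrite add0r hk.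
Qed.

(** Sums over words are computed by recursion on the first letter, which turns decompositions of
    walks by their first step, or by a prefix of given length, into plain rewriting. *)
Fixpoint wsum n (f : seq step -> nat) : nat :=
  if n is m.+1 then
    (wsum m (fun u => f (North :: u)) + wsum m (fun u => f (East :: u)) +
     (wsum m (fun u => f (South :: u)) + wsum m (fun u => f (West :: u))))%N
  else f [::].

Lemma big_step (F : step -> nat) :
  (\sum_(s : step) F s = F North + F East + (F South + F West))%N.
Proof.
rewrite (bigD1 North) //= (bigD1 East) ?step_eqE //= (bigD1 South) ?step_eqE //=.
rewrite (bigD1 West) ?step_eqE //= big1 => [|s]; first by rewrite addn0 !addnA.
by rewrite !step_eqE; case: s.
Qed.

Lemma wsum_tuple n (f : seq step -> nat) : (\sum_(w : n.-tuple step) f w = wsum n f)%N.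
Proof.
elim: n f => [|n IH] f /=.
  rewrite (big_pred1 [tuple]) // => w; apply/esym/eqP/val_inj; by case/tupleP: w || rewrite tuple0.
rewrite -!IH -(big_step (fun s => \sum_(w : n.-tuple step) f (s :: w))%N) pair_big /=.
rewrite (reindex (fun p : step * n.-tuple step => [tuple of p.1 :: p.2])) //.
exists (fun w : n.+1.-tuple step => (thead w, [tuple of behead w])) => [[s w] _|w _] /=.
  by rewrite theadE; congr pair; apply: val_inj.
by rewrite -tuple_eta.
Qed.

Lemma card_wsum n (P : pred (seq step)) : #|[pred w : n.-tuple step | P w]| = wsum n P.
Proof. by rewrite -wsum_tuple -sum1_card big_mkcond; apply: eq_bigr => w _; rewrite inE; case: (P w). Qed.

Lemma eq_wsum n f g : (forall w, size w = n -> f w = g w) -> wsum n f = wsum n g.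
Proof.
elim: n f g => [|n IH] f g H; first exact: H.
by rewrite /=; congr (_ + _ + (_ + _))%N; apply: IH => w wn; apply: H; rewrite /= wn.
Qed.

Lemma wsum0 n : wsum n (fun=> 0%N) = 0%N.
Proof. by elim: n => //= n ->. Qed.

Lemma wsumD n f g : wsum n (fun w => f w + g w)%N = (wsum n f + wsum n g)%N.
Proof. by elim: n f g => [//|n IH] f g /=; rewrite !IH; lia. Qed.

Lemma wsumZ n c f : wsum n (fun w => c * f w)%N = (c * wsum n f)%N.
Proof. by elim: n f => [//|n IH] f /=; rewrite !IH !mulnDr. Qed.

Lemma wsum_sum n (I : Type) (r : seq I) (F : I -> seq step -> nat) :
  wsum n (fun w => \sum_(i <- r) F i w)%N = (\sum_(i <- r) wsum n (F i))%N.
Proof.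
elim: r => [|i r IH].
  by rewrite big_nil (@eq_wsum _ _ (fun=> 0%N)) ?wsum0 // => w _; rewrite big_nil.
by rewrite big_cons -IH -wsumD; apply: eq_wsum => w _; rewrite big_cons.
Qed.

Lemma wsum_cat m p f : wsum (m + p) f = wsum m (fun u => wsum p (fun v => f (u ++ v))).
Proof. by elim: m f => [//|m IH] f /=; rewrite !IH. Qed.

Lemma wsum_le n f : (forall w, f w <= 1)%N -> (wsum n f <= 4 ^ n)%N.
Proof.
elim: n f => [|n IH] f H /=; first exact: H.
by rewrite expnS; have := IH _ (fun u => H (North :: u)); have := IH _ (fun u => H (East :: u));
  have := IH _ (fun u => H (South :: u)); have := IH _ (fun u => H (West :: u)); lia.
Qed.

Definition run_count k p i n := wsum n (fun w => run k p i w).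

Lemma run_countS k p i n : run_count k p i n.+1 = (((p != South) && (i < k)) * run_count k North i.+1 n + run_count k East i n +
  ((p != North) && (0 < i)) * run_count k South i.-1 n)%N.
Proof.
rewrite /run_count /= wsum0 addn0 -!wsumZ; congr (_ + _ + _)%N; apply: eq_wsum => w _.
  by case: (p != South); case: (i < k)%N; case: (run _ _ _ _).
by case: (p != North); case: (0 < i)%N; case: (run _ _ _ _).
Qed.

Lemma run_count_le k p i n : (run_count k p i n <= 4 ^ n)%N.
Proof. by apply: wsum_le => w; case: (run _ _ _ _). Qed.

Lemma run_count_small k n : (n < k)%N -> run_count k East 0 n = 0%N.
Proof.
move=> nk; rewrite -(wsum0 n); apply: eq_wsum => w wn.
suff: ~~ run k East 0 w by case: (run _ _ _ _).
apply/negP => /runP[]; rewrite ?step_eqE // => _ _ _; rewrite add0r => hk.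
have : hs w <= (size w)%:Z.
  by elim: (w) => [|s u IH]; rewrite ?hs_nil // hs_cons /=; case: s => /=; lia.
by rewrite wn hk; lia.
Qed.

Lemma nes_pseudo_bridgesE n : nes_pseudo_bridges n = (\sum_(k < n.+1) run_count k East 0 n)%N.
Proof.
apply: eq_bigr => k _; rewrite /nes_pseudo_bridges_of_height.
rewrite (card_wsum n (fun w => [&& nes_walk w, pseudo_bridge w & height w (size w) - height w 0 == k%:Z])).
by apply: eq_wsum => w _; rewrite nes_pseudo_bridge_run.
Qed.

(** * The transfer system for a strip *)

Section Strip.
Context {R : realType}.
Implicit Types (z : Cplx R) (k i n : nat).

Lemma psrad_count (c : nat -> nat) : (forall n, c n <= 4 ^ n)%N -> psrad (gf R c) (4^-1 : R).
Proof.
move=> H; apply: psrad_const; first by rewrite invr_gt0.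
exists 1 => n; rewrite /gf nm_nat exprVn ler_pdivrMr ?exprn_gt0 // mul1r -natrX ler_nat; exact: H.
Qed.

Definition run_series k p i z : Cplx R := psum (gf R (run_count k p i)) z.

Lemma psum_rec (c : nat -> nat) z : (forall n, c n <= 4 ^ n)%N -> nm z < 4^-1 ->
  psum (gf R c) z = (c 0%N)%:R + z * psum (gf R (fun n => c n.+1)) z.
Proof.
move=> H zr; rewrite (psum_split 1 (psrad_count H) zr) big_ord1 expr0 mulr1 expr1.
by congr (_ + _ * psum _ _).
Qed.

Lemma run_series_rec k p i z : nm z < 4^-1 -> run_series k p i z = (i == k)%:R +
  z * (((p != South) && (i < k)%N)%:R * run_series k North i.+1 z + run_series k East i z +
       ((p != North) && (0 < i)%N)%:R * run_series k South i.-1 z).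
Proof.
move=> zr; have rd q j := psrad_count (run_count_le k q j).
rewrite {1}/run_series psum_rec //; last exact: run_count_le.
congr (_ + _ * _); rewrite /run_series.
rewrite -!(psumZ _ (rd _ _) zr) -(psumD (psradZ _ (rd _ _)) (rd _ _) zr).
rewrite -(psumD (psradD (psradZ _ (rd _ _)) (rd _ _)) (psradZ _ (rd _ _)) zr).
by congr (psum _ _); apply/funext => n; rewrite /gf run_countS !natrD !natrM.
Qed.

(** The three series at height [i], multiplied by [z^i], as multiples of the unknown at the starting
    point. The first component is [G], with its index shifted by one. *)
Fixpoint strip z i : Cplx R * Cplx R * Cplx R :=
  if i is j.+1 then
    let: (n, e, s) := strip z j in
    let n' := n - z * e in let e' := n' + z ^+ 2 * s in (n', e', z * e' + z ^+ 2 * s)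
  else (1, 1, z).

Lemma strip_G z k : (strip z k.+1).1.1 = G k z.
Proof.
suff H : (strip z k.+1).1.1 = G k z /\ (strip z k.+2).1.1 = G k.+1 z by case: H.
elim: k => [|k [IH1 IH2]]; first by rewrite G0 G1 /=; split; ring.
split=> //; rewrite GSS -IH1 -IH2 /=.
by case: (strip z k) => [[n e] s] /=; ring.
Qed.

(* The equation of the system at height [i] gives the unknowns at height [i + 1] in terms of those at height [i]. *)
Lemma strip_sol k z i : nm z < 4^-1 -> (i <= k)%N ->
  let x := run_series k East 0 z in
  [/\ z ^+ i * run_series k North i z = (strip z i).1.1 * x,
      z ^+ i * run_series k East i z = (strip z i).1.2 * x &
      (i < k)%N -> z ^+ i * run_series k South i z = (strip z i).2 * x].
Proof.
move=> zr ik x; elim: i ik => [|i IH] ik.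
  have EN : run_series k North 0 z = x.
    by rewrite /x run_series_rec // [RHS]run_series_rec // !step_eqE.
  rewrite !expr0 !mul1r EN /=; split=> // k0.
  rewrite run_series_rec // !step_eqE /= -/x; move: (k0); rewrite lt0n eq_sym => /negPf ->.
  by rewrite !mul0r !add0r addr0.
have [h1 h2 h3] := IH (ltnW ik); move: h3 => /(_ ik) h3.
have nE := run_series_rec k North i zr; have ne : (i == k) = false by rewrite ltn_eqF.
rewrite ne !step_eqE ik /= mul1r mul0r add0r addr0 in nE.
have EE : run_series k East i.+1 z = run_series k North i.+1 z + z * run_series k South i z.
  by rewrite [LHS]run_series_rec // [run_series k North _ _ in RHS]run_series_rec // !step_eqE /= !mul1r mul0r; ring.
rewrite [strip z i.+1]/=; case: (strip z i) h1 h2 h3 => [[n' e'] s'] /= h1 h2 h3.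
have hn : z ^+ i.+1 * run_series k North i.+1 z = (n' - z * e') * x.
  rewrite mulrBl -h1 -mulrA -h2 nE exprS; ring.
have he : z ^+ i.+1 * run_series k East i.+1 z = (n' - z * e' + z ^+ 2 * s') * x.
  by rewrite EE mulrDr hn [RHS]mulrDl -mulrA -h3 exprS; ring.
split=> // ik'; rewrite run_series_rec // !step_eqE /= ltn_eqF // mul0r !add0r mul1r.
rewrite [RHS]mulrDl -[z * _ * x]mulrA -he -mulrA -h3 -/(run_series _ _ _ _) exprS.
by move: (run_series k East i.+1 z) => v; ring.
Qed.

(** At the top height there is no upward step and the empty walk contributes 1: this equation closes
    the system and determines the unknown at the starting point. *)
Lemma strip_total k z : nm z < 4^-1 -> G k z * run_series k East 0 z = z ^+ k.
Proof.
move=> zr; have [h1 h2 _] := strip_sol zr (leqnn k).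
rewrite run_series_rec // eqxx ltnn !step_eqE /= in h1.
rewrite -strip_G /=; case: (strip z k) h1 h2 => [[n e] s] /= h1 h2.
rewrite mulrBl -h1 -mulrA -h2; ring.
Qed.

Lemma G_small k z : nm z < 4^-1 -> G k z != 0.
Proof.
move=> zr; apply/eqP => g0; have := strip_total k zr; rewrite g0 mul0r => /esym/eqP.
rewrite expf_eq0 => /andP[_ /eqP z0]; move: g0; rewrite z0 G_at0 => /eqP.
by rewrite oner_eq0.
Qed.

Lemma strip_fk k z : nm z < 4^-1 -> run_series k East 0 z = fk k z.
Proof.
move=> zr; have g0 := G_small k zr.
by apply: (mulfI g0); rewrite strip_total // /fk mulrC divfK.
Qed.

(** For [|z| < 1/16] the terms of length [n] are at most [4^-n], and they vanish for [k > n]; they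
    are thus bounded by [2^-n 2^-k], which allows the exchange of the sums over lengths and
    heights. *)
Lemma nes_sums z : nm z < 16^-1 -> sums (fun n => gf R nes_pseudo_bridges n * z ^+ n) (Fser z).
Proof.
move=> zr; have z4 : nm z < 4^-1 by lra.
pose y (n k : nat) : Cplx R := (run_count k East 0 n)%:R * z ^+ n.
have h01 : 0 <= (2^-1 : R) < 1 by apply/andP; split; lra.
have yb n k : nm (y n k) <= 1 * 2^-1 ^+ n * 2^-1 ^+ k.
  rewrite mul1r -exprD; have [nk|kn] := ltnP n k.
    by rewrite /y run_count_small // mul0r nm0 exprn_ge0 // invr_ge0.
  rewrite /y nmM nm_nat nmX.
  apply: (@le_trans _ _ ((4 ^ n)%:R * (16^-1) ^+ n)).
    apply: ler_pM; rewrite ?ler0n ?exprn_ge0 ?nm_ge0 ?ler_nat ?run_count_le //.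
    by apply: lerXn2r; rewrite ?nnegrE ?nm_ge0 ?invr_ge0 // ltW.
  rewrite natrX -exprMn (_ : 4%:R / 16 = 2^-1 ^+ 2 :> R); last by field.
  rewrite -exprM; apply: ler_wiXn2l; [lra|lra|].
  by rewrite mul2n -addnn leq_add2l.
have := csum_exchange h01 h01 yb.
have -> : (fun n => csum (y n)) = fun n => gf R nes_pseudo_bridges n * z ^+ n.
  apply/funext => n; apply: sums_csum.
  rewrite /gf nes_pseudo_bridgesE natr_sum mulr_suml.
  apply: (@sums_fin _ (y n) n.+1) => k nk.
  by rewrite /y run_count_small // mul0r.
rewrite (_ : csum _ = Fser z) //; congr csum; apply/funext => k.
by rewrite -strip_fk.
Qed.

End Strip.

(** * Factorization of bridges *)

Lemma saI w : self_avoiding w <->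
  forall i j, (i < j)%N -> (j <= size w)%N -> vec (take i w) <> vec (take j w).
Proof.
split=> [/saP H i j ij jw E0|H].
  have /eqP := H _ _ _ (split3 w ij) (split3_neq0 ij jw); apply.
  have := vec_cat (take i (take j w)) (drop i (take j w)); rewrite cat_take_drop (take_takel w (ltnW ij)) E0.
  by move/eqP; rewrite -[X in X == _]addr0 (inj_eq (addrI _)) eq_sym => /eqP.
apply/saP => a u b wE u0; apply/eqP => vu.
have u1 : (0 < size u)%N by rewrite lt0n size_eq0.
have T1 : take (size a) w = a by rewrite wE take_size_cat.
have T2 : take (size (a ++ u)) w = a ++ u by rewrite wE catA take_size_cat.
apply: (H (size a) (size (a ++ u))).
- by rewrite size_cat; lia.
- by rewrite wE !size_cat; lia.
by rewrite T1 T2 vec_cat vu addr0.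
Qed.

Lemma bridgeI w : bridge w <-> self_avoiding w /\
  forall i, (i < size w)%N -> 0 <= hs (take i w) < hs w.
Proof.
rewrite bridgeP; split=> -[sw H]; split=> //.
  move=> i iw; apply: (H _ (drop i w)); first by rewrite cat_take_drop.
  by rewrite -size_eq0 size_drop -lt0n subn_gt0.
move=> a b wE b0; have T1 : take (size a) w = a by rewrite wE take_size_cat.
have := H (size a); rewrite T1; apply.
by rewrite wE size_cat -[X in (X < _)%N]addn0 ltn_add2l lt0n size_eq0.
Qed.

Lemma weakly_directedI w : weakly_directed w <-> self_avoiding w /\
  forall i j, (i < j)%N -> (j <= size w)%N -> hs (take i w) = hs (take j w) ->
    exists s, s \notin drop i (take j w).
Proof.
rewrite weakly_directedP; split=> -[sw H]; split=> //.
  move=> i j ij jw hij; apply: (H _ _ _ (split3 w ij) (split3_neq0 ij jw)).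
  have := hs_cat (take i (take j w)) (drop i (take j w)); rewrite cat_take_drop (take_takel w (ltnW ij)).
  by lia.
move=> a u b wE u0 hu; have u1 : (0 < size u)%N by rewrite lt0n size_eq0.
have T1 : take (size a) w = a by rewrite wE take_size_cat.
have T2 : take (size (a ++ u)) w = a ++ u by rewrite wE catA take_size_cat.
have := H (size a) (size (a ++ u)); rewrite T1 T2 drop_size_cat //; apply.
- by rewrite size_cat; lia.
- by rewrite wE !size_cat; lia.
by rewrite hs_cat hu addr0.
Qed.

Lemma bridge_nil : bridge [::].
Proof. by apply/bridgeI; split=> //; apply/saI => i j ij; rewrite leqn0 => /eqP j0; rewrite j0 in ij. Qed.

Lemma bridge_sa w : bridge w -> self_avoiding w.
Proof. by case/andP. Qed.

Lemma bridge_bound w i : bridge w -> 0 <= hs (take i w) <= hs w.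
Proof.
move=> /bridgeI[_ H]; have h0 : 0 <= hs w.
  by case: (w) H => [|s u]; [rewrite hs_nil|move=> /(_ 0%N isT); rewrite take0 hs_nil => /andP[_ /ltW]].
have [iw|wi] := ltnP i (size w); first by case/andP: (H i iw) => -> /ltW.
by rewrite take_oversize // h0 lexx.
Qed.

Lemma bridge_lt w i : bridge w -> (i < size w)%N -> hs (take i w) < hs w.
Proof. by move=> /bridgeI[_ H] /H/andP[]. Qed.

Lemma bridge_cat u v : bridge u -> bridge v -> bridge (u ++ v).
Proof.
move=> bu bv; apply/bridgeI; split.
  apply/saI => i j ij; rewrite size_cat => jw; rewrite !take_cat.
  case: ltnP => iu; case: ltnP => ju.
  - by have /saI H := bridge_sa bu; apply: H => //; apply: ltnW.
  - move=> /(congr1 snd); rewrite -!/(hs _) hs_cat.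
    by have := bridge_lt bu iu; have := bridge_bound (j - size u) bv; lia.
  - by lia.
  have /saI H := bridge_sa bv; rewrite !vec_cat => /addrI; apply: H; lia.
move=> i; rewrite size_cat => iw; rewrite take_cat; case: ltnP => iu; rewrite !hs_cat.
  by have := bridge_bound i bu; have := bridge_lt bu iu; have := bridge_bound 0 bv; rewrite take0 hs_nil; lia.
have iv : (i - size u < size v)%N by lia.
have := bridge_bound 0 bu; rewrite take0 hs_nil.
by have := bridge_lt bv iv; have := bridge_bound (i - size u) bv; lia.
Qed.

Lemma hs_take_drop w m i : hs (take i (drop m w)) = hs (take (m + i) w) - hs (take m w).
Proof. by rewrite takeD hs_cat; lia. Qed.

Lemma bridge_cut w m : bridge w -> (m <= size w)%N ->
  (forall i, (i < m)%N -> hs (take i w) < hs (take m w)) ->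
  (forall j, (m <= j)%N -> hs (take m w) <= hs (take j w)) ->
  bridge (take m w) && bridge (drop m w).
Proof.
move=> bw mw H1 H2; apply/andP; split; apply/bridgeI; split.
- exact/sa_take/bridge_sa.
- move=> i; rewrite size_takel // => im; rewrite take_takel ?(ltnW im) // H1 // andbT.
  by have /andP[] := bridge_bound i bw.
- exact/sa_drop/bridge_sa.
move=> i; rewrite size_drop => im; rewrite hs_take_drop.
have -> : hs (drop m w) = hs w - hs (take m w) by rewrite -{2}(cat_take_drop m w) hs_cat; lia.
have iw : (m + i < size w)%N by lia.
by have := bridge_lt bw iw; have := H2 (m + i)%N (leq_addr _ _); lia.
Qed.

Lemma cut_take w m i : bridge (take m w) -> (m <= size w)%N -> (i < m)%N -> hs (take i w) < hs (take m w).
Proof.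
move=> b mw im; have := bridge_lt b (i := i); rewrite size_takel // => /(_ im).
by rewrite take_takel // ltnW.
Qed.

Lemma cut_drop w m j : bridge (drop m w) -> (m <= j)%N -> hs (take m w) <= hs (take j w).
Proof.
move=> b mj; have /andP[+ _] := bridge_bound (j - m) b.
by rewrite hs_take_drop subnKC // subr_ge0.
Qed.

Definition irr w := [&& w != [::], bridge w &
  [forall m : 'I_(size w), (0 < m)%N ==> ~~ (bridge (take m w) && bridge (drop m w))]].

Lemma irr_bridge w : irr w -> bridge w. Proof. by case/and3P. Qed.

Lemma irr_cut w m : irr w -> (0 < m)%N -> (m < size w)%N -> ~~ (bridge (take m w) && bridge (drop m w)).
Proof. by case/and3P=> _ _ /forallP H m0 mw; have := H (Ordinal mw); rewrite /= m0. Qed.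

(** The factorization is carried out once, for any property that a concatenation of bridges has
    exactly when both factors have it; it is applied to NES and to weakly directed bridges. *)
Definition bridge_morph (K : pred (seq step)) :=
  forall u v, bridge u -> bridge v -> K (u ++ v) = K u && K v.

(** The smallest position at which the bridge splits gives an irreducible first factor; the prefix
    at any later position would itself split at the smallest one. Exactly one term of the sum is
    therefore 1. *)
Lemma factor_count (K : pred (seq step)) w : bridge_morph K -> w != [::] ->
  ((bridge w && K w) : nat) = (\sum_(m < (size w).+1)
     (irr (take m w) && K (take m w)) * (bridge (drop m w) && K (drop m w)))%N.
Proof.
move=> KM w0; have [/andP[bw Kw]|nb] := boolP (bridge w && K w); last first.
  rewrite big1 // => m _; case: (boolP (irr _ && _)) => // /andP[/irr_bridge b1 k1].
  case: (boolP (bridge (drop m w) && _)) => // /andP[b2 k2].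
  by case/negP: nb; rewrite -(cat_take_drop m w) bridge_cat // KM // k1 k2.
pose cut m := [&& (0 < m)%N, (m <= size w)%N, bridge (take m w) & bridge (drop m w)].
have ex : exists m, cut m.
  by exists (size w); rewrite /cut take_size drop_size bw bridge_nil leqnn lt0n size_eq0 w0.
case: (ex_minnP ex) => m /and4P[m0 mw b1 b2] mmin.
have mlt : (m < (size w).+1)%N by [].
rewrite (bigD1 (Ordinal mlt)) //= big1 => [|m' mm'].
  have /andP[k1 k2] : K (take m w) && K (drop m w) by rewrite -KM // cat_take_drop.
  rewrite b2 k1 k2 !andbT muln1 addn0; suff -> : irr (take m w) by [].
  apply/and3P; split=> //; first by rewrite -size_eq0 size_takel // -lt0n.
  apply/forallP => -[i iS]; apply/implyP => /= i0; apply/negP => /andP[c1 c2].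
  have im : (i < m)%N by apply: leq_trans iS _; rewrite size_takel.
  clear iS.
  have : cut i.
    rewrite /cut i0 (leq_trans (ltnW im) mw) -(take_takel w (ltnW im)) c1 /=.
    have -> : drop i w = drop i (take m w) ++ drop m w.
      by rewrite -{1}(cat_take_drop m w) drop_cat size_takel // im.
    exact: bridge_cat.
  by move/mmin; rewrite leqNgt im.
case: (boolP (irr _ && _)) => // /andP[ir _]; case: (boolP (bridge (drop m' w) && _)) => // /andP[b2' _].
have m'w : (m' <= size w)%N by rewrite -ltnS.
have m'0 : (0 < m')%N by case/and3P: ir => + _ _; rewrite -size_eq0 size_takel // -lt0n.
have mle : (m <= m')%N by apply: mmin; rewrite /cut m'0 m'w b2' irr_bridge.
have mlt' : (m < m')%N by rewrite ltn_neqAle mle andbT; apply: contraNneq mm' => h; apply/eqP/val_inj.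
have sT : size (take m' w) = m' by rewrite size_takel.
have := irr_cut ir m0; rewrite sT => /(_ mlt') /negP[]; apply: bridge_cut.
- exact: irr_bridge.
- by rewrite sT.
- by move=> i im; rewrite !take_takel //; [exact: cut_take|lia].
by move=> j mj; rewrite [take m _]take_takel // -take_min; apply: cut_drop => //; lia.
Qed.

Lemma bridge_morph_nes : bridge_morph nes_walk.
Proof.
move=> u v bu bv; rewrite /nes_walk all_cat (bridge_sa (bridge_cat bu bv)).
by rewrite (bridge_sa bu) (bridge_sa bv).
Qed.

(** Vertices of [u] before its end lie strictly below that end, and those of [v] at or above it, so
    two vertices at the same height always belong to the same factor. *)
Lemma bridge_morph_wd : bridge_morph weakly_directed.
Proof.
move=> u v bu bv; apply/idP/andP => [/weakly_directedP[sw H]|[/weakly_directedI[_ Hu] /weakly_directedI[_ Hv]]].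
  split; apply/weakly_directedP; split; try exact: bridge_sa.
    by move=> a x b uE; apply: (H a x (b ++ v)); rewrite uE -!catA.
  by move=> a x b vE; apply: (H (u ++ a) x b); rewrite vE -!catA.
apply/weakly_directedI; split; first exact/bridge_sa/bridge_cat.
move=> i j ij; rewrite size_cat => jw; rewrite !take_cat.
case: ltnP => iu; case: ltnP => ju.
- by move=> h; apply: Hu => //; apply: ltnW.
- rewrite hs_cat => h; have := bridge_lt bu iu; have := bridge_bound (j - size u) bv; lia.
- by lia.
rewrite !hs_cat drop_cat ltnNge iu /= => /addrI; apply: Hv; lia.
Qed.

Lemma ivt w c (L : int) : c <= L <= c + hs w -> exists i, c + hs (take i w) = L.
Proof.
elim: w c => [|s w IH] c.
  by move=> h; exists 0%N; move: h; rewrite take0 hs_nil addr0 => /le_anti.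
rewrite hs_cons => h; have [->|cL] := eqVneq c L; first by exists 0%N; rewrite take0 hs_nil addr0.
have [|i <-] := IH (c + (step_vec s).2).
  by move: h; case: s => /=; lia.
by exists i.+1; rewrite /= hs_cons addrA.
Qed.

Lemma hs_noS w : South \notin w -> 0 <= hs w /\ (North \in w -> 0 < hs w).
Proof.
elim: w => [|s w IH]; first by rewrite hs_nil.
rewrite !inE negb_or !step_eqE => /andP[sS /IH[h1 h2]]; rewrite hs_cons.
move: sS h1; case: s => //= _ h1; split=> //; by [lia|move=> h; have := h2 h; lia].
Qed.

Lemma hs_noN w : North \notin w -> hs w <= 0 /\ (South \in w -> hs w < 0).
Proof.
elim: w => [|s w IH]; first by rewrite hs_nil.
rewrite !inE negb_or !step_eqE => /andP[sS /IH[h1 h2]]; rewrite hs_cons.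
move: sS h1; case: s => //= _ h1; split=> //; by [lia|move=> h; have := h2 h; lia].
Qed.

Lemma notin_vertical v : East \notin v -> West \notin v -> all (mem [:: North; South]) v.
Proof.
move=> vE vW; apply/allP => s sv; rewrite !inE !step_eqE.
by case: s sv vE vW => // ->.
Qed.

Lemma horizontal_split w : East \in w -> West \in w -> exists p X v Y r,
  [/\ w = p ++ X :: v ++ Y :: r, (X == East) && (Y == West) || (X == West) && (Y == East) &
      all (mem [:: North; South]) v].
Proof.
have first_split (t : step) u : t \in u -> exists v r, u = v ++ t :: r /\ t \notin v.
  move=> tu; exists (take (index t u) u), (drop (index t u).+1 u).
  rewrite in_take_leq ?index_size // ltnn; split=> //.
  by rewrite -[in LHS](cat_take_drop (index t u) u) (drop_nth t) ?index_mem // nth_index.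
elim: w => [//|s w IH]; rewrite !inE !step_eqE => wE wW.
have rec : East \in w -> West \in w -> exists p X v Y r,
  [/\ s :: w = p ++ X :: v ++ Y :: r, (X == East) && (Y == West) || (X == West) && (Y == East) &
      all (mem [:: North; South]) v].
  by move=> h1 h2; have [p [X [v [Y [r [-> h3 h4]]]]]] := IH h1 h2; exists (s :: p), X, v, Y, r.
case: s wE wW rec => /= wE wW rec; try exact: rec.
  have [h|h] := boolP (East \in w); first exact: rec.
  have [v [r [wE' vW]]] := first_split _ _ wW.
  exists [::], East, v, West, r; rewrite wE' !eqxx /=; split=> //.
  by apply: notin_vertical => //; move: h; rewrite wE' mem_cat negb_or => /andP[].
have [h|h] := boolP (West \in w); first exact: rec.
have [v [r [wE' vW]]] := first_split _ _ wE.
exists [::], West, v, East, r; rewrite wE' !eqxx orbT /=; split=> //.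
by apply: notin_vertical => //; move: h; rewrite wE' mem_cat negb_or => /andP[].
Qed.

Lemma hs_block p X k V Y r : hs (p ++ X :: nseq k V ++ Y :: r) =
  hs p + (step_vec X).2 + (step_vec V).2 * k%:Z + (step_vec Y).2 + hs r.
Proof. by rewrite hs_cat hs_cons hs_cat hs_nseq hs_cons; lia. Qed.

Lemma take_block (p : seq step) X k V Y r i : take (size p + (k.+2 + i)) (p ++ X :: nseq k V ++ Y :: r) =
  p ++ X :: nseq k V ++ Y :: take i r.
Proof.
rewrite takeD take_size_cat // drop_size_cat // addSn /=; congr (_ ++ _ :: _).
rewrite take_cat size_nseq addSn ltnNge leqW ?leq_addr //=; congr (_ ++ _).
by rewrite subSn ?leq_addr // addKn.
Qed.

Lemma low_block (p : seq step) X k V u i : (i <= k)%N ->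
  take (size p + i.+1) (p ++ X :: nseq k V ++ u) = p ++ X :: nseq i V.
Proof.
move=> ik; rewrite takeD take_size_cat // drop_size_cat //=; congr (_ ++ _ :: _).
rewrite take_cat size_nseq; case: ltngtP ik => // [ik|->] _; last by rewrite subnn take0 cats0.
by rewrite take_nseq // ltnW.
Qed.

(** The upward run [V^k] passes from level at most [M] to a level above [M], while [p] stays at or
    below [M] and [r] leads only above it: the vertex of the run at level [M + 1] is a cut. *)
Lemma block_cut w (p : seq step) X k V Y r (M : int) : bridge w ->
  w = p ++ X :: nseq k V ++ Y :: r -> (step_vec X).2 = 0 -> (step_vec Y).2 = 0 -> V = North ->
  (forall i, hs (take i p) <= M) -> hs p <= M -> M < hs p + k%:Z ->
  (forall i, M < hs p + k%:Z + hs (take i r)) ->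
  exists m, [/\ (0 < m)%N, (m < size w)%N & bridge (take m w) && bridge (drop m w)].
Proof.
move=> bw wE hX hY VE HM pM Mk above.
have [j jE] : exists j : nat, M + 1 - hs p = j%:Z.
  by exists (absz (M + 1 - hs p)%R); rewrite gez0_abs //; clear -pM; lia.
have lowh i : (i <= k)%N -> hs (take (size p + i.+1) w) = hs p + i%:Z.
  by move=> ik; rewrite wE low_block // hs_cat hs_cons hs_nseq hX VE /= add0r mul1r.
have jk : (j <= k)%N by clear -Mk jE; lia.
have jM : hs p + j%:Z = M + 1 by clear -jE; lia.
have sizew : size w = (size p + (k.+2 + size r))%N.
  by rewrite wE size_cat /= size_cat size_nseq /=; clear; lia.
have jw : (size p + j.+1 < size w)%N by rewrite sizew; clear -jk; lia.
exists (size p + j.+1)%N; split=> //; first by rewrite addnS.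
apply: bridge_cut => //; first exact: ltnW.
  move=> i im; rewrite lowh // jM; have [ip|pi] := leqP i (size p).
    have -> : take i w = take i p.
      by rewrite wE take_cat; case: ltngtP ip => // -> _; rewrite subnn take0 cats0 take_size.
    by have := HM i; move: (hs _) => v; clear; lia.
  have [e iE] : exists e, i = (size p + e.+1)%N.
    by exists (i - size p).-1; clear -pi; lia.
  have ej : (e < j)%N by clear -iE im; lia.
  by rewrite iE lowh; [clear -ej jM; lia|clear -ej jk; lia].
move=> i mi; rewrite lowh //.
have [e iE] : exists e, i = (size p + e.+1)%N by exists (i - size p).-1; clear -mi; lia.
have je : (j <= e)%N by clear -iE mi; lia.
rewrite iE; have [ek|ke] := leqP e k; first by rewrite lowh //; clear -je; lia.
have -> : (size p + e.+1 = size p + (k.+2 + (e - k.+1)))%N by clear -ke; lia.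
rewrite wE take_block hs_block hX hY VE /= jM.
by have := above (e - k.+1)%N; move: (hs _) (hs _) => u v; clear; lia.
Qed.

(* Between consecutive horizontal steps in opposite directions, the walk goes straight up or down. If the levels met before and after this portion have one in common, the walk between two vertices at that level uses all four steps; otherwise, the portion goes up and contains a vertex at which the bridge factors. *)
Lemma irr_wd w : irr w -> weakly_directed w -> (West \notin w) || (East \notin w).
Proof.
move=> iw /weakly_directedP[sw wd]; have bw := irr_bridge iw.
apply: contraT; rewrite negb_or !negbK => /andP[wW wE].
have [p [X [v [Y [r [wE' XY vv]]]]]] := horizontal_split wE wW.
have XYv : vec [:: X; Y] = 0.
  by rewrite !vec_cons vec_nil; move: XY => /orP[] /andP[/eqP -> /eqP ->].
have [hX hY] : (step_vec X).2 = 0 /\ (step_vec Y).2 = 0.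
  by move: XY => /orP[] /andP[/eqP -> /eqP ->].
case: v vv wE' => [_ wE'|V v vv wE'].
  have /saP/(_ p [:: X; Y] r) := sw; rewrite wE' => /(_ erefl isT).
  by rewrite XYv eqxx.
have vE : V :: v = nseq (size v).+1 V.
  apply: vertical_run => //; apply/sa_path/(@sa_infix (p ++ [:: X]) _ (Y :: r)).
  by rewrite -catA -wE'.
move: (size v) vE wE' => k -> wE'; have VV : V \in [:: North; South] by case/andP: vv.
(* A factor returning to its level and containing [X], [Y] and [V] can only lack the vertical
   direction opposite to [V]; but then its height is monotone and changes at [V]. *)
have noret p1 p2 r1 r2 : p = p1 ++ p2 -> r = r1 ++ r2 ->
    hs (p2 ++ X :: nseq k.+1 V ++ Y :: r1) <> 0.
  move=> pE rE h0; set x := p2 ++ _ in h0.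
  have xw : w = p1 ++ x ++ r2 by rewrite wE' pE rE /x -!catA /= -!catA.
  have x0 : x != [::] by rewrite /x; case: (p2).
  have [s sx] := wd _ _ _ xw x0 h0.
  have [Xx Yx Vx] : [/\ X \in x, Y \in x & V \in x].
    by split; rewrite /x /= !(mem_cat, inE) eqxx ?orbT.
  have [sX sY sV] : [/\ s != X, s != Y & s != V].
    by split; apply: contraNneq sx => ->.
  have sv : (s == North) || (s == South).
    by move: sX sY XY; rewrite !step_eqE; case: (s); case: (X); case: (Y).
  case/orP: sv => /eqP sE; rewrite sE in sx sV.
    have VS : V = South by move: sV VV; rewrite !inE !step_eqE; case: (V).
    by have [_] := hs_noN sx; rewrite -{1}VS => /(_ Vx); rewrite h0.
  have VN : V = North by move: sV VV; rewrite !inE !step_eqE; case: (V).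
  by have [_] := hs_noS sx; rewrite -{1}VN => /(_ Vx); rewrite h0.
have hw : hs w = hs p + (step_vec V).2 * k.+1%:Z + hs r.
  by rewrite wE' hs_block hX hY; clear; lia.
have pw : (size p < size w)%N by rewrite wE' size_cat /=; clear; lia.
have hp : hs p < hs w by have := bridge_lt bw pw; rewrite wE' take_size_cat.
have cases : V = South \/ V = North by move: VV; rewrite !inE => /orP[/eqP|/eqP]; [right|left].
case: cases => VE; rewrite VE /= in hw.
  (* After a descent the walk comes back to the level of the end of [p], since this level is below
     the top of the bridge. *)
  have [|i hi] := @ivt r 0 k.+1%:Z; first by move: hp; rewrite hw; clear; lia.
  case: (noret p [::] (take i r) (drop i r)); rewrite ?cats0 ?cat_take_drop //.
  by rewrite hs_block hX hY VE hs_nil /=; move: hi; clear; lia.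
(* [M] is the largest height reached by [p]. If the walk after the run came down to a level at most
   [M], that level would also occur in [p], which [noret] excludes. *)
have [M [HM [i1 HMi]]] : exists M : int, (forall i, hs (take i p) <= M) /\ exists i, hs (take i p) = M.
  elim/last_ind: (p) => [|q s [M [HM [i Hi]]]].
    by exists 0; split; [move=> i; rewrite hs_nil|exists 0%N; rewrite hs_nil].
  have tk j : take j (rcons q s) = if (j <= size q)%N then take j q else rcons q s.
    rewrite -cats1 take_cat; case: ltngtP => [//|jq|->].
      by rewrite take_oversize //= subn_gt0.
    by rewrite subnn take0 cats0 take_size.
  have [h|h] := lerP (hs (rcons q s)) M.
    exists M; split=> [j|]; first by rewrite tk; case: ifP.
    exists (minn i (size q)); rewrite tk geq_minr -[RHS]Hi.
    by case: (leqP i (size q)) => // /ltnW iq; rewrite (take_oversize iq) take_size.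
  exists (hs (rcons q s)); split=> [j|]; last by exists (size q).+1; rewrite tk ltnn.
  by rewrite tk; case: ifP => // _; apply: le_trans (HM j) (ltW h).
have above i : M < hs p + k.+1%:Z + hs (take i r).
  rewrite ltNge; apply/negP => h.
  have tw : take (size p + (k.+3 + i)) w = p ++ X :: nseq k.+1 V ++ Y :: take i r.
    by rewrite wE' take_block.
  have hb := bridge_bound (size p + (k.+3 + i)) bw; rewrite tw in hb.
  rewrite hs_block hX hY VE /= in hb.
  have [|i2 hi2] := @ivt (take i1 p) 0 (hs p + k.+1%:Z + hs (take i r)).
    by rewrite HMi add0r h andbT; move: hb => /andP[+ _]; rewrite !addr0 mul1r.
  rewrite add0r -take_min in hi2.
  case: (noret (take (minn i2 i1) p) (drop (minn i2 i1) p) (take i r) (drop i r)); rewrite ?cat_take_drop //.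
  have := hs_cat (take (minn i2 i1) p) (drop (minn i2 i1) p); rewrite cat_take_drop => hpp.
  rewrite hs_block hX hY VE /=; move: hi2; rewrite {1}hpp; clear; move: (hs _) (hs _) (hs _) => x y t.
  by lia.
have pM : hs p <= M by have := HM (size p); rewrite take_size.
have Mk : M < hs p + k.+1%:Z by have := above 0%N; rewrite take0 hs_nil addr0.
have [m [m0 mw cm]] := block_cut bw wE' hX hY VE HM pM Mk above.
by have := irr_cut iw m0 mw; rewrite cm.
Qed.

Lemma wsum_split m n A B : (m <= n)%N ->
  wsum n (fun w => A (take m w) * B (drop m w))%N = (wsum m A * wsum (n - m) B)%N.
Proof.
move=> mn; rewrite -{1}(subnKC mn) wsum_cat mulnC -wsumZ; apply: eq_wsum => u um.
rewrite mulnC -wsumZ; apply: eq_wsum => v _.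
by rewrite take_size_cat // drop_size_cat.
Qed.

Definition bcount (K : pred (seq step)) n := wsum n (fun w => bridge w && K w).
Definition icount (K : pred (seq step)) n := wsum n (fun w => irr w && K w).

Lemma bcount_le K n : (bcount K n <= 4 ^ n)%N.
Proof. by apply: wsum_le => w; case: (_ && _). Qed.

Lemma icount_le K n : (icount K n <= 4 ^ n)%N.
Proof. by apply: wsum_le => w; case: (_ && _). Qed.

Lemma bcountS (K : pred (seq step)) n : bridge_morph K ->
  bcount K n.+1 = (\sum_(m < n.+2) icount K m * bcount K (n.+1 - m))%N.
Proof.
move=> KM; rewrite /bcount (@eq_wsum _ _ (fun w => \sum_(m < n.+2)
     (irr (take m w) && K (take m w)) * (bridge (drop m w) && K (drop m w)))%N).
  rewrite wsum_sum; apply: eq_bigr => m _.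
  by rewrite (wsum_split (fun w => irr w && K w) (fun w => bridge w && K w)) // -ltnS.
by move=> w wn; rewrite factor_count // ?wn // -size_eq0 wn.
Qed.

(** All earlier vertices being strictly lower, the last step of a bridge is N. The rest may reach
    its final height several times, hence is only a pseudo-bridge. *)
Lemma nes_bridge_rcons u s : bridge (u ++ [:: s]) && nes_walk (u ++ [:: s]) =
  (s == North) && (nes_walk u && pseudo_bridge u).
Proof.
apply/idP/idP.
  move=> /andP[/bridgeI[su H] /andP[_]]; rewrite all_cat => /andP[au _].
  have sau : self_avoiding u by apply: (@sa_infix [::] u [:: s]).
  have Hs i : (i <= size u)%N -> 0 <= hs (take i u) < hs u + (step_vec s).2.
    move=> iu; have := H i; rewrite size_cat /= addn1 ltnS => /(_ iu).
    by rewrite takel_cat // hs_cat hs_cons hs_nil addr0.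
  have sN : s = North.
    have := Hs _ (leqnn _); rewrite take_size; case: (s) => //=; clear; lia.
  rewrite sN eqxx /nes_walk sau au /=; apply/pseudo_bridgeP; split=> // a b uE.
  have T1 : take (size a) u = a by rewrite uE take_size_cat.
  have su' : (size a <= size u)%N by rewrite uE size_cat leq_addr.
  by have := Hs _ su'; rewrite T1 sN /=; clear; lia.
move=> /and3P[/eqP -> /andP[sau au] /pseudo_bridgeP[_ H]].
have au' : all (mem [:: North; East; South]) (u ++ [:: North]) by rewrite all_cat au /= !inE !step_eqE.
have sa' : self_avoiding (u ++ [:: North]).
  rewrite nes_saP // cat_path -nes_saP // sau /= andbT.
  case/lastP: u H {sau au au'} => [//|u s'] H; rewrite last_rcons.
  case: s' H => // H; have := H u [:: South]; rewrite -cats1 => /(_ erefl).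
  by rewrite hs_cat hs_cons hs_nil /=; clear; lia.
rewrite /nes_walk sa' au' !andbT; apply/bridgeI; split=> // i; rewrite size_cat /= addn1 ltnS => iu.
rewrite takel_cat // hs_cat hs_cons hs_nil /=.
have := H (take i u) (drop i u); rewrite cat_take_drop => /(_ erefl).
by clear; lia.
Qed.

Lemma nes_pseudo_bridges_wsum n :
  nes_pseudo_bridges n = wsum n (fun w => nes_walk w && pseudo_bridge w).
Proof.
rewrite nes_pseudo_bridgesE -wsum_sum; apply: eq_wsum => w wn.
have E1 (k : nat) : run k East 0 w = [&& nes_walk w, pseudo_bridge w & hs w == k%:Z].
  by rewrite -nes_pseudo_bridge_run height0 height_size subr0.
case: (boolP (nes_walk w && pseudo_bridge w)) => [/andP[nw pw]|np]; last first.
  by rewrite big1 // => k _; rewrite E1 andbA (negPf np).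
have hw : hs w <= n%:Z.
  rewrite -wn; elim: (w) => [|s u IH]; rewrite ?hs_nil // hs_cons /=; case: s => /=; move: IH; clear; lia.
have h0 : 0 <= hs w by have /pseudo_bridgeP[_ /(_ [::] w erefl)] := pw; rewrite hs_nil => /andP[].
have [k kE] : exists k : nat, hs w = k%:Z by exists (absz (hs w)); rewrite gez0_abs.
have kn : (k < n.+1)%N by move: hw; rewrite kE; clear; lia.
rewrite (bigD1 (Ordinal kn)) //= E1 nw pw kE eqxx big1 // => i ik.
rewrite E1 nw pw kE /=; case: eqP => // -[h]; case/eqP: ik; apply: val_inj; exact/esym.
Qed.

Lemma bcount_nes n : bcount nes_walk n.+1 = nes_pseudo_bridges n.
Proof.
rewrite nes_pseudo_bridges_wsum /bcount -(addn1 n) wsum_cat; apply: eq_wsum => u _ /=.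
by rewrite !nes_bridge_rcons !step_eqE /= !addn0.
Qed.

(** * The reflection exchanging E and W *)

Definition flip (s : step) := match s with East => West | West => East | _ => s end.

Lemma flipK : involutive flip. Proof. by case. Qed.

Lemma vec_flip w : vec (map flip w) = (- (vec w).1, (vec w).2).
Proof.
elim: w => [|s w IH]; first by rewrite vec_nil /= oppr0.
rewrite /= !vec_cons IH; case: s => /=; congr pair => /=; clear; lia.
Qed.

Lemma hs_flip w : hs (map flip w) = hs w. Proof. by rewrite /hs vec_flip. Qed.

Lemma bridge_flip w : bridge (map flip w) = bridge w.
Proof.
have imp u : bridge u -> bridge (map flip u).
  move=> /bridgeI[/saI su H]; apply/bridgeI; split.
    apply/saI => i j ij; rewrite size_map => ju; rewrite -!map_take !vec_flip => -[/oppr_inj h1 h2].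
    by apply: (su i j ij ju); move: h1 h2; case: (vec _) => a b; case: (vec _) => c d /= -> ->.
  by move=> i; rewrite size_map -map_take !hs_flip; apply: H.
apply/idP/idP; last exact: imp.
by move/imp; rewrite (mapK flipK).
Qed.

Lemma irr_flip w : irr (map flip w) = irr w.
Proof.
have imp u : irr u -> irr (map flip u).
  move=> iu; have /and3P[u0 bu _] := iu; apply/and3P; split.
  - by rewrite -size_eq0 size_map size_eq0.
  - by rewrite bridge_flip.
  apply/forallP => -[m mS]; apply/implyP => /= m0; rewrite size_map in mS.
  by rewrite -map_take -map_drop !bridge_flip; apply: irr_cut.
apply/idP/idP; last exact: imp.
by move/imp; rewrite (mapK flipK).
Qed.

Lemma wsum_flip n f : wsum n (fun w => f (map flip w)) = wsum n f.
Proof.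
elim: n f => [//|n IH] f /=.
rewrite (IH (fun u => f (North :: u))) (IH (fun u => f (West :: u))).
by rewrite (IH (fun u => f (South :: u))) (IH (fun u => f (East :: u))); clear; lia.
Qed.

Lemma bridge_nseq k : bridge (nseq k North).
Proof.
have aN : all (mem [:: North; East; South]) (nseq k North) by apply/allP => s /nseqP[-> _]; rewrite !inE !step_eqE.
apply/bridgeI; split.
  by rewrite nes_saP //; elim: k {aN} => [//|k IH] /=; case: k IH.
move=> i; rewrite size_nseq => ik; rewrite take_nseq ?(ltnW ik) // !hs_nseq /=.
by move: ik; clear; lia.
Qed.

Lemma irr_vertical w : irr w -> East \notin w -> West \notin w -> w = [:: North].
Proof.
move=> iw wE wW; have bw := irr_bridge iw; have v := notin_vertical wE wW.
case: w iw wE wW bw v => [/and3P[]//|s w] iw _ _ bw v.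
have wE := vertical_run (sa_path (bridge_sa bw)) v; rewrite wE in iw bw *.
have sN : s = North.
  move: v bw => /= /andP[+ _]; rewrite !inE !step_eqE; case: s {iw wE} => // _.
  move=> /(@bridge_bound _ 0); rewrite take0 hs_nil -[South :: _]/(nseq (size w).+1 South) hs_nseq /=.
  by clear; lia.
rewrite sN in iw *; move: (size w) iw => [//|k] iw.
have := irr_cut (m := 1) iw; rewrite size_nseq => /(_ isT isT).
by rewrite take_nseq // drop_nseq !bridge_nseq.
Qed.

Lemma irr_North : irr [:: North].
Proof.
by apply/and3P; split; [|exact: (bridge_nseq 1)|apply/forallP => -[[|m] mS]].
Qed.

(* The reflection exchanging E and W maps the irreducible bridges without W to those without E; only N avoids both. *)
Lemma irr_count w : ((irr w && weakly_directed w) + (w == [:: North]) =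
  (irr w && nes_walk w) + (irr (map flip w) && nes_walk (map flip w)))%N.
Proof.
rewrite irr_flip; have [iw|niw] := boolP (irr w); last first.
  rewrite /=; case: eqP => // wN; by rewrite wN irr_North in niw.
have bw := irr_bridge iw; have sw := bridge_sa bw.
have nesE u : self_avoiding u -> nes_walk u = (West \notin u).
  move=> su; rewrite /nes_walk su /=; elim: (u) => [//|s v IH].
  rewrite inE negb_or /= IH; congr andb; by rewrite !inE !step_eqE; case: (s).
have EW : (West \in map flip w) = (East \in w).
  by rewrite -[West]/(flip East) mem_map //; apply: inv_inj flipK.
rewrite nesE // nesE ?bridge_sa ?bridge_flip // EW.
have wdE : weakly_directed w = (West \notin w) || (East \notin w).
  apply/idP/idP; first exact: irr_wd.
  move=> h; apply/weakly_directedP; split=> // a u b wE _ _.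
  by case/orP: h => h; [exists West|exists East]; apply: contra h; rewrite wE !mem_cat => ->; rewrite orbT.
rewrite wdE; have [W|W] := boolP (West \in w); have [E'|E'] := boolP (East \in w) => /=.
- by case: eqP => // h; rewrite h !inE !step_eqE in W.
- by case: eqP => // h; rewrite h !inE !step_eqE in W.
- by case: eqP => // h; rewrite h !inE !step_eqE in E'.
by rewrite (irr_vertical iw E' W) eqxx.
Qed.

Lemma icount_wd n : (icount weakly_directed n + (n == 1) = 2 * icount nes_walk n)%N.
Proof.
have -> : ((n == 1) : nat) = wsum n (fun w => w == [:: North]).
  case: n => [//|[|n]]; first by rewrite /= !eqseq_cons !step_eqE.
  by rewrite (@eq_wsum _ _ (fun=> 0%N)) ?wsum0 // => -[|s [|t w]] //= _; rewrite eqseq_cons andbF.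
rewrite /icount -wsumD (eq_wsum (fun w _ => irr_count w)) wsumD.
by rewrite (wsum_flip n (fun w => irr w && nes_walk w)) mul2n addnn.
Qed.

Lemma weakly_directed_nil : weakly_directed [::].
Proof.
apply/weakly_directedI; split; first exact: bridge_sa bridge_nil.
by move=> i j ij; rewrite leqn0 => /eqP j0; rewrite j0 in ij.
Qed.

Lemma weakly_directed_bridgesE n : weakly_directed_bridges n = bcount weakly_directed n.
Proof.
rewrite /weakly_directed_bridges (card_wsum n (fun w => weakly_directed w && bridge w)).
by apply: eq_wsum => w _; rewrite andbC.
Qed.

(** * Generating functions of bridges and the conclusion *)

Section Series.
Context {R : realType}.
Implicit Types (z : Cplx R).

Lemma factor_series (K : pred (seq step)) z : bridge_morph K -> K [::] -> nm z < 4^-1 ->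
  psum (gf R (bcount K)) z = 1 + psum (gf R (icount K)) z * psum (gf R (bcount K)) z.
Proof.
move=> KM K0 zr; have Rb := psrad_count (R := R) (bcount_le K); have Ri := psrad_count (R := R) (icount_le K).
rewrite -(psum_conv Ri Rb zr).
have -> : 1 = psum (fun n => (1 : {poly Cplx R})`_n) z by rewrite psum_poly hornerC.
have R1 : psrad (fun n => (1 : {poly Cplx R})`_n) 4^-1 by exact: psrad_poly.
rewrite -(psumD R1 (psrad_conv Ri Rb) zr); congr psum; apply/funext => -[|n].
  by rewrite /psconv big_ord1 coefC /= /gf /bcount /icount /= bridge_nil K0 mul0r addr0.
rewrite coefC /= add0r /gf bcountS // /psconv natr_sum.
by apply: eq_bigr => m _; rewrite natrM.
Qed.

Lemma nes_pseudo_bridges_le n : (nes_pseudo_bridges n <= 4 ^ n)%N.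
Proof. by rewrite nes_pseudo_bridges_wsum; apply: wsum_le => w; case: (_ && _). Qed.

Lemma anal_nes : anal_ball (@Fser R) 0 16^-1 (gf R nes_pseudo_bridges).
Proof.
split=> [|w wr]; first by apply: psrad_le (psrad_count nes_pseudo_bridges_le); lra.
by rewrite subr0; apply/esym/sums_csum/nes_sums; rewrite -[w]subr0.
Qed.

(** Let [I] and [J] be the series of the irreducible bridges that are NES and weakly directed.
    NES-bridges have series [1 + z F = 1 / (1 - I)], the reflection gives [J = 2 I - z], and the
    weakly directed bridges have series [1 / (1 - J)]. *)
Lemma anal_wd : anal_ball (@WF R) 0 16^-1 (gf R weakly_directed_bridges).
Proof.
have -> : weakly_directed_bridges = bcount weakly_directed by apply/funext => n; rewrite weakly_directed_bridgesE.
split=> [|z]; first by apply: psrad_le (psrad_count (bcount_le _)); lra.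
rewrite subr0 => zr; have z4 : nm z < 4^-1 by lra.
have [_ /(_ z)] := anal_nes; rewrite subr0 => /(_ zr) FE.
have bE : psum (gf R (bcount nes_walk)) z = 1 + z * Fser z.
  rewrite psum_rec //; last exact: bcount_le.
  have -> : bcount nes_walk 0 = 1%N by rewrite /bcount /= bridge_nil.
  by rewrite FE; congr (_ + _ * psum _ _); apply/funext => n; rewrite /gf bcount_nes.
have b1 := factor_series bridge_morph_nes isT z4.
have w1 := factor_series bridge_morph_wd weakly_directed_nil z4.
have JE : psum (gf R (icount weakly_directed)) z + z = 2 * psum (gf R (icount nes_walk)) z.
  have Rw := psrad_count (R := R) (icount_le weakly_directed).
  have Rn := psrad_count (R := R) (icount_le nes_walk).
  rewrite -(psumZ _ Rn z4).
  have -> : psum (gf R (icount weakly_directed)) z + z =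
      psum (gf R (icount weakly_directed)) z + psum (fun n => ('X : {poly Cplx R})`_n) z.
    by rewrite psum_poly hornerX.
  have RX : psrad (fun n => ('X : {poly Cplx R})`_n) 4^-1 by exact: psrad_poly.
  rewrite -(psumD Rw RX z4); congr psum; apply/funext => n.
  by rewrite coefX /gf -natrD icount_wd natrM.
rewrite bE in b1; set w := psum (gf R (bcount _)) z in w1 *.
set I := psum _ z in b1 JE; set J := psum _ z in w1 JE; set F := Fser z in b1 *.
have wW : w * Wden z F = 1 + z * F.
  have J2 : J = 2 * I - z by rewrite -JE addrK.
  have I2 : I * (1 + z * F) = z * F by apply: (addrI 1); rewrite -b1.
  have w2 : w * (1 - J) = 1 by rewrite mulrBr mulr1 [w * J]mulrC {1}w1 addrK.
  rewrite (_ : Wden z F = (1 - J) * (1 + z * F)); first by rewrite mulrA w2 mul1r.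
  rewrite J2.
  have -> : (1 - (2 * I - z)) * (1 + z * F) = (1 + z) * (1 + z * F) - 2 * (I * (1 + z * F)) by ring.
  by rewrite I2 /Wden; ring.
have b0 : 1 + z * F != 0.
  by apply: contra_eq_neq b1 => ->; rewrite mulr0 addr0 eq_sym oner_eq0.
have D0 : Wden z F != 0 by apply: contraNneq b0 => D; rewrite -wW D mulr0.
by rewrite /WF /Wof -/F -wW mulfK.
Qed.

Lemma anal_ball_sums_around (Phi : Cplx R -> Cplx R) (a : nat -> Cplx R) r : 0 < r -> anal_ball Phi 0 r a ->
  sums_around_0_to a Phi.
Proof.
move=> r0 [Ra H]; apply: near_nm r0 _ => z zr; rewrite /ps_partial_sums.
have := psrad_sums Ra (h := z); rewrite subr0 in zr; move=> /(_ zr).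
rewrite /sums -[psum _ _]/(psum a z) H ?subr0 //.
rewrite (_ : series _ = psums (fun n => a n * z ^+ n)) //.
by apply/funext => n; rewrite /series /psums /= big_mkord.
Qed.

Lemma sums_around_converges (Phi : Cplx R -> Cplx R) (a : nat -> Cplx R) :
  sums_around_0_to a Phi -> converges_around_0 a.
Proof. by apply: filterS => z H; apply/cvg_ex; exists (Phi z). Qed.

Lemma Fser_mero z : ~ E R z -> mero_at (@Fser R) z.
Proof.
move=> zE; have [->|z0] := eqVneq z 0; last exact: F_mero.
by apply: anal_mero; exists 16^-1, (gf R nes_pseudo_bridges); split; [rewrite invr_gt0|exact: anal_nes].
Qed.

Lemma WF_mero z : ~ E R z -> mero_at (@WF R) z.
Proof.
move=> zE; have mF := Fser_mero zE; have mi := anal_mero (anal_id z); have m1 := anal_mero (anal_cst 1 z).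
apply: mero_div; first by apply: mero_add => //; apply: mero_mul.
apply: mero_add; first exact: mero_add.
apply: mero_mul => //; apply: (@mero_ext _ (fun w => w * w + (-1) * w)).
  by apply/near_dnbhs/near_all => w; rewrite mulN1r.
by apply: mero_add; apply: mero_mul => //; apply/anal_mero/anal_cst.
Qed.

End Series.

Theorem proposition19 (R : realType) :
  let B := gf R nes_pseudo_bridges in
  let W := gf R weakly_directed_bridges in
  [/\ converges_around_0 B /\
      (exists F : Cplx R -> Cplx R,
         [/\ sums_around_0_to B F,
             meromorphic_on (~` E R) F &
             natural_boundary (~` E R) F (E0 R)]),
      converges_around_0 W /\
      (exists F : Cplx R -> Cplx R,
         [/\ sums_around_0_to W F,
             meromorphic_on (~` E R) F &
             natural_boundary (~` E R) F (E0 R)]),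
      ~ D_finite B &
      ~ D_finite W].
Proof.
move=> B W; have r0 : 0 < 16^-1 :> R by rewrite invr_gt0.
have sB := anal_ball_sums_around r0 anal_nes; have sW := anal_ball_sums_around r0 anal_wd.
split.
- split; first exact: sums_around_converges sB.
  exists Fser; split; [exact: sB| |exact: Fser_boundary].
  by apply: mero_meromorphic => z; apply: Fser_mero.
- split; first exact: sums_around_converges sW.
  exists WF; split; [exact: sW| |exact: WF_boundary].
  by apply: mero_meromorphic => z; apply: WF_mero.
- exact: not_D_finite r0 anal_nes Fser_mero Fser_boundary.
exact: not_D_finite r0 anal_wd WF_mero WF_boundary.
Qed.
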